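(* Let $\psi_1$ be a radiation solution of the Helmholtz equation in $\mathcal{U}$, let $F_n,G_n$ be the coefficients of its Karp expansion and let $f_n$ be the coefficients of its asymptotic expansion at infinity (see context). Then the coefficients $F_n,G_n$ and $f_n$, $n\in\mathbb{N}$, are related by the formulas $$F_n(\phi)-iG_n(\phi)=f_n(\phi)-\sum_{j=1}^{n}\left(C_{0j}F_{n-j}(\phi)-iC_{1j}G_{n-j}(\phi)\right),$$ $$F_n(\phi)+iG_n(\phi)=(-1)^n\left(f_n(\phi+\pi)-\sum_{j=1}^{n}(-1)^{(n-j)}\left(C_{0j}F_{n-j}(\phi)+iC_{1j}G_{n-j}(\phi)\right)\right).$$ By these formulas, the coefficients $f_0,\dots,f_n$ uniquely determine the coefficients $F_0,G_0,\dots,F_n,G_n$ in a recursive way.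
   Context: $\mathbb{N}$ denotes the natural numbers including $0$. $\mathcal{U}$ is a region (open connected set) in $\mathbb{R}^2$ consisting of all points outside a closed bounded regular curve $S$. The Helmholtz equation is $\Delta\psi(x)+\kappa^2\psi(x)=0$, $x\in\mathcal{U}$, $\kappa>0$, where $\Delta$ is the Laplacian in $x$. A radiation solution is a solution $\psi_1$ of the Helmholtz equation in $\mathcal{U}$ of class $C^2$ satisfying $\sqrt{|x|}\left(\frac{\partial}{\partial|x|}-i\kappa\right)\psi_1(x)\to0$ as $|x|\to+\infty$, uniformly in $x/|x|$. $(r,\phi)$ are the polar coordinates of $x$, $r=|x|$; functions of $\phi$ are $2\pi$-periodic. $H_0,H_1$ are the Hankel functions of the first kind of orders $0$ and $1$. Let $\rho>0$ be such that $\mathbb{R}^2\setminus B_\rho\subset\mathcal{U}$, where $B_\rho=\{x\in\mathbb{R}^2:|x|<\rho\}$. Karp expansion (a known theorem of Karp): $$\psi_1(x)=H_0(\kappa|x|)\sum_{j=0}^{\infty}\frac{F_j(\phi)}{|x|^j}+H_1(\kappa|x|)\sum_{j=0}^{\infty}\frac{G_j(\phi)}{|x|^j},\quad x\in\mathbb{R}^2\setminus B_\rho,$$ with the series converging absolutely and uniformly for $|x|\ge\rho_1$, for any $\rho_1>\rho$. Asymptotic expansion (known; in general divergent, understood in the asymptotic sense): $$\psi_1(x)\sim\sqrt{\frac{2}{\pi\kappa|x|}}\,e^{i(\kappa|x|-\frac{\pi}{4})}\sum_{j=0}^{\infty}\frac{f_j(\phi)}{|x|^j},\quad |x|\to\infty.$$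 The constants are $$C_{\nu j}=\frac{(\frac12-\nu)_j\,\Gamma(\nu+j+\frac12)}{j!\,\Gamma(\nu+\frac12)(2i)^j},\quad \nu=0,1,\ j\in\mathbb{N},$$ where $(a)_j=a(a+1)\cdots(a+j-1)$ is the Pochhammer symbol; they are the coefficients in $H_\nu(r)\sim\sqrt{\frac{2}{\pi r}}\,e^{i(r-\frac12\nu\pi-\frac{\pi}{4})}\sum_{j=0}^\infty\frac{C_{\nu j}}{r^j}$ as $r\to+\infty$.
   Formalization: The constants C_{0j}, C_{1j} in both formulas are replaced by C_{0j}/κ^j, C_{1j}/κ^j, because the printed formulas fail for κ ≠ 1 (e.g. ψ_1 = H_0(κ|x|), n = 1); for κ = 1 they are unchanged. *)

(* Defs.v *)
(* Stdlib reals with Coquelicot. *)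
From Stdlib Require Import Reals Arith.
From Coquelicot Require Export Coquelicot.
Open Scope R_scope.

(** * The domain *)

Definition enorm (p : R * R) : R := sqrt (fst p ^ 2 + snd p ^ 2).

(* Only the values on [0,1] matter; two-sided differentiability at the end
   points is no restriction, since a C^1 arc on [0,1] extends to R. *)
Definition regular_arc (c : R -> R * R) : Prop :=
  forall t, 0 <= t <= 1 ->
    ex_derive (fun s => fst (c s)) t /\
    ex_derive (fun s => snd (c s)) t /\
    continuous (Derive (fun s => fst (c s))) t /\
    continuous (Derive (fun s => snd (c s))) t /\
    (Derive (fun s => fst (c s)) t, Derive (fun s => snd (c s)) t) <> (0, 0).

(* A simple closed chain of N >= 1 regular arcs. Corners are allowed; a smooth
   regular closed curve is the case N = 1. *)
Definition closed_regular_curve (S : R * R -> Prop) : Prop :=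
  exists (N : nat) (c : nat -> R -> R * R),
    (0 < N)%nat /\
    (forall i, (i < N)%nat -> regular_arc (c i)) /\
    (forall i, (i < N)%nat -> c i 1 = c (Nat.modulo (i + 1) N) 0) /\
    (forall i j s t, (i < N)%nat -> (j < N)%nat ->
       0 <= s < 1 -> 0 <= t < 1 -> c i s = c j t -> i = j /\ s = t) /\
    (forall p, S p <-> exists i t, (i < N)%nat /\ 0 <= t <= 1 /\ c i t = p).

(* The points that can be joined to infinity without meeting S. For a closed
   curve S this set is open and connected, so it is a region. *)
Definition outside (S : R * R -> Prop) (x : R * R) : Prop :=
  exists p : R -> R * R,
    (forall t, continuous p t) /\
    p 0 = x /\
    (forall t, 0 <= t -> ~ S (p t)) /\
    is_lim (fun t => enorm (p t)) p_infty p_infty.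

(** * Radiation solutions *)

Definition laplacian (psi : R -> R -> C) (x y : R) : C :=
  (Derive_n (fun s => Re (psi s y)) 2 x + Derive_n (fun s => Re (psi x s)) 2 y,
   Derive_n (fun s => Im (psi s y)) 2 x + Derive_n (fun s => Im (psi x s)) 2 y).

Definition polar (psi : R -> R -> C) (r phi : R) : C :=
  psi (r * cos phi) (r * sin phi).

Definition radial_derivative (psi : R -> R -> C) (r phi : R) : C :=
  (Derive (fun s => Re (polar psi s phi)) r,
   Derive (fun s => Im (polar psi s phi)) r).

(* psi is a total function; its values off U are irrelevant. *)
Definition radiation_solution
    (kappa : R) (U : R * R -> Prop) (psi : R -> R -> C) : Prop :=
  (forall x y, U (x, y) ->
     ex_diff_n (fun s t => Re (psi s t)) 2 x y /\
     ex_diff_n (fun s t => Im (psi s t)) 2 x y) /\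
  (forall x y, U (x, y) ->
     (laplacian psi x y + RtoC (kappa ^ 2)%R * psi x y)%C = RtoC 0) /\
  (forall eps : R, 0 < eps -> exists r0 : R, forall r phi : R, r0 < r ->
     Cmod (RtoC (sqrt r) *
       (radial_derivative psi r phi - Ci * RtoC kappa * polar psi r phi))%C < eps).

(** * Special functions *)

(* Euler's integral, for x > 0. *)
Definition Gamma (x : R) : R :=
  RInt_gen (fun t => Rpower t (x - 1) * exp (- t))
    (at_right 0) (Rbar_locally p_infty).

Fixpoint pochhammer (a : R) (j : nat) : R :=
  match j with
  | O => 1
  | S k => pochhammer a k * (a + INR k)
  end.

Definition harmonic (n : nat) : R := sum_n_m (fun k => / INR k) 1 n.

Definition euler_gamma : R :=
  real (Lim_seq (fun n => harmonic n - ln (INR n))).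

(* The digamma function at n + 1. *)
Definition digammaS (n : nat) : R := - euler_gamma + harmonic n.

Definition bessel_J (n : nat) (x : R) : R :=
  (x / 2) ^ n *
  PSeries (fun k => (-1) ^ k / (INR (fact k) * INR (fact (n + k)))) ((x / 2) ^ 2).

(* The standard series of Y_n for integer order n and x > 0. The finite sum is
   over 0 <= k < n, indexed by j = k + 1. *)
Definition bessel_Y (n : nat) (x : R) : R :=
  2 / PI * ln (x / 2) * bessel_J n x
  - / PI * / (x / 2) ^ n *
      sum_n_m (fun j => INR (fact (n - j)) / INR (fact (j - 1))
                          * ((x / 2) ^ 2) ^ (j - 1)) 1 n
  - / PI * (x / 2) ^ n *
      PSeries (fun k => (digammaS k + digammaS (n + k)) *
                 ((-1) ^ k / (INR (fact k) * INR (fact (n + k))))) ((x / 2) ^ 2).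

(* The Hankel function of the first kind, J_n + i Y_n. *)
Definition hankel1 (n : nat) (x : R) : C := (bessel_J n x, bessel_Y n x).

Definition Cnu (nu j : nat) : C :=
  (RtoC (pochhammer (1 / 2 - INR nu) j * Gamma (INR nu + INR j + 1 / 2))%R /
   (RtoC (INR (fact j) * Gamma (INR nu + 1 / 2))%R * (RtoC 2 * Ci) ^ j))%C.

(** * Expansions *)

Definition angular_coefficients (F : nat -> R -> C) : Prop :=
  forall j phi, F j (phi + 2 * PI) = F j phi.

(* sum_j F_j(phi) / r^j = A(r, phi), absolutely and uniformly for r >= rho1. *)
Definition abs_unif_converges
    (F : nat -> R -> C) (A : R -> R -> C) (rho1 : R) : Prop :=
  (forall r phi, rho1 <= r ->
     ex_series (fun j => Cmod (F j phi / RtoC (r ^ j)%R)%C)) /\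
  (forall eps : R, 0 < eps -> exists N : nat, forall n r phi,
     (N <= n)%nat -> rho1 <= r ->
     Cmod (sum_n (fun j => (F j phi / RtoC (r ^ j)%R)%C) n - A r phi)%C < eps).

Definition karp_expansion
    (kappa rho : R) (psi : R -> R -> C) (F G : nat -> R -> C) : Prop :=
  angular_coefficients F /\ angular_coefficients G /\
  exists A B : R -> R -> C,
    (forall r phi, rho <= r ->
       is_series (fun j => (F j phi / RtoC (r ^ j)%R)%C) (A r phi) /\
       is_series (fun j => (G j phi / RtoC (r ^ j)%R)%C) (B r phi) /\
       polar psi r phi =
         (hankel1 0 (kappa * r) * A r phi + hankel1 1 (kappa * r) * B r phi)%C) /\
    (forall rho1, rho < rho1 ->
       abs_unif_converges F A rho1 /\ abs_unif_converges G B rho1).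

(* sqrt (2 / (pi kappa r)) * exp (i (kappa r - pi / 4)) *)
Definition outgoing_factor (kappa r : R) : C :=
  (RtoC (sqrt (2 / (PI * kappa * r))) *
   (cos (kappa * r - PI / 4), sin (kappa * r - PI / 4)))%C.

(* In every direction phi, each partial sum up to order N has error o(r^-N)
   relative to the leading factor. No uniformity in phi is required. *)
Definition asymptotic_expansion
    (kappa : R) (psi : R -> R -> C) (f : nat -> R -> C) : Prop :=
  angular_coefficients f /\
  forall (N : nat) (phi : R),
    is_lim (fun r => r ^ N *
        Cmod (polar psi r phi / outgoing_factor kappa r
              - sum_n (fun j => (f j phi / RtoC (r ^ j)%R)%C) N)%C)
      p_infty 0.

(** * The recursion *)

(* The coefficient of r^-j in the expansion of H_nu(kappa r) is
   Cnu nu j / kappa^j, whence the powers of kappa. *)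
Definition karp_relations
    (kappa : R) (f F G : nat -> R -> C) (n : nat) (phi : R) : Prop :=
  (F n phi - Ci * G n phi =
     f n phi
     - sum_n_m (fun j =>
         Cnu 0 j / RtoC (kappa ^ j)%R * F (n - j)%nat phi
         - Ci * (Cnu 1 j / RtoC (kappa ^ j)%R) * G (n - j)%nat phi) 1 n)%C /\
  (F n phi + Ci * G n phi =
     RtoC ((-1) ^ n)%R *
     (f n (phi + PI)%R
      - sum_n_m (fun j =>
          RtoC ((-1) ^ (n - j))%R *
          (Cnu 0 j / RtoC (kappa ^ j)%R * F (n - j)%nat phi
           + Ci * (Cnu 1 j / RtoC (kappa ^ j)%R) * G (n - j)%nat phi)) 1 n))%C.

Definition set_coefficient
    (F : nat -> R -> C) (n : nat) (a : C) : nat -> R -> C :=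
  fun m phi => if Nat.eqb m n then a else F m phi.

(* Main.v *)
Require Import Defs.
From Stdlib Require Import Reals Arith ZArith Lra Lia Psatz.
From Coquelicot Require Import Coquelicot.
Open Scope R_scope.

(* Outside the disc of radius rho the angular Fourier modes of psi solve Bessel's
   equation of integer order m. The radiation condition makes their Wronskian with
   H_m(kappa r) vanish, so they are multiples of H_m(kappa r). Now
   H_m = P_m H_0 + Q_m H_1, where the Lommel polynomials P_m, Q_m in 1/r have the
   parity of m and m - 1. Summing over m gives, for large r, an expansion of Karp's
   shape whose coefficients satisfy F_j(phi + pi) = (-1)^j F_j(phi) and
   G_j(phi + pi) = -(-1)^j G_j(phi).

   Such an expansion is determined by f: its coefficients grow at most geometrically
   in j, whereas the C_{nu j} grow factorially, so no nontrivial pair F, G yields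
   f = 0. Hence the given F, G have this parity. The first relation is the product
   of the asymptotic series of H_0, H_1 with the Karp series; the second is the
   first at phi + pi.

   The asymptotic series of H_0 and H_1 come from
   (pi i / 2) H_0(x) = int exp(i x cosh w) dw along 0 -> (1+i) pi/2 -> +oo + i pi/2,
   which is identified with J_0 + i Y_0 by Bessel's equation and the behaviour at
   x = 0. Laplace's method gives the leading term, and the oscillatory equation
   h'' + 2 i h' + h / (4 x^2) = 0 for h = sqrt x exp(-i x) H_0 then gives all orders. *)

(** * Bessel functions of orders 0 and 1 *)

(** Parity cannot be read off the given Karp series: it represents the field for r >= rho only, and
    H_0, H_1 carry a logarithm, so r -> -r together with phi -> phi + pi is not a symmetry of the
    formula. What can be compared on each ray is the asymptotic series, hence the detour through
    growth. Two constants must come out exactly. [bessel_Y] contains Euler's constant as a limit of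
    harmonic sums, so matching the contour integral with Y_0 at the origin needs the classical
    relation between that limit and the exponential integral. The leading factor of H_0 needs the
    Gaussian integral sqrt(pi)/2; it is obtained by inserting the leading terms, with an unknown
    factor Q, into the Wronskian of J_0 and Y_0. The sum over m is controlled by comparing two
    recurrences: that of the Lommel polynomials with all signs made positive, at the argument 4x,
    and that of |H_m(x)|. The Wronskian forbids decay of |H_m|, so |H_m| eventually follows the
    growing solution, while the larger argument slows the majorant; the quotient decays
    geometrically. *)

Section RealDerivatives.
Variables (f g : R -> R) (x a b : R).

Lemma der_plus : is_derive f x a -> is_derive g x b ->
  is_derive (fun t : R => f t + g t) x (a + b).
Proof. intros Hf Hg. exact (is_derive_plus f g x a b Hf Hg). Qed.

Lemma der_minus : is_derive f x a -> is_derive g x b ->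
  is_derive (fun t : R => f t - g t) x (a - b).
Proof. intros Hf Hg. exact (is_derive_minus f g x a b Hf Hg). Qed.

Lemma der_mult : is_derive f x a -> is_derive g x b ->
  is_derive (fun t : R => f t * g t) x (a * g x + f x * b).
Proof. intros Hf Hg. exact (is_derive_mult f g x a b Hf Hg Rmult_comm). Qed.

Lemma der_comp : is_derive f (g x) a -> is_derive g x b ->
  is_derive (fun t : R => f (g t)) x (b * a).
Proof. intros Hf Hg. exact (is_derive_comp f g x a b Hf Hg). Qed.

Lemma der_scal (c : R) : is_derive f x a -> is_derive (fun t : R => c * f t) x (c * a).
Proof. intros Hf. exact (is_derive_scal f x c a Hf). Qed.

Lemma der_opp : is_derive f x a -> is_derive (fun t : R => - f t) x (- a).
Proof. intros Hf. exact (is_derive_opp f x a Hf). Qed.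
End RealDerivatives.

Lemma der_const (c x : R) : is_derive (fun _ : R => c) x 0.
Proof. exact (is_derive_const c x). Qed.

Lemma der_id (x : R) : is_derive (fun t : R => t) x 1.
Proof. exact (is_derive_id x). Qed.

(** * Entire power series behind J_n and Y_n *)

Lemma CV_radius_fact_bound (a : nat -> R) (K : R) :
  (forall n, Rabs (a n) <= K / INR (fact n)) -> CV_radius a = p_infty.
Proof.
  intros Ha.
  assert (H : forall r : R, Rbar_le r (CV_radius a)).
  { intros r.
    destruct (CV_radius_bounded a) as [Hub _].
    apply Hub.
    destruct (maj_by_pos (fun n => Rabs r ^ n / INR (fact n))) as [M [HM HMn]].
    { exists 0. apply cv_speed_pow_fact. }
    exists (K * M). intros n.
    rewrite Rabs_mult, <- RPow_abs.
    specialize (Ha n). specialize (HMn n).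
    assert (Hf : 0 < INR (fact n)) by apply INR_fact_lt_0.
    assert (Hp : 0 <= Rabs r ^ n) by (apply pow_le, Rabs_pos).
    assert (HK : 0 <= K).
    { apply Rmult_le_reg_r with (/ INR (fact n)).
      apply Rinv_0_lt_compat; lra.
      rewrite Rmult_0_l. apply Rle_trans with (2 := Ha). apply Rabs_pos. }
    apply Rle_trans with (K / INR (fact n) * Rabs r ^ n).
    apply Rmult_le_compat_r; auto.
    unfold Rdiv. rewrite Rmult_assoc. apply Rmult_le_compat_l; auto.
    rewrite Rmult_comm. apply Rle_trans with (2 := HMn). apply Rle_abs. }
  destruct (CV_radius a) as [r | | ]; auto.
  - specialize (H (r + 1)). simpl in H. lra.
  - specialize (H 0). simpl in H. contradiction.
Qed.

Lemma is_derive_PSeries_entire (a : nat -> R) (x : R) :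
  CV_radius a = p_infty -> is_derive (PSeries a) x (PSeries (PS_derive a) x).
Proof. intros H. apply is_derive_PSeries. now rewrite H. Qed.

Lemma ex_pseries_entire (a : nat -> R) (x : R) :
  CV_radius a = p_infty -> ex_pseries a x.
Proof. intros H. apply CV_radius_inside. now rewrite H. Qed.

Definition Jcoef (n k : nat) : R := (-1) ^ k / (INR (fact k) * INR (fact (n + k))).
Definition Ycoef (n k : nat) : R := (digammaS k + digammaS (n + k)) * Jcoef n k.

Lemma Rabs_pow_neg1 (k : nat) : Rabs ((-1) ^ k) = 1.
Proof. rewrite <- RPow_abs, Rabs_left by lra. replace (- -1) with 1 by lra. apply pow1. Qed.

Lemma INR_fact_ge1 (k : nat) : 1 <= INR (fact k).
Proof. replace 1 with (INR 1) by reflexivity. apply le_INR. apply lt_O_fact. Qed.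

Lemma Jcoef_abs (n k : nat) : Rabs (Jcoef n k) <= / (INR (fact k) * INR (fact k)).
Proof.
  unfold Jcoef, Rdiv. rewrite Rabs_mult, Rabs_pow_neg1, Rmult_1_l, Rabs_inv, Rabs_mult.
  assert (H1 := INR_fact_ge1 k). assert (H2 := INR_fact_ge1 (n + k)).
  rewrite !Rabs_pos_eq by lra.
  assert (INR (fact k) <= INR (fact (n + k))) by (apply le_INR, fact_le; lia).
  apply Rinv_le_contravar. nra. nra.
Qed.

Lemma CV_Jcoef (n : nat) : CV_radius (Jcoef n) = p_infty.
Proof.
  apply CV_radius_fact_bound with 1. intros k.
  apply Rle_trans with (1 := Jcoef_abs n k).
  assert (H1 := INR_fact_ge1 k).
  unfold Rdiv; rewrite Rmult_1_l. apply Rinv_le_contravar; nra.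
Qed.

Lemma harmonic_S (n : nat) : harmonic (S n) = harmonic n + / INR (S n).
Proof.
  unfold harmonic. rewrite sum_n_Sm by lia. reflexivity.
Qed.

Lemma harmonic_0 : harmonic 0 = 0.
Proof. unfold harmonic. rewrite sum_n_m_zero by lia. reflexivity. Qed.

Lemma harmonic_bound (n : nat) : 0 <= harmonic n <= INR n.
Proof.
  induction n as [|n IH].
  - rewrite harmonic_0. simpl. lra.
  - rewrite harmonic_S. assert (H := pos_INR n).
    assert (0 < / INR (S n) <= 1).
    { rewrite S_INR. split. apply Rinv_0_lt_compat; lra.
      rewrite <- Rinv_1. apply Rinv_le_contravar; lra. }
    rewrite (S_INR n) in *. lra.
Qed.

Lemma digammaS_step (n : nat) : INR (S n) * (digammaS (S n) - digammaS n) = 1.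
Proof.
  unfold digammaS. rewrite harmonic_S.
  assert (INR (S n) <> 0) by (apply not_0_INR; lia).
  field_simplify; auto.
Qed.

Lemma INR_le_fact (k : nat) : INR k <= INR (fact k).
Proof. apply le_INR. induction k; simpl; [lia|]. assert (H:=lt_O_fact k). nia. Qed.

(** Digamma values grow at most linearly in k, and k <= k! lets one of the two factorials in [Jcoef]
    absorb them. *)
Lemma CV_Ycoef (n : nat) : CV_radius (Ycoef n) = p_infty.
Proof.
  apply CV_radius_fact_bound with (2 * Rabs euler_gamma + INR n + 2). intros k.
  unfold Ycoef. rewrite Rabs_mult.
  assert (H0 := Jcoef_abs n k).
  assert (H1 := INR_fact_ge1 k). assert (H2 := INR_le_fact k).
  assert (Hd : Rabs (digammaS k + digammaS (n + k)) <=
    (2 * Rabs euler_gamma + INR n + 2) * INR (fact k)).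
  { unfold digammaS. assert (Hk := harmonic_bound k). assert (Hnk := harmonic_bound (n+k)).
    rewrite plus_INR in Hnk.
    assert (Hg := Rabs_pos euler_gamma). assert (Hn := pos_INR n).
    assert (Hg1 := Rle_abs euler_gamma).
    assert (Hg2 := Rle_abs (- euler_gamma)). rewrite Rabs_Ropp in Hg2.
    assert (Hm : (2 * Rabs euler_gamma + INR n) * 1 <= (2 * Rabs euler_gamma + INR n) * INR (fact k))
      by (apply Rmult_le_compat_l; lra).
    apply Rabs_le. split. lra. lra. }
  assert (Hf : 0 < / INR (fact k)) by (apply Rinv_0_lt_compat; lra).
  apply Rle_trans with ((2 * Rabs euler_gamma + INR n + 2) * INR (fact k) * (/ (INR (fact k) * INR (fact k)))).
  - apply Rmult_le_compat; auto; apply Rabs_pos.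
  - apply Req_le. field. lra.
Qed.

(* The entire functions in u = x^2/4 behind J_n and Y_n. *)
Lemma PJ0_derive (u : R) : is_derive (PSeries (Jcoef 0)) u (- PSeries (Jcoef 1) u).
Proof.
  evar_last. apply is_derive_PSeries_entire, CV_Jcoef.
  rewrite <- PSeries_opp. apply PSeries_ext. intros k.
  unfold PS_derive, PS_opp, Jcoef. rewrite !plus_O_n. change (opp ?x) with (- x).
  change (1 + k)%nat with (S k). rewrite fact_simpl, mult_INR. simpl pow.
  assert (H1 := INR_fact_ge1 k). assert (INR (S k) <> 0) by (apply not_0_INR; lia).
  field. split; auto. lra.
Qed.

Lemma PS1_derive (a : nat -> R) (u : R) :
  CV_radius a = p_infty ->
  is_derive (fun v => v * PSeries a v) u (PSeries (fun k => INR (S k) * a k) u).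
Proof.
  intros Ha.
  apply is_derive_ext with (PSeries (PS_incr_1 a)).
  intros t. apply PSeries_incr_1.
  evar_last. apply is_derive_PSeries_entire. rewrite CV_radius_incr_1. exact Ha.
  apply PSeries_ext. intros k. reflexivity.
Qed.

Lemma PJ1_derive (u : R) :
  is_derive (fun v => v * PSeries (Jcoef 1) v) u (PSeries (Jcoef 0) u).
Proof.
  evar_last. apply PS1_derive, CV_Jcoef.
  apply PSeries_ext. intros k. unfold Jcoef.
  change (1 + k)%nat with (S k). rewrite plus_O_n, fact_simpl, mult_INR.
  assert (H1 := INR_fact_ge1 k). assert (INR (S k) <> 0) by (apply not_0_INR; lia).
  field. split; auto. lra.
Qed.

Lemma PY0_derive (u : R) :
  is_derive (PSeries (Ycoef 0)) u (PSeries (PS_derive (Ycoef 0)) u).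
Proof. apply is_derive_PSeries_entire, CV_Ycoef. Qed.

(** This is Y_0' = -Y_1 with the logarithmic terms stripped, in u = x^2/4: the 1 on the right is the
    pole 2/(pi x), and the digamma step 1/(k+1) matches the remaining coefficients. *)
Lemma PY0_relation (u : R) :
  PSeries (Jcoef 0) u - u * PSeries (PS_derive (Ycoef 0)) u = 1 + u * PSeries (Ycoef 1) u.
Proof.
  rewrite <- !PSeries_incr_1.
  assert (HJ := ex_pseries_entire _ u (CV_Jcoef 0)).
  assert (E1 : ex_pseries (PS_incr_1 (PS_derive (Ycoef 0))) u).
  { apply ex_pseries_entire. rewrite CV_radius_incr_1, CV_radius_derive. apply CV_Ycoef. }
  assert (E2 : ex_pseries (PS_incr_1 (Ycoef 1)) u).
  { apply ex_pseries_entire. rewrite CV_radius_incr_1. apply CV_Ycoef. }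
  rewrite <- PSeries_minus by assumption.
  rewrite PSeries_decr_1 by (now apply ex_pseries_minus).
  rewrite (PSeries_decr_1 (PS_incr_1 (Ycoef 1))) by assumption.
  replace (PS_minus (Jcoef 0) (PS_incr_1 (PS_derive (Ycoef 0))) 0) with 1.
  2:{ unfold PS_minus, PS_plus, PS_opp, Jcoef, plus, opp; simpl. change zero with 0. field. }
  simpl (PS_incr_1 (Ycoef 1) 0). change zero with 0.
  rewrite Rplus_0_l. f_equal. f_equal. apply PSeries_ext. intros k.
  unfold PS_decr_1, PS_minus, PS_plus, PS_opp, PS_incr_1, PS_derive, Ycoef, Jcoef.
  change plus with Rplus. change opp with Ropp.
  change (1 + k)%nat with (S k). rewrite !plus_O_n, fact_simpl, mult_INR. simpl pow.
  assert (H1 := INR_fact_ge1 k). assert (Hk : INR (S k) <> 0) by (apply not_0_INR; lia).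
  assert (Hd := digammaS_step k).
  replace (digammaS k) with (digammaS (S k) - / INR (S k)).
  2:{ apply Rmult_eq_reg_l with (INR (S k)); auto. rewrite Rmult_minus_distr_l, Rinv_r; auto. lra. }
  field. split; auto. lra.
Qed.

Lemma PY1_derive (u : R) :
  is_derive (fun v => v * PSeries (Ycoef 1) v) u (PSeries (Jcoef 1) u + PSeries (Ycoef 0) u).
Proof.
  evar_last. apply PS1_derive, CV_Ycoef.
  rewrite <- PSeries_plus by (apply ex_pseries_entire; [apply CV_Jcoef || apply CV_Ycoef]).
  apply PSeries_ext. intros k. unfold Ycoef, Jcoef, PS_plus. change plus with Rplus.
  change (1 + k)%nat with (S k). rewrite !plus_O_n, fact_simpl, mult_INR.
  assert (H1 := INR_fact_ge1 k). assert (Hk : INR (S k) <> 0) by (apply not_0_INR; lia).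
  assert (Hd := digammaS_step k).
  replace (digammaS k) with (digammaS (S k) - / INR (S k)).
  2:{ apply Rmult_eq_reg_l with (INR (S k)); auto. rewrite Rmult_minus_distr_l, Rinv_r; auto. lra. }
  field. split; auto. lra.
Qed.

Lemma bessel_J0_eq (x : R) : bessel_J 0 x = PSeries (Jcoef 0) ((x / 2) ^ 2).
Proof. unfold bessel_J. rewrite pow_O, Rmult_1_l. reflexivity. Qed.

Lemma bessel_J1_eq (x : R) : bessel_J 1 x = x / 2 * PSeries (Jcoef 1) ((x / 2) ^ 2).
Proof. unfold bessel_J. rewrite pow_1. reflexivity. Qed.

Lemma bessel_Y0_eq (x : R) :
  bessel_Y 0 x = 2 / PI * ln (x / 2) * PSeries (Jcoef 0) ((x / 2) ^ 2)
    - / PI * PSeries (Ycoef 0) ((x / 2) ^ 2).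
Proof.
  unfold bessel_Y. rewrite sum_n_m_zero by lia. change zero with 0.
  rewrite bessel_J0_eq, pow_O.
  change (PSeries (fun k => (digammaS k + digammaS (0 + k)) *
    ((-1) ^ k / (INR (fact k) * INR (fact (0 + k))))) ((x / 2) ^ 2))
    with (PSeries (Ycoef 0) ((x / 2) ^ 2)).
  ring.
Qed.

Lemma bessel_Y1_eq (x : R) : 0 < x ->
  bessel_Y 1 x = 2 / PI * ln (x / 2) * (x / 2 * PSeries (Jcoef 1) ((x / 2) ^ 2))
    - 2 / (PI * x) - / PI * (x / 2 * PSeries (Ycoef 1) ((x / 2) ^ 2)).
Proof.
  intros Hx. assert (HP := PI_RGT_0).
  unfold bessel_Y. rewrite sum_n_n, bessel_J1_eq.
  change (PSeries (fun k => (digammaS k + digammaS (1 + k)) *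
    ((-1) ^ k / (INR (fact k) * INR (fact (1 + k))))) ((x / 2) ^ 2))
    with (PSeries (Ycoef 1) ((x / 2) ^ 2)).
  simpl (fact _). simpl pow. simpl INR. field. lra.
Qed.

Lemma locally_gt (a x : R) (P : R -> Prop) :
  a < x -> (forall t, a < t -> P t) -> locally x P.
Proof. intros Hx HP. apply (filter_imp _ _ HP). now apply (open_gt a). Qed.

Lemma is_derive_ext_gt (a : R) (f g : R -> R) (x l : R) :
  a < x -> (forall t, a < t -> f t = g t) -> is_derive f x l -> is_derive g x l.
Proof.
  intros Hx He. apply is_derive_ext_loc. now apply locally_gt with a.
Qed.

Lemma is_derive_sqhalf (x : R) : is_derive (fun x => (x / 2) ^ 2) x (x / 2).
Proof. auto_derive; auto. field. Qed.

Lemma bessel_J0_derive (x : R) : is_derive (bessel_J 0) x (- bessel_J 1 x).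
Proof.
  apply is_derive_ext with (fun x => PSeries (Jcoef 0) ((x / 2) ^ 2)).
  { intros t. symmetry. apply bessel_J0_eq. }
  evar_last. apply (is_derive_comp (PSeries (Jcoef 0)) (fun x => (x / 2) ^ 2)).
  apply PJ0_derive. apply is_derive_sqhalf.
  rewrite bessel_J1_eq. unfold scal; simpl; unfold mult; simpl. ring.
Qed.

(** With u = x^2/4, J_1 is 2/x times the product that [PJ1_derive] differentiates; the same device
    serves Y_1. *)
Lemma bessel_J1_derive (x : R) : 0 < x ->
  is_derive (bessel_J 1) x (bessel_J 0 x - bessel_J 1 x / x).
Proof.
  intros Hx.
  apply (is_derive_ext_gt 0) with
    (fun x => 2 / x * ((x / 2) ^ 2 * PSeries (Jcoef 1) ((x / 2) ^ 2))).
  assumption.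
  { intros t Ht. rewrite bessel_J1_eq. field. lra. }
  evar_last. apply (is_derive_mult (fun x => 2 / x)).
  auto_derive. lra. reflexivity.
  apply (is_derive_comp (fun v => v * PSeries (Jcoef 1) v) (fun x => (x / 2) ^ 2)).
  apply PJ1_derive. apply is_derive_sqhalf. intros; apply Rmult_comm.
  rewrite bessel_J1_eq, bessel_J0_eq. unfold scal, plus, mult; simpl; unfold mult; simpl. field. lra.
Qed.

Lemma bessel_Y0_derive (x : R) : 0 < x -> is_derive (bessel_Y 0) x (- bessel_Y 1 x).
Proof.
  intros Hx. assert (HP := PI_RGT_0).
  apply is_derive_ext with (fun x => 2 / PI * ln (x / 2) * PSeries (Jcoef 0) ((x / 2) ^ 2)
    - / PI * PSeries (Ycoef 0) ((x / 2) ^ 2)).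
  { intros t. symmetry. apply bessel_Y0_eq. }
  evar_last. apply @is_derive_minus. apply (is_derive_mult (fun x => 2 / PI * ln (x / 2))).
  auto_derive. lra. reflexivity.
  apply (is_derive_comp (PSeries (Jcoef 0)) (fun x => (x / 2) ^ 2)).
  apply PJ0_derive. apply is_derive_sqhalf. intros; apply Rmult_comm.
  apply is_derive_scal.
  apply (is_derive_comp (PSeries (Ycoef 0)) (fun x => (x / 2) ^ 2)).
  apply PY0_derive. apply is_derive_sqhalf.
  rewrite bessel_Y1_eq by auto.
  assert (E := PY0_relation ((x / 2) ^ 2)).
  unfold scal, minus, plus, opp, mult; simpl; unfold mult; simpl.
  change (x / 2 * (x / 2 * 1)) with ((x/2)^2) in *.
  set (p0 := PSeries (Jcoef 0) ((x / 2) ^ 2)) in *.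
  set (y1 := PSeries (Ycoef 1) ((x / 2) ^ 2)) in *.
  set (d0 := PSeries (PS_derive (Ycoef 0)) ((x / 2) ^ 2)) in *.
  replace p0 with (1 + (x / 2) ^ 2 * y1 + (x / 2) ^ 2 * d0) by lra.
  field. lra.
Qed.

Lemma bessel_Y1_derive (x : R) : 0 < x ->
  is_derive (bessel_Y 1) x (bessel_Y 0 x - bessel_Y 1 x / x).
Proof.
  intros Hx. assert (HP := PI_RGT_0).
  apply (is_derive_ext_gt 0) with
    (fun x => 2 / x * (2 / PI * ln (x / 2) * ((x / 2) ^ 2 * PSeries (Jcoef 1) ((x / 2) ^ 2))
       - / PI - / PI * ((x / 2) ^ 2 * PSeries (Ycoef 1) ((x / 2) ^ 2)))).
  assumption.
  { intros t Ht. rewrite bessel_Y1_eq by auto. field. lra. }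
  evar_last. apply (is_derive_mult (fun x => 2 / x)).
  auto_derive. lra. reflexivity.
  apply @is_derive_minus. apply @is_derive_minus.
  apply (is_derive_mult (fun x => 2 / PI * ln (x / 2))).
  auto_derive. lra. reflexivity.
  apply (is_derive_comp (fun v => v * PSeries (Jcoef 1) v) (fun x => (x / 2) ^ 2)).
  apply PJ1_derive. apply is_derive_sqhalf. intros; apply Rmult_comm.
  apply @is_derive_const. apply is_derive_scal.
  apply (is_derive_comp (fun v => v * PSeries (Ycoef 1) v) (fun x => (x / 2) ^ 2)).
  apply PY1_derive. apply is_derive_sqhalf. intros; apply Rmult_comm.
  rewrite bessel_Y1_eq, bessel_Y0_eq by auto.
  unfold scal, minus, plus, opp, mult; simpl; unfold mult; simpl. change zero with 0. field. lra.
Qed.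

(** * Behaviour at the origin *)

(** Behaviour at the origin is tested along this one sequence. The quantities compared are constant
    on the half-line or solve Bessel's equation, so a single sequence settles them. *)
Definition xs (n : nat) : R := / (INR n + 1).

Lemma xs_pos (n : nat) : 0 < xs n.
Proof. apply Rinv_0_lt_compat. assert (H := pos_INR n). lra. Qed.

Lemma xs_le1 (n : nat) : xs n <= 1.
Proof. unfold xs. rewrite <- Rinv_1. assert (H := pos_INR n). apply Rinv_le_contravar; lra. Qed.

Lemma is_lim_seq_xs : is_lim_seq xs 0.
Proof.
  unfold xs. apply (is_lim_seq_inv (fun n => INR n + 1) p_infty); [|easy].
  apply is_lim_seq_plus with p_infty 1. apply is_lim_seq_INR. apply is_lim_seq_const. reflexivity.
Qed.

Lemma ln_half_bound (x : R) : 0 < x <= 1 -> Rabs (ln (x / 2)) <= 2 / x.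
Proof.
  intros [Hx Hx1].
  assert (ln (x/2) < 0). { rewrite <- ln_1. apply ln_increasing; lra. }
  rewrite Rabs_left by auto.
  rewrite <- ln_Rinv by lra.
  assert (H0 : 0 < / (x / 2)) by (apply Rinv_0_lt_compat; lra).
  apply Rle_trans with (/ (x/2)).
  - apply Rlt_le. apply exp_lt_inv. rewrite exp_ln by auto.
    assert (H1 := exp_ineq1 (/ (x/2))). lra.
  - apply Req_le. field. lra.
Qed.

Lemma is_lim_seq_PSeries_xs (a : nat -> R) : CV_radius a = p_infty ->
  is_lim_seq (fun n => PSeries a ((xs n / 2) ^ 2)) (a 0%nat).
Proof.
  intros Ha. rewrite <- (PSeries_0 a).
  apply (is_lim_seq_continuous (PSeries a)).
  - apply PSeries_continuity. rewrite Ha. easy.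
  - replace 0 with (0 / 2 * (0 / 2)) by field.
    apply is_lim_seq_ext with (fun n => xs n / 2 * (xs n / 2)). intros; simpl; ring.
    apply is_lim_seq_mult'; apply (is_lim_seq_scal_r _ (/2) 0); apply is_lim_seq_xs.
Qed.

Lemma is_lim_seq_sq_ln_xs : is_lim_seq (fun n => (xs n / 2) ^ 2 * ln (xs n / 2)) 0.
Proof.
  apply is_lim_seq_abs_0.
  apply is_lim_seq_le_le with (fun _ => 0) xs.
  - intros n. split. apply Rabs_pos.
    assert (H := xs_pos n). assert (H1 := xs_le1 n).
    rewrite Rabs_mult, Rabs_pos_eq by nra.
    apply Rle_trans with ((xs n / 2) ^ 2 * (2 / xs n)).
    apply Rmult_le_compat_l. nra. now apply ln_half_bound.
    apply Rle_trans with (xs n / 2). apply Req_le; field; lra. lra.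
  - apply is_lim_seq_const.
  - apply is_lim_seq_xs.
Qed.

Lemma Jcoef_n0_0 : Jcoef 0 0 = 1.
Proof. unfold Jcoef; simpl; field. Qed.

Lemma bessel_J0_lim : is_lim_seq (fun n => bessel_J 0 (xs n)) 1.
Proof.
  rewrite <- Jcoef_n0_0. apply is_lim_seq_ext with (2 := is_lim_seq_PSeries_xs _ (CV_Jcoef 0)).
  intros n. symmetry. apply bessel_J0_eq.
Qed.

(** The logarithm is left multiplied by J_0 - 1 = O(x^2), and the constant comes from psi(1) =
    -gamma, which enters [Ycoef 0 0] twice. *)
Lemma bessel_Y0_lim :
  is_lim_seq (fun n => bessel_Y 0 (xs n) - 2 / PI * (ln (xs n / 2) + euler_gamma)) 0.
Proof.
  apply is_lim_seq_ext with (fun n =>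
     (2 / PI) * ((xs n / 2) ^ 2 * ln (xs n / 2)) * PSeries (PS_decr_1 (Jcoef 0)) ((xs n / 2) ^ 2)
     - / PI * PSeries (Ycoef 0) ((xs n / 2) ^ 2) - 2 / PI * euler_gamma).
  { intros n. rewrite bessel_Y0_eq.
    rewrite (PSeries_decr_1 (Jcoef 0)) by (apply ex_pseries_entire, CV_Jcoef).
    rewrite Jcoef_n0_0. ring. }
  replace (Finite 0) with (Finite ((2 / PI * 0) * Jcoef 0 1 - / PI * Ycoef 0 0 - 2 / PI * euler_gamma)).
  apply is_lim_seq_minus'; [|apply is_lim_seq_const].
  apply is_lim_seq_minus'.
  - apply is_lim_seq_mult'.
    + apply (is_lim_seq_scal_l _ (2/PI) 0). apply is_lim_seq_sq_ln_xs.
    + apply (is_lim_seq_PSeries_xs (PS_decr_1 (Jcoef 0))). rewrite CV_radius_decr_1. apply CV_Jcoef.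
  - apply (is_lim_seq_scal_l _ (/ PI) (Ycoef 0 0)). apply is_lim_seq_PSeries_xs, CV_Ycoef.
  - f_equal. unfold Ycoef, Jcoef, digammaS. simpl. rewrite harmonic_0. assert (H := PI_RGT_0). field. lra.
Qed.

Lemma is_derive_zero_const (f : R -> R) (a : R) :
  (forall x, a < x -> is_derive f x 0) -> forall x y, a < x -> a < y -> f x = f y.
Proof.
  intros H x y Hx Hy.
  destruct (MVT_gen f x y (fun _ => 0)) as [c [_ Hc]].
  - intros z Hz. apply H. assert (a < Rmin x y) by now apply Rmin_glb_lt. lra.
  - intros z Hz. assert (a < Rmin x y) by now apply Rmin_glb_lt.
    apply derivable_continuous_pt. exists 0. apply is_derive_Reals, H. lra.
  - lra.
Qed.

(** The derivative formulas make the left side constant, so its value is the limit at 0. There every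
    logarithm carries a factor x^2, and only the pole of Y_1 times J_0(0) = 1 survives. *)
Lemma bessel_wronskian (x : R) : 0 < x ->
  x * (bessel_J 1 x * bessel_Y 0 x - bessel_J 0 x * bessel_Y 1 x) = 2 / PI.
Proof.
  intros Hx. assert (HP := PI_RGT_0).
  set (W := fun x => x * (bessel_J 1 x * bessel_Y 0 x - bessel_J 0 x * bessel_Y 1 x)).
  change (W x = 2 / PI).
  assert (HW : forall y, 0 < y -> is_derive W y 0).
  { intros y Hy. unfold W. evar_last.
    apply der_mult. apply der_id. apply der_minus.
    apply der_mult. now apply bessel_J1_derive. now apply bessel_Y0_derive.
    apply der_mult. now apply bessel_J0_derive. now apply bessel_Y1_derive.
    cbv beta. field. lra. }
  assert (L : is_lim_seq (fun n => W (xs n)) (2 / PI)).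
  { apply is_lim_seq_ext with (fun n =>
      (4 / PI * PSeries (Jcoef 1) ((xs n / 2) ^ 2)) *
         ((xs n / 2) ^ 2 * ln (xs n / 2) * PSeries (Jcoef 0) ((xs n / 2) ^ 2))
      - (4 / PI * PSeries (Jcoef 0) ((xs n / 2) ^ 2)) *
         ((xs n / 2) ^ 2 * ln (xs n / 2) * PSeries (Jcoef 1) ((xs n / 2) ^ 2))
      + (xs n) * (xs n) * (/ (2 * PI) * (PSeries (Jcoef 0) ((xs n / 2) ^ 2) * PSeries (Ycoef 1) ((xs n / 2) ^ 2)
         - PSeries (Jcoef 1) ((xs n / 2) ^ 2) * PSeries (Ycoef 0) ((xs n / 2) ^ 2)))
      + 2 / PI * PSeries (Jcoef 0) ((xs n / 2) ^ 2)).
    { intros n. unfold W. assert (H := xs_pos n).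
      rewrite bessel_J1_eq, bessel_J0_eq, bessel_Y0_eq, bessel_Y1_eq by auto. field. lra. }
    replace (Finite (2 / PI)) with (Finite (
      (4 / PI * Jcoef 1 0) * (0 * Jcoef 0 0) - (4 / PI * Jcoef 0 0) * (0 * Jcoef 1 0)
      + 0 * 0 * (/ (2 * PI) * (Jcoef 0 0 * Ycoef 1 0 - Jcoef 1 0 * Ycoef 0 0)) + 2 / PI * Jcoef 0 0)).
    2:{ f_equal. rewrite Jcoef_n0_0. field. lra. }
    repeat (apply is_lim_seq_minus' || apply is_lim_seq_plus' || apply is_lim_seq_mult' ||
      apply is_lim_seq_const || apply is_lim_seq_sq_ln_xs || apply is_lim_seq_xs ||
      (apply is_lim_seq_PSeries_xs; (apply CV_Jcoef || apply CV_Ycoef))). }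
  assert (L' : is_lim_seq (fun n => W (xs n)) (W x)).
  { apply is_lim_seq_ext with (fun _ => W x).
    intros n. apply is_derive_zero_const with 0; auto using xs_pos. apply is_lim_seq_const. }
  apply is_lim_seq_unique in L. apply is_lim_seq_unique in L'. rewrite L in L'. now injection L'.
Qed.

(** * Differentiation under the integral sign *)

Lemma continuity_2d_snd (f : R -> R -> R) (x t : R) :
  continuity_2d_pt f x t -> continuous (f x) t.
Proof.
  intros H. apply continuity_pt_filterlim. intros eps Heps.
  destruct (H (mkposreal eps Heps)) as [d Hd].
  exists d. split. apply cond_pos. intros u [_ Hu].
  apply Hd. rewrite Rminus_diag, Rabs_R0. apply cond_pos. exact Hu.
Qed.

(** Conditions on a whole half-line [lo < u] replace the neighbourhood conditions of the general
    rule; all parameter integrals below are of this kind. *)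
Lemma der_RInt_param (f f1 : R -> R -> R) (lo a b x : R) :
  lo < x ->
  (forall u t, lo < u -> is_derive (fun z => f z t) u (f1 u t)) ->
  (forall u t, lo < u -> continuity_2d_pt f u t) ->
  (forall u t, lo < u -> continuity_2d_pt f1 u t) ->
  is_derive (fun u => RInt (f u) a b) x (RInt (f1 x) a b).
Proof.
  intros Hx Hd Hf Hf1.
  evar_last. apply is_derive_RInt_param.
  - apply locally_gt with lo; auto. intros u Hu t _. exists (f1 u t). now apply Hd.
  - intros t _. apply continuity_2d_pt_ext_loc with f1; auto.
    exists (mkposreal (x - lo) ltac:(lra)). simpl. intros u v Hu _.
    symmetry. apply is_derive_unique. apply Hd. apply Rabs_def2 in Hu. lra.
  - apply locally_gt with lo; auto. intros u Hu.
    apply (@ex_RInt_continuous R_CompleteNormedModule). intros z _. now apply continuity_2d_snd, Hf.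
  - apply RInt_ext. intros t _. apply is_derive_unique. now apply Hd.
Qed.

(** * The integrand exp(-y/t)/t^k, extended by 0 *)

(** The substitution t = exp(-a) moves the infinite end of the contour to t = 0. For y > 0 the
    integrand is flat there, so the extension by 0 stays differentiable and improper integrals
    become integrals over a compact interval. *)
Definition eta (k : nat) (y t : R) : R :=
  if Rle_dec t 0 then 0 else exp (- y / t) / t ^ k.

Lemma eta_pos_eq (k : nat) (y t : R) : 0 < t -> eta k y t = exp (- y / t) / t ^ k.
Proof. intros Ht. unfold eta. destruct (Rle_dec t 0); [lra|reflexivity]. Qed.

Lemma eta_neg_eq (k : nat) (y t : R) : t <= 0 -> eta k y t = 0.
Proof. intros Ht. unfold eta. destruct (Rle_dec t 0); [reflexivity|lra]. Qed.

Lemma eta_S (k : nat) (y t : R) : t * eta (S k) y t = eta k y t.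
Proof.
  destruct (Rle_dec t 0).
  - rewrite !eta_neg_eq by auto. ring.
  - rewrite !eta_pos_eq by lra. simpl. field. split. apply pow_nonzero; lra. lra.
Qed.

(** Raise 1 + s <= exp s, with s = z/(m+1), to the power m + 1. *)
Lemma exp_ge_pow (m : nat) (z : R) : 0 <= z -> (z / INR (S m)) ^ (S m) <= exp z.
Proof.
  intros Hz.
  assert (Hm : 0 < INR (S m)) by (apply lt_0_INR; lia).
  assert (Hq : 0 <= z / INR (S m)) by (apply Rdiv_le_0_compat; lra).
  replace (exp z) with (exp (z / INR (S m)) ^ (S m)).
  - apply pow_incr. split; auto.
    assert (H := exp_ineq1_le (z / INR (S m))). lra.
  - rewrite <- Rpower_pow by apply exp_pos. unfold Rpower. rewrite ln_exp. f_equal. field. lra.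
Qed.

Lemma exp_neg_le_pow (m : nat) (z : R) : 0 < z -> exp (- z) <= (INR (S m) / z) ^ (S m).
Proof.
  intros Hz.
  assert (Hm : 0 < INR (S m)) by (apply lt_0_INR; lia).
  rewrite exp_Ropp. replace (INR (S m) / z) with (/ (z / INR (S m))) by (field; lra).
  rewrite pow_inv. apply Rinv_le_contravar.
  - apply pow_lt. apply Rdiv_lt_0_compat; lra.
  - apply exp_ge_pow. lra.
Qed.

Lemma eta_nonneg (k : nat) (y t : R) : 0 <= eta k y t.
Proof.
  destruct (Rle_dec t 0).
  - rewrite eta_neg_eq by auto. lra.
  - rewrite eta_pos_eq by lra. apply Rdiv_le_0_compat. apply Rlt_le, exp_pos. apply pow_lt; lra.
Qed.

(** The power k + j + 1 in [exp_neg_le_pow] outweighs t^k and leaves j + 1 powers of t: j = 0 gives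
    continuity at t = 0, j = 1 differentiability. *)
Lemma eta_le (k j : nat) (y t : R) : 0 < y -> 0 <= t ->
  eta k y t <= (INR (S (k + j)) / y) ^ (S (k + j)) * t ^ (S j).
Proof.
  intros Hy Ht.
  assert (Hm : 0 < INR (S (k + j))) by (apply lt_0_INR; lia).
  destruct (Rle_dec t 0).
  - rewrite eta_neg_eq by auto. apply Rmult_le_pos; apply pow_le; auto.
    apply Rdiv_le_0_compat; lra.
  - rewrite eta_pos_eq by lra.
    assert (H := exp_neg_le_pow (k + j) (y / t)).
    replace (- (y / t)) with (- y / t) in H by (field; lra).
    assert (Hk : 0 < t ^ k) by (apply pow_lt; lra).
    apply Rmult_le_reg_r with (t ^ k); auto.
    replace (exp (- y / t) / t ^ k * t ^ k) with (exp (- y / t)) by (field; lra).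
    apply Rle_trans with (1 := H ltac:(apply Rdiv_lt_0_compat; lra)).
    apply Req_le. rewrite Rmult_assoc, <- pow_add.
    replace (S j + k)%nat with (S (k + j)) by lia.
    rewrite <- Rpow_mult_distr. f_equal. field. lra.
Qed.

Lemma continuity_2d_pt_pow2 (k : nat) (y t : R) : continuity_2d_pt (fun _ v => v ^ k) y t.
Proof.
  apply (continuity_1d_2d_pt_comp (fun v => v ^ k) (fun _ v => v)).
  apply derivable_continuous_pt, derivable_pt_pow. apply continuity_2d_pt_id2.
Qed.

Lemma continuity_2d_exp (f : R -> R -> R) (y t : R) :
  continuity_2d_pt f y t -> continuity_2d_pt (fun u v => exp (f u v)) y t.
Proof.
  apply (continuity_1d_2d_pt_comp exp). apply derivable_continuous_pt, derivable_pt_exp.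
Qed.

Lemma eta_continuity (k : nat) (y t : R) : 0 < y -> continuity_2d_pt (eta k) y t.
Proof.
  intros Hy. destruct (total_order_T t 0) as [[Ht|Ht]|Ht].
  - apply continuity_2d_pt_ext_loc with (fun _ _ => 0).
    + exists (mkposreal (- t) ltac:(lra)). simpl. intros u v _ Hv.
      apply Rabs_def2 in Hv. symmetry. apply eta_neg_eq. lra.
    + apply continuity_2d_pt_const.
  - subst t. intros eps.
    (* The constant of [eta_le] at y/2 serves all parameters u within y/2 of y. *)
    set (M := (INR (S (k + 0)) / (y / 2)) ^ (S (k + 0))).
    assert (Hm : 0 < INR (S (k + 0))) by (apply lt_0_INR; lia).
    assert (HM : 0 < M). { apply pow_lt. apply Rdiv_lt_0_compat; lra. }
    assert (He := cond_pos eps).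
    assert (Hd : 0 < Rmin (y / 2) (eps / M)).
    { apply Rmin_pos. lra. apply Rdiv_lt_0_compat; auto. }
    exists (mkposreal _ Hd). simpl. intros u v Hu Hv.
    rewrite (eta_neg_eq k y 0) by lra. rewrite Rminus_0_r, Rabs_pos_eq by apply eta_nonneg.
    assert (Hu' := Rlt_le_trans _ _ _ Hu (Rmin_l _ _)).
    assert (Hv' := Rlt_le_trans _ _ _ Hv (Rmin_r _ _)).
    rewrite Rminus_0_r in Hv'. apply Rabs_def2 in Hu'.
    destruct (Rle_dec v 0). rewrite eta_neg_eq; auto.
    apply Rle_lt_trans with (M * v).
    + apply Rle_trans with (1 := eta_le k 0 u v ltac:(lra) ltac:(lra)).
      rewrite pow_1. apply Rmult_le_compat_r. lra. apply pow_incr. split.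
      apply Rdiv_le_0_compat; lra. apply Rmult_le_compat_l. lra. apply Rinv_le_contravar; lra.
    + rewrite Rabs_pos_eq in Hv' by lra.
      apply Rmult_lt_compat_l with (r := M) in Hv'; auto.
      replace (M * (eps / M)) with (pos eps) in Hv' by (field; lra). exact Hv'.
  - apply continuity_2d_pt_ext_loc with (fun u v => exp (- u * / v) * / v ^ k).
    + exists (mkposreal t Ht). simpl. intros u v _ Hv.
      apply Rabs_def2 in Hv. symmetry. apply eta_pos_eq. lra.
    + apply continuity_2d_pt_mult.
      * apply continuity_2d_exp. apply continuity_2d_pt_mult.
        apply continuity_2d_pt_opp, continuity_2d_pt_id1.
        apply continuity_2d_pt_inv. apply continuity_2d_pt_id2. lra.
      * apply continuity_2d_pt_inv. apply continuity_2d_pt_pow2. apply pow_nonzero. lra.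
Qed.

Lemma eta_derive_y (k : nat) (y t : R) :
  is_derive (fun z => eta k z t) y (- eta (S k) y t).
Proof.
  destruct (Rle_dec t 0).
  - rewrite eta_neg_eq by auto. rewrite Ropp_0.
    apply is_derive_ext with (fun _ => 0). intros; symmetry; now apply eta_neg_eq.
    apply der_const.
  - rewrite eta_pos_eq by lra.
    apply is_derive_ext with (fun z => exp (- z / t) / t ^ k).
    intros; symmetry; apply eta_pos_eq; lra.
    assert (t ^ k <> 0) by (apply pow_nonzero; lra).
    auto_derive. auto. simpl. unfold Rdiv. field. lra.
Qed.

Lemma is_derive_0_of_sq (f : R -> R) (K : R) :
  f 0 = 0 -> (forall t, Rabs (f t) <= K * t ^ 2) -> is_derive f 0 0.
Proof.
  intros H0 HK. apply is_derive_Reals. intros eps Heps.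
  assert (Hd : 0 < eps / (Rabs K + 1)). { apply Rdiv_lt_0_compat; auto. assert (H:=Rabs_pos K). lra. }
  exists (mkposreal _ Hd). simpl. intros h Hh Hhd. rewrite Rplus_0_l, H0, !Rminus_0_r.
  unfold Rdiv. rewrite Rabs_mult, Rabs_inv.
  assert (Hh' : 0 < Rabs h) by now apply Rabs_pos_lt.
  assert (HKp := Rabs_pos K). assert (HK' := Rle_abs K).
  specialize (HK h). rewrite <- pow2_abs in HK.
  apply Rle_lt_trans with (Rabs K * Rabs h).
  - apply Rmult_le_reg_r with (Rabs h); auto. rewrite Rmult_assoc, Rinv_l by lra. nra.
  - apply Rle_lt_trans with ((Rabs K + 1) * Rabs h). nra.
    apply Rmult_lt_reg_r with (/ (Rabs K + 1)). apply Rinv_0_lt_compat; lra.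
    replace ((Rabs K + 1) * Rabs h * / (Rabs K + 1)) with (Rabs h) by (field; lra). exact Hhd.
Qed.

Lemma eta_derive_t (k : nat) (y t : R) : 0 < y ->
  is_derive (eta k y) t (y * eta (S (S k)) y t - INR k * eta (S k) y t).
Proof.
  intros Hy. destruct (total_order_T t 0) as [[Ht|Ht]|Ht].
  - rewrite !eta_neg_eq by lra. rewrite !Rmult_0_r, Rminus_0_r.
    apply is_derive_ext_loc with (fun _ => 0).
    apply (filter_imp (fun u => u < 0)). intros; symmetry; apply eta_neg_eq; lra.
    now apply (open_lt 0). apply der_const.
  - subst t. rewrite !eta_neg_eq by lra. rewrite !Rmult_0_r, Rminus_0_r.
    apply is_derive_0_of_sq with ((INR (S (k + 1)) / y) ^ (S (k + 1))).
    apply eta_neg_eq; lra.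
    intros t. rewrite Rabs_pos_eq by apply eta_nonneg.
    destruct (Rle_dec t 0).
    + rewrite eta_neg_eq by auto. apply Rmult_le_pos. apply pow_le.
      apply Rdiv_le_0_compat; auto. apply pos_INR. nra.
    + apply eta_le; lra.
  - apply is_derive_ext_loc with (fun t => exp (- y / t) / t ^ k).
    apply (filter_imp (fun u => 0 < u)). intros; symmetry; apply eta_pos_eq; lra.
    now apply (open_gt 0).
    rewrite !eta_pos_eq by lra.
    assert (t ^ k <> 0) by (apply pow_nonzero; lra).
    auto_derive. split; auto. lra.
    change (- y * / t) with (- y / t). set (e := exp (- y / t)).
    destruct k. simpl. field. lra.
    generalize (INR (S k)); intros c.
    change (Nat.pred (S k)) with k. simpl pow. simpl in H.
    assert (t ^ k <> 0) by (apply pow_nonzero; lra). field. lra.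
Qed.

(** The exponential integral E_1(y/a), after the substitution s = y/t. *)
Definition expint (a y : R) : R := RInt (eta 1 y) 0 a.

Lemma expint_derive (a y : R) : 0 < a -> 0 < y ->
  is_derive (expint a) y (- exp (- y / a) / y).
Proof.
  intros Ha Hy. unfold expint. evar_last.
  apply (der_RInt_param (eta 1) (fun u t => - eta 2 u t) 0); auto.
  - intros u t Hu. apply eta_derive_y.
  - intros u t Hu. now apply eta_continuity.
  - intros u t Hu. now apply continuity_2d_pt_opp, eta_continuity.
  - apply is_RInt_unique.
    (* [eta 0] has t-derivative [y * eta 2], so [- eta 0 / y] is a primitive of [- eta 2], and it
       vanishes at 0. *)
    replace (- exp (- y / a) / y) with (minus ((-/y) * eta 0 y a) ((-/y) * eta 0 y 0)).
    apply (is_RInt_derive (fun t => (-/y) * eta 0 y t)).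
    + intros x _. evar_last. apply der_scal. now apply eta_derive_t. simpl. field. lra.
    + intros x _. apply (continuous_opp (eta 2 y)). now apply continuity_2d_snd, eta_continuity.
    + rewrite (eta_neg_eq 0 y 0) by lra. rewrite eta_pos_eq by lra.
      unfold minus, plus, opp; simpl. field. lra.
Qed.

Lemma ex_RInt_eta (k : nat) (y a b : R) : 0 < y -> ex_RInt (eta k y) a b.
Proof.
  intros Hy. apply (@ex_RInt_continuous R_CompleteNormedModule). intros z _.
  now apply continuity_2d_snd, eta_continuity.
Qed.

Lemma expint_bound (a y : R) : 0 < a -> 0 < y -> 0 <= expint a y <= a / y.
Proof.
  intros Ha Hy. split.
  - apply RInt_ge_0. lra. now apply ex_RInt_eta. intros; apply eta_nonneg.
  - apply Rle_trans with (RInt (fun _ => / y) 0 a).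
    + apply RInt_le. lra. now apply ex_RInt_eta. apply ex_RInt_const.
      intros t Ht. rewrite eta_pos_eq by lra.
      assert (H := exp_neg_le_pow 0 (y / t)).
      assert (Hyt : 0 < y / t) by (apply Rdiv_lt_0_compat; lra). specialize (H Hyt).
      replace (- (y / t)) with (- y / t) in H by (field; lra). simpl in H.
      apply Rmult_le_reg_r with t. lra.
      replace (exp (- y / t) / t ^ 1 * t) with (exp (- y / t)) by (field; lra).
      apply Rle_trans with (1 := H). apply Req_le. field. lra.
    + rewrite RInt_const. unfold scal; simpl; unfold mult; simpl. apply Req_le. field. lra.
Qed.

(** * Euler's constant *)

Definition ein_fun (t : R) : R := if Req_dec_T t 0 then 1 else (1 - exp (- t)) / t.

Lemma ein_fun_eq (t : R) : t <> 0 -> ein_fun t = (1 - exp (- t)) / t.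
Proof. intros H. unfold ein_fun. destruct (Req_dec_T t 0); [contradiction|reflexivity]. Qed.

Lemma exp_neg_quad (t : R) : 0 <= t -> 0 <= exp (- t) - 1 + t <= t * t.
Proof.
  intros Ht. assert (H := exp_ineq1_le (- t)). split. lra.
  destruct (Req_dec t 0). subst. rewrite Ropp_0, exp_0. lra.
  assert (H1 := exp_ineq1_le t).
  assert (exp (-t) <= / (1 + t)). { rewrite exp_Ropp. apply Rinv_le_contravar; lra. }
  assert (/ (1 + t) <= 1 - t + t * t).
  { apply Rmult_le_reg_r with (1 + t). lra. rewrite Rinv_l by lra. nra. }
  lra.
Qed.

Lemma ein_fun_continuous (t : R) : 0 <= t -> continuous (fun t => ein_fun (Rabs t)) t.
Proof.
  intros [Ht|Ht].
  - apply continuous_ext_loc with (fun t => (1 - exp (- t)) / t).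
    apply (filter_imp (fun u => 0 < u)). intros u Hu. rewrite Rabs_pos_eq by lra. symmetry. apply ein_fun_eq. lra.
    now apply (open_gt 0).
    apply (ex_derive_continuous (fun t => (1 - exp (- t)) / t)). auto_derive. lra.
  - subst t. apply continuity_pt_filterlim. intros eps Heps. exists eps. split; auto.
    intros u [_ Hu]. simpl in *. unfold R_dist in *. rewrite Rminus_0_r in Hu.
    rewrite (Rabs_R0). unfold ein_fun at 2. destruct (Req_dec_T 0 0); [|lra].
    destruct (Req_dec u 0). subst. rewrite Rabs_R0. unfold ein_fun. destruct (Req_dec_T 0 0); [|lra].
    rewrite Rminus_diag, Rabs_R0; auto.
    assert (Hp : 0 < Rabs u) by now apply Rabs_pos_lt.
    rewrite ein_fun_eq by lra.
    assert (H' := exp_neg_quad (Rabs u) ltac:(lra)).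
    apply Rle_lt_trans with (2 := Hu).
    replace ((1 - exp (- Rabs u)) / Rabs u - 1) with (- ((exp (- Rabs u) - 1 + Rabs u) / Rabs u)) by (field; lra).
    rewrite Rabs_Ropp, Rabs_pos_eq.
    apply Rmult_le_reg_r with (Rabs u); auto. unfold Rdiv. rewrite Rmult_assoc, Rinv_l by lra. lra.
    apply Rdiv_le_0_compat; lra.
Qed.

(** The complementary exponential integral. [Rabs] makes the integrand continuous on the whole line,
    so that integrability and the derivative carry no side conditions. *)
Definition Ein (y : R) : R := RInt (fun t => ein_fun (Rabs t)) 0 y.

Lemma ein_abs_continuous (t : R) : continuous (fun t => ein_fun (Rabs t)) t.
Proof.
  destruct (Rle_dec 0 t). now apply ein_fun_continuous.
  apply continuous_ext with (fun t => ein_fun (Rabs (- t))).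
  intros u. now rewrite Rabs_Ropp.
  apply (continuous_comp Ropp (fun t => ein_fun (Rabs t))).
  apply (ex_derive_continuous Ropp). auto_derive. auto.
  apply ein_fun_continuous. lra.
Qed.

Lemma ex_RInt_ein (a b : R) : ex_RInt (fun t => ein_fun (Rabs t)) a b.
Proof. apply (@ex_RInt_continuous R_CompleteNormedModule). intros; apply ein_abs_continuous. Qed.

Lemma Ein_derive (y : R) : is_derive Ein y (ein_fun (Rabs y)).
Proof.
  apply (is_derive_RInt (fun t => ein_fun (Rabs t)) Ein 0).
  - apply filter_forall. intros x. apply (@RInt_correct R_CompleteNormedModule). apply ex_RInt_ein.
  - apply ein_abs_continuous.
Qed.

Lemma pow_bernoulli (n : nat) (z : R) : 0 <= z <= 1 -> 1 - INR n * z <= (1 - z) ^ n.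
Proof.
  intros Hz. induction n as [|n IH].
  - simpl. lra.
  - rewrite S_INR. simpl pow. assert (Hn := pos_INR n).
    assert (0 <= INR n * z) by nra.
    apply Rle_trans with ((1 - z) * (1 - INR n * z)). nra.
    apply Rmult_le_compat_l; lra.
Qed.

Lemma exp_neg_pow (n : nat) (s : R) : (0 < n)%nat -> exp (- (s / INR n)) ^ n = exp (- s).
Proof.
  intros Hn. assert (0 < INR n) by now apply lt_0_INR.
  rewrite <- Rpower_pow by apply exp_pos. unfold Rpower. rewrite ln_exp. f_equal. field. lra.
Qed.

(** With z = s/n, the upper bound comes from (1 - z) exp z >= 1 - z^2, raised to the power n, and
    Bernoulli's inequality. *)
Lemma exp_minus_pow_bound (n : nat) (s : R) : (0 < n)%nat -> 0 <= s <= INR n ->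
  0 <= exp (- s) - (1 - s / INR n) ^ n <= s * (s / INR n * exp (- s)).
Proof.
  intros Hn [Hs Hsn]. assert (Hn' : 0 < INR n) by now apply lt_0_INR.
  set (z := s / INR n).
  assert (Hz : 0 <= z <= 1).
  { unfold z. split. apply Rdiv_le_0_compat; lra.
    apply Rmult_le_reg_r with (INR n); auto. unfold Rdiv. rewrite Rmult_assoc, Rinv_l by lra. lra. }
  assert (Hns : s = INR n * z) by (unfold z; field; lra).
  rewrite <- (exp_neg_pow n s Hn). fold z.
  split.
  - apply Rge_le, Rge_minus, Rle_ge. apply pow_incr. split. lra.
    assert (H := exp_ineq1_le (- z)). lra.
  - assert (H1 : exp (- z) ^ n * (1 - INR n * (z * z)) <= (1 - z) ^ n).
    { apply Rle_trans with (exp (- z) ^ n * (1 - z * z) ^ n).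
      - apply Rmult_le_compat_l. apply pow_le, Rlt_le, exp_pos.
        apply pow_bernoulli. nra.
      - rewrite <- Rpow_mult_distr. apply pow_incr.
        assert (He := exp_pos (- z)). split. apply Rmult_le_pos. lra. nra.
        replace (1 - z * z) with ((1 - z) * (1 + z)) by ring.
        assert (H := exp_ineq1_le z).
        apply Rle_trans with (exp (- z) * ((1 - z) * exp z)).
        apply Rmult_le_compat_l. lra. apply Rmult_le_compat_l; lra.
        rewrite exp_Ropp. apply Req_le. field. assert (Hz' := exp_pos z). lra. }
    rewrite Hns at 1. set (E := exp (- z) ^ n) in *. lra.
Qed.

(** Each 1/(k+1) is the integral of (1/n)(1 - s/n)^k. The geometric sum is the familiar integrand (1
    - (1 - s/n)^n)/s, here without a division by s. *)
Lemma harmonic_integral (n : nat) : (0 < n)%nat ->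
  is_RInt (fun s => sum_n (fun k => / INR n * (1 - s / INR n) ^ k) (pred n)) 0 (INR n) (harmonic n).
Proof.
  intros Hn. assert (Hn' : 0 < INR n) by now apply lt_0_INR.
  replace (harmonic n) with (sum_n (fun k => / INR (S k)) (pred n)).
  2:{ unfold harmonic. unfold sum_n. rewrite (sum_n_m_S (fun k => / INR k)).
      now replace (S (pred n)) with n by lia. }
  induction (pred n) as [|k IH].
  - apply is_RInt_ext with (fun s => / INR n * (1 - s / INR n) ^ 0).
    intros; now rewrite sum_O. rewrite sum_O. simpl pow.
    evar_last. apply @is_RInt_const. unfold scal; simpl; unfold mult; simpl. field. lra.
  - rewrite sum_Sn.
    apply is_RInt_ext with (fun s => plus (sum_n (fun k => / INR n * (1 - s / INR n) ^ k) k)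
      (/ INR n * (1 - s / INR n) ^ (S k))).
    intros; now rewrite sum_Sn.
    apply @is_RInt_plus. exact IH.
    assert (Hk : INR (S (S k)) <> 0) by (apply not_0_INR; lia).
    evar_last. apply (is_RInt_derive (fun s => - / INR (S (S k)) * (1 - s / INR n) ^ (S (S k)))).
    + intros x _. evar_last. apply der_scal.
      apply (is_derive_pow (fun s => 1 - s / INR n) (S (S k)) x (- / INR n)).
      auto_derive. auto. field. lra.
      change (Nat.pred (S (S k))) with (S k). set (P := (1 - x / INR n) ^ S k).
      generalize dependent (INR (S (S k))). intros c Hc. field. lra.
    + intros x _. apply (ex_derive_continuous (fun x => / INR n * (1 - x / INR n) ^ S k)). auto_derive. auto.
    + unfold minus, plus, opp; simpl opp. cbv beta.
      replace (1 - INR n / INR n) with 0 by (field; lra).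
      replace (1 - 0 / INR n) with 1 by (field; lra). rewrite pow1, pow_i by lia.
      simpl plus. change (- / INR (S (S k)) * 0 + - (- / INR (S (S k)) * 1) = / INR (S (S k))). ring.
Qed.

Lemma geom_quotient (q c : R) (m : nat) :
  (1 - q) * sum_n (fun k => c * q ^ k) m = c * (1 - q ^ (S m)).
Proof.
  induction m as [|m IH].
  - rewrite sum_O. simpl. ring.
  - rewrite sum_Sn. change plus with Rplus. rewrite Rmult_plus_distr_l, IH. simpl. ring.
Qed.

Lemma ein_harmonic_pointwise (n : nat) (s : R) : (0 < n)%nat -> 0 < s < INR n ->
  0 <= sum_n (fun k => / INR n * (1 - s / INR n) ^ k) (pred n) - ein_fun (Rabs s) <= / INR n * (s * exp (- s)).
Proof.
  intros Hn Hs. assert (Hn' : 0 < INR n) by now apply lt_0_INR.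
  rewrite Rabs_pos_eq, ein_fun_eq by lra.
  assert (H := exp_minus_pow_bound n s Hn ltac:(lra)).
  assert (G := geom_quotient (1 - s / INR n) (/ INR n) (pred n)).
  replace (S (pred n)) with n in G by lia.
  set (Sg := sum_n _ _) in *.
  replace Sg with ((1 - (1 - s / INR n) ^ n) / s).
  2:{ apply Rmult_eq_reg_l with (s / INR n). 2: { apply Rgt_not_eq, Rdiv_lt_0_compat; lra. }
      replace (1 - (1 - s / INR n)) with (s / INR n) in G by ring. rewrite G. field. lra. }
  replace ((1 - (1 - s / INR n) ^ n) / s - (1 - exp (- s)) / s) with
     ((exp (- s) - (1 - s / INR n) ^ n) / s) by (field; lra).
  split.
  - apply Rdiv_le_0_compat; lra.
  - apply Rmult_le_reg_r with s. lra. unfold Rdiv at 1. rewrite Rmult_assoc, Rinv_l by lra. lra.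
Qed.

(** The integrands differ by a nonnegative amount of at most s exp(-s)/n, and s exp(-s) has integral
    1 over the half-line. *)
Lemma harmonic_Ein (n : nat) : (0 < n)%nat -> 0 <= harmonic n - Ein (INR n) <= / INR n.
Proof.
  intros Hn. assert (Hn' : 0 < INR n) by now apply lt_0_INR.
  assert (HI := is_RInt_minus _ _ _ _ _ _ (harmonic_integral n Hn) (RInt_correct _ _ _ (ex_RInt_ein 0 (INR n)))).
  change (minus (harmonic n) (RInt (fun t => ein_fun (Rabs t)) 0 (INR n))) with (harmonic n - Ein (INR n)) in HI.
  assert (HE : is_RInt (fun s => / INR n * (s * exp (- s))) 0 (INR n)
     (minus (/ INR n * (- (INR n + 1) * exp (- INR n))) (/ INR n * (- (0 + 1) * exp (- 0))))).
  { apply (is_RInt_derive (fun s => / INR n * (- (s + 1) * exp (- s)))).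
    - intros x _. auto_derive. auto. ring.
    - intros x _. apply (ex_derive_continuous (fun x => / INR n * (x * exp (- x)))). auto_derive. auto. }
  split.
  - assert (HZ : is_RInt (fun _ : R => 0) 0 (INR n) 0).
    { evar_last. apply (is_RInt_const (V := R_NormedModule) 0 (INR n) 0).
      unfold scal; simpl; unfold mult; simpl; ring. }
    apply (is_RInt_le _ _ 0 (INR n) _ _ ltac:(lra) HZ HI).
    intros s Hs. apply ein_harmonic_pointwise; auto.
  - apply Rle_trans with (minus (/ INR n * (- (INR n + 1) * exp (- INR n))) (/ INR n * (- (0 + 1) * exp (- 0)))).
    + apply (is_RInt_le _ _ 0 (INR n) _ _ ltac:(lra) HI HE). intros s Hs. apply ein_harmonic_pointwise; auto.
    + unfold minus, plus, opp; simpl. rewrite Ropp_0, exp_0.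
      assert (0 < / INR n) by now apply Rinv_0_lt_compat.
      assert (0 < exp (- INR n)) by apply exp_pos.
      assert (0 <= / INR n * ((INR n + 1) * exp (- INR n))).
      { apply Rmult_le_pos. lra. apply Rmult_le_pos; lra. }
      lra.
Qed.

Lemma is_lim_seq_inv_INR : is_lim_seq (fun n => / INR n) 0.
Proof. apply (is_lim_seq_inv _ p_infty). apply is_lim_seq_INR. easy. Qed.

(** E_1(z) + ln z - Ein(z) has derivative 0. At z = n both E_1(n) and H_n - Ein(n) tend to 0, which
    identifies the constant as -gamma and shows on the way that the limit defining [euler_gamma]
    exists. *)
Lemma expint_eq (a y : R) : 0 < a -> 0 < y ->
  expint a y = - euler_gamma - ln (y / a) + Ein (y / a).
Proof.
  intros Ha Hy.
  set (phi := fun y => expint a y + ln (y / a) - Ein (y / a)).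
  assert (Hc : forall u v, 0 < u -> 0 < v -> phi u = phi v).
  { apply is_derive_zero_const. intros x Hx. unfold phi. evar_last.
    apply der_minus. apply der_plus. now apply expint_derive.
    auto_derive. 2: reflexivity. apply Rdiv_lt_0_compat; lra.
    apply (der_comp Ein). apply Ein_derive. auto_derive; auto.
    assert (0 < x / a) by (apply Rdiv_lt_0_compat; lra).
    rewrite Rabs_pos_eq, ein_fun_eq by lra.
    replace (- x / a) with (- (x / a)) by (field; lra). set (e := exp _). field. lra. }
  assert (L : is_lim_seq (fun n => harmonic n - ln (INR n)) (- phi y)).
  { apply is_lim_seq_ext_loc with (fun n => (expint a (a * INR n) + (harmonic n - Ein (INR n))) - phi y).
    - exists 1%nat. intros n Hn. assert (Hn' : 0 < INR n) by (apply lt_0_INR; lia).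
      (* The constant is evaluated where y/a is the integer n. *)
      rewrite (Hc y (a * INR n)); auto. 2: now apply Rmult_lt_0_compat.
      unfold phi. replace (a * INR n / a) with (INR n) by (field; lra). ring.
    - replace (Finite (- phi y)) with (Finite (0 + 0 - phi y)) by (f_equal; ring).
      apply is_lim_seq_minus'; [|apply is_lim_seq_const]. apply is_lim_seq_plus'.
      + apply is_lim_seq_le_le_loc with (fun _ => 0) (fun n => / INR n).
        2: apply is_lim_seq_const. 2: apply is_lim_seq_inv_INR.
        exists 1%nat. intros n Hn. assert (Hn' : 0 < INR n) by (apply lt_0_INR; lia).
        assert (H := expint_bound a (a * INR n) Ha ltac:(apply Rmult_lt_0_compat; lra)).
        replace (a / (a * INR n)) with (/ INR n) in H by (field; lra). exact H.
      + apply is_lim_seq_le_le_loc with (fun _ => 0) (fun n => / INR n).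
        2: apply is_lim_seq_const. 2: apply is_lim_seq_inv_INR.
        exists 1%nat. intros n Hn. apply harmonic_Ein. lia. }
  apply is_lim_seq_unique in L. unfold euler_gamma. rewrite L. simpl real. unfold phi. ring.
Qed.

(** * The contour integral *)

Lemma cosh_derive (a : R) : is_derive cosh a (sinh a).
Proof. unfold cosh, sinh. auto_derive. auto. field. Qed.

Lemma sinh_derive (a : R) : is_derive sinh a (cosh a).
Proof. unfold cosh, sinh. auto_derive. auto. field. Qed.

Lemma cos_derive (a : R) : is_derive cos a (- sin a).
Proof. auto_derive. auto. ring. Qed.

Lemma sin_derive (a : R) : is_derive sin a (cos a).
Proof. auto_derive. auto. ring. Qed.

Lemma cosh2_sinh2 (a : R) : cosh a * cosh a - sinh a * sinh a = 1.
Proof.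
  unfold cosh, sinh. assert (H : exp a * exp (- a) = 1) by (rewrite <- exp_plus, Rplus_opp_r; apply exp_0).
  replace ((exp a + exp (- a)) / 2 * ((exp a + exp (- a)) / 2) - (exp a - exp (- a)) / 2 * ((exp a - exp (- a)) / 2))
    with (exp a * exp (- a)) by field. exact H.
Qed.

(* For w = (1+i)a : cosh w = cC + i cS and exp(i x cosh w) = eR + i eI. *)
Definition cS (a : R) : R := sinh a * sin a.
Definition cC (a : R) : R := cosh a * cos a.
Definition eR (x a : R) : R := exp (- x * cS a) * cos (x * cC a).
Definition eI (x a : R) : R := exp (- x * cS a) * sin (x * cC a).

Lemma cS_derive (a : R) : is_derive cS a (sinh a * cos a + cosh a * sin a).
Proof.
  unfold cS. evar_last. apply der_mult. apply sinh_derive. apply sin_derive. ring.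
Qed.

Lemma cC_derive (a : R) : is_derive cC a (sinh a * cos a - cosh a * sin a).
Proof.
  unfold cC. evar_last. apply der_mult. apply cosh_derive. apply cos_derive. ring.
Qed.

Lemma cos2_eq (a : R) : cos a * cos a = 1 - sin a * sin a.
Proof. assert (H := sin2_cos2 a). unfold Rsqr in H. lra. Qed.

Lemma eR_derive_x (x a : R) : is_derive (fun z => eR z a) x (- cS a * eR x a - cC a * eI x a).
Proof. unfold eR, eI. auto_derive. auto. ring. Qed.

Lemma eI_derive_x (x a : R) : is_derive (fun z => eI z a) x (- cS a * eI x a + cC a * eR x a).
Proof. unfold eR, eI. auto_derive. auto. ring. Qed.

Lemma eR_derive_a (x a : R) : is_derive (eR x) a
  (- x * (sinh a * cos a + cosh a * sin a) * eR x a - x * (sinh a * cos a - cosh a * sin a) * eI x a).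
Proof.
  unfold eR, eI. evar_last. apply der_mult.
  apply (der_comp exp). apply is_derive_exp. apply der_scal. apply cS_derive.
  apply (der_comp cos). apply cos_derive. apply der_scal. apply cC_derive. cbv beta. ring.
Qed.

Lemma eI_derive_a (x a : R) : is_derive (eI x) a
  (- x * (sinh a * cos a + cosh a * sin a) * eI x a + x * (sinh a * cos a - cosh a * sin a) * eR x a).
Proof.
  unfold eR, eI. evar_last. apply der_mult.
  apply (der_comp exp). apply is_derive_exp. apply der_scal. apply cS_derive.
  apply (der_comp sin). apply sin_derive. apply der_scal. apply cC_derive. cbv beta. ring.
Qed.

Lemma continuity_2d_of_snd (f : R -> R) (x a : R) : continuous f a -> continuity_2d_pt (fun _ v => f v) x a.
Proof.
  intros H. apply (continuity_1d_2d_pt_comp f (fun _ v => v)).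
  now apply continuity_pt_filterlim. apply continuity_2d_pt_id2.
Qed.

Lemma continuity_2d_of_derive (f : R -> R) (x a l : R) : is_derive f a l -> continuity_2d_pt (fun _ v => f v) x a.
Proof.
  intros H. apply continuity_2d_of_snd. apply (ex_derive_continuous f). now exists l.
Qed.

Lemma cS_continuity_2d (x a : R) : continuity_2d_pt (fun _ v => cS v) x a.
Proof. eapply continuity_2d_of_derive, cS_derive. Qed.

Lemma cC_continuity_2d (x a : R) : continuity_2d_pt (fun _ v => cC v) x a.
Proof. eapply continuity_2d_of_derive, cC_derive. Qed.

Lemma eR_continuity_2d (x a : R) : continuity_2d_pt eR x a.
Proof.
  unfold eR. apply continuity_2d_pt_mult. apply continuity_2d_exp.
  apply continuity_2d_pt_mult. apply continuity_2d_pt_opp, continuity_2d_pt_id1. apply cS_continuity_2d.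
  apply (continuity_1d_2d_pt_comp cos). apply continuity_cos.
  apply continuity_2d_pt_mult. apply continuity_2d_pt_id1. apply cC_continuity_2d.
Qed.

Lemma eI_continuity_2d (x a : R) : continuity_2d_pt eI x a.
Proof.
  unfold eI. apply continuity_2d_pt_mult. apply continuity_2d_exp.
  apply continuity_2d_pt_mult. apply continuity_2d_pt_opp, continuity_2d_pt_id1. apply cS_continuity_2d.
  apply (continuity_1d_2d_pt_comp sin). apply continuity_sin.
  apply continuity_2d_pt_mult. apply continuity_2d_pt_id1. apply cC_continuity_2d.
Qed.

Ltac cont2d := repeat first
  [ apply eR_continuity_2d | apply eI_continuity_2d | apply cS_continuity_2d | apply cC_continuity_2d
  | apply continuity_2d_pt_const | apply continuity_2d_pt_id1 | apply continuity_2d_pt_id2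
  | apply continuity_2d_pt_minus | apply continuity_2d_pt_plus | apply continuity_2d_pt_mult
  | apply continuity_2d_pt_opp ].

(* x-derivatives of (1+i) exp(i x cosh w), of order j = 0, 1, 2 *)
Definition dRe (j : nat) (x a : R) : R :=
  match j with
  | O => eR x a - eI x a
  | 1%nat => (- cS a * eR x a - cC a * eI x a) - (- cS a * eI x a + cC a * eR x a)
  | _ => (cS a * cS a - cC a * cC a) * (eR x a - eI x a) + 2 * cS a * cC a * (eI x a + eR x a)
  end.
Definition dIm (j : nat) (x a : R) : R :=
  match j with
  | O => eR x a + eI x a
  | 1%nat => (- cS a * eR x a - cC a * eI x a) + (- cS a * eI x a + cC a * eR x a)
  | _ => (cS a * cS a - cC a * cC a) * (eR x a + eI x a) + 2 * cS a * cC a * (eI x a - eR x a)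
  end.

Lemma dRe_continuity (j : nat) (x a : R) : continuity_2d_pt (dRe j) x a.
Proof. destruct j as [|[|j]]; unfold dRe; cont2d. Qed.

Lemma dIm_continuity (j : nat) (x a : R) : continuity_2d_pt (dIm j) x a.
Proof. destruct j as [|[|j]]; unfold dIm; cont2d. Qed.

Lemma dRe_derive (j : nat) (x a : R) : (j < 2)%nat -> is_derive (fun z => dRe j z a) x (dRe (S j) x a).
Proof.
  intros Hj. destruct j as [|[|j]]; [| |lia]; unfold dRe; evar_last.
  - apply der_minus. apply eR_derive_x. apply eI_derive_x.
  - ring.
  - apply der_minus. apply der_minus; apply der_scal. apply eR_derive_x. apply eI_derive_x.
    apply der_plus; apply der_scal. apply eI_derive_x. apply eR_derive_x.
  - cbv beta. ring.
Qed.

Lemma dIm_derive (j : nat) (x a : R) : (j < 2)%nat -> is_derive (fun z => dIm j z a) x (dIm (S j) x a).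
Proof.
  intros Hj. destruct j as [|[|j]]; [| |lia]; unfold dIm; evar_last.
  - apply der_plus. apply eR_derive_x. apply eI_derive_x.
  - ring.
  - apply der_plus. apply der_minus; apply der_scal. apply eR_derive_x. apply eI_derive_x.
    apply der_plus; apply der_scal. apply eI_derive_x. apply eR_derive_x.
  - cbv beta. ring.
Qed.

Definition Ere (j : nat) (x : R) : R := RInt (dRe j x) 0 (PI / 2).
Definition Eim (j : nat) (x : R) : R := RInt (dIm j x) 0 (PI / 2).

Lemma Ere_derive (j : nat) (x : R) : (j < 2)%nat -> is_derive (Ere j) x (Ere (S j) x).
Proof.
  intros Hj. apply (der_RInt_param (dRe j) (dRe (S j)) (x - 1)). lra.
  intros u t _. now apply dRe_derive.
  intros u t _. apply dRe_continuity. intros u t _. apply dRe_continuity.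
Qed.

Lemma Eim_derive (j : nat) (x : R) : (j < 2)%nat -> is_derive (Eim j) x (Eim (S j) x).
Proof.
  intros Hj. apply (der_RInt_param (dIm j) (dIm (S j)) (x - 1)). lra.
  intros u t _. now apply dIm_derive.
  intros u t _. apply dIm_continuity. intros u t _. apply dIm_continuity.
Qed.

Lemma is_RInt_dRe (j : nat) (x : R) : is_RInt (dRe j x) 0 (PI / 2) (Ere j x).
Proof.
  apply (@RInt_correct R_CompleteNormedModule). apply (@ex_RInt_continuous R_CompleteNormedModule).
  intros z _. apply continuity_2d_snd, dRe_continuity.
Qed.

Lemma is_RInt_dIm (j : nat) (x : R) : is_RInt (dIm j x) 0 (PI / 2) (Eim j x).
Proof.
  apply (@RInt_correct R_CompleteNormedModule). apply (@ex_RInt_continuous R_CompleteNormedModule).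
  intros z _. apply continuity_2d_snd, dIm_continuity.
Qed.

Lemma is_RInt_R_unique (f : R -> R) (a b l1 l2 : R) : is_RInt f a b l1 -> is_RInt f a b l2 -> l1 = l2.
Proof. intros H1 H2. rewrite <- (is_RInt_unique _ _ _ _ H1). now apply is_RInt_unique. Qed.

(** The Bessel integrand and the a-derivative of its primitive differ by a multiple of this
    expression; once it is factored out, [ring] verifies the rest. *)
Definition hyp_trig_defect (a : R) : R :=
  (sinh a * sin a) ^ 2 - (cosh a * cos a) ^ 2 + 1 - (cosh a * sin a) ^ 2 + (sinh a * cos a) ^ 2.

Lemma hyp_trig_defect_0 (a : R) : hyp_trig_defect a = 0.
Proof.
  unfold hyp_trig_defect. assert (H1 := cos2_eq a). assert (H2 := cosh2_sinh2 a).
  transitivity (1 - (cosh a * cosh a - sinh a * sinh a) * (cos a * cos a + sin a * sin a)). ring.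
  rewrite H2, H1. ring.
Qed.

(** Bessel's operator applied to exp(i x cosh w) is the w-derivative of i sinh w exp(i x cosh w);
    [F] is the real part of that primitive. The boundary term sits at the corner w = (1+i) pi/2,
    where cosh w = i sinh(pi/2) and sinh w = i cosh(pi/2). *)
Lemma Ere_ode (x : R) :
  x * Ere 2 x + Ere 1 x + x * Ere 0 x = - cosh (PI / 2) * exp (- x * sinh (PI / 2)).
Proof.
  set (F := fun a => - (sinh a * cos a * eI x a + cosh a * sin a * eR x a)).
  apply is_RInt_R_unique with (fun a => x * dRe 2 x a + dRe 1 x a + x * dRe 0 x a) 0 (PI / 2).
  - apply (is_RInt_plus (fun a => x * dRe 2 x a + dRe 1 x a) (fun a => x * dRe 0 x a)).
    apply (is_RInt_plus (fun a => x * dRe 2 x a) (dRe 1 x)).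
    apply (is_RInt_scal (dRe 2 x)). apply is_RInt_dRe. apply is_RInt_dRe.
    apply (is_RInt_scal (dRe 0 x)). apply is_RInt_dRe.
  - replace (- cosh (PI / 2) * exp (- x * sinh (PI / 2))) with (minus (F (PI / 2)) (F 0)).
    apply (is_RInt_derive F).
    + intros a _. unfold F. evar_last. apply der_opp, der_plus.
      apply der_mult. apply der_mult. apply sinh_derive. apply cos_derive. apply eI_derive_a.
      apply der_mult. apply der_mult. apply cosh_derive. apply sin_derive. apply eR_derive_a.
      cbv beta. unfold dRe, cS, cC. apply Rminus_diag_uniq.
      transitivity (- x * (eR x a - eI x a) * hyp_trig_defect a).
      unfold hyp_trig_defect; ring. rewrite hyp_trig_defect_0; ring.
    + intros a _. apply continuity_2d_snd with (f := fun x a => x * dRe 2 x a + dRe 1 x a + x * dRe 0 x a).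
      apply continuity_2d_pt_plus. apply continuity_2d_pt_plus. apply continuity_2d_pt_mult.
      apply continuity_2d_pt_id1. apply dRe_continuity. apply dRe_continuity.
      apply continuity_2d_pt_mult.
      apply continuity_2d_pt_id1. apply dRe_continuity.
    + unfold F, minus, plus, opp; simpl. unfold eR, eI, cS, cC. rewrite cos_PI2, sin_PI2, sin_0, sinh_0.
      rewrite !Rmult_0_r, cos_0, sin_0, !Rmult_1_r. ring.
Qed.

Lemma Eim_ode (x : R) : x * Eim 2 x + Eim 1 x + x * Eim 0 x = 0.
Proof.
  set (F := fun a => sinh a * cos a * eR x a - cosh a * sin a * eI x a).
  apply is_RInt_R_unique with (fun a => x * dIm 2 x a + dIm 1 x a + x * dIm 0 x a) 0 (PI / 2).
  - apply (is_RInt_plus (fun a => x * dIm 2 x a + dIm 1 x a) (fun a => x * dIm 0 x a)).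
    apply (is_RInt_plus (fun a => x * dIm 2 x a) (dIm 1 x)).
    apply (is_RInt_scal (dIm 2 x)). apply is_RInt_dIm. apply is_RInt_dIm.
    apply (is_RInt_scal (dIm 0 x)). apply is_RInt_dIm.
  - evar_last. apply (is_RInt_derive F).
    + intros a _. unfold F. evar_last. apply der_minus.
      apply der_mult. apply der_mult. apply sinh_derive. apply cos_derive. apply eR_derive_a.
      apply der_mult. apply der_mult. apply cosh_derive. apply sin_derive. apply eI_derive_a.
      cbv beta. unfold dIm, cS, cC. apply Rminus_diag_uniq.
      transitivity (- x * (eR x a + eI x a) * hyp_trig_defect a).
      unfold hyp_trig_defect; ring. rewrite hyp_trig_defect_0; ring.
    + intros a _. apply continuity_2d_snd with (f := fun x a => x * dIm 2 x a + dIm 1 x a + x * dIm 0 x a).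
      apply continuity_2d_pt_plus. apply continuity_2d_pt_plus. apply continuity_2d_pt_mult.
      apply continuity_2d_pt_id1. apply dIm_continuity. apply dIm_continuity.
      apply continuity_2d_pt_mult.
      apply continuity_2d_pt_id1. apply dIm_continuity.
    + unfold F, minus, plus, opp; simpl. unfold eR, eI, cS, cC. rewrite cos_PI2, sin_PI2, sin_0, sinh_0.
      rewrite !Rmult_0_r, cos_0, sin_0, !Rmult_1_r. ring.
Qed.

Lemma E_at_0 : Ere 0 0 = PI / 2 /\ Eim 0 0 = PI / 2.
Proof.
  assert (HR : forall a, eR 0 a = 1).
  { intros a. unfold eR. rewrite Ropp_0, !Rmult_0_l, exp_0, cos_0. ring. }
  assert (HI : forall a, eI 0 a = 0).
  { intros a. unfold eI. rewrite Ropp_0, !Rmult_0_l, exp_0, sin_0. ring. }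
  assert (HC : forall f : R -> R, (forall a, f a = 1) -> RInt f 0 (PI / 2) = PI / 2).
  { intros f Hf. rewrite (RInt_ext f (fun _ => 1)) by (intros; apply Hf).
    rewrite RInt_const. unfold scal; simpl; unfold mult; simpl. ring. }
  unfold Ere, Eim. split; apply HC; intros a; simpl; rewrite HR, HI; ring.
Qed.

(** * The horizontal part of the contour, in the variable t = exp(-a) *)

(** The image of the corner a = pi/2. On w = a + i pi/2 the integrand is the real function exp(-x
    sinh a). *)
Definition t0 : R := exp (- (PI / 2)).

Lemma t0_bounds : 0 < t0 < 1.
Proof.
  unfold t0. split. apply exp_pos. rewrite <- exp_0. apply exp_increasing.
  assert (H := PI_RGT_0). lra.
Qed.

(* x-derivatives of exp(-x sinh a) / t, with sinh a = (1/t - t)/2 *)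
Definition dT (j : nat) (x t : R) : R :=
  match j with
  | O => eta 1 (x / 2) t
  | 1%nat => / 2 * (t * eta 1 (x / 2) t - eta 2 (x / 2) t)
  | _ => / 4 * (eta 3 (x / 2) t - 2 * eta 1 (x / 2) t + t * t * eta 1 (x / 2) t)
  end * exp (x * t / 2).

Definition Tint (j : nat) (x : R) : R := RInt (dT j x) 0 t0.

Lemma eta_half_continuity (k : nat) (x t : R) : 0 < x -> continuity_2d_pt (fun x t => eta k (x / 2) t) x t.
Proof.
  intros Hx eps. destruct (eta_continuity k (x / 2) t ltac:(lra) eps) as [d Hd].
  exists d. intros u v Hu Hv. apply Hd; auto.
  replace (u / 2 - x / 2) with ((u - x) / 2) by field. unfold Rdiv. rewrite Rabs_mult, (Rabs_pos_eq (/ 2)) by lra.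
  assert (H := Rabs_pos (u - x)). lra.
Qed.

Lemma dT_continuity (j : nat) (x t : R) : 0 < x -> continuity_2d_pt (dT j) x t.
Proof.
  intros Hx. unfold dT, Rdiv. apply continuity_2d_pt_mult.
  - destruct j as [|[|j]].
    + now apply eta_half_continuity.
    + repeat first [ now apply eta_half_continuity | apply continuity_2d_pt_const | apply continuity_2d_pt_id2
        | apply continuity_2d_pt_minus | apply continuity_2d_pt_plus | apply continuity_2d_pt_mult ].
    + repeat first [ now apply eta_half_continuity | apply continuity_2d_pt_const | apply continuity_2d_pt_id2
        | apply continuity_2d_pt_minus | apply continuity_2d_pt_plus | apply continuity_2d_pt_mult ].
  - apply continuity_2d_exp. cont2d.
Qed.

Lemma eta_half_derive (k : nat) (x t : R) :
  is_derive (fun z => eta k (z / 2) t) x (/ 2 * - eta (S k) (x / 2) t).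
Proof.
  apply (der_comp (fun y => eta k y t) (fun z => z / 2)). apply eta_derive_y. auto_derive. auto. field.
Qed.

Lemma dT_derive (j : nat) (x t : R) : (j < 2)%nat -> is_derive (fun z => dT j z t) x (dT (S j) x t).
Proof.
  intros Hj. assert (He : is_derive (fun z => exp (z * t / 2)) x (t / 2 * exp (x * t / 2))).
  { auto_derive. auto. unfold Rdiv. ring. }
  assert (E1 := eta_S 1 (x / 2) t). assert (E2 := eta_S 2 (x / 2) t).
  destruct j as [|[|j]]; [| |lia]; unfold dT; evar_last.
  - apply der_mult. apply eta_half_derive. exact He.
  - cbv beta. field.
  - apply der_mult. apply der_scal, der_minus. apply der_scal. apply eta_half_derive.
    apply eta_half_derive. exact He.
  - cbv beta. rewrite <- E1, <- E2. field.
Qed.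

Lemma Tint_derive (j : nat) (x : R) : (j < 2)%nat -> 0 < x -> is_derive (Tint j) x (Tint (S j) x).
Proof.
  intros Hj Hx. apply (der_RInt_param (dT j) (dT (S j)) 0). lra.
  intros u t _. now apply dT_derive.
  intros u t Hu. now apply dT_continuity. intros u t Hu. now apply dT_continuity.
Qed.

Lemma ex_RInt_dT (j : nat) (x a b : R) : 0 < x -> ex_RInt (dT j x) a b.
Proof.
  intros Hx. apply (@ex_RInt_continuous R_CompleteNormedModule).
  intros z _. now apply continuity_2d_snd, dT_continuity.
Qed.

Lemma is_RInt_dT (j : nat) (x : R) : 0 < x -> is_RInt (dT j x) 0 t0 (Tint j x).
Proof. intros Hx. apply (@RInt_correct R_CompleteNormedModule). now apply ex_RInt_dT. Qed.

(** The primitive [F] is cosh a exp(-x sinh a) in the variable t. Its value at the corner is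
    opposite to the right side of [Ere_ode], so the two parts of the contour together solve Bessel's
    equation. *)
Lemma Tint_ode (x : R) : 0 < x ->
  x * Tint 2 x + Tint 1 x + x * Tint 0 x = cosh (PI / 2) * exp (- x * sinh (PI / 2)).
Proof.
  intros Hx.
  set (F := fun t => / 2 * (eta 1 (x / 2) t + t * eta 0 (x / 2) t) * exp (x * t / 2)).
  apply is_RInt_R_unique with (fun t => x * dT 2 x t + dT 1 x t + x * dT 0 x t) 0 t0.
  - apply (is_RInt_plus (fun a => x * dT 2 x a + dT 1 x a) (fun a => x * dT 0 x a)).
    apply (is_RInt_plus (fun a => x * dT 2 x a) (dT 1 x)).
    apply (is_RInt_scal (dT 2 x)). now apply is_RInt_dT. now apply is_RInt_dT.
    apply (is_RInt_scal (dT 0 x)). now apply is_RInt_dT.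
  - replace (cosh (PI / 2) * exp (- x * sinh (PI / 2))) with (minus (F t0) (F 0)).
    apply (is_RInt_derive F).
    + intros t _. unfold F. evar_last. apply der_mult.
      apply der_scal, der_plus. apply eta_derive_t. lra.
      apply der_mult. apply der_id. apply eta_derive_t. lra.
      auto_derive. auto. reflexivity.
      cbv beta. unfold dT. rewrite <- (eta_S 0), <- (eta_S 1), <- (eta_S 2). simpl INR. unfold Rdiv. field.
    + intros t _. apply continuity_2d_snd with (f := fun x a => x * dT 2 x a + dT 1 x a + x * dT 0 x a).
      apply continuity_2d_pt_plus. apply continuity_2d_pt_plus. apply continuity_2d_pt_mult.
      apply continuity_2d_pt_id1. now apply dT_continuity. now apply dT_continuity.
      apply continuity_2d_pt_mult.
      apply continuity_2d_pt_id1. now apply dT_continuity.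
    + assert (H0 := t0_bounds). unfold F. rewrite !(eta_neg_eq _ _ 0) by lra.
      rewrite !eta_pos_eq by lra. unfold minus, plus, opp; simpl.
      assert (Hinv : / t0 = exp (PI / 2)) by (unfold t0; rewrite exp_Ropp; apply Rinv_inv).
      replace (exp (- x * sinh (PI / 2))) with (exp (- (x / 2) / t0) * exp (x * t0 / 2)).
      2:{ rewrite <- exp_plus. f_equal. unfold sinh. fold t0. rewrite <- Hinv. field. lra. }
      unfold cosh. rewrite <- Hinv. fold t0. field. lra.
Qed.

(** Dropping the factor exp(x t / 2) costs at most x t relative to an integrand below 1/t; the
    logarithmic singularity of [Tint 0] is therefore that of the exponential integral. *)
Lemma Tint_expint (x : R) : 0 < x <= 1 -> 0 <= Tint 0 x - expint t0 (x / 2) <= x.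
Proof.
  intros [Hx Hx1]. assert (H0 := t0_bounds).
  assert (HI := is_RInt_minus _ _ _ _ _ _ (is_RInt_dT 0 x Hx)
    (RInt_correct _ _ _ (ex_RInt_eta 1 (x / 2) 0 t0 ltac:(lra)))).
  change (minus (Tint 0 x) (RInt (eta 1 (x / 2)) 0 t0)) with (Tint 0 x - expint t0 (x / 2)) in HI.
  assert (HB : forall t, 0 < t < t0 -> 0 <= dT 0 x t - eta 1 (x / 2) t <= x).
  { intros t Ht. unfold dT. replace (eta 1 (x / 2) t * exp (x * t / 2) - eta 1 (x / 2) t) with
      (eta 1 (x / 2) t * (exp (x * t / 2) - 1)) by ring.
    assert (Hn := eta_nonneg 1 (x / 2) t).
    assert (He := exp_ineq1_le (x * t / 2)).
    assert (Hz : 0 <= x * t / 2 <= / 2). { split; nra. }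
    split. apply Rmult_le_pos. auto. lra.
    assert (H1 : eta 1 (x / 2) t <= / t).
    { rewrite eta_pos_eq, pow_1 by lra. unfold Rdiv at 1. rewrite <- (Rmult_1_l (/ t)) at 2.
      apply Rmult_le_compat_r. apply Rlt_le, Rinv_0_lt_compat; lra.
      rewrite <- exp_0. apply Rlt_le, exp_increasing.
      assert (0 < (x / 2) / t) by (apply Rdiv_lt_0_compat; lra).
      replace (- (x / 2) / t) with (- (x / 2 / t)) by (field; lra). lra. }
    assert (H2 : exp (x * t / 2) - 1 <= x * t).
    { set (z := x * t / 2) in *. replace (x * t) with (2 * z) by (unfold z; field).
      assert (H3 := exp_ineq1_le (- z)).
      assert (H4 : exp z <= / (1 - z)). { rewrite <- (Ropp_involutive z) at 1. rewrite exp_Ropp.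
        apply Rinv_le_contravar; lra. }
      assert (/ (1 - z) <= 1 + 2 * z). { apply Rmult_le_reg_r with (1 - z). lra. rewrite Rinv_l by lra. nra. }
      lra. }
    apply Rle_trans with (/ t * (x * t)). apply Rmult_le_compat; lra. apply Req_le; field; lra. }
  assert (HC : forall c, is_RInt (fun _ : R => c) 0 t0 (t0 * c)).
  { intros c. evar_last. apply (is_RInt_const (V := R_NormedModule) 0 t0 c).
    unfold scal; simpl; unfold mult; simpl; ring. }
  split.
  - replace 0 with (t0 * 0) by ring. apply (is_RInt_le _ _ 0 t0 _ _ ltac:(lra) (HC 0) HI).
    intros t Ht. now apply HB.
  - apply Rle_trans with (t0 * x). apply (is_RInt_le _ _ 0 t0 _ _ ltac:(lra) HI (HC x)).
    intros t Ht. now apply HB. nra.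
Qed.

(** * Uniqueness for Bessel's equation of order 0 *)

Lemma bessel0_solution (d d1 : R -> R) :
  (forall x, 0 < x -> is_derive d x (d1 x)) ->
  (forall x, 0 < x -> is_derive d1 x (- d1 x / x - d x)) ->
  exists a b, forall x, 0 < x -> d x = a * bessel_J 0 x + b * bessel_Y 0 x.
Proof.
  intros Hd Hd1. assert (HP := PI_RGT_0).
  (* [A] and [B] are x times the Wronskians of d with Y_0 and with J_0. Both are constant, and
     [bessel_wronskian] is the determinant that solves for d. *)
  set (A := fun x => x * (- d x * bessel_Y 1 x - d1 x * bessel_Y 0 x)).
  set (B := fun x => x * (- d x * bessel_J 1 x - d1 x * bessel_J 0 x)).
  assert (HA : forall x, 0 < x -> is_derive A x 0).
  { intros x Hx. unfold A. evar_last.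
    apply der_mult. apply der_id. apply der_minus; apply der_mult.
    apply der_opp. now apply Hd. now apply bessel_Y1_derive. now apply Hd1. now apply bessel_Y0_derive.
    cbv beta. field. lra. }
  assert (HB : forall x, 0 < x -> is_derive B x 0).
  { intros x Hx. unfold B. evar_last.
    apply der_mult. apply der_id. apply der_minus; apply der_mult.
    apply der_opp. now apply Hd. now apply bessel_J1_derive. now apply Hd1. apply bessel_J0_derive.
    cbv beta. field. lra. }
  exists (PI / 2 * A 1), (- (PI / 2) * B 1). intros x Hx.
  rewrite (is_derive_zero_const A 0 HA 1 x) by lra.
  rewrite (is_derive_zero_const B 0 HB 1 x) by lra.
  assert (W := bessel_wronskian x Hx).
  transitivity (PI / 2 * d x * (x * (bessel_J 1 x * bessel_Y 0 x - bessel_J 0 x * bessel_Y 1 x))).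
  rewrite W. field. lra. unfold A, B. ring.
Qed.

Lemma is_lim_seq_ln_xs : is_lim_seq (fun n => ln (xs n / 2)) m_infty.
Proof.
  apply is_lim_seq_ext with (fun n => - ln (2 * (INR n + 1))).
  - intros n. assert (H := pos_INR n). rewrite <- ln_Rinv by lra. f_equal. unfold xs. field. lra.
  - apply (is_lim_seq_opp (fun n => ln (2 * (INR n + 1))) p_infty).
    apply (filterlim_comp _ _ _ (fun n => 2 * (INR n + 1)) ln eventually (Rbar_locally p_infty)).
    2: apply is_lim_ln_p.
    apply is_lim_seq_le_p_loc with INR. exists 0%nat. intros n _. assert (H := pos_INR n). lra.
    apply is_lim_seq_INR.
Qed.

Lemma bessel_Y0_lim_infty : is_lim_seq (fun n => bessel_Y 0 (xs n)) m_infty.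
Proof.
  assert (HP := PI_RGT_0).
  apply is_lim_seq_ext with (fun n => (bessel_Y 0 (xs n) - 2 / PI * (ln (xs n / 2) + euler_gamma)) +
    2 / PI * (ln (xs n / 2) + euler_gamma)). intros; ring.
  apply is_lim_seq_plus with 0 m_infty. apply bessel_Y0_lim. 2: reflexivity.
  assert (0 < 2 / PI) by (apply Rdiv_lt_0_compat; lra).
  replace m_infty with (Rbar_mult (2 / PI) m_infty).
  apply is_lim_seq_scal_l. apply is_lim_seq_plus with m_infty euler_gamma.
  apply is_lim_seq_ln_xs. apply is_lim_seq_const. reflexivity.
  simpl. destruct (Rle_dec 0 (2 / PI)); [|lra]. destruct (Rle_lt_or_eq_dec _ _ r); [reflexivity|lra].
Qed.

(** Since Y_0 is unbounded at 0, its coefficient vanishes; then J_0(0) = 1 kills the other one. *)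
Lemma bessel0_unique (d d1 : R -> R) :
  (forall x, 0 < x -> is_derive d x (d1 x)) ->
  (forall x, 0 < x -> is_derive d1 x (- d1 x / x - d x)) ->
  is_lim_seq (fun n => d (xs n)) 0 ->
  forall x, 0 < x -> d x = 0.
Proof.
  intros Hd Hd1 HL. destruct (bessel0_solution d d1 Hd Hd1) as [a [b Hab]].
  assert (L1 : is_lim_seq (fun n => b * bessel_Y 0 (xs n)) (0 - a * 1)).
  { apply is_lim_seq_ext with (fun n => d (xs n) - a * bessel_J 0 (xs n)).
    intros n. rewrite Hab by apply xs_pos. ring.
    apply is_lim_seq_minus'. exact HL. apply (is_lim_seq_scal_l _ a 1). apply bessel_J0_lim. }
  assert (Hb : b = 0).
  { destruct (Req_dec b 0) as [|Hb]; auto. exfalso.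
    assert (L2 : is_lim_seq (fun n => bessel_Y 0 (xs n)) (/ b * (0 - a * 1))).
    { apply is_lim_seq_ext with (fun n => / b * (b * bessel_Y 0 (xs n))). intros; field; auto.
      apply (is_lim_seq_scal_l _ (/ b) (0 - a * 1)). exact L1. }
    apply is_lim_seq_unique in L2. rewrite (is_lim_seq_unique _ _ bessel_Y0_lim_infty) in L2. discriminate. }
  subst b.
  assert (Ha : 0 - a * 1 = 0).
  { apply is_lim_seq_unique in L1. rewrite (Lim_seq_ext _ (fun _ => 0)), Lim_seq_const in L1.
    now injection L1. intros; ring. }
  intros x Hx. rewrite Hab by auto. replace a with 0 by lra. ring.
Qed.

Lemma is_lim_seq_continuous_xs (f : R -> R) (l : R) : is_derive f 0 l -> is_lim_seq (fun n => f (xs n)) (f 0).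
Proof.
  intros H. apply (is_lim_seq_continuous f).
  apply continuity_pt_filterlim. apply (ex_derive_continuous f). now exists l.
  apply is_lim_seq_xs.
Qed.

(** Euler's constant cancels against the one in [expint_eq]. What remains is ln t0 = -pi/2, the
    value that will cancel [Ere 0 0]. *)
Lemma Tint_lim : is_lim_seq (fun n => Tint 0 (xs n) + ln (xs n / 2) + euler_gamma) (- (PI / 2)).
Proof.
  assert (H0 := t0_bounds).
  apply is_lim_seq_ext with (fun n => (Tint 0 (xs n) - expint t0 (xs n / 2)) + Ein (xs n / (2 * t0)) + ln t0).
  { intros n. assert (Hx := xs_pos n). rewrite expint_eq by lra.
    replace (xs n / 2 / t0) with (xs n / (2 * t0)) by (field; lra).
    replace (ln (xs n / (2 * t0))) with (ln (xs n / 2) - ln t0). ring.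
    rewrite <- ln_div by lra. f_equal. field. lra. }
  replace (Finite (- (PI / 2))) with (Finite (0 + Ein (0 / (2 * t0)) + ln t0)).
  2:{ f_equal. unfold t0 at 2. rewrite ln_exp. unfold Rdiv at 1. rewrite Rmult_0_l. unfold Ein.
      rewrite RInt_point. unfold zero; simpl. ring. }
  apply is_lim_seq_plus'; [|apply is_lim_seq_const]. apply is_lim_seq_plus'.
  - apply is_lim_seq_le_le with (fun _ => 0) xs.
    intros n. apply Tint_expint. split. apply xs_pos. apply xs_le1.
    apply is_lim_seq_const. apply is_lim_seq_xs.
  - apply (is_lim_seq_continuous_xs (fun x => Ein (x / (2 * t0))) (/ (2 * t0) * ein_fun (Rabs (0 / (2 * t0))))).
    apply (der_comp Ein). apply Ein_derive. auto_derive; auto. field. lra.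
Qed.

(** The real part of (pi i / 2) H_0. The horizontal part of the contour contributes real values
    only, so it enters Y_0 and not J_0. *)
Lemma bessel_Y0_contour (x : R) : 0 < x -> PI / 2 * bessel_Y 0 x = - (Ere 0 x + Tint 0 x).
Proof.
  intros Hx. assert (HP := PI_RGT_0).
  cut (Ere 0 x + Tint 0 x + PI / 2 * bessel_Y 0 x = 0). lra.
  revert x Hx.
  apply (bessel0_unique (fun x => Ere 0 x + Tint 0 x + PI / 2 * bessel_Y 0 x)
    (fun x => Ere 1 x + Tint 1 x + PI / 2 * - bessel_Y 1 x)).
  - intros x Hx. apply der_plus. apply der_plus. now apply Ere_derive; lia. apply Tint_derive; auto; lia.
    apply der_scal. now apply bessel_Y0_derive.
  - intros x Hx. evar_last. apply der_plus. apply der_plus. now apply Ere_derive; lia. apply Tint_derive; auto; lia.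
    apply der_scal, der_opp. now apply bessel_Y1_derive.
    (* The corner terms of the two equations cancel in the sum. *)
    assert (E := Ere_ode x). assert (T := Tint_ode x Hx).
    replace (Ere 2 x) with ((- cosh (PI / 2) * exp (- x * sinh (PI / 2)) - Ere 1 x - x * Ere 0 x) / x).
    replace (Tint 2 x) with ((cosh (PI / 2) * exp (- x * sinh (PI / 2)) - Tint 1 x - x * Tint 0 x) / x).
    set (e := exp _). field. lra.
    apply Rmult_eq_reg_l with x; [|lra]. rewrite <- T. field. lra.
    apply Rmult_eq_reg_l with x; [|lra]. rewrite <- E. field. lra.
  - apply is_lim_seq_ext with (fun n => Ere 0 (xs n) + (Tint 0 (xs n) + ln (xs n / 2) + euler_gamma) +
      PI / 2 * (bessel_Y 0 (xs n) - 2 / PI * (ln (xs n / 2) + euler_gamma))).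
    intros n. field. lra.
    replace (Finite 0) with (Finite (PI / 2 + - (PI / 2) + PI / 2 * 0)) by (f_equal; ring).
    apply is_lim_seq_plus'. apply is_lim_seq_plus'.
    + rewrite <- (proj1 E_at_0). apply (is_lim_seq_continuous_xs (Ere 0) (Ere 1 0)). apply Ere_derive; lia.
    + apply Tint_lim.
    + apply (is_lim_seq_scal_l _ (PI / 2) 0). apply bessel_Y0_lim.
Qed.

Lemma bessel_J0_contour (x : R) : 0 < x -> PI / 2 * bessel_J 0 x = Eim 0 x.
Proof.
  intros Hx. assert (HP := PI_RGT_0).
  cut (Eim 0 x - PI / 2 * bessel_J 0 x = 0). lra.
  revert x Hx.
  apply (bessel0_unique (fun x => Eim 0 x - PI / 2 * bessel_J 0 x)
    (fun x => Eim 1 x - PI / 2 * - bessel_J 1 x)).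
  - intros x Hx. apply der_minus. apply Eim_derive; lia.
    apply der_scal. apply bessel_J0_derive.
  - intros x Hx. evar_last. apply der_minus. apply Eim_derive; lia.
    apply der_scal, der_opp. now apply bessel_J1_derive.
    assert (E := Eim_ode x).
    replace (Eim 2 x) with ((- Eim 1 x - x * Eim 0 x) / x). field. lra.
    apply Rmult_eq_reg_l with x; [|lra]. replace (x * ((- Eim 1 x - x * Eim 0 x) / x)) with (- Eim 1 x - x * Eim 0 x) by (field; lra). lra.
  - replace (Finite 0) with (Finite (PI / 2 - PI / 2 * 1)) by (f_equal; ring).
    apply is_lim_seq_minus'.
    + rewrite <- (proj2 E_at_0). apply (is_lim_seq_continuous_xs (Eim 0) (Eim 1 0)). apply Eim_derive; lia.
    + apply (is_lim_seq_scal_l _ (PI / 2) 1). apply bessel_J0_lim.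
Qed.

Lemma bessel_Y1_contour (x : R) : 0 < x -> PI / 2 * bessel_Y 1 x = Ere 1 x + Tint 1 x.
Proof.
  intros Hx.
  assert (D1 : is_derive (fun x => PI / 2 * bessel_Y 0 x) x (PI / 2 * - bessel_Y 1 x)).
  { now apply der_scal, bessel_Y0_derive. }
  assert (D2 : is_derive (fun x => PI / 2 * bessel_Y 0 x) x (- (Ere 1 x + Tint 1 x))).
  { apply (is_derive_ext_gt 0) with (fun x => - (Ere 0 x + Tint 0 x)); auto.
    intros t Ht. symmetry. now apply bessel_Y0_contour.
    apply der_opp, der_plus. apply Ere_derive; lia. apply Tint_derive; auto; lia. }
  apply is_derive_unique in D1. apply is_derive_unique in D2. lra.
Qed.

Lemma bessel_J1_contour (x : R) : 0 < x -> PI / 2 * bessel_J 1 x = - Eim 1 x.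
Proof.
  intros Hx.
  assert (D1 : is_derive (fun x => PI / 2 * bessel_J 0 x) x (PI / 2 * - bessel_J 1 x)).
  { apply der_scal, bessel_J0_derive. }
  assert (D2 : is_derive (fun x => PI / 2 * bessel_J 0 x) x (Eim 1 x)).
  { apply (is_derive_ext_gt 0) with (Eim 0); auto.
    intros t Ht. symmetry. now apply bessel_J0_contour. apply Eim_derive; lia. }
  apply is_derive_unique in D1. apply is_derive_unique in D2. lra.
Qed.

(** * Laplace asymptotics of the contour integral *)

(** The mean value theorem takes the place of integration. A factor 1/(k+1) is given up, which makes
    the constants below crude, but each use raises the power by one. *)
Lemma mvt_pow_bound (f f' : R -> R) (b M : R) (k : nat) :
  0 <= M -> f 0 = 0 ->
  (forall c, is_derive f c (f' c)) ->
  (forall c, 0 <= c <= b -> Rabs (f' c) <= M * c ^ k) ->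
  forall a, 0 <= a <= b -> Rabs (f a) <= M * a ^ (S k).
Proof.
  intros HM H0 Hd Hb a Ha.
  destruct (MVT_gen f 0 a f') as [c [Hc Hfc]].
  - intros; apply Hd.
  - intros x _. apply continuity_pt_filterlim. apply (ex_derive_continuous f). now exists (f' x).
  - rewrite Rmin_left, Rmax_right in Hc by lra.
    rewrite H0, !Rminus_0_r in Hfc. rewrite Hfc, Rabs_mult, (Rabs_pos_eq a) by lra.
    simpl. replace (M * (a * a ^ k)) with (M * a ^ k * a) by ring.
    apply Rmult_le_compat_r. lra. apply Rle_trans with (M * c ^ k). apply Hb; lra.
    apply Rmult_le_compat_l; auto. apply pow_incr; lra.
Qed.

Lemma PI2_le_2 : PI / 2 <= 2.
Proof. assert (H := PI_4). lra. Qed.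

Definition Kc : R := cosh (PI / 2).

Lemma cosh_le_Kc (a : R) : 0 <= a <= PI / 2 -> 0 <= cosh a <= Kc.
Proof.
  intros Ha. unfold Kc. split.
  - unfold cosh. assert (H1 := exp_pos a). assert (H2 := exp_pos (- a)). lra.
  - destruct (MVT_gen cosh a (PI / 2) sinh) as [c [Hc Hfc]].
    + intros; apply cosh_derive.
    + intros; apply derivable_continuous_pt, derivable_pt_cosh.
    + rewrite Rmin_left, Rmax_right in Hc by lra.
      assert (0 <= sinh c). { rewrite <- sinh_0. destruct (Req_dec 0 c) as [E|E]. rewrite E; lra.
        apply Rlt_le, sinh_lt. lra. }
      assert (0 <= sinh c * (PI / 2 - a)) by (apply Rmult_le_pos; lra). lra.
Qed.

Lemma Kc_ge_1 : 1 <= Kc.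
Proof. rewrite <- cosh_0. apply cosh_le_Kc. assert (H := PI_RGT_0). lra. Qed.

Definition dS (a : R) : R := sinh a * cos a + cosh a * sin a.
Definition dC (a : R) : R := sinh a * cos a - cosh a * sin a.

Lemma dS_derive (a : R) : is_derive dS a (2 * cC a).
Proof.
  unfold dS, cC. evar_last. apply der_plus; apply der_mult.
  apply sinh_derive. apply cos_derive. apply cosh_derive. apply sin_derive. cbv beta. ring.
Qed.

Lemma dC_derive (a : R) : is_derive dC a (- 2 * cS a).
Proof.
  unfold dC, cS. evar_last. apply der_minus; apply der_mult.
  apply sinh_derive. apply cos_derive. apply cosh_derive. apply sin_derive. cbv beta. ring.
Qed.

Lemma cC_bound (a : R) : 0 <= a <= PI / 2 -> Rabs (cC a) <= Kc.
Proof.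
  intros Ha. unfold cC. rewrite Rabs_mult. assert (H := cosh_le_Kc a Ha).
  rewrite (Rabs_pos_eq (cosh a)) by lra. rewrite <- (Rmult_1_r Kc).
  apply Rmult_le_compat; try lra. apply Rabs_pos. apply Rabs_le. apply COS_bound.
Qed.

Lemma cS_bound (a : R) : 0 <= a <= PI / 2 -> Rabs (cS a) <= 2 * Kc * a ^ 2.
Proof.
  assert (H1 := Kc_ge_1).
  apply (mvt_pow_bound cS dS). lra. unfold cS. rewrite sinh_0. ring. apply cS_derive.
  apply (mvt_pow_bound dS (fun a => 2 * cC a)). lra. unfold dS. rewrite sinh_0, sin_0. ring. apply dS_derive.
  intros c Hc. rewrite Rabs_mult, (Rabs_pos_eq 2) by lra. assert (H := cC_bound c Hc). simpl. lra.
Qed.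

Lemma cC_minus1_bound (a : R) : 0 <= a <= PI / 2 -> Rabs (cC a - 1) <= 4 * Kc * a ^ 4.
Proof.
  assert (H1 := Kc_ge_1).
  apply (mvt_pow_bound (fun a => cC a - 1) dC). lra. unfold cC. rewrite cosh_0, cos_0. ring.
  intros c. evar_last. apply der_minus. apply cC_derive. apply der_const. unfold dC; ring.
  apply (mvt_pow_bound dC (fun a => - 2 * cS a)). lra. unfold dC. rewrite sinh_0, sin_0. ring. apply dC_derive.
  intros c Hc. rewrite Rabs_mult, (Rabs_left (-2)) by lra. assert (H := cS_bound c Hc). lra.
Qed.

(** Two mean value steps from [cC_minus1_bound] reach a^6; two powers are traded for a factor 4 by a
    <= 2, so that the error has the order handled by [gauss_weight_4]. *)
Lemma cS_minus_sq_bound (a : R) : 0 <= a <= PI / 2 -> Rabs (cS a - a ^ 2) <= 32 * Kc * a ^ 4.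
Proof.
  intros Ha. assert (H1 := Kc_ge_1).
  assert (H : Rabs (cS a - a ^ 2) <= 8 * Kc * a ^ 6).
  { revert a Ha.
    apply (mvt_pow_bound (fun a => cS a - a ^ 2) (fun a => dS a - 2 * a)). lra. unfold cS. rewrite sinh_0. ring.
    intros c. apply der_minus. apply cS_derive. auto_derive. auto. ring.
    apply (mvt_pow_bound (fun a => dS a - 2 * a) (fun a => 2 * cC a - 2)). lra.
    unfold dS. rewrite sinh_0, sin_0. ring.
    intros c. apply der_minus. apply dS_derive. auto_derive. auto. ring.
    intros c Hc. replace (2 * cC c - 2) with (2 * (cC c - 1)) by ring.
    rewrite Rabs_mult, (Rabs_pos_eq 2) by lra. assert (H := cC_minus1_bound c Hc). lra. }
  apply Rle_trans with (1 := H). replace (8 * Kc * a ^ 6) with (8 * Kc * a ^ 4 * a ^ 2) by ring.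
  replace (32 * Kc * a ^ 4) with (8 * Kc * a ^ 4 * 4) by ring.
  assert (0 <= a ^ 4) by (apply pow_le; lra).
  apply Rmult_le_compat_l. apply Rmult_le_pos; lra. assert (H2 := PI2_le_2). simpl. nra.
Qed.

Lemma cS_lower (a : R) : 0 <= a <= PI / 2 -> a ^ 2 / 3 <= cS a.
Proof.
  intros Ha. assert (H2 := PI2_le_2). unfold cS.
  (* From sin a >= a - a^3/6 and a <= 2. *)
  assert (Hs : a / 3 <= sin a).
  { destruct (pre_sin_bound a 0) as [H _]; try lra.
    unfold sin_approx, sin_term in H. simpl in H. nra. }
  assert (Hh : a <= sinh a).
  { destruct (MVT_gen sinh 0 a cosh) as [c [Hc Hfc]].
    + intros; apply sinh_derive.
    + intros; apply derivable_continuous_pt, derivable_pt_sinh.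
    + rewrite sinh_0, !Rminus_0_r in Hfc. rewrite Hfc.
      assert (1 <= cosh c). { assert (H := cosh2_sinh2 c). assert (0 < cosh c).
        unfold cosh. assert (H3 := exp_pos c). assert (H4 := exp_pos (- c)). lra. nra. }
      nra. }
  simpl. nra.
Qed.

(** * Pointwise comparison of the integrand with a Gaussian *)

Lemma exp_lipschitz (u v m : R) : u <= m -> v <= m -> Rabs (exp u - exp v) <= Rabs (u - v) * exp m.
Proof.
  intros Hu Hv.
  destruct (MVT_gen exp v u exp) as [c [Hc Hfc]].
  - intros; apply is_derive_exp.
  - intros; apply derivable_continuous_pt, derivable_pt_exp.
  - rewrite Hfc, Rabs_mult, Rmult_comm. apply Rmult_le_compat_l. apply Rabs_pos.
    rewrite Rabs_pos_eq by (apply Rlt_le, exp_pos).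
    assert (c <= m). { destruct Hc as [_ Hc]. apply Rle_trans with (1 := Hc). now apply Rmax_lub. }
    destruct (Req_dec c m). subst; lra. apply Rlt_le, exp_increasing. lra.
Qed.

Lemma cos_lipschitz (u v : R) : Rabs (cos u - cos v) <= Rabs (u - v).
Proof.
  destruct (MVT_gen cos v u (fun c => - sin c)) as [c [Hc Hfc]].
  - intros; apply cos_derive.
  - intros; apply continuity_cos.
  - rewrite Hfc, Rabs_mult, Rabs_Ropp. assert (H := SIN_bound c).
    assert (Rabs (sin c) <= 1) by (apply Rabs_le; lra). assert (H1 := Rabs_pos (u - v)). nra.
Qed.

Lemma sin_lipschitz (u v : R) : Rabs (sin u - sin v) <= Rabs (u - v).
Proof.
  destruct (MVT_gen sin v u cos) as [c [Hc Hfc]].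
  - intros; apply sin_derive.
  - intros; apply continuity_sin.
  - rewrite Hfc, Rabs_mult. assert (H := COS_bound c).
    assert (Rabs (cos c) <= 1) by (apply Rabs_le; lra). assert (H1 := Rabs_pos (u - v)). nra.
Qed.

Lemma Rabs_cos_le1 (u : R) : Rabs (cos u) <= 1.
Proof. apply Rabs_le. apply COS_bound. Qed.
Lemma Rabs_sin_le1 (u : R) : Rabs (sin u) <= 1.
Proof. apply Rabs_le. apply SIN_bound. Qed.

Section Pointwise.
Variables (x a : R).
Hypothesis (Hx : 0 < x) (Ha : 0 <= a <= PI / 2).

(** One weight above both [exp (- x * cS a)] and [exp (- x * a ^ 2)], thanks to [cS_lower]. Each
    error is a power of a times this weight. *)
Let E := exp (- (x * a ^ 2 / 3)).

Lemma gauss_weight_2 : a ^ 2 * E <= 3 / x.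
Proof.
  destruct (Req_dec a 0) as [->|Hn].
  - simpl. rewrite !Rmult_0_l. apply Rdiv_le_0_compat; lra.
  - assert (Hz : 0 < x * a ^ 2 / 3). { apply Rdiv_lt_0_compat; try lra. apply Rmult_lt_0_compat; auto. apply pow_lt; lra. }
    assert (H := exp_neg_le_pow 0 _ Hz). fold E in H.
    assert (0 < a ^ 2) by (apply pow_lt; lra).
    apply Rle_trans with (a ^ 2 * (INR 1 / (x * a ^ 2 / 3)) ^ 1). apply Rmult_le_compat_l; lra.
    apply Req_le. simpl INR. field. lra.
Qed.

Lemma gauss_weight_4 : x * a ^ 4 * E <= 36 / x.
Proof.
  destruct (Req_dec a 0) as [->|Hn].
  - simpl. rewrite !Rmult_0_l, Rmult_0_r, Rmult_0_l. apply Rdiv_le_0_compat; lra.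
  - assert (Hz : 0 < x * a ^ 2 / 3). { apply Rdiv_lt_0_compat; try lra. apply Rmult_lt_0_compat; auto. apply pow_lt; lra. }
    assert (H := exp_neg_le_pow 1 _ Hz). fold E in H.
    assert (0 < a ^ 4) by (apply pow_lt; lra).
    apply Rle_trans with (x * a ^ 4 * (INR 2 / (x * a ^ 2 / 3)) ^ 2). apply Rmult_le_compat_l; auto. apply Rmult_le_pos; lra.
    apply Req_le. simpl INR. field. lra.
Qed.

Lemma exp_cS_le : exp (- x * cS a) <= E.
Proof.
  assert (H := cS_lower a Ha). unfold E.
  destruct (Req_dec (- x * cS a) (- (x * a ^ 2 / 3))) as [->|Hn]. lra.
  apply Rlt_le, exp_increasing. nra.
Qed.

Lemma exp_sq_le : exp (- x * a ^ 2) <= E.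
Proof.
  unfold E. assert (0 <= x * a ^ 2) by (apply Rmult_le_pos; [lra|apply pow2_ge_0]).
  destruct (Req_dec (- x * a ^ 2) (- (x * a ^ 2 / 3))) as [->|Hn]. lra.
  apply Rlt_le, exp_increasing. lra.
Qed.

Lemma exp_cS_diff : Rabs (exp (- x * cS a) - exp (- x * a ^ 2)) <= 1152 * Kc / x.
Proof.
  assert (H1 := Kc_ge_1).
  assert (Hl := cS_lower a Ha). assert (Hp : 0 <= a ^ 2) by apply pow2_ge_0.
  apply Rle_trans with (1 := exp_lipschitz (- x * cS a) (- x * a ^ 2) (- (x * a ^ 2 / 3)) ltac:(nra) ltac:(nra)).
  fold E. replace (- x * cS a - - x * a ^ 2) with (- (x * (cS a - a ^ 2))) by ring.
  rewrite Rabs_Ropp, Rabs_mult, (Rabs_pos_eq x) by lra.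
  assert (H := cS_minus_sq_bound a Ha).
  assert (HE : 0 < E) by apply exp_pos.
  apply Rle_trans with (x * (32 * Kc * a ^ 4) * E).
  apply Rmult_le_compat_r. lra. apply Rmult_le_compat_l; lra.
  replace (x * (32 * Kc * a ^ 4) * E) with (32 * Kc * (x * a ^ 4 * E)) by ring.
  replace (1152 * Kc / x) with (32 * Kc * (36 / x)) by (field; lra).
  apply Rmult_le_compat_l. lra. apply gauss_weight_4.
Qed.

Lemma phase_diff : exp (- x * a ^ 2) * Rabs (x * cC a - x) <= 144 * Kc / x.
Proof.
  assert (H1 := Kc_ge_1). assert (H := cC_minus1_bound a Ha).
  replace (x * cC a - x) with (x * (cC a - 1)) by ring.
  rewrite Rabs_mult, (Rabs_pos_eq x) by lra.
  apply Rle_trans with (E * (x * (4 * Kc * a ^ 4))).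
  apply Rmult_le_compat. apply Rlt_le, exp_pos. apply Rmult_le_pos. lra. apply Rabs_pos.
  apply exp_sq_le. apply Rmult_le_compat_l; lra.
  replace (E * (x * (4 * Kc * a ^ 4))) with (4 * Kc * (x * a ^ 4 * E)) by ring.
  replace (144 * Kc / x) with (4 * Kc * (36 / x)) by (field; lra).
  apply Rmult_le_compat_l. lra. apply gauss_weight_4.
Qed.

(** Amplitude and phase are replaced separately. They cost 1152 = 32 * 36 and 144 = 4 * 36: the
    constants of [cS_minus_sq_bound] and [cC_minus1_bound] times the 36 of [gauss_weight_4]. *)
Lemma trig_approx (tr : R -> R) :
  (forall u, Rabs (tr u) <= 1) -> (forall u v, Rabs (tr u - tr v) <= Rabs (u - v)) ->
  Rabs (exp (- x * cS a) * tr (x * cC a) - exp (- x * a ^ 2) * tr x) <= 1296 * Kc / x.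
Proof.
  intros Hb Hl.
  replace (exp (- x * cS a) * tr (x * cC a) - exp (- x * a ^ 2) * tr x) with
    ((exp (- x * cS a) - exp (- x * a ^ 2)) * tr (x * cC a) + exp (- x * a ^ 2) * (tr (x * cC a) - tr x)) by ring.
  apply Rle_trans with (1 := Rabs_triang _ _). rewrite !Rabs_mult.
  rewrite (Rabs_pos_eq (exp (- x * a ^ 2))) by (apply Rlt_le, exp_pos).
  assert (H1 := exp_cS_diff). assert (H2 := phase_diff).
  assert (H3 : Rabs (exp (- x * cS a) - exp (- x * a ^ 2)) * Rabs (tr (x * cC a)) <= 1152 * Kc / x).
  { apply Rle_trans with (2 := H1). rewrite <- (Rmult_1_r (Rabs (exp _ - _))) at 2.
    apply Rmult_le_compat_l. apply Rabs_pos. apply Hb. }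
  assert (H4 : exp (- x * a ^ 2) * Rabs (tr (x * cC a) - tr x) <= exp (- x * a ^ 2) * Rabs (x * cC a - x)).
  { apply Rmult_le_compat_l. apply Rlt_le, exp_pos. apply Hl. }
  replace (1296 * Kc / x) with (1152 * Kc / x + 144 * Kc / x) by (field; lra). lra.
Qed.

Lemma eR_approx : Rabs (eR x a - exp (- x * a ^ 2) * cos x) <= 1296 * Kc / x.
Proof. apply trig_approx. apply Rabs_cos_le1. apply cos_lipschitz. Qed.

Lemma eI_approx : Rabs (eI x a - exp (- x * a ^ 2) * sin x) <= 1296 * Kc / x.
Proof. apply trig_approx. apply Rabs_sin_le1. apply sin_lipschitz. Qed.

Lemma weighted_small (w : R) : Rabs w <= 16 * Kc * a ^ 2 ->
  Rabs (w * eR x a) <= 48 * Kc / x /\ Rabs (w * eI x a) <= 48 * Kc / x.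
Proof.
  intros Hw. assert (H1 := Kc_ge_1).
  assert (G : forall tr, Rabs tr <= 1 -> Rabs (w * (exp (- x * cS a) * tr)) <= 48 * Kc / x).
  { intros tr Ht. rewrite !Rabs_mult, (Rabs_pos_eq (exp _)) by (apply Rlt_le, exp_pos).
    assert (HE := exp_cS_le). assert (Hp := exp_pos (- x * cS a)).
    assert (Hp2 : 0 <= a ^ 2) by apply pow2_ge_0.
    apply Rle_trans with ((16 * Kc * a ^ 2) * (E * 1)).
    apply Rmult_le_compat; auto. apply Rabs_pos. apply Rmult_le_pos. lra. apply Rabs_pos.
    apply Rmult_le_compat; auto. lra. apply Rabs_pos.
    replace (48 * Kc / x) with (16 * Kc * (3 / x)) by (field; lra).
    replace (16 * Kc * a ^ 2 * (E * 1)) with (16 * Kc * (a ^ 2 * E)) by ring.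
    apply Rmult_le_compat_l. lra. apply gauss_weight_2. }
  split; apply G. apply Rabs_cos_le1. apply Rabs_sin_le1.
Qed.

(** In the x-derivative the factor cosh w = cC + i cS is replaced by 1 at the price of four terms of
    [weighted_small]; 3000 exceeds 2 * 1296 + 4 * 48. *)
Lemma dRe_dIm_approx :
  Rabs (dRe 0 x a - exp (- x * a ^ 2) * (cos x - sin x)) <= 3000 * Kc / x /\
  Rabs (dIm 0 x a - exp (- x * a ^ 2) * (cos x + sin x)) <= 3000 * Kc / x /\
  Rabs (dRe 1 x a - exp (- x * a ^ 2) * (- cos x - sin x)) <= 3000 * Kc / x /\
  Rabs (dIm 1 x a - exp (- x * a ^ 2) * (cos x - sin x)) <= 3000 * Kc / x.
Proof.
  assert (H1 := Kc_ge_1). assert (Hp2 : 0 <= a ^ 2) by apply pow2_ge_0.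
  assert (HR := eR_approx). assert (HI := eI_approx).
  destruct (weighted_small (cS a)) as [S1 S2].
  { assert (H := cS_bound a Ha). nra. }
  destruct (weighted_small (cC a - 1)) as [C1 C2].
  { assert (H := cC_minus1_bound a Ha). assert (H2 := PI2_le_2).
    apply Rle_trans with (1 := H). replace (4 * Kc * a ^ 4) with (4 * Kc * a ^ 2 * a ^ 2) by ring.
    replace (16 * Kc * a ^ 2) with (4 * Kc * a ^ 2 * 4) by ring.
    apply Rmult_le_compat_l. apply Rmult_le_pos; lra. simpl. nra. }
  assert (HK : 1296 * Kc / x = 1296 * (Kc / x)) by (field; lra).
  assert (HK2 : 48 * Kc / x = 48 * (Kc / x)) by (field; lra).
  assert (HK3 : 3000 * Kc / x = 3000 * (Kc / x)) by (field; lra).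
  rewrite HK, HK2, HK3 in *.
  assert (0 < Kc / x) by (apply Rdiv_lt_0_compat; lra).
  set (k := Kc / x) in *. clearbody k. clear HK HK2 HK3.
  apply Rabs_le_between in HR, HI, S1, S2, C1, C2.
  unfold dRe, dIm.
  repeat split; apply Rabs_le; lra.
Qed.
End Pointwise.

Definition gint (x : R) : R := RInt (fun a => exp (- x * a ^ 2)) 0 (PI / 2).

Lemma ex_RInt_gauss (x a b : R) : ex_RInt (fun a => exp (- x * a ^ 2)) a b.
Proof.
  apply (@ex_RInt_continuous R_CompleteNormedModule). intros z _.
  apply (ex_derive_continuous (fun a => exp (- x * a ^ 2))). auto_derive. auto.
Qed.

Lemma RInt_approx (f : R -> R) (If c x K : R) : 0 <= K ->
  is_RInt f 0 (PI / 2) If ->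
  (forall a, 0 <= a <= PI / 2 -> Rabs (f a - exp (- x * a ^ 2) * c) <= K) ->
  Rabs (If - gint x * c) <= 2 * K.
Proof.
  intros HK Hf Hb. assert (HP := PI_RGT_0). assert (H2 := PI2_le_2).
  assert (HI : is_RInt (fun a => f a - exp (- x * a ^ 2) * c) 0 (PI / 2) (If - gint x * c)).
  { apply (is_RInt_minus f). exact Hf.
    apply is_RInt_ext with (fun a => c * exp (- x * a ^ 2)). intros; apply Rmult_comm.
    rewrite Rmult_comm. apply (is_RInt_scal (fun a => exp (- x * a ^ 2))).
    apply (@RInt_correct R_CompleteNormedModule), ex_RInt_gauss. }
  rewrite <- (is_RInt_unique _ _ _ _ HI).
  apply Rle_trans with ((PI / 2 - 0) * K).
  apply abs_RInt_le_const. lra. eexists; exact HI. exact Hb. nra.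
Qed.

Lemma E_approx (x : R) : 0 < x ->
  Rabs (Ere 0 x - gint x * (cos x - sin x)) <= 6000 * Kc / x /\
  Rabs (Eim 0 x - gint x * (cos x + sin x)) <= 6000 * Kc / x /\
  Rabs (Ere 1 x - gint x * (- cos x - sin x)) <= 6000 * Kc / x /\
  Rabs (Eim 1 x - gint x * (cos x - sin x)) <= 6000 * Kc / x.
Proof.
  intros Hx. assert (H1 := Kc_ge_1).
  assert (0 < 3000 * Kc / x) by (apply Rdiv_lt_0_compat; lra).
  replace (6000 * Kc / x) with (2 * (3000 * Kc / x)) by (field; lra).
  split; [|split; [|split]].
  - apply (RInt_approx (dRe 0 x)). lra. apply is_RInt_dRe. intros a Ha. apply (dRe_dIm_approx x a Hx Ha).
  - apply (RInt_approx (dIm 0 x)). lra. apply is_RInt_dIm. intros a Ha. apply (dRe_dIm_approx x a Hx Ha).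
  - apply (RInt_approx (dRe 1 x)). lra. apply is_RInt_dRe. intros a Ha. apply (dRe_dIm_approx x a Hx Ha).
  - apply (RInt_approx (dIm 1 x)). lra. apply is_RInt_dIm. intros a Ha. apply (dRe_dIm_approx x a Hx Ha).
Qed.

(** On (0, t0] one has 1/t - t >= (1 - t0^2)/t, so the growing factor is absorbed by lowering the
    first argument of [eta]. *)
Lemma dT_le_eta (x t : R) (k : nat) : 0 < x -> 0 < t <= t0 ->
  eta k (x / 2) t * exp (x * t / 2) <= eta k (x * (1 - t0 ^ 2) / 2) t.
Proof.
  intros Hx Ht. assert (H0 := t0_bounds). rewrite !eta_pos_eq by lra.
  assert (Hp : 0 < t ^ k) by (apply pow_lt; lra).
  replace (exp (- (x / 2) / t) / t ^ k * exp (x * t / 2)) with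
    (exp (- (x / 2) / t + x * t / 2) / t ^ k) by (rewrite exp_plus; field; lra).
  apply Rmult_le_compat_r. apply Rlt_le, Rinv_0_lt_compat; auto.
  assert (- (x / 2) / t + x * t / 2 <= - (x * (1 - t0 ^ 2) / 2) / t).
  { apply Rmult_le_reg_r with t. lra.
    replace ((- (x / 2) / t + x * t / 2) * t) with (- (x / 2) + x * t ^ 2 / 2) by (field; lra).
    replace (- (x * (1 - t0 ^ 2) / 2) / t * t) with (- (x / 2) + x * t0 ^ 2 / 2) by (field; lra).
    assert (t ^ 2 <= t0 ^ 2) by (apply pow_incr; lra). nra. }
  destruct (Req_dec (- (x / 2) / t + x * t / 2) (- (x * (1 - t0 ^ 2) / 2) / t)) as [->|]. lra.
  apply Rlt_le, exp_increasing. lra.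
Qed.

(** This part of the contour is exponentially small, as sinh a >= sinh(pi/2) there; a bound K/x is
    enough against the leading order x^(-1/2). *)
Lemma Tint_bound : exists K, 0 < K /\ forall x, 1 <= x ->
  Rabs (Tint 0 x) <= K / x /\ Rabs (Tint 1 x) <= K / x.
Proof.
  assert (H0 := t0_bounds).
  set (c := (1 - t0 ^ 2) / 2).
  assert (Hc : 0 < c). { unfold c. simpl. nra. }
  (* The two summands are the constants of [eta_le] for k = 1 and k = 2. *)
  set (K := (2 / c) ^ 2 + (3 / c) ^ 3).
  assert (P2 : 0 < (2 / c) ^ 2) by (apply pow_lt, Rdiv_lt_0_compat; lra).
  assert (P3 : 0 < (3 / c) ^ 3) by (apply pow_lt, Rdiv_lt_0_compat; lra).
  exists K. split. unfold K; lra.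
  intros x Hx.
  assert (Hpt : forall k t, (k = 1 \/ k = 2)%nat -> 0 <= t <= t0 -> 0 <= eta k (x / 2) t * exp (x * t / 2) <= K / x).
  { intros k t Hk Ht. split. apply Rmult_le_pos. apply eta_nonneg. apply Rlt_le, exp_pos.
    destruct (Req_dec t 0) as [->|Hn].
    rewrite eta_neg_eq, Rmult_0_l by lra. apply Rdiv_le_0_compat. unfold K; lra. lra.
    apply Rle_trans with (1 := dT_le_eta x t k ltac:(lra) ltac:(lra)).
    replace (x * (1 - t0 ^ 2) / 2) with (x * c) by (unfold c; field).
    assert (Hy : 0 < x * c) by (apply Rmult_lt_0_compat; lra).
    apply Rle_trans with (1 := eta_le k 0 (x * c) t Hy ltac:(lra)).
    assert (Hix : 0 < / x <= 1). { split. apply Rinv_0_lt_compat; lra. rewrite <- Rinv_1. apply Rinv_le_contravar; lra. }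
    rewrite pow_1.
    destruct Hk as [-> | ->]; simpl (S _); simpl INR.
    - replace ((1 + 1) / (x * c)) with (2 / c * / x) by (field; lra).
      rewrite Rpow_mult_distr.
      apply Rle_trans with ((2 / c) ^ 2 * (/ x) ^ 2 * 1). apply Rmult_le_compat_l; try lra.
      apply Rmult_le_pos. lra. apply pow_le; lra.
      unfold K, Rdiv at 2. apply Rle_trans with ((2 / c) ^ 2 * / x).
      rewrite Rmult_1_r. apply Rmult_le_compat_l. lra. simpl. nra.
      apply Rmult_le_compat_r; lra.
    - replace ((1 + 1 + 1) / (x * c)) with (3 / c * / x) by (field; lra).
      rewrite Rpow_mult_distr.
      apply Rle_trans with ((3 / c) ^ 3 * (/ x) ^ 3 * 1). apply Rmult_le_compat_l; try lra.
      apply Rmult_le_pos. lra. apply pow_le; lra.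
      unfold K, Rdiv at 2. apply Rle_trans with ((3 / c) ^ 3 * / x).
      rewrite Rmult_1_r. apply Rmult_le_compat_l. lra.
      replace ((/ x) ^ 3) with (/ x * (/ x * / x)) by ring.
      rewrite <- (Rmult_1_r (/ x)) at 4. apply Rmult_le_compat_l; nra.
      apply Rmult_le_compat_r; lra. }
  assert (G : forall j If, is_RInt (dT j x) 0 t0 If -> (j < 2)%nat -> Rabs If <= K / x).
  { intros j If HI Hj. rewrite <- (is_RInt_unique _ _ _ _ HI).
    assert (HK : 0 <= K / x). { apply Rdiv_le_0_compat. unfold K; lra. lra. }
    apply Rle_trans with ((t0 - 0) * (K / x)); [|nra].
    apply abs_RInt_le_const. lra. eexists; exact HI.
    intros t Ht. destruct j as [|[|j]]; [| |lia]; unfold dT.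
    - rewrite Rabs_pos_eq; apply Hpt; auto.
    - assert (A1 := Hpt 1%nat t (or_introl eq_refl) Ht). assert (A2 := Hpt 2%nat t (or_intror eq_refl) Ht).
      set (e := exp (x * t / 2)) in *. set (u1 := eta 1 (x / 2) t) in *. set (u2 := eta 2 (x / 2) t) in *.
      replace (/ 2 * (t * u1 - u2) * e) with (/ 2 * (t * (u1 * e)) - / 2 * (u2 * e)) by ring.
      assert (0 <= t * (u1 * e) <= K / x) by nra.
      apply Rabs_le. lra. }
  split; apply (G _ _ (is_RInt_dT _ x ltac:(lra))); lia.
Qed.

(** * The Gaussian integral *)

Definition gauss (M : R) : R := RInt (fun y => exp (- y ^ 2)) 0 M.

Lemma ex_RInt_gauss1 (a b : R) : ex_RInt (fun y => exp (- y ^ 2)) a b.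
Proof.
  apply (@ex_RInt_continuous R_CompleteNormedModule). intros z _.
  apply (ex_derive_continuous (fun y => exp (- y ^ 2))). auto_derive. auto.
Qed.

Lemma gauss_derive (M : R) : is_derive gauss M (exp (- M ^ 2)).
Proof.
  apply (is_derive_RInt (fun y => exp (- y ^ 2)) gauss 0).
  - apply filter_forall. intros x. apply (@RInt_correct R_CompleteNormedModule). apply ex_RInt_gauss1.
  - apply (ex_derive_continuous (fun y => exp (- y ^ 2))). auto_derive. auto.
Qed.

Lemma gauss_incr (u v : R) : u <= v -> gauss u <= gauss v.
Proof.
  intros Huv. destruct (MVT_gen gauss u v (fun y => exp (- y ^ 2))) as [c [Hc E]].
  - intros; apply gauss_derive.
  - intros. apply continuity_pt_filterlim. apply (ex_derive_continuous gauss). eexists; apply gauss_derive.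
  - assert (H := exp_pos (- c ^ 2)). assert (0 <= exp (- c ^ 2) * (v - u)) by (apply Rmult_le_pos; lra). lra.
Qed.

Lemma gauss_0 : gauss 0 = 0.
Proof. unfold gauss. rewrite RInt_point. reflexivity. Qed.

(** From exp(-y^2) <= 1/(1 + y^2), whose integral is [atan]. *)
Lemma gauss_bound (M : R) : 0 <= M -> gauss M <= PI / 2.
Proof.
  intros HM.
  apply Rle_trans with (atan M).
  - destruct (MVT_gen (fun y => atan y - gauss y) 0 M (fun y => / (1 + y²) - exp (- y ^ 2))) as [c [Hc E]].
    + intros. apply der_minus. apply is_derive_atan. apply gauss_derive.
    + intros x _. apply continuity_pt_filterlim. apply (ex_derive_continuous (fun y => atan y - gauss y)).
      eexists. apply der_minus. apply is_derive_atan. apply gauss_derive.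
    + rewrite gauss_0, atan_0, Rsqr_pow2 in E.
      assert (exp (- c ^ 2) <= / (1 + c ^ 2)).
      { rewrite exp_Ropp. assert (H := exp_ineq1_le (c ^ 2)). assert (H2 := pow2_ge_0 c). apply Rinv_le_contravar; lra. }
      assert (0 <= (/ (1 + c ^ 2) - exp (- c ^ 2)) * (M - 0)) by (apply Rmult_le_pos; lra). lra.
  - apply Rlt_le, atan_bound.
Qed.

(** Only existence and positivity, by monotonicity; the value is found in [gauss_value] once the
    Bessel functions are expressed through Q. *)
Lemma gauss_lim : exists Q, 0 < Q /\ is_lim gauss p_infty Q.
Proof.
  destruct (completeness (fun z => exists M, 0 <= M /\ z = gauss M)) as [Q [Hub Hlub]].
  - exists (PI / 2). intros z [M [HM ->]]. now apply gauss_bound.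
  - exists (gauss 0). exists 0. split; auto; lra.
  - exists Q. split.
    + apply Rlt_le_trans with (gauss 1).
      * rewrite <- gauss_0. destruct (MVT_gen gauss 0 1 (fun y => exp (- y ^ 2))) as [c [Hc E]].
        intros; apply gauss_derive.
        intros. apply continuity_pt_filterlim. apply (ex_derive_continuous gauss). eexists; apply gauss_derive.
        assert (H := exp_pos (- c ^ 2)). lra.
      * apply Hub. exists 1. split; auto; lra.
    + apply is_lim_spec. intros eps.
      destruct (Classical_Prop.classic (exists M, 0 <= M /\ Q - eps < gauss M)) as [[M [HM HMQ]]|Hn].
      * exists M. intros x HxM. assert (H1 := gauss_incr M x ltac:(lra)).
        assert (H2 : gauss x <= Q). { apply Hub. exists x. split; auto; lra. }
        apply Rabs_lt_between'. assert (H := cond_pos eps). lra.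
      * exfalso. assert (H : Q <= Q - eps). { apply Hlub. intros z [M [HM ->]].
          destruct (Rle_dec (gauss M) (Q - eps)); auto. exfalso. apply Hn. exists M. split; auto. lra. }
        assert (H1 := cond_pos eps). lra.
Qed.

Lemma gint_gauss (x : R) : 0 < x -> sqrt x * gint x = gauss (sqrt x * (PI / 2)).
Proof.
  intros Hx. unfold gint, gauss.
  assert (E : RInt (fun y => scal (sqrt x) (exp (- (sqrt x * y + 0) ^ 2))) 0 (PI / 2) =
    RInt (fun y => exp (- y ^ 2)) (sqrt x * 0 + 0) (sqrt x * (PI / 2) + 0)).
  { apply (RInt_comp_lin (fun y => exp (- y ^ 2))). apply ex_RInt_gauss1. }
  rewrite Rmult_0_r, !Rplus_0_r in E. rewrite <- E.
  assert (E2 : RInt (fun y => scal (sqrt x) (exp (- x * y ^ 2))) 0 (PI / 2) = scal (sqrt x) (RInt (fun y => exp (- x * y ^ 2)) 0 (PI / 2))).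
  { apply is_RInt_unique. apply (is_RInt_scal (V := R_NormedModule) (fun y => exp (- x * y ^ 2))).
    apply (@RInt_correct R_CompleteNormedModule), ex_RInt_gauss. }
  change (scal (sqrt x) (RInt (fun y => exp (- x * y ^ 2)) 0 (PI / 2))) with (sqrt x * RInt (fun y => exp (- x * y ^ 2)) 0 (PI / 2)) in E2.
  rewrite <- E2. apply RInt_ext. intros y _. do 2 f_equal. rewrite Rplus_0_r, Rpow_mult_distr, pow2_sqrt by lra. ring.
Qed.

Lemma is_lim_inv_sqrt : is_lim (fun x => / sqrt x) p_infty 0.
Proof.
  replace (Finite 0) with (Rbar_inv p_infty) by reflexivity.
  apply is_lim_inv. apply (is_lim_sqrt_p (fun x => x)). apply is_lim_id. easy.
Qed.

Lemma is_lim_le_0 (f g : R -> R) (X : R) :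
  (forall x, X <= x -> Rabs (f x) <= g x) -> is_lim g p_infty 0 -> is_lim f p_infty 0.
Proof.
  intros H Hg. apply is_lim_spec. apply is_lim_spec in Hg. intros eps. destruct (Hg eps) as [M HM].
  exists (Rmax X M). intros x Hx. assert (H1 := Rmax_l X M). assert (H2 := Rmax_r X M).
  rewrite Rminus_0_r. specialize (HM x ltac:(lra)). rewrite Rminus_0_r in HM.
  apply Rle_lt_trans with (2 := HM). apply Rle_trans with (2 := Rle_abs _). apply H. lra.
Qed.

Lemma is_lim_abs_zero (f : R -> R) : is_lim f p_infty 0 -> is_lim (fun x => Rabs (f x)) p_infty 0.
Proof.
  intros H. apply is_lim_spec. apply is_lim_spec in H. intros eps. destruct (H eps) as [M HM].
  exists M. intros x Hx. specialize (HM x Hx). rewrite Rminus_0_r in *. now rewrite Rabs_Rabsolu.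
Qed.

Lemma is_lim_sqrt_bound (f : R -> R) (K : R) :
  (forall x, 1 <= x -> Rabs (f x) <= K / x) -> is_lim (fun x => sqrt x * f x) p_infty 0.
Proof.
  intros H. apply is_lim_le_0 with (fun x => K * / sqrt x) 1.
  - intros x Hx. assert (Hs : 0 < sqrt x) by (apply sqrt_lt_R0; lra).
    rewrite Rabs_mult, (Rabs_pos_eq (sqrt x)) by lra.
    apply Rle_trans with (sqrt x * (K / x)). apply Rmult_le_compat_l. lra. now apply H.
    apply Req_le. rewrite <- (sqrt_sqrt x) at 2 by lra. field. lra.
  - replace (Finite 0) with (Rbar_mult K 0) by (simpl; now rewrite Rmult_0_r).
    apply is_lim_scal_l. apply is_lim_inv_sqrt.
Qed.

Lemma contour_lead (f : R -> R) (tr : R -> R) (K Q : R) :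
  (forall x, 1 <= x -> Rabs (f x - gint x * tr x) <= K / x) ->
  (forall x, Rabs (tr x) <= 2) ->
  is_lim gauss p_infty Q ->
  is_lim (fun x => sqrt x * f x - Q * tr x) p_infty 0.
Proof.
  intros Hf Ht HQ.
  assert (L1 := is_lim_sqrt_bound (fun x => f x - gint x * tr x) K Hf).
  assert (L2 : is_lim (fun x => gauss (sqrt x * (PI / 2)) - Q) p_infty 0).
  { replace (Finite 0) with (Rbar_minus Q Q) by (simpl; f_equal; ring).
    apply is_lim_minus with Q Q. 2: apply is_lim_const. 2: reflexivity.
    apply (is_lim_comp gauss (fun x => sqrt x * (PI / 2)) p_infty Q p_infty). exact HQ.
    assert (HP := PI_RGT_0).
    replace p_infty with (Rbar_mult p_infty (PI / 2)) at 2.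
    apply is_lim_scal_r. apply (is_lim_sqrt_p (fun x => x)). apply is_lim_id.
    simpl. destruct (Rle_dec 0 (PI / 2)); [|lra]. destruct (Rle_lt_or_eq_dec _ _ r); [reflexivity|lra].
    exists 0. intros. discriminate. }
  apply is_lim_le_0 with (fun x => Rabs (sqrt x * (f x - gint x * tr x)) + 2 * Rabs (gauss (sqrt x * (PI / 2)) - Q)) 1.
  - intros x Hx. rewrite <- gint_gauss by lra.
    replace (sqrt x * f x - Q * tr x) with (sqrt x * (f x - gint x * tr x) + (sqrt x * gint x - Q) * tr x) by ring.
    apply Rle_trans with (1 := Rabs_triang _ _). apply Rplus_le_compat_l. rewrite Rabs_mult, (Rmult_comm 2).
    apply Rmult_le_compat_l. apply Rabs_pos. apply Ht.
  - replace (Finite 0) with (Rbar_plus 0 (2 * 0)) by (simpl; f_equal; ring).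
    apply is_lim_plus with 0 (2 * 0). now apply is_lim_abs_zero.
    apply (is_lim_scal_l _ 2 p_infty 0). now apply is_lim_abs_zero. reflexivity.
Qed.

Lemma bessel_lead_Q : exists Q, 0 < Q /\ is_lim gauss p_infty Q /\
  is_lim (fun x => sqrt x * (PI / 2 * bessel_J 0 x) - Q * (cos x + sin x)) p_infty 0 /\
  is_lim (fun x => sqrt x * (PI / 2 * bessel_Y 0 x) - Q * (sin x - cos x)) p_infty 0 /\
  is_lim (fun x => sqrt x * (PI / 2 * bessel_J 1 x) - Q * (sin x - cos x)) p_infty 0 /\
  is_lim (fun x => sqrt x * (PI / 2 * bessel_Y 1 x) - Q * (- cos x - sin x)) p_infty 0.
Proof.
  destruct gauss_lim as [Q [HQ0 HQ]]. exists Q. split; auto. split; auto.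
  destruct Tint_bound as [K [HK HT]].
  assert (Hc := Rabs_cos_le1). assert (Hs := Rabs_sin_le1).
  split; [|split; [|split]]; apply contour_lead with (6000 * Kc + K); auto; intros x;
    try (assert (Hcx := Hc x); assert (Hsx := Hs x); apply Rabs_le_between in Hcx; apply Rabs_le_between in Hsx;
         apply Rabs_le; lra);
    intros Hx; destruct (E_approx x ltac:(lra)) as (E1 & E2 & E3 & E4); destruct (HT x Hx) as [T1 T2];
    assert (Hk : 0 < K / x) by (apply Rdiv_lt_0_compat; lra);
    replace ((6000 * Kc + K) / x) with (6000 * Kc / x + K / x) by (field; lra).
  - rewrite bessel_J0_contour by lra. lra.
  - rewrite bessel_Y0_contour by lra.
    apply Rabs_le_between in E1. apply Rabs_le_between in T1. apply Rabs_le. lra.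
  - rewrite bessel_J1_contour by lra. apply Rabs_le_between in E4. apply Rabs_le. lra.
  - rewrite bessel_Y1_contour by lra.
    apply Rabs_le_between in E3. apply Rabs_le_between in T2. apply Rabs_le. lra.
Qed.

(** * Leading behaviour of the Hankel functions *)

Lemma cos_2piN (n : nat) : cos (2 * INR n * PI) = 1 /\ sin (2 * INR n * PI) = 0.
Proof.
  replace (2 * INR n * PI) with (0 + 2 * INR n * PI) by ring.
  rewrite cos_period, sin_period, cos_0, sin_0. auto.
Qed.

Lemma is_lim_seq_2piN : is_lim_seq (fun n => 2 * INR n * PI) p_infty.
Proof.
  apply is_lim_seq_le_p_loc with INR. exists 0%nat. intros n _. assert (H := PI2_3_2). assert (H1 := pos_INR n). nra.
  apply is_lim_seq_INR.
Qed.

Lemma is_lim_along_2piN (f : R -> R) : is_lim f p_infty 0 -> is_lim_seq (fun n => f (2 * INR n * PI)) 0.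
Proof.
  intros H.
  apply (filterlim_comp _ _ _ (fun n => 2 * INR n * PI) f eventually (Rbar_locally p_infty)).
  apply is_lim_seq_2piN. exact H.
Qed.

(** The four leading terms share the factor Q. Inserted into the Wronskian along x = 2 pi n, where
    cos = 1 and sin = 0, they give 2 Q^2 = pi/2. *)
Lemma gauss_value (Q : R) : 0 < Q ->
  is_lim (fun x => sqrt x * (PI / 2 * bessel_J 0 x) - Q * (cos x + sin x)) p_infty 0 ->
  is_lim (fun x => sqrt x * (PI / 2 * bessel_Y 0 x) - Q * (sin x - cos x)) p_infty 0 ->
  is_lim (fun x => sqrt x * (PI / 2 * bessel_J 1 x) - Q * (sin x - cos x)) p_infty 0 ->
  is_lim (fun x => sqrt x * (PI / 2 * bessel_Y 1 x) - Q * (- cos x - sin x)) p_infty 0 ->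
  Q = sqrt PI / 2.
Proof.
  intros HQ L1 L2 L3 L4. assert (HP := PI_RGT_0).
  assert (G : forall f tr c, is_lim (fun x => sqrt x * (PI / 2 * f x) - Q * tr x) p_infty 0 ->
    (forall n, tr (2 * INR n * PI) = c) -> is_lim_seq (fun n => sqrt (2 * INR n * PI) * (PI / 2 * f (2 * INR n * PI))) (Q * c)).
  { intros f tr c L Ht.
    apply is_lim_seq_ext with (fun n => (sqrt (2 * INR n * PI) * (PI / 2 * f (2 * INR n * PI)) - Q * tr (2 * INR n * PI)) + Q * c).
    intros n. rewrite Ht. ring.
    replace (Finite (Q * c)) with (Finite (0 + Q * c)) by (f_equal; ring).
    apply is_lim_seq_plus'. 2: apply is_lim_seq_const.
    exact (is_lim_along_2piN _ L). }
  assert (C := fun n => proj1 (cos_2piN n)). assert (S := fun n => proj2 (cos_2piN n)).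
  apply (G _ (fun x => cos x + sin x) 1) in L1. 2: intros n; rewrite C, S; ring.
  apply (G _ (fun x => sin x - cos x) (-1)) in L2. 2: intros n; rewrite C, S; ring.
  apply (G _ (fun x => sin x - cos x) (-1)) in L3. 2: intros n; rewrite C, S; ring.
  apply (G _ (fun x => - cos x - sin x) (-1)) in L4. 2: intros n; rewrite C, S; ring.
  assert (L := is_lim_seq_minus' _ _ _ _ (is_lim_seq_mult' _ _ _ _ L3 L2) (is_lim_seq_mult' _ _ _ _ L1 L4)).
  assert (L' : is_lim_seq (fun n => PI / 2) (Q * -1 * (Q * -1) - Q * 1 * (Q * -1))).
  { apply is_lim_seq_ext_loc with (2 := L). exists 1%nat. intros n Hn. cbv beta.
    assert (Hx : 0 < 2 * INR n * PI). { assert (0 < INR n) by (apply lt_0_INR; lia). nra. }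
    set (x := 2 * INR n * PI) in *.
    transitivity (PI * PI / 4 * ((sqrt x * sqrt x) * (bessel_J 1 x * bessel_Y 0 x - bessel_J 0 x * bessel_Y 1 x))).
    field. rewrite sqrt_sqrt by lra. rewrite bessel_wronskian by auto. field. lra. }
  apply is_lim_seq_unique in L'. rewrite Lim_seq_const in L'. injection L' as E.
  apply Rsqr_inj. lra. apply Rdiv_le_0_compat. apply sqrt_pos. lra.
  unfold Rsqr. replace (sqrt PI / 2 * (sqrt PI / 2)) with (sqrt PI * sqrt PI / 4) by field.
  rewrite sqrt_sqrt by lra. nra.
Qed.

Lemma gauss_lim_value : is_lim gauss p_infty (sqrt PI / 2).
Proof.
  destruct bessel_lead_Q as [Q (HQ & L & L1 & L2 & L3 & L4)].
  now rewrite <- (gauss_value Q HQ L1 L2 L3 L4).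
Qed.

(** * Division by the outgoing factor *)

Definition cis (t : R) : C := (cos t, sin t).

Lemma Cmod_cis (t : R) : Cmod (cis t) = 1.
Proof.
  unfold Cmod, cis; simpl. transitivity (sqrt 1); [f_equal|apply sqrt_1]. assert (H := sin2_cos2 t). unfold Rsqr in H. lra.
Qed.

Lemma cis_plus (s t : R) : cis (s + t) = (cis s * cis t)%C.
Proof. unfold cis, Cmult; simpl. rewrite cos_plus, sin_plus. f_equal; ring. Qed.

Lemma cis_0 : cis 0 = RtoC 1.
Proof. unfold cis. rewrite cos_0, sin_0. reflexivity. Qed.

(** The reciprocal of [outgoing_factor 1 x], written as a product that can be differentiated. *)
Definition outinv (x : R) : C := (RtoC (sqrt (PI / 2 * x)) * cis (PI / 4 - x))%C.

Lemma outgoing_factor_scal (kappa r : R) : outgoing_factor kappa r = outgoing_factor 1 (kappa * r).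
Proof. unfold outgoing_factor. now rewrite !Rmult_1_r, Rmult_1_l, <- Rmult_assoc. Qed.

Lemma outinv_spec (x : R) : 0 < x -> (outinv x * outgoing_factor 1 x)%C = RtoC 1.
Proof.
  intros Hx. assert (HP := PI_RGT_0). unfold outinv, outgoing_factor.
  change (cos (1 * x - PI / 4), sin (1 * x - PI / 4)) with (cis (1 * x - PI / 4)).
  transitivity (RtoC (sqrt (PI / 2 * x) * sqrt (2 / (PI * 1 * x))) * (cis (PI / 4 - x) * cis (1 * x - PI / 4)))%C.
  rewrite RtoC_mult. ring.
  rewrite <- cis_plus, <- sqrt_mult_alt by (apply Rmult_le_pos; lra).
  replace (PI / 2 * x * (2 / (PI * 1 * x))) with 1 by (field; lra).
  replace (PI / 4 - x + (1 * x - PI / 4)) with 0 by ring. rewrite sqrt_1, cis_0. ring.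
Qed.

Lemma outgoing_factor_neq_0 (x : R) : 0 < x -> outgoing_factor 1 x <> RtoC 0.
Proof.
  intros Hx E. assert (H := outinv_spec x Hx). rewrite E, Cmult_0_r in H.
  apply (f_equal fst) in H. simpl in H. lra.
Qed.

Lemma Cdiv_outgoing (z : C) (x : R) : 0 < x -> (z / outgoing_factor 1 x)%C = (outinv x * z)%C.
Proof.
  intros Hx. assert (H := outgoing_factor_neq_0 x Hx).
  transitivity (outinv x * outgoing_factor 1 x * z / outgoing_factor 1 x)%C.
  rewrite outinv_spec by auto. field; auto. field; auto.
Qed.

Definition hnorm (nu : nat) (x : R) : C := (outinv x * hankel1 nu x)%C.

Lemma Cmod_le_abs (z : C) : Cmod z <= Rabs (fst z) + Rabs (snd z).
Proof.
  destruct z as [a b].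
  replace (a, b) with (RtoC a + Ci * RtoC b)%C by (unfold RtoC, Ci, Cplus, Cmult; simpl; f_equal; ring).
  simpl. apply Rle_trans with (1 := Cmod_triangle _ _). rewrite Cmod_mult, !Cmod_R.
  rewrite Cmod_Ci. replace (a + (0 * b - 1 * 0)) with a by ring. replace (0 + (0 * 0 + 1 * b)) with b by ring. lra.
Qed.

Definition Clim0 (f : R -> C) : Prop := is_lim (fun x => Cmod (f x)) p_infty 0.

Lemma Clim0_le (f : R -> C) (g : R -> R) (X : R) :
  (forall x, X <= x -> Cmod (f x) <= g x) -> is_lim g p_infty 0 -> Clim0 f.
Proof.
  intros H Hg. apply is_lim_le_0 with g X; auto. intros x Hx. rewrite Rabs_pos_eq by apply Cmod_ge_0. auto.
Qed.

Lemma Clim0_ext (f g : R -> C) (X : R) : (forall x, X <= x -> f x = g x) -> Clim0 f -> Clim0 g.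
Proof. intros H Hf. apply Clim0_le with (fun x => Cmod (f x)) X; auto. intros. rewrite H; auto. lra. Qed.

Lemma Clim0_plus (f g : R -> C) : Clim0 f -> Clim0 g -> Clim0 (fun x => f x + g x)%C.
Proof.
  intros Hf Hg. apply Clim0_le with (fun x => Cmod (f x) + Cmod (g x)) 0.
  intros; apply Cmod_triangle. replace (Finite 0) with (Rbar_plus 0 0) by (simpl; f_equal; ring).
  now apply is_lim_plus with 0 0.
Qed.

Lemma Clim0_mult_bound (f g : R -> C) (K X : R) : (forall x, X <= x -> Cmod (g x) <= K) -> Clim0 f -> Clim0 (fun x => g x * f x)%C.
Proof.
  intros HK Hf. apply Clim0_le with (fun x => K * Cmod (f x)) X.
  intros x Hx. rewrite Cmod_mult. apply Rmult_le_compat_r. apply Cmod_ge_0. auto.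
  replace (Finite 0) with (Rbar_mult K 0) by (simpl; f_equal; ring). now apply is_lim_scal_l.
Qed.

Lemma Clim0_scal (c : C) (f : R -> C) : Clim0 f -> Clim0 (fun x => c * f x)%C.
Proof. intros H. apply (Clim0_mult_bound f (fun _ => c) (Cmod c) 0); auto. intros; lra. Qed.

Lemma Clim0_re_im (f : R -> C) : is_lim (fun x => fst (f x)) p_infty 0 -> is_lim (fun x => snd (f x)) p_infty 0 -> Clim0 f.
Proof.
  intros H1 H2. apply Clim0_le with (fun x => Rabs (fst (f x)) + Rabs (snd (f x))) 0.
  intros; apply Cmod_le_abs. replace (Finite 0) with (Rbar_plus 0 0) by (simpl; f_equal; ring).
  apply is_lim_plus with 0 0; [exact (is_lim_abs_zero _ H1) | exact (is_lim_abs_zero _ H2) | reflexivity].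
Qed.

(** [u] is the phase exp(-i nu pi/2), that is 1 or -i, and [(1, -1)] is sqrt 2 exp(-i pi/4): the
    hypotheses state the real and imaginary parts of the leading term. *)
Lemma hankel_lead_aux (f g : R -> R) (u : C) (Q : R) :
  is_lim (fun x => sqrt x * (PI / 2 * f x) - Q * (fst (u * (1, -1) * cis x)%C)) p_infty 0 ->
  is_lim (fun x => sqrt x * (PI / 2 * g x) - Q * (snd (u * (1, -1) * cis x)%C)) p_infty 0 ->
  Q = sqrt PI / 2 ->
  Clim0 (fun x => outinv x * (f x, g x) - u)%C.
Proof.
  intros H1 H2 HQ. assert (HP := PI_RGT_0).
  apply Clim0_ext with (fun x => (RtoC (sqrt (PI / 2) * (2 / PI)) * cis (PI / 4 - x)) *
     ((sqrt x * (PI / 2 * f x) - Q * (fst (u * (1, -1) * cis x)%C))%R, (sqrt x * (PI / 2 * g x) - Q * (snd (u * (1, -1) * cis x)%C))%R))%C 1.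
  - intros x Hx. unfold outinv. rewrite sqrt_mult_alt by lra.
    set (e := cis (PI / 4 - x)).
    assert (E : (RtoC (sqrt (PI / 2) * (2 / PI) * Q) * (e * (1, -1) * cis x))%C = RtoC 1).
    { unfold e. replace ((1, -1) : C) with (RtoC (sqrt 2) * cis (- (PI / 4)))%C.
      2:{ unfold cis, Cmult, RtoC; simpl. rewrite cos_neg, sin_neg, cos_PI4, sin_PI4.
          assert (sqrt 2 <> 0) by (apply Rgt_not_eq, sqrt_lt_R0; lra). f_equal; field; auto. }
      transitivity (RtoC (sqrt (PI / 2) * (2 / PI) * Q * sqrt 2) * (cis (PI / 4 - x) * cis (- (PI / 4)) * cis x))%C.
      rewrite (RtoC_mult _ (sqrt 2)). ring.
      rewrite <- !cis_plus. replace (PI / 4 - x + - (PI / 4) + x) with 0 by ring. rewrite cis_0.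
      replace (sqrt (PI / 2) * (2 / PI) * Q * sqrt 2) with 1. ring.
      transitivity (sqrt (PI / 2) * sqrt 2 * (2 / PI) * Q). 2: ring.
      rewrite <- sqrt_mult_alt by lra. replace (PI / 2 * 2) with PI by field. rewrite HQ.
      replace (sqrt PI * (2 / PI) * (sqrt PI / 2)) with (sqrt PI * sqrt PI / PI) by (field; lra).
      rewrite sqrt_sqrt by lra. field. lra. }
    transitivity (RtoC (sqrt (PI / 2) * sqrt x) * e * (f x, g x) - u * (RtoC (sqrt (PI / 2) * (2 / PI) * Q) * (e * (1, -1) * cis x)))%C.
    2:{ rewrite E. ring. }
    set (w := (u * (1, -1) * cis x)%C).
    transitivity (RtoC (sqrt (PI / 2) * sqrt x) * e * (f x, g x) - RtoC (sqrt (PI / 2) * (2 / PI) * Q) * e * w)%C.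
    2:{ unfold w; ring. }
    clearbody w e. destruct w as [w1 w2]; destruct e as [e1 e2]. unfold Cmult, Cminus, Cplus, Copp, RtoC; simpl.
    f_equal; field; lra.
  - apply Clim0_mult_bound with (sqrt (PI / 2) * (2 / PI)) 0.
    + intros x _. rewrite Cmod_mult, Cmod_cis, Cmod_R, Rabs_pos_eq. lra.
      apply Rmult_le_pos. apply sqrt_pos. apply Rdiv_le_0_compat; lra.
    + apply Clim0_re_im; assumption.
Qed.

Lemma hnorm_lead : Clim0 (fun x => hnorm 0 x - RtoC 1)%C /\ Clim0 (fun x => hnorm 1 x - - Ci)%C.
Proof.
  destruct bessel_lead_Q as [Q (HQ & L & L1 & L2 & L3 & L4)].
  assert (E := gauss_value Q HQ L1 L2 L3 L4).
  split; apply (hankel_lead_aux _ _ _ Q); auto.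
  - revert L1. apply is_lim_ext. intros x. unfold cis, Cmult; simpl. ring.
  - revert L2. apply is_lim_ext. intros x. unfold cis, Cmult; simpl. ring.
  - revert L3. apply is_lim_ext. intros x. unfold cis, Cmult; simpl. ring.
  - revert L4. apply is_lim_ext. intros x. unfold cis, Cmult; simpl. ring.
Qed.

(** * Complex-valued functions of a real variable *)

(** Componentwise, so that the real differentiation rules and monotonicity arguments apply to each
    part. *)
Definition Cder (f : R -> C) (x : R) (l : C) : Prop :=
  is_derive (fun t => fst (f t)) x (fst l) /\ is_derive (fun t => snd (f t)) x (snd l).

Lemma Cder_plus (f g : R -> C) (x : R) (a b : C) :
  Cder f x a -> Cder g x b -> Cder (fun t => f t + g t)%C x (a + b)%C.
Proof. intros [H1 H2] [H3 H4]. split; simpl; now apply der_plus. Qed.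

Lemma Cder_minus (f g : R -> C) (x : R) (a b : C) :
  Cder f x a -> Cder g x b -> Cder (fun t => f t - g t)%C x (a - b)%C.
Proof. intros [H1 H2] [H3 H4]. split; simpl; apply der_plus; auto; now apply der_opp. Qed.

Lemma Cder_mult (f g : R -> C) (x : R) (a b : C) :
  Cder f x a -> Cder g x b -> Cder (fun t => f t * g t)%C x (a * g x + f x * b)%C.
Proof.
  intros [H1 H2] [H3 H4]. split; simpl.
  - evar_last. apply der_minus; apply der_mult; eauto. simpl. ring.
  - evar_last. apply der_plus; apply der_mult; eauto. simpl. ring.
Qed.

Lemma Cder_const (c : C) (x : R) : Cder (fun _ => c) x (RtoC 0).
Proof. split; simpl; apply der_const. Qed.

Lemma Cder_scal (c : C) (f : R -> C) (x : R) (a : C) : Cder f x a -> Cder (fun t => c * f t)%C x (c * a)%C.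
Proof.
  intros H. assert (H1 := Cder_mult _ _ _ _ _ (Cder_const c x) H).
  cbv beta in H1. replace (c * a)%C with (RtoC 0 * f x + c * a)%C by ring. exact H1.
Qed.

Lemma Cder_RtoC (f : R -> R) (x l : R) : is_derive f x l -> Cder (fun t => RtoC (f t)) x (RtoC l).
Proof. intros H. split; simpl; auto. apply der_const. Qed.

Lemma Cder_ext_gt (a : R) (f g : R -> C) (x : R) (l : C) :
  a < x -> (forall t, a < t -> f t = g t) -> Cder f x l -> Cder g x l.
Proof.
  intros Hx He [H1 H2].
  split; [apply (is_derive_ext_gt a (fun t => fst (f t))) | apply (is_derive_ext_gt a (fun t => snd (f t)))]; auto;
  intros t Ht; now rewrite He.
Qed.

Lemma Cder_cis (w b x : R) : Cder (fun t => cis (w * t + b)) x (Ci * RtoC w * cis (w * x + b))%C.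
Proof.
  unfold cis. split; simpl.
  - auto_derive; auto. ring.
  - auto_derive; auto. ring.
Qed.

Lemma Cder_eq (f : R -> C) (x : R) (a b : C) : Cder f x a -> a = b -> Cder f x b.
Proof. now intros H <-. Qed.

Lemma RtoC_neq_0 (x : R) : x <> 0 -> RtoC x <> RtoC 0.
Proof. intros H E. apply RtoC_inj in E. auto. Qed.

Lemma outinv_der (x : R) : 0 < x -> Cder outinv x ((RtoC (/ (2 * x)) - Ci) * outinv x)%C.
Proof.
  intros Hx. assert (HP := PI_RGT_0). unfold outinv.
  eapply Cder_eq.
  - apply (Cder_mult (fun x => RtoC (sqrt (PI / 2 * x))) (fun x => cis (PI / 4 - x))).
    + apply Cder_RtoC. auto_derive. 2: reflexivity. nra.
    + split. apply (is_derive_ext (fun t => fst (cis (-1 * t + PI / 4)))).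
      intros t; f_equal; f_equal; ring. apply (proj1 (Cder_cis (-1) (PI / 4) x)).
      apply (is_derive_ext (fun t => snd (cis (-1 * t + PI / 4)))).
      intros t; f_equal; f_equal; ring. apply (proj2 (Cder_cis (-1) (PI / 4) x)).
  - cbv beta. replace (-1 * x + PI / 4) with (PI / 4 - x) by ring.
    set (e := cis _). assert (Hs : 0 < PI / 2 * x) by nra.
    assert (Hq := sqrt_lt_R0 _ Hs).
    replace (PI / 2 * 1 * / (2 * sqrt (PI / 2 * x))) with (/ (2 * x) * sqrt (PI / 2 * x)).
    rewrite RtoC_mult. replace (RtoC (-1)) with (- RtoC 1)%C by (rewrite <- RtoC_opp; reflexivity). ring.
    apply Rmult_eq_reg_r with (2 * sqrt (PI / 2 * x)). 2: lra.
    transitivity (/ x * (sqrt (PI / 2 * x) * sqrt (PI / 2 * x))). field. lra.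
    rewrite sqrt_sqrt by lra. field. lra.
Qed.

Lemma hankel1_der_0 (x : R) : 0 < x -> Cder (hankel1 0) x (- hankel1 1 x)%C.
Proof. intros Hx. split; simpl. apply bessel_J0_derive. now apply bessel_Y0_derive. Qed.

Lemma hankel1_der_1 (x : R) : 0 < x -> Cder (hankel1 1) x (hankel1 0 x - RtoC (/ x) * hankel1 1 x)%C.
Proof.
  intros Hx. split; simpl; evar_last. now apply bessel_J1_derive. field; lra. now apply bessel_Y1_derive. field; lra.
Qed.

Lemma hnorm_der_0 (x : R) : 0 < x -> Cder (hnorm 0) x ((RtoC (/ (2 * x)) - Ci) * hnorm 0 x - hnorm 1 x)%C.
Proof.
  intros Hx. eapply Cder_eq. apply Cder_mult. now apply outinv_der. now apply hankel1_der_0.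
  unfold hnorm. ring.
Qed.

Lemma hnorm_der_1 (x : R) : 0 < x -> Cder (hnorm 1) x ((- RtoC (/ (2 * x)) - Ci) * hnorm 1 x + hnorm 0 x)%C.
Proof.
  intros Hx. eapply Cder_eq. apply Cder_mult. now apply outinv_der. now apply hankel1_der_1.
  unfold hnorm. replace (/ x) with (2 * / (2 * x)) by (field; lra). rewrite RtoC_mult.
  replace (RtoC 2) with (RtoC 1 + RtoC 1)%C by (rewrite <- RtoC_plus; f_equal; ring). ring.
Qed.

(** The derivative of [hnorm 0]. The bootstrap controls this pair, and [hnorm 1] is recovered from
    it linearly. *)
Definition hder (x : R) : C := ((RtoC (/ (2 * x)) - Ci) * hnorm 0 x - hnorm 1 x)%C.

Lemma hder_der (x : R) : 0 < x ->
  Cder hder x (- (RtoC 2 * Ci * hder x) - RtoC (/ (4 * x ^ 2)) * hnorm 0 x)%C.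
Proof.
  intros Hx. unfold hder. eapply Cder_eq.
  - apply Cder_minus. apply Cder_mult. apply Cder_minus. apply (Cder_RtoC (fun x => / (2 * x)) x (- / (2 * x ^ 2))).
    auto_derive. lra. field. lra. apply Cder_const. now apply hnorm_der_0. now apply hnorm_der_1.
  - cbv beta. set (a := hnorm 0 x). set (b := hnorm 1 x). destruct a as [a1 a2]; destruct b as [b1 b2].
    unfold Cmult, Cminus, Cplus, Copp, RtoC, Ci; simpl. f_equal; field; lra.
Qed.

Lemma hder_lim : Clim0 hder.
Proof.
  destruct hnorm_lead as [H0 H1].
  apply Clim0_ext with (fun x => (RtoC (/ (2 * x)) - Ci) * (hnorm 0 x - RtoC 1) + (RtoC (/ (2 * x)) + - RtoC 1 * (hnorm 1 x - - Ci)))%C 1.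
  - intros x _. unfold hder. ring.
  - apply Clim0_plus.
    + apply Clim0_mult_bound with 2 1; auto. intros x Hx. unfold Cminus. apply Rle_trans with (1 := Cmod_triangle _ _).
      rewrite Cmod_opp, Cmod_Ci, Cmod_R. assert (0 < / (2 * x)) by (apply Rinv_0_lt_compat; lra).
      rewrite Rabs_pos_eq by lra. assert (/ (2 * x) <= / 1) by (apply Rinv_le_contravar; lra). lra.
    + apply Clim0_plus; [|now apply Clim0_scal].
      apply Clim0_le with (fun x => / 2 * / x) 1.
      * intros x Hx. rewrite Cmod_R. rewrite Rabs_pos_eq. apply Req_le; field; lra. apply Rlt_le, Rinv_0_lt_compat; lra.
      * replace (Finite 0) with (Rbar_mult (/ 2) 0) by (simpl; f_equal; ring). apply is_lim_scal_l.
        replace (Finite 0) with (Rbar_inv p_infty) by reflexivity. apply is_lim_inv. apply is_lim_id. easy.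
Qed.

(** * Asymptotic expansions in powers of 1/x *)

(* To order N: the first N remainders, rescaled by powers of x, are bounded. *)
Fixpoint asymN (N : nat) (g : R -> C) (a : nat -> C) : Prop :=
  match N with
  | O => exists K X, forall x, X <= x -> Cmod (g x) <= K
  | S n => asymN n (fun x => RtoC x * (g x - a 0%nat))%C (fun j => a (S j))
  end.

Definition asym (g : R -> C) (a : nat -> C) : Prop := forall N, asymN N g a.

Lemma asymN_ext (N : nat) : forall (g h : R -> C) (a b : nat -> C) (X : R),
  (forall x, X <= x -> g x = h x) -> (forall j, a j = b j) -> asymN N g a -> asymN N h b.
Proof.
  induction N as [|N IH]; intros g h a b X He Ha; simpl.
  - intros [K [Y H]]. exists K, (Rmax X Y). intros x Hx.
    assert (H1 := Rmax_l X Y). assert (H2 := Rmax_r X Y). rewrite <- He by lra. apply H. lra.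
  - apply IH with X; auto. intros x Hx. rewrite He, Ha; auto.
Qed.

Lemma asym_ext (g h : R -> C) (a b : nat -> C) (X : R) :
  (forall x, X <= x -> g x = h x) -> (forall j, a j = b j) -> asym g a -> asym h b.
Proof. intros H1 H2 H N. now apply asymN_ext with g a X. Qed.

Lemma Cmod_mult_1_le (x : R) (z : C) : 1 <= x -> Cmod z <= Cmod (RtoC x * z)%C.
Proof.
  intros Hx. rewrite Cmod_mult, Cmod_R, Rabs_pos_eq by lra. assert (H := Cmod_ge_0 z). nra.
Qed.

Lemma asymN_le (N : nat) : forall (g : R -> C) (a : nat -> C), asymN (S N) g a -> asymN N g a.
Proof.
  induction N as [|N IH]; intros g a.
  - simpl. intros [K [X H]]. exists (K + Cmod (a 0%nat)), (Rmax X 1). intros x Hx.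
    assert (H1 := Rmax_l X 1). assert (H2 := Rmax_r X 1).
    replace (g x) with ((g x - a 0%nat) + a 0%nat)%C by ring.
    apply Rle_trans with (1 := Cmod_triangle _ _). apply Rplus_le_compat_r.
    apply Rle_trans with (1 := Cmod_mult_1_le x _ ltac:(lra)). apply H. lra.
  - intros H. simpl. apply IH. exact H.
Qed.

Lemma asym_step (g : R -> C) (a : nat -> C) :
  asym g a <-> asym (fun x => RtoC x * (g x - a 0%nat))%C (fun j => a (S j)).
Proof.
  split.
  - intros H N. exact (H (S N)).
  - intros H [|N]. apply asymN_le. exact (H 0%nat). exact (H N).
Qed.

Lemma asymN_plus (N : nat) : forall (g h : R -> C) (a b : nat -> C),
  asymN N g a -> asymN N h b -> asymN N (fun x => g x + h x)%C (fun j => a j + b j)%C.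
Proof.
  induction N as [|N IH]; intros g h a b.
  - intros [K [X H]] [L [Y H']]. exists (K + L), (Rmax X Y). intros x Hx.
    assert (H1 := Rmax_l X Y). assert (H2 := Rmax_r X Y).
    apply Rle_trans with (1 := Cmod_triangle _ _). apply Rplus_le_compat; auto. apply H; lra. apply H'; lra.
  - intros H1 H2. assert (H := IH _ _ _ _ H1 H2). simpl. apply (asymN_ext N) with (3 := H) (X := 0); auto. intros x _. ring.
Qed.

Lemma asymN_scal (N : nat) : forall (c : C) (g : R -> C) (a : nat -> C),
  asymN N g a -> asymN N (fun x => c * g x)%C (fun j => c * a j)%C.
Proof.
  induction N as [|N IH]; intros c g a.
  - intros [K [X H]]. exists (Cmod c * K), X. intros x Hx. rewrite Cmod_mult.
    apply Rmult_le_compat_l. apply Cmod_ge_0. auto.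
  - intros H1. assert (H := IH c _ _ H1). simpl. apply (asymN_ext N) with (3 := H) (X := 0); auto. intros x _. ring.
Qed.

Definition conv (a b : nat -> C) (n : nat) : C := sum_n (fun k => a k * b (n - k)%nat)%C n.

Lemma conv_S (a b : nat -> C) (n : nat) :
  conv a b (S n) = (a 0%nat * b (S n) + conv (fun j => a (S j)) b n)%C.
Proof.
  unfold conv. unfold sum_n at 1. rewrite sum_Sn_m by lia. rewrite Nat.sub_0_r.
  change plus with Cplus. f_equal. unfold sum_n. rewrite <- sum_n_m_S. apply sum_n_m_ext. intros k. f_equal.
Qed.

(** x (g h - a_0 b_0) = a_0 x (h - b_0) + x (g - a_0) h lowers the order by one, and [conv_S] is the
    same splitting of the coefficients. *)
Lemma asymN_mult (N : nat) : forall (g h : R -> C) (a b : nat -> C),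
  asymN N g a -> asymN N h b -> asymN N (fun x => g x * h x)%C (conv a b).
Proof.
  induction N as [|N IH]; intros g h a b.
  - intros [K [X H]] [L [Y H']]. exists (K * L), (Rmax X Y). intros x Hx.
    assert (H1 := Rmax_l X Y). assert (H2 := Rmax_r X Y). rewrite Cmod_mult.
    apply Rmult_le_compat; try apply Cmod_ge_0. apply H; lra. apply H'; lra.
  - intros H1 H2. simpl.
    assert (H3 := IH _ _ _ _ H1 (asymN_le _ _ _ H2)). simpl in H2.
    assert (H4 := asymN_plus _ _ _ _ _ (asymN_scal _ (a 0%nat) _ _ H2) H3).
    apply (asymN_ext N) with (3 := H4) (X := 0).
    + intros x _. cbv beta. unfold conv. rewrite sum_O. ring_simplify.
      replace (0 - 0)%nat with 0%nat by reflexivity. ring.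
    + intros j. now rewrite conv_S.
Qed.

Lemma asym_plus (g h : R -> C) (a b : nat -> C) :
  asym g a -> asym h b -> asym (fun x => g x + h x)%C (fun j => a j + b j)%C.
Proof. intros H1 H2 N. now apply asymN_plus. Qed.
Lemma asym_mult (g h : R -> C) (a b : nat -> C) :
  asym g a -> asym h b -> asym (fun x => g x * h x)%C (conv a b).
Proof. intros H1 H2 N. now apply asymN_mult. Qed.

Lemma asymN_dilate (N : nat) (kappa : R) : 0 < kappa -> forall (g : R -> C) (a : nat -> C),
  asymN N g a -> asymN N (fun r => g (kappa * r)) (fun j => a j / RtoC (kappa ^ j))%C.
Proof.
  intros Hk. induction N as [|N IH]; intros g a.
  - intros [K [X H]]. exists K, (X / kappa). intros x Hx. apply H.
    apply Rmult_le_compat_l with (r := kappa) in Hx; [|lra]. replace (kappa * (X / kappa)) with X in Hx by (field; lra). exact Hx.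
  - intros H. assert (H1 := asymN_scal _ (/ RtoC kappa)%C _ _ (IH _ _ H)). simpl.
    assert (HkC : RtoC kappa <> RtoC 0) by (apply RtoC_neq_0; lra).
    apply (asymN_ext N) with (3 := H1) (X := 0).
    + intros x _. cbv beta. rewrite RtoC_mult. simpl. field. auto.
    + intros j. assert (RtoC (kappa ^ j) <> RtoC 0) by (apply RtoC_neq_0, pow_nonzero; lra).
      simpl. rewrite RtoC_mult. field. auto.
Qed.

Lemma asym_dilate (kappa : R) (g : R -> C) (a : nat -> C) : 0 < kappa ->
  asym g a -> asym (fun r => g (kappa * r)) (fun j => a j / RtoC (kappa ^ j))%C.
Proof. intros Hk H N. now apply asymN_dilate. Qed.

Lemma asym_unique_0 (g : R -> C) (a b : nat -> C) : asym g a -> asym g b -> a 0%nat = b 0%nat.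
Proof.
  intros Ha Hb. destruct (Ha 1%nat) as [K [X H]]. destruct (Hb 1%nat) as [L [Y H']].
  cut ((a 0%nat - b 0%nat)%C = RtoC 0).
  { intros E. transitivity ((a 0%nat - b 0%nat) + b 0%nat)%C. ring. rewrite E. ring. }
  apply Cmod_eq_0. destruct (Rle_lt_or_eq_dec 0 _ (Cmod_ge_0 (a 0%nat - b 0%nat)%C)) as [Hp|]; auto. exfalso.
  set (m := Cmod (a 0%nat - b 0%nat)%C) in *.
  set (x := Rmax (Rmax X Y) (Rmax 1 ((K + L + 1) / m))).
  assert (H1 := Rmax_l (Rmax X Y) (Rmax 1 ((K + L + 1) / m))).
  assert (H2 := Rmax_r (Rmax X Y) (Rmax 1 ((K + L + 1) / m))). fold x in H1, H2.
  assert (H3 := Rmax_l X Y). assert (H4 := Rmax_r X Y).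
  assert (H5 := Rmax_l 1 ((K + L + 1) / m)). assert (H6 := Rmax_r 1 ((K + L + 1) / m)).
  specialize (H x ltac:(lra)). specialize (H' x ltac:(lra)).
  assert (Hs : x * m <= K + L).
  { unfold m. rewrite <- (Rabs_pos_eq x) at 1 by lra. rewrite <- Cmod_R, <- Cmod_mult.
    replace (RtoC x * (a 0%nat - b 0%nat))%C with (RtoC x * (g x - b 0%nat) + - (RtoC x * (g x - a 0%nat)))%C by ring.
    apply Rle_trans with (1 := Cmod_triangle _ _). rewrite Cmod_opp. lra. }
  assert (K + L + 1 <= x * m).
  { replace (K + L + 1) with ((K + L + 1) / m * m) by (field; lra). apply Rmult_le_compat_r; lra. }
  lra.
Qed.

Lemma asym_unique (n : nat) : forall (g : R -> C) (a b : nat -> C), asym g a -> asym g b -> a n = b n.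
Proof.
  induction n as [|n IH]; intros g a b Ha Hb.
  - now apply asym_unique_0 with g.
  - assert (E := asym_unique_0 _ _ _ Ha Hb).
    apply (IH (fun x => RtoC x * (g x - a 0%nat))%C (fun j => a (S j)) (fun j => b (S j))).
    exact (proj1 (asym_step g a) Ha). rewrite E. exact (proj1 (asym_step g b) Hb).
Qed.

Ltac asC := match goal with |- @eq _ ?a ?b => change (@eq C a b) end.

Lemma sum_n_C_S (a : nat -> C) (N : nat) : sum_n a (S N) = (a 0%nat + sum_n (fun j => a (S j)) N)%C.
Proof. unfold sum_n. rewrite sum_Sn_m by lia. change plus with Cplus. f_equal. now rewrite <- sum_n_m_S. Qed.

Lemma sum_n_C_scal (c : C) (a : nat -> C) (N : nat) : sum_n (fun j => c * a j)%C N = (c * sum_n a N)%C.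
Proof.
  induction N as [|N IH]. now rewrite !sum_O. rewrite !sum_Sn, IH. symmetry. apply Cmult_plus_distr_l.
Qed.

(** Removing a_0 and multiplying by x turns a truncation bound of order N + 1 into one of order N
    for the shifted coefficients. *)
Lemma asymN_of_trunc (N : nat) : forall (g : R -> C) (a : nat -> C),
  (exists K X, forall x, X <= x -> x ^ N * Cmod (g x - sum_n (fun j => a j / RtoC (x ^ j)) N)%C <= K) ->
  asymN N g a.
Proof.
  induction N as [|N IH]; intros g a [K [X H]].
  - exists (K + Cmod (a 0%nat)), X. intros x Hx. specialize (H x Hx). rewrite sum_O in H. simpl in H.
    replace (g x) with ((g x - a 0%nat / 1) + a 0%nat)%C by (field; apply RtoC_neq_0; lra).
    apply Rle_trans with (1 := Cmod_triangle _ _). lra.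
  - simpl. apply IH. exists K, (Rmax X 1). intros x Hx.
    assert (H1 := Rmax_l X 1). assert (H2 := Rmax_r X 1).
    specialize (H x ltac:(lra)). apply Rle_trans with (2 := H). apply Req_le.
    simpl pow. rewrite (Rmult_comm x), Rmult_assoc. f_equal.
    assert (Hm : forall z, x * Cmod z = Cmod (RtoC x * z)%C).
    { intros z. now rewrite Cmod_mult, Cmod_R, Rabs_pos_eq by lra. }
    rewrite Hm. f_equal.
    rewrite (sum_n_C_S (fun j => a j / RtoC (x ^ j))%C).
    assert (HxC : RtoC x <> RtoC 0) by (apply RtoC_neq_0; lra).
    rewrite (sum_n_ext (fun j => a (S j) / RtoC (x ^ j))%C (fun j => RtoC x * (a (S j) / RtoC (x ^ S j)))%C).
    rewrite sum_n_C_scal. simpl (x ^ 0). asC. field. auto.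
    intros j. assert (RtoC (x ^ j) <> RtoC 0) by (apply RtoC_neq_0, pow_nonzero; lra).
    simpl pow. rewrite RtoC_mult. asC. field. auto.
Qed.

Lemma asym_of_lim (g : R -> C) (a : nat -> C) :
  (forall N, is_lim (fun r => r ^ N * Cmod (g r - sum_n (fun j => a j / RtoC (r ^ j)) N)%C) p_infty 0) -> asym g a.
Proof.
  intros H N. apply asymN_of_trunc. specialize (H N). apply is_lim_spec in H.
  destruct (H (mkposreal 1 Rlt_0_1)) as [M HM]. exists 1, (M + 1). intros x Hx.
  specialize (HM x ltac:(lra)). rewrite Rminus_0_r in HM. simpl in HM.
  apply Rle_trans with (1 := Rle_abs _). lra.
Qed.

(** * Oscillatory bootstrap *)

(** Integration from infinity without an integral: f - M/x^(p+1) is increasing and tends to 0, hence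
    is at most 0; the same holds for -f. *)
Lemma tail_bound_R (g g' : R -> R) (M X : R) (p : nat) : 0 < X ->
  (forall x, X < x -> is_derive g x (g' x)) ->
  (forall x, X < x -> Rabs (g' x) <= M / x ^ (S (S p))) ->
  is_lim g p_infty 0 ->
  forall x, X < x -> Rabs (g x) <= M / x ^ (S p).
Proof.
  intros HX Hd Hb HL.
  assert (G : forall (f f' : R -> R), (forall x, X < x -> is_derive f x (f' x)) ->
    (forall x, X < x -> Rabs (f' x) <= M / x ^ (S (S p))) -> is_lim f p_infty 0 -> forall x, X < x -> f x <= M / x ^ (S p)).
  { clear g g' Hd Hb HL. intros f f' Hd Hb HL x Hx.
    set (h := fun x => f x - M / x ^ (S p)).
    assert (Hh : forall y, X < y -> is_derive h y (f' y + INR (S p) * (M / y ^ (S (S p))))).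
    { intros y Hy. unfold h. evar_last. apply der_minus. now apply Hd.
      apply (is_derive_ext_gt 0 (fun x => M * (/ x) ^ (S p))). lra. intros t Ht. rewrite pow_inv. reflexivity.
      apply der_scal. apply (is_derive_pow (fun x => / x) (S p) y (- / y ^ 2)). auto_derive. lra. field. lra.
      change (Nat.pred (S p)) with p. generalize (INR (S p)). intros c. simpl pow. rewrite pow_inv.
      field. split. apply pow_nonzero; lra. lra. }
    assert (Hinc : forall y, x < y -> h x <= h y).
    { intros y Hy. destruct (MVT_gen h x y (fun y => f' y + INR (S p) * (M / y ^ (S (S p))))) as [c [Hc E]].
      - intros z Hz. apply Hh. rewrite Rmin_left in Hz; lra.
      - intros z Hz. apply continuity_pt_filterlim. apply (ex_derive_continuous h). eexists. apply Hh.
        rewrite Rmin_left in Hz; lra.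
      - rewrite Rmin_left in Hc by lra. assert (HcX : X < c) by lra.
        specialize (Hb c HcX). apply Rabs_le_between in Hb.
        assert (1 <= INR (S p)). { rewrite S_INR. assert (H := pos_INR p). lra. }
        assert (0 <= (f' c + INR (S p) * (M / c ^ S (S p))) * (y - x)).
        { apply Rmult_le_pos; [|lra]. assert (0 <= M / c ^ S (S p)) by lra. nra. }
        lra. }
    assert (HLh : is_lim h p_infty 0).
    { unfold h. replace (Finite 0) with (Rbar_minus 0 0) by (simpl; f_equal; ring).
      apply is_lim_minus with 0 0; [exact HL | | reflexivity].
      apply is_lim_le_0 with (fun x => Rabs M * / x) 1.
      - intros y Hy. unfold Rdiv. rewrite Rabs_mult. apply Rmult_le_compat_l. apply Rabs_pos.
        assert (1 <= y ^ p) by (apply pow_R1_Rle; lra).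
        rewrite Rabs_pos_eq. apply Rinv_le_contravar. lra. simpl. nra.
        apply Rlt_le, Rinv_0_lt_compat. apply pow_lt; lra.
      - replace (Finite 0) with (Rbar_mult (Rabs M) 0) by (simpl; f_equal; ring). apply is_lim_scal_l.
        replace (Finite 0) with (Rbar_inv p_infty) by reflexivity. apply is_lim_inv. apply is_lim_id. easy. }
    assert (h x <= 0).
    { destruct (Rle_dec (h x) 0); auto. exfalso. apply is_lim_spec in HLh.
      destruct (HLh (mkposreal (h x) ltac:(lra))) as [Y HY]. simpl in HY.
      specialize (HY (Rmax x Y + 1)). assert (H1 := Rmax_l x Y). assert (H2 := Rmax_r x Y).
      specialize (HY ltac:(lra)). specialize (Hinc (Rmax x Y + 1) ltac:(lra)).
      rewrite Rminus_0_r in HY. apply Rabs_def2 in HY. lra. }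
    unfold h in H. lra. }
  intros x Hx. apply Rabs_le. split.
  - cut (- g x <= M / x ^ S p). lra.
    apply (G (fun x => - g x) (fun x => - g' x)); auto.
    + intros y Hy. now apply der_opp, Hd.
    + intros y Hy. rewrite Rabs_Ropp. auto.
    + replace (Finite 0) with (Rbar_opp 0) by (simpl; f_equal; ring). now apply is_lim_opp.
  - now apply (G g g').
Qed.

Lemma Rabs_fst_le (z : C) : Rabs (fst z) <= Cmod z.
Proof. apply Rle_trans with (2 := Rmax_Cmod z). apply Rmax_l. Qed.
Lemma Rabs_snd_le (z : C) : Rabs (snd z) <= Cmod z.
Proof. apply Rle_trans with (2 := Rmax_Cmod z). apply Rmax_r. Qed.

Lemma tail_bound_C (g g' : R -> C) (M X : R) (p : nat) : 0 < X ->
  (forall x, X < x -> Cder g x (g' x)) ->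
  (forall x, X < x -> Cmod (g' x) <= M / x ^ (S (S p))) ->
  Clim0 g ->
  forall x, X < x -> Cmod (g x) <= 2 * M / x ^ (S p).
Proof.
  intros HX Hd Hb HL x Hx.
  apply Rle_trans with (1 := Cmod_le_abs _).
  replace (2 * M / x ^ S p) with (M / x ^ S p + M / x ^ S p) by (field; apply pow_nonzero; lra).
  apply Rplus_le_compat.
  - apply (tail_bound_R (fun x => fst (g x)) (fun x => fst (g' x)) M X p); auto.
    intros y Hy. now apply Hd. intros y Hy. apply Rle_trans with (2 := Hb y Hy). apply Rabs_fst_le.
    apply is_lim_le_0 with (fun x => Cmod (g x)) 0. intros; apply Rabs_fst_le. exact HL.
  - apply (tail_bound_R (fun x => snd (g x)) (fun x => snd (g' x)) M X p); auto.
    intros y Hy. now apply Hd. intros y Hy. apply Rle_trans with (2 := Hb y Hy). apply Rabs_snd_le.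
    apply is_lim_le_0 with (fun x => Cmod (g x)) 0. intros; apply Rabs_snd_le. exact HL.
Qed.

(* Both e^{2ix} k and k + 2i d have small derivative, so each pass gains a power of 1/x. *)
Lemma bootstrap_step (d k r : R -> C) (K R0 X : R) (p : nat) : 1 <= X ->
  (forall x, X < x -> Cder d x (k x)) ->
  (forall x, X < x -> Cder k x (- (RtoC 2 * Ci * k x) - RtoC (/ (4 * x ^ 2)) * d x - r x)%C) ->
  (forall x, X < x -> Cmod (d x) <= K / x ^ p) ->
  (forall x, X < x -> Cmod (r x) <= R0 / x ^ (S (S p))) ->
  Clim0 d -> Clim0 k ->
  exists K', forall x, X < x -> Cmod (d x) <= K' / x ^ (S p) /\ Cmod (k x) <= K' / x ^ (S p).
Proof.
  intros HX Hd Hk HK Hr Ld Lk.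
  set (s := fun x => (- (RtoC (/ (4 * x ^ 2)) * d x) - r x)%C).
  assert (Hs : forall x, X < x -> Cmod (s x) <= (K + R0) / x ^ (S (S p))).
  { intros x Hx. unfold s. unfold Cminus. apply Rle_trans with (1 := Cmod_triangle _ _).
    rewrite !Cmod_opp, Cmod_mult, Cmod_R.
    specialize (HK x Hx). specialize (Hr x Hx).
    assert (Hp : 0 < x ^ p) by (apply pow_lt; lra).
    replace ((K + R0) / x ^ S (S p)) with (/ (x ^ 2) * (K / x ^ p) + R0 / x ^ S (S p)).
    2:{ simpl. field. lra. }
    apply Rplus_le_compat; auto.
    assert (Hx2 : 0 < x ^ 2) by (apply pow_lt; lra).
    apply Rmult_le_compat; auto. apply Rabs_pos. apply Cmod_ge_0.
    rewrite Rabs_pos_eq. apply Rinv_le_contravar; lra. apply Rlt_le, Rinv_0_lt_compat; lra. }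
  assert (B1 : forall x, X < x -> Cmod (cis (2 * x + 0) * k x)%C <= 2 * (K + R0) / x ^ (S p)).
  { apply (tail_bound_C (fun x => cis (2 * x + 0) * k x)%C (fun x => cis (2 * x + 0) * s x)%C); auto. lra.
    - intros x Hx. eapply Cder_eq. apply Cder_mult. apply Cder_cis. now apply Hk. unfold s. cbv beta. ring.
    - intros x Hx. rewrite Cmod_mult, Cmod_cis, Rmult_1_l. auto.
    - apply Clim0_mult_bound with 1 0; auto. intros; rewrite Cmod_cis; lra. }
  assert (B2 : forall x, X < x -> Cmod (k x + RtoC 2 * Ci * d x)%C <= 2 * (K + R0) / x ^ (S p)).
  { apply (tail_bound_C (fun x => k x + RtoC 2 * Ci * d x)%C s); auto. lra.
    - intros x Hx. eapply Cder_eq. apply Cder_plus. now apply Hk. apply Cder_scal. now apply Hd. unfold s. ring.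
    - apply Clim0_plus; auto. now apply Clim0_scal. }
  exists (2 * (K + R0)). intros x Hx. specialize (B1 x Hx). specialize (B2 x Hx).
  rewrite Cmod_mult, Cmod_cis, Rmult_1_l in B1.
  assert (B : Cmod (RtoC 2 * Ci * d x)%C <= 2 * (K + R0) / x ^ (S p) + 2 * (K + R0) / x ^ (S p)).
  { replace (RtoC 2 * Ci * d x)%C with ((k x + RtoC 2 * Ci * d x) + - k x)%C by ring.
    apply Rle_trans with (1 := Cmod_triangle _ _). rewrite Cmod_opp. lra. }
  rewrite !Cmod_mult, Cmod_Ci, Cmod_R, Rabs_pos_eq in B by lra. split; lra.
Qed.

(** * The Gamma function at half-integers *)

Notation gen_int f l := (is_RInt_gen f (at_right 0) (Rbar_locally p_infty) l).

Lemma filter_prod_pos (P : R * R -> Prop) :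
  (forall a b, 0 < a -> a < b -> P (a, b)) -> filter_prod (at_right 0) (Rbar_locally p_infty) P.
Proof.
  intros H. apply (Filter_prod _ _ _ (fun a => 0 < a < 1) (fun b => 1 < b)).
  - exists (mkposreal 1 Rlt_0_1). intros y Hy Hp. split; auto.
    unfold ball in Hy; simpl in Hy; unfold AbsRing_ball, abs, minus, plus, opp in Hy; simpl in Hy.
    apply Rabs_def2 in Hy. lra.
  - exists 1. auto.
  - intros a b Ha Hb. apply H; lra.
Qed.

Lemma is_RInt_gen_half_line (F f : R -> R) (l0 l1 : R) :
  (forall t, 0 < t -> is_derive F t (f t)) -> (forall t, 0 < t -> continuous f t) ->
  filterlim F (at_right 0) (locally l0) -> is_lim F p_infty l1 -> gen_int f (l1 - l0).
Proof.
  intros Hd Hc H0 H1.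
  apply is_RInt_gen_ext with (Derive F).
  - apply filter_prod_pos. intros a b Ha Hab x Hx. simpl in Hx. rewrite Rmin_left in Hx by lra.
    apply is_derive_unique, Hd. lra.
  - apply is_RInt_gen_Derive; auto.
    + apply filter_prod_pos. intros a b Ha Hab x Hx. simpl in Hx. rewrite Rmin_left in Hx by lra.
      exists (f x). apply Hd. lra.
    + apply filter_prod_pos. intros a b Ha Hab x Hx. simpl in Hx. rewrite Rmin_left in Hx by lra.
      apply continuous_ext_loc with f.
      apply (filter_imp (fun t => 0 < t)). intros t Ht. symmetry. apply is_derive_unique. now apply Hd.
      apply (open_gt 0). lra. apply Hc. lra.
Qed.

Definition gamfun (x t : R) : R := Rpower t (x - 1) * exp (- t).

Lemma gamfun_continuous (x t : R) : 0 < t -> continuous (gamfun x) t.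
Proof.
  intros Ht. unfold gamfun, Rpower. apply (ex_derive_continuous (fun t => exp ((x - 1) * ln t) * exp (- t))).
  auto_derive. auto.
Qed.

(** [2 * gauss (sqrt t)] is a primitive, so Gamma(1/2) inherits the Gaussian value. *)
Lemma Gamma_half_integral : gen_int (gamfun (1 / 2)) (sqrt PI).
Proof.
  replace (sqrt PI) with (2 * (sqrt PI / 2) - 2 * gauss (sqrt 0)).
  2:{ rewrite sqrt_0, gauss_0. field. }
  apply (is_RInt_gen_half_line (fun t => 2 * gauss (sqrt t))).
  - intros t Ht. evar_last. apply der_scal. apply (der_comp gauss). apply gauss_derive.
    apply (is_derive_sqrt (fun t => t)). apply der_id. exact Ht.
    unfold gamfun. replace (1 / 2 - 1) with (- / 2) by field. rewrite Rpower_Ropp, Rpower_sqrt by auto.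
    rewrite pow2_sqrt by lra. assert (H := sqrt_lt_R0 t Ht). unfold Rdiv. field. lra.
  - intros t Ht. now apply gamfun_continuous.
  - apply (filterlim_filter_le_1 (F := locally 0)). intros P [d Hd]. exists d. intros; auto.
    apply (filterlim_comp _ _ _ sqrt (fun u => 2 * gauss u) _ (locally (sqrt 0))).
    apply continuity_pt_filterlim. apply continuity_pt_sqrt. lra.
    apply (ex_derive_continuous (fun u => 2 * gauss u)). eexists. apply der_scal, gauss_derive.
  - apply (is_lim_scal_l (fun t => gauss (sqrt t)) 2 p_infty (sqrt PI / 2)).
    apply (is_lim_comp gauss sqrt p_infty _ p_infty). apply gauss_lim_value.
    apply (is_lim_sqrt_p (fun x => x)). apply is_lim_id. exists 0. intros; discriminate.
Qed.

(** Integration by parts: t^x exp(-t) vanishes at both ends, at infinity because t^x <= t^(m+1) with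
    m the integer part of x. *)
Lemma Gamma_step (x l : R) : 0 < x -> gen_int (gamfun x) l -> gen_int (gamfun (x + 1)) (x * l).
Proof.
  intros Hx H.
  assert (H1 : gen_int (fun t => gamfun (x + 1) t - x * gamfun x t) (0 - 0)).
  { apply (is_RInt_gen_half_line (fun t => - (Rpower t x * exp (- t)))).
    - intros t Ht. unfold gamfun, Rpower. replace (x + 1 - 1) with x by ring.
      auto_derive. auto. replace (exp ((x - 1) * ln t)) with (exp (x * ln t) * / t).
      field. lra. replace ((x - 1) * ln t) with (x * ln t + - ln t) by ring.
      rewrite exp_plus, exp_Ropp, exp_ln by auto. reflexivity.
    - intros t Ht. unfold gamfun, Rpower.
      apply (ex_derive_continuous (fun t => exp ((x + 1 - 1) * ln t) * exp (- t) - x * (exp ((x - 1) * ln t) * exp (- t)))).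
      auto_derive. auto.
    - replace 0 with (- (0 * exp (- 0))) at 2 by ring.
      apply (filterlim_comp _ _ _ (fun t => Rpower t x * exp (- t)) Ropp _ (locally (0 * exp (- 0)))).
      2: apply (filterlim_opp (0 * exp (- 0))).
      apply (filterlim_comp_2 (fun t => Rpower t x) (fun t => exp (- t)) Rmult (G := locally 0) (H := locally (exp (- 0)))).
      + unfold Rpower.
        apply (filterlim_comp _ _ _ (fun t => x * ln t) exp _ (Rbar_locally m_infty)).
        2: apply is_lim_exp_m.
        apply (filterlim_comp _ _ _ ln (fun y => x * y) _ (Rbar_locally m_infty)). apply is_lim_ln_0.
        replace m_infty with (Rbar_mult x m_infty) at 2. apply filterlim_Rbar_mult_l.
        simpl. destruct (Rle_dec 0 x); [|lra]. destruct (Rle_lt_or_eq_dec _ _ r); [reflexivity|lra].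
      + apply (filterlim_filter_le_1 (F := locally 0)). intros P [d Hd]. exists d. intros; auto.
        apply (ex_derive_continuous (fun t => exp (- t))). auto_derive. auto.
      + apply (filterlim_mult (K := R_AbsRing) 0 (exp (- 0))).
    - destruct (nfloor_ex x ltac:(lra)) as [m Hm].
      apply is_lim_le_0 with (fun t => INR (S (S m)) ^ (S (S m)) * / t) 1.
      + intros t Ht. rewrite Rabs_Ropp, Rabs_pos_eq.
        2: apply Rlt_le, Rmult_lt_0_compat; apply exp_pos.
        apply Rle_trans with (t ^ (S m) * (INR (S (S m)) / t) ^ (S (S m))).
        * apply Rmult_le_compat. apply Rlt_le, exp_pos. apply Rlt_le, exp_pos.
          rewrite <- Rpower_pow by lra. destruct (Req_dec t 1) as [->|Hn].
          unfold Rpower. rewrite ln_1, !Rmult_0_r. lra.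
          apply Rlt_le, Rpower_lt. lra. rewrite S_INR. lra.
          apply exp_neg_le_pow. lra.
        * apply Req_le. unfold Rdiv. rewrite Rpow_mult_distr.
          generalize (INR (S (S m)) ^ (S (S m))). intros c. simpl. rewrite pow_inv. field. split; [lra|apply pow_nonzero; lra].
      + replace (Finite 0) with (Rbar_mult (INR (S (S m)) ^ (S (S m))) 0) by (simpl; f_equal; ring). apply is_lim_scal_l.
        replace (Finite 0) with (Rbar_inv p_infty) by reflexivity. apply is_lim_inv. apply is_lim_id. easy. }
  assert (H2 := is_RInt_gen_plus _ _ _ _ H1 (is_RInt_gen_scal _ x _ H)).
  replace (x * l) with (plus (0 - 0) (scal x l)).
  2:{ unfold plus, scal; simpl; unfold mult; simpl. ring. }
  revert H2. apply is_RInt_gen_ext. apply filter_prod_pos. intros a b _ _ t _.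
  unfold plus, scal; simpl; unfold mult; simpl. ring.
Qed.

Fixpoint gam (j : nat) : R := match j with O => sqrt PI | S k => (INR k + 1 / 2) * gam k end.

Lemma gam_pos (j : nat) : 0 < gam j.
Proof.
  induction j as [|j IH]; simpl. apply sqrt_lt_R0, PI_RGT_0.
  apply Rmult_lt_0_compat; auto. assert (H := pos_INR j). lra.
Qed.

Lemma Gamma_half (j : nat) : Gamma (INR j + 1 / 2) = gam j.
Proof.
  unfold Gamma. apply (is_RInt_gen_unique (V := R_CompleteNormedModule)).
  change (gen_int (gamfun (INR j + 1 / 2)) (gam j)).
  induction j as [|j IH].
  - simpl. rewrite Rplus_0_l. apply Gamma_half_integral.
  - rewrite S_INR. replace (INR j + 1 + 1 / 2) with (INR j + 1 / 2 + 1) by ring.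
    apply Gamma_step; auto. assert (H := pos_INR j). lra.
Qed.

Lemma Ci2_neq_0 : (RtoC 2 * Ci)%C <> RtoC 0.
Proof. intros E. apply (f_equal snd) in E. simpl in E. lra. Qed.

Lemma Ci_neq_0 : Ci <> RtoC 0.
Proof. intros E. apply (f_equal snd) in E. simpl in E. lra. Qed.

Lemma Cpow_neq_0 (z : C) (n : nat) : z <> RtoC 0 -> (z ^ n)%C <> RtoC 0.
Proof. intros Hz. induction n as [|n IH]; simpl. apply RtoC_neq_0; lra. now apply Cmult_neq_0. Qed.

Lemma Cnu_eq (nu j : nat) : Cnu nu j =
  (RtoC (pochhammer (1 / 2 - INR nu) j * gam (nu + j) / (INR (fact j) * gam nu)) / (RtoC 2 * Ci) ^ j)%C.
Proof.
  unfold Cnu. rewrite <- plus_INR, !Gamma_half.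
  assert (H1 := gam_pos nu). assert (H2 := INR_fact_lt_0 j).
  rewrite RtoC_div by nra. field. split. apply RtoC_neq_0. nra.
  apply Cpow_neq_0, Ci2_neq_0.
Qed.

Lemma Cnu_0 (nu : nat) : Cnu nu 0 = RtoC 1.
Proof.
  rewrite Cnu_eq. rewrite Nat.add_0_r. simpl. assert (H1 := gam_pos nu).
  replace (1 * gam nu / (1 * gam nu)) with 1 by (field; lra). field.
Qed.

(** The first-order recursion in j is what Bessel's equation produces; from here on it replaces the
    Gamma quotients. *)
Lemma Cnu_S (nu j : nat) : (RtoC 2 * Ci * RtoC (INR (S j)) * Cnu nu (S j))%C =
  (RtoC ((1 / 2 - INR nu + INR j) * (INR nu + INR j + 1 / 2)) * Cnu nu j)%C.
Proof.
  rewrite !Cnu_eq. rewrite Nat.add_succ_r. change (gam (S (nu + j))) with ((INR (nu + j) + 1 / 2) * gam (nu + j)).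
  rewrite plus_INR, fact_simpl, mult_INR. simpl pochhammer.
  change ((RtoC 2 * Ci) ^ S j)%C with ((RtoC 2 * Ci) * (RtoC 2 * Ci) ^ j)%C.
  assert (H1 := gam_pos nu). assert (H2 := INR_fact_lt_0 j). assert (H3 : 0 < INR (S j)) by (apply lt_0_INR; lia).
  generalize dependent (INR (S j)). intros s Hs.
  set (p := pochhammer _ j). set (g := gam (nu + j)). set (q := ((RtoC 2 * Ci) ^ j)%C).
  assert (Hq : q <> RtoC 0) by apply Cpow_neq_0, Ci2_neq_0.
  set (P := 1 / 2 - INR nu + INR j). set (N := INR nu + INR j + 1 / 2).
  replace (p * P * (N * g) / (s * INR (fact j) * gam nu)) with (/ s * (P * N) * (p * g / (INR (fact j) * gam nu))) by (field; lra).
  rewrite !RtoC_mult, RtoC_inv by lra. field. repeat split; first [assumption | apply Ci_neq_0 | apply RtoC_neq_0; lra].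
Qed.

(** * Expansions of the Hankel functions to all orders *)

Definition hP (N : nat) (x : R) : C := sum_n (fun j => Cnu 0 j / RtoC (x ^ j))%C N.
Definition hP1 (N : nat) (x : R) : C := sum_n (fun j => - (RtoC (INR j) * Cnu 0 j / RtoC (x ^ S j)))%C N.
Definition hP2 (N : nat) (x : R) : C := sum_n (fun j => RtoC (INR j * (INR j + 1)) * Cnu 0 j / RtoC (x ^ S (S j)))%C N.

Lemma Cder_div_pow (c : C) (j : nat) (x : R) : 0 < x ->
  Cder (fun x => c / RtoC (x ^ j))%C x (- (RtoC (INR j) * c / RtoC (x ^ S j)))%C.
Proof.
  intros Hx.
  apply (Cder_ext_gt 0 (fun x => c * RtoC ((/ x) ^ j))%C); auto.
  { intros t Ht. rewrite pow_inv, RtoC_inv by (apply pow_nonzero; lra). reflexivity. }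
  eapply Cder_eq. apply Cder_scal. apply Cder_RtoC.
  apply (is_derive_pow (fun x => / x) j x (- / x ^ 2)). auto_derive. lra. field. lra.
  assert (HxC : RtoC x <> RtoC 0) by (apply RtoC_neq_0; lra).
  destruct j as [|j].
  - simpl INR. rewrite !Rmult_0_l. unfold Cdiv. ring.
  - change (Nat.pred (S j)) with j. generalize (INR (S j)); intros s.
    assert (Hp : RtoC (x ^ j) <> RtoC 0) by (apply RtoC_neq_0, pow_nonzero; lra).
    replace (s * - / x ^ 2 * (/ x) ^ j) with (- (s * / (x * (x * x ^ j)))).
    assert (Hq : 0 < x ^ j) by (apply pow_lt; lra).
    assert (Hq2 : 0 < x * (x * x ^ j)) by (repeat apply Rmult_lt_0_compat; auto).
    unfold Rdiv. rewrite RtoC_opp, RtoC_mult, RtoC_inv, !RtoC_mult by lra. simpl pow. rewrite !RtoC_mult. field. auto.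
    rewrite pow_inv. field. split. apply pow_nonzero; lra. lra.
Qed.

Lemma Cder_sum_n (f f' : nat -> R -> C) (x : R) (N : nat) :
  (forall j, Cder (f j) x (f' j x)) -> Cder (fun x => sum_n (fun j => f j x) N) x (sum_n (fun j => f' j x) N).
Proof.
  intros H. induction N as [|N IH].
  - rewrite sum_O. destruct (H 0%nat) as [H1 H2].
    split; [apply (is_derive_ext (fun t => fst (f 0%nat t))) | apply (is_derive_ext (fun t => snd (f 0%nat t)))]; auto;
    intros t; now rewrite sum_O.
  - rewrite sum_Sn. destruct (Cder_plus _ _ _ _ _ IH (H (S N))) as [H1 H2].
    split; [apply (is_derive_ext (fun x => fst (sum_n (fun j => f j x) N + f (S N) x)%C)) |
      apply (is_derive_ext (fun x => snd (sum_n (fun j => f j x) N + f (S N) x)%C))]; auto;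
    intros t; now rewrite sum_Sn.
Qed.

Lemma hP_der (N : nat) (x : R) : 0 < x -> Cder (hP N) x (hP1 N x).
Proof.
  intros Hx. apply (Cder_sum_n (fun j x => Cnu 0 j / RtoC (x ^ j))%C (fun j x => - (RtoC (INR j) * Cnu 0 j / RtoC (x ^ S j)))%C).
  intros j. now apply Cder_div_pow.
Qed.

Lemma hP1_der (N : nat) (x : R) : 0 < x -> Cder (hP1 N) x (hP2 N x).
Proof.
  intros Hx. apply (Cder_sum_n (fun j x => - (RtoC (INR j) * Cnu 0 j / RtoC (x ^ S j)))%C
    (fun j x => RtoC (INR j * (INR j + 1)) * Cnu 0 j / RtoC (x ^ S (S j)))%C).
  intros j.
  apply (Cder_ext_gt 0 (fun x => (- (RtoC (INR j) * Cnu 0 j)) / RtoC (x ^ S j))%C); auto.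
  { intros t Ht. unfold Cdiv. ring. }
  eapply Cder_eq. now apply Cder_div_pow. rewrite S_INR, RtoC_mult. unfold Cdiv. ring.
Qed.

(** By [Cnu_S], adding the term of index N + 1 cancels the old remainder and creates one of the next
    order. The truncated series thus solves the oscillatory equation up to a single power. *)
Lemma hP_residual (N : nat) (x : R) : 0 < x ->
  (hP2 N x + RtoC 2 * Ci * hP1 N x + RtoC (/ (4 * x ^ 2)) * hP N x)%C =
  (RtoC ((INR N + 1 / 2) ^ 2) * Cnu 0 N / RtoC (x ^ S (S N)))%C.
Proof.
  intros Hx. assert (HxC : RtoC x <> RtoC 0) by (apply RtoC_neq_0; lra).
  assert (H4 : RtoC 4 <> RtoC 0) by (apply RtoC_neq_0; lra).
  induction N as [|N IH].
  - unfold hP2, hP1, hP. rewrite !sum_O. simpl INR.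
    replace ((0 + 1 / 2) ^ 2) with (/ 4) by field.
    replace (0 * (0 + 1)) with 0 by ring. simpl pow. rewrite !RtoC_mult, !RtoC_inv by nra. rewrite !RtoC_mult. field. auto.
  - unfold hP2, hP1, hP. rewrite !sum_Sn. fold (hP2 N x) (hP1 N x) (hP N x). change plus with Cplus.
    assert (Hp : RtoC (x ^ N) <> RtoC 0) by (apply RtoC_neq_0, pow_nonzero; lra).
    transitivity ((hP2 N x + RtoC 2 * Ci * hP1 N x + RtoC (/ (4 * x ^ 2)) * hP N x) +
      (RtoC (INR (S N) * (INR (S N) + 1)) * Cnu 0 (S N) / RtoC (x ^ S (S (S N)))
       - (RtoC 2 * Ci * RtoC (INR (S N)) * Cnu 0 (S N)) / RtoC (x ^ S (S N))
       + RtoC (/ (4 * x ^ 2)) * (Cnu 0 (S N) / RtoC (x ^ S N))))%C.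
    { unfold Cdiv. ring. }
    rewrite IH, Cnu_S. simpl (INR 0). rewrite S_INR.
    replace ((1 / 2 - 0 + INR N) * (0 + INR N + 1 / 2)) with ((INR N + 1 / 2) ^ 2) by ring.
    replace ((INR N + 1 + 1 / 2) ^ 2) with ((INR N + 1) * (INR N + 1 + 1) + / 4) by field.
    generalize ((INR N + 1) * (INR N + 1 + 1)) ((INR N + 1 / 2) ^ 2). intros u v.
    simpl pow. rewrite RtoC_plus, !RtoC_inv by nra. rewrite !RtoC_mult. asC. field. auto.
Qed.

Lemma Clim0_div_pow (c : C) (j : nat) : Clim0 (fun x => c / RtoC (x ^ S j))%C.
Proof.
  apply Clim0_le with (fun x => Cmod c * / x) 1.
  - intros x Hx. unfold Cdiv. rewrite <- RtoC_inv by (apply pow_nonzero; lra). rewrite Cmod_mult, Cmod_R.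
    assert (1 <= x ^ j) by (apply pow_R1_Rle; lra).
    apply Rmult_le_compat_l. apply Cmod_ge_0. rewrite Rabs_pos_eq. simpl. apply Rinv_le_contravar; nra.
    apply Rlt_le, Rinv_0_lt_compat, pow_lt. lra.
  - replace (Finite 0) with (Rbar_mult (Cmod c) 0) by (simpl; f_equal; ring). apply is_lim_scal_l.
    replace (Finite 0) with (Rbar_inv p_infty) by reflexivity. apply is_lim_inv. apply is_lim_id. easy.
Qed.

Lemma hP_lim (N : nat) : Clim0 (fun x => hP N x - RtoC 1)%C.
Proof.
  induction N as [|N IH].
  - apply Clim0_ext with (fun x => RtoC 0) 0.
    intros x _. unfold hP. rewrite sum_O, Cnu_0. simpl. field.
    apply Clim0_le with (fun _ => 0) 0. intros. rewrite Cmod_0. lra. apply is_lim_const.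
  - apply Clim0_ext with (fun x => (hP N x - RtoC 1) + Cnu 0 (S N) / RtoC (x ^ S N))%C 0.
    intros x _. unfold hP. rewrite sum_Sn. change plus with Cplus. ring.
    apply Clim0_plus. exact IH. apply Clim0_div_pow.
Qed.

Lemma hP1_lim (N : nat) : Clim0 (hP1 N).
Proof.
  induction N as [|N IH].
  - apply Clim0_ext with (fun x => (- (RtoC (INR 0) * Cnu 0 0)) / RtoC (x ^ 1))%C 0.
    intros x _. unfold hP1. rewrite sum_O. unfold Cdiv. ring.
    apply Clim0_div_pow.
  - apply Clim0_ext with (fun x => hP1 N x + (- (RtoC (INR (S N)) * Cnu 0 (S N))) / RtoC (x ^ S (S N)))%C 0.
    intros x _. unfold hP1. rewrite sum_Sn. change plus with Cplus. unfold Cdiv. ring.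
    apply Clim0_plus. exact IH. apply Clim0_div_pow.
Qed.

(** The bare limits give p = 0; [bootstrap_step] then raises p by one at a time, for the error and
    its derivative together, while the residual of order N + 2 stays small enough. *)
Lemma hnorm_trunc (N : nat) : exists K X, 1 <= X /\ forall x, X < x ->
  Cmod (hnorm 0 x - hP N x)%C <= K / x ^ N /\ Cmod (hder x - hP1 N x)%C <= K / x ^ N.
Proof.
  set (d := fun x => (hnorm 0 x - hP N x)%C). set (k := fun x => (hder x - hP1 N x)%C).
  set (r := fun x => (RtoC ((INR N + 1 / 2) ^ 2) * Cnu 0 N / RtoC (x ^ S (S N)))%C).
  assert (Ld : Clim0 d).
  { apply Clim0_ext with (fun x => (hnorm 0 x - RtoC 1) + RtoC (-1) * (hP N x - RtoC 1))%C 0.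
    intros x _. unfold d. replace (RtoC (-1)) with (- RtoC 1)%C by (rewrite <- RtoC_opp; reflexivity). ring.
    apply Clim0_plus. apply hnorm_lead. apply Clim0_scal, hP_lim. }
  assert (Lk : Clim0 k).
  { apply Clim0_ext with (fun x => hder x + RtoC (-1) * hP1 N x)%C 0.
    intros x _. unfold k. replace (RtoC (-1)) with (- RtoC 1)%C by (rewrite <- RtoC_opp; reflexivity). ring.
    apply Clim0_plus. apply hder_lim. apply Clim0_scal, hP1_lim. }
  assert (H0 : exists X, 1 <= X /\ forall x, X < x -> Cmod (d x) <= 1 /\ Cmod (k x) <= 1).
  { apply is_lim_spec in Ld. apply is_lim_spec in Lk.
    destruct (Ld (mkposreal 1 Rlt_0_1)) as [M1 H1]. destruct (Lk (mkposreal 1 Rlt_0_1)) as [M2 H2]. simpl in H1, H2.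
    exists (Rmax 1 (Rmax M1 M2)). assert (A1 := Rmax_l 1 (Rmax M1 M2)). assert (A2 := Rmax_r 1 (Rmax M1 M2)).
    assert (A3 := Rmax_l M1 M2). assert (A4 := Rmax_r M1 M2). split; auto. intros x Hx.
    specialize (H1 x ltac:(lra)). specialize (H2 x ltac:(lra)). rewrite Rminus_0_r in H1, H2.
    apply Rabs_def2 in H1. apply Rabs_def2 in H2. lra. }
  destruct H0 as [X [HX H0]].
  assert (G : forall p, (p <= N)%nat -> exists K, forall x, X < x -> Cmod (d x) <= K / x ^ p /\ Cmod (k x) <= K / x ^ p).
  { induction p as [|p IH]; intros Hp.
    - exists 1. intros x Hx. simpl. replace (1 / 1) with 1 by field. auto.
    - destruct IH as [K HK]. lia.
      apply (bootstrap_step d k r K (Cmod (RtoC ((INR N + 1 / 2) ^ 2) * Cnu 0 N)) X p); auto.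
      + intros x Hx. apply Cder_minus. apply hnorm_der_0; lra. apply hP_der; lra.
      + intros x Hx. eapply Cder_eq. apply Cder_minus. apply hder_der; lra. apply hP1_der; lra.
        unfold r, d, k. rewrite <- hP_residual by lra. ring.
      + intros x Hx. now apply HK.
      + intros x Hx. unfold r, Cdiv. rewrite <- RtoC_inv by (apply pow_nonzero; lra).
        rewrite Cmod_mult, Cmod_R. apply Rmult_le_compat_l. apply Cmod_ge_0.
        rewrite Rabs_pos_eq. apply Rinv_le_contravar. apply pow_lt; lra. apply Rle_pow. lra. lia.
        apply Rlt_le, Rinv_0_lt_compat, pow_lt. lra. }
  destruct (G N ltac:(lia)) as [K HK]. exists K, X. auto.
Qed.

Lemma asym_hnorm_0 : asym (hnorm 0) (Cnu 0).
Proof.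
  intros N. apply asymN_of_trunc. destruct (hnorm_trunc N) as [K [X [HX H]]].
  exists K, (X + 1). intros x Hx. destruct (H x ltac:(lra)) as [H1 _]. fold (hP N x).
  assert (Hp : 0 < x ^ N) by (apply pow_lt; lra).
  apply Rmult_le_compat_l with (r := x ^ N) in H1; [|lra].
  replace (x ^ N * (K / x ^ N)) with K in H1 by (field; lra). exact H1.
Qed.

(** H_1 has the extra phase exp(-i pi/2) = -i relative to the common outgoing factor; it is moved
    into the coefficients. *)
Definition h1coef (j : nat) : C := (- Ci * Cnu 1 j)%C.

(** The ratio C_{1j}/C_{0j} = -(2j+1)/(2j-1), multiplied out. It transfers the expansion of H_0 to
    H_1, and its limit -1 drives the uniqueness argument. *)
Lemma Cnu_1_0 (j : nat) : (RtoC (2 * INR j - 1) * Cnu 1 j = - (RtoC (2 * INR j + 1) * Cnu 0 j))%C.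
Proof.
  induction j as [|j IH].
  - rewrite !Cnu_0. simpl INR. replace (2 * 0 - 1) with (- (1)) by ring. replace (2 * 0 + 1) with 1 by ring.
    rewrite RtoC_opp. ring.
  - assert (Hj : 0 < INR (S j)) by (apply lt_0_INR; lia).
    assert (H0 : (RtoC 2 * Ci * RtoC (INR (S j)))%C <> RtoC 0).
    { apply Cmult_neq_0. apply Ci2_neq_0. apply RtoC_neq_0. lra. }
    assert (E0 := Cnu_S 0 j). assert (E1 := Cnu_S 1 j). simpl (INR 0) in E0. simpl (INR 1) in E1.
    set (m := (RtoC 2 * Ci * RtoC (INR (S j)))%C) in *.
    assert (E : (m * (RtoC (2 * INR (S j) - 1) * Cnu 1 (S j)) = m * - (RtoC (2 * INR (S j) + 1) * Cnu 0 (S j)))%C).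
    { transitivity (RtoC (2 * INR (S j) - 1) * (m * Cnu 1 (S j)))%C. ring.
      transitivity (- (RtoC (2 * INR (S j) + 1) * (m * Cnu 0 (S j))))%C. 2: ring.
      rewrite E0, E1.
      replace ((1 / 2 - 1 + INR j) * (1 + INR j + 1 / 2)) with (/ 2 * (INR j + 3 / 2) * (2 * INR j - 1)) by field.
      rewrite (RtoC_mult _ (2 * INR j - 1)).
      transitivity (RtoC (2 * INR (S j) - 1) * RtoC (/ 2 * (INR j + 3 / 2)) * (RtoC (2 * INR j - 1) * Cnu 1 j))%C. ring.
      rewrite IH.
      transitivity (- (RtoC ((2 * INR (S j) - 1) * (/ 2 * (INR j + 3 / 2)) * (2 * INR j + 1)) * Cnu 0 j))%C.
      rewrite !RtoC_mult; ring.
      transitivity (- (RtoC ((2 * INR (S j) + 1) * ((1 / 2 - 0 + INR j) * (0 + INR j + 1 / 2))) * Cnu 0 j))%C.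
      2: rewrite !RtoC_mult; ring.
      do 3 f_equal. rewrite S_INR. field. }
    transitivity (/ m * (m * (RtoC (2 * INR (S j) - 1) * Cnu 1 (S j))))%C. field; auto.
    rewrite E. field; auto.
Qed.

Lemma odd_neq_0 (j : nat) : 2 * INR j - 1 <> 0.
Proof.
  destruct j. simpl. lra. rewrite S_INR. assert (H := pos_INR j). lra.
Qed.

(** The coefficient form of [hnorm 1] = (1/(2x) - i) [hnorm 0] - [hder]. *)
Lemma h1coef_S (j : nat) : h1coef (S j) = (- Ci * Cnu 0 (S j) + RtoC (INR j + 1 / 2) * Cnu 0 j)%C.
Proof.
  unfold h1coef.
  assert (E := Cnu_1_0 (S j)). assert (E0 := Cnu_S 0 j). simpl (INR 0) in E0.
  assert (Hn := odd_neq_0 (S j)).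
  assert (Hm : RtoC (2 * INR (S j) - 1) <> RtoC 0) by now apply RtoC_neq_0.
  assert (Hmul : forall u v : C, (RtoC (2 * INR (S j) - 1) * u = RtoC (2 * INR (S j) - 1) * v)%C -> u = v).
  { intros u v H. transitivity (/ RtoC (2 * INR (S j) - 1) * (RtoC (2 * INR (S j) - 1) * u))%C. field; auto.
    rewrite H. field; auto. }
  apply Hmul.
  transitivity (- Ci * (RtoC (2 * INR (S j) - 1) * Cnu 1 (S j)))%C. ring. rewrite E.
  transitivity (- Ci * RtoC (2 * INR (S j) - 1) * Cnu 0 (S j) + RtoC 2 * (RtoC ((1 / 2 - 0 + INR j) * (0 + INR j + 1 / 2)) * Cnu 0 j))%C.
  - rewrite <- E0. rewrite RtoC_minus, RtoC_plus, RtoC_mult. ring.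
  - rewrite S_INR. replace (2 * (INR j + 1) - 1) with (2 * (INR j + 1 / 2)) by field.
    replace ((1 / 2 - 0 + INR j) * (0 + INR j + 1 / 2)) with ((INR j + 1 / 2) * (INR j + 1 / 2)) by ring.
    rewrite !RtoC_mult. ring.
Qed.

Lemma h1_trunc (N : nat) (x : R) : 0 < x ->
  ((RtoC (/ (2 * x)) - Ci) * hP N x - hP1 N x)%C =
  (sum_n (fun j => h1coef j / RtoC (x ^ j)) N + RtoC (INR N + 1 / 2) * Cnu 0 N / RtoC (x ^ S N))%C.
Proof.
  intros Hx. assert (HxC : RtoC x <> RtoC 0) by (apply RtoC_neq_0; lra).
  assert (H2 : RtoC 2 <> RtoC 0) by (apply RtoC_neq_0; lra).
  induction N as [|N IH].
  - unfold hP, hP1. rewrite !sum_O. unfold h1coef. rewrite !Cnu_0. simpl INR. simpl pow.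
    replace (0 + 1 / 2) with (/ 2) by field. rewrite !RtoC_inv, !RtoC_mult by lra. field. auto.
  - unfold hP1, hP. rewrite !sum_Sn. fold (hP1 N x) (hP N x). change plus with Cplus.
    assert (Hp : RtoC (x ^ N) <> RtoC 0) by (apply RtoC_neq_0, pow_nonzero; lra).
    rewrite h1coef_S.
    transitivity (((RtoC (/ (2 * x)) - Ci) * hP N x - hP1 N x) +
      ((RtoC (/ (2 * x)) - Ci) * (Cnu 0 (S N) / RtoC (x ^ S N)) + RtoC (INR (S N)) * Cnu 0 (S N) / RtoC (x ^ S (S N))))%C.
    { ring. }
    rewrite IH. set (s := sum_n _ N). asC. replace (1 / 2) with (/ 2) by field. rewrite !RtoC_plus, !RtoC_inv, !RtoC_mult by lra.
    simpl pow. rewrite !RtoC_mult. field. auto.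
Qed.

Lemma asym_hnorm_1 : asym (hnorm 1) h1coef.
Proof.
  intros N. apply asymN_of_trunc. destruct (hnorm_trunc N) as [K [X [HX H]]].
  set (c := (RtoC (INR N + 1 / 2) * Cnu 0 N)%C).
  exists (3 * K + Cmod c), (X + 1). intros x Hx. destruct (H x ltac:(lra)) as [H1 H2].
  assert (Hp : 0 < x ^ N) by (apply pow_lt; lra).
  assert (E : (hnorm 1 x - sum_n (fun j => h1coef j / RtoC (x ^ j)) N)%C =
    ((RtoC (/ (2 * x)) - Ci) * (hnorm 0 x - hP N x) + (- (hder x - hP1 N x) + c / RtoC (x ^ S N)))%C).
  { assert (T := h1_trunc N x ltac:(lra)). fold c in T.
    transitivity ((RtoC (/ (2 * x)) - Ci) * hnorm 0 x - hder x -
       ((RtoC (/ (2 * x)) - Ci) * hP N x - hP1 N x) + c / RtoC (x ^ S N))%C. 2: ring.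
    rewrite T. unfold hder. ring. }
  rewrite E.
  assert (B : Cmod ((RtoC (/ (2 * x)) - Ci) * (hnorm 0 x - hP N x) + (- (hder x - hP1 N x) + c / RtoC (x ^ S N)))%C
     <= 2 * (K / x ^ N) + (K / x ^ N + Cmod c * / x ^ N)).
  { apply Rle_trans with (1 := Cmod_triangle _ _). apply Rplus_le_compat.
    - rewrite Cmod_mult. apply Rmult_le_compat; try apply Cmod_ge_0; auto.
      unfold Cminus. apply Rle_trans with (1 := Cmod_triangle _ _).
      rewrite Cmod_opp, Cmod_Ci, Cmod_R. assert (0 < / (2 * x)) by (apply Rinv_0_lt_compat; lra).
      rewrite Rabs_pos_eq by lra. assert (/ (2 * x) <= / 1) by (apply Rinv_le_contravar; lra). lra.
    - apply Rle_trans with (1 := Cmod_triangle _ _). rewrite Cmod_opp. apply Rplus_le_compat; auto.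
      unfold Cdiv. rewrite <- RtoC_inv by (apply pow_nonzero; lra). rewrite Cmod_mult, Cmod_R.
      apply Rmult_le_compat_l. apply Cmod_ge_0. simpl.
      rewrite Rabs_pos_eq. apply Rinv_le_contravar; nra. apply Rlt_le, Rinv_0_lt_compat. nra. }
  apply Rmult_le_compat_l with (r := x ^ N) in B; [|lra].
  apply Rle_trans with (1 := B). apply Req_le. field. lra.
Qed.

(** * Uniqueness of the coefficients *)

Lemma Cnu0_abs_S (n : nat) : 2 * INR (S n) * Cmod (Cnu 0 (S n)) = (INR n + 1 / 2) ^ 2 * Cmod (Cnu 0 n).
Proof.
  assert (E := f_equal Cmod (Cnu_S 0 n)). simpl (INR 0) in E.
  rewrite !Cmod_mult, Cmod_Ci, !Cmod_R in E.
  rewrite (Rabs_pos_eq 2), (Rabs_pos_eq (INR (S n))) in E by (try apply pos_INR; lra).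
  rewrite Rabs_pos_eq in E. 2:{ assert (H := pos_INR n). nra. }
  rewrite Rmult_1_r in E. rewrite E. ring.
Qed.

Lemma Cnu0_abs_pos (n : nat) : 0 < Cmod (Cnu 0 n).
Proof.
  induction n as [|n IH].
  - rewrite Cnu_0, Cmod_R, Rabs_pos_eq; lra.
  - assert (E := Cnu0_abs_S n). assert (H := pos_INR n).
    assert (H1 : 0 < INR (S n)) by (apply lt_0_INR; lia).
    assert (0 < (INR n + 1 / 2) ^ 2 * Cmod (Cnu 0 n)).
    { apply Rmult_lt_0_compat; auto. apply pow_lt. lra. }
    rewrite <- E in H0. nra.
Qed.

(** The exact ratio is 2(n+1)/(n+1/2)^2, and (n+1)^2 <= 4 (n+1/2)^2. *)
Lemma Cnu0_abs_ratio (n : nat) : Cmod (Cnu 0 n) <= 8 / INR (S n) * Cmod (Cnu 0 (S n)).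
Proof.
  assert (E := Cnu0_abs_S n). assert (Hp := Cnu0_abs_pos n). assert (H := pos_INR n).
  assert (H1 : 0 < INR (S n)) by (apply lt_0_INR; lia). rewrite S_INR in *.
  apply Rmult_le_reg_l with ((INR n + 1 / 2) ^ 2). apply pow_lt; lra.
  rewrite <- E.
  replace ((INR n + 1 / 2) ^ 2 * (8 / (INR n + 1) * Cmod (Cnu 0 (S n)))) with
    (2 * (INR n + 1) * Cmod (Cnu 0 (S n)) * (4 * (INR n + 1 / 2) ^ 2 / (INR n + 1) ^ 2)) by (field; lra).
  rewrite <- (Rmult_1_r (2 * (INR n + 1) * Cmod (Cnu 0 (S n)))) at 1.
  apply Rmult_le_compat_l. assert (H2 := Cmod_ge_0 (Cnu 0 (S n))). nra.
  apply Rmult_le_reg_r with ((INR n + 1) ^ 2). apply pow_lt; lra.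
  unfold Rdiv. rewrite Rmult_assoc, Rinv_l by (apply pow_nonzero; lra). simpl. nra.
Qed.

Lemma Cnu1_abs_le (n : nat) : Cmod (Cnu 1 n) <= 3 * Cmod (Cnu 0 n).
Proof.
  assert (E := f_equal Cmod (Cnu_1_0 n)). rewrite Cmod_opp, !Cmod_mult, !Cmod_R in E.
  assert (Hp := Cnu0_abs_pos n).
  destruct n as [|n]. rewrite !Cnu_0, Cmod_R, Rabs_pos_eq; lra.
  rewrite S_INR in E. assert (H := pos_INR n). rewrite !Rabs_pos_eq in E by lra.
  apply Rmult_le_reg_l with (2 * (INR n + 1) - 1). lra. rewrite E. nra.
Qed.

(** Horner form of the sum over j of K^(n-j) |C_{0j}|, the worst case of a convolution with a
    sequence of geometric growth. *)
Fixpoint geomconv (K : R) (n : nat) : R :=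
  match n with O => Cmod (Cnu 0 0) | S k => Cmod (Cnu 0 (S k)) + K * geomconv K k end.

Lemma conv_bound (K L : R) (e : nat -> C) : 0 <= K -> (forall j, Cmod (e j) <= L * Cmod (Cnu 0 j)) ->
  forall n (a : nat -> C) M, 0 <= M -> (forall j, Cmod (a j) <= M * K ^ j) ->
  Cmod (conv a e n) <= L * M * geomconv K n.
Proof.
  intros HK He. induction n as [|n IH]; intros a M HM Ha.
  - unfold conv. rewrite sum_O. simpl. rewrite Cmod_mult.
    replace (L * M * Cmod (Cnu 0 0)) with (M * (L * Cmod (Cnu 0 0))) by ring.
    apply Rmult_le_compat; try apply Cmod_ge_0. specialize (Ha 0%nat). simpl in Ha. lra. apply He.
  - rewrite conv_S. apply Rle_trans with (1 := Cmod_triangle _ _). rewrite Cmod_mult. simpl geomconv.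
    replace (L * M * (Cmod (Cnu 0 (S n)) + K * geomconv K n)) with
      (M * (L * Cmod (Cnu 0 (S n))) + L * (M * K) * geomconv K n) by ring.
    apply Rplus_le_compat.
    + apply Rmult_le_compat; try apply Cmod_ge_0. specialize (Ha 0%nat). simpl in Ha. lra. apply He.
    + apply IH. now apply Rmult_le_pos. intros j. specialize (Ha (S j)). simpl in Ha. lra.
Qed.

(** Factorial growth beats K^n: once n + 1 >= 16 K, the ratio bound gives K |C_{0n}| <= |C_{0,n+1}|
    / 2. A constant B >= 2 then reproduces itself, as 1 + B/2 <= B. *)
Lemma geomconv_ratio_bound (K : R) : 0 <= K ->
  exists B n0, forall n, (n0 <= n)%nat -> geomconv K n <= B * Cmod (Cnu 0 n).
Proof.
  intros HK. destruct (nfloor_ex (16 * K) ltac:(lra)) as [m Hm].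
  exists (Rmax 2 (geomconv K (S m) / Cmod (Cnu 0 (S m)))), (S m).
  set (B := Rmax _ _). assert (HB := Rmax_l 2 (geomconv K (S m) / Cmod (Cnu 0 (S m)))). fold B in HB.
  assert (G : forall p, geomconv K (S m + p) <= B * Cmod (Cnu 0 (S m + p))).
  { induction p as [|p IH].
    - rewrite Nat.add_0_r. assert (H := Cnu0_abs_pos (S m)).
      assert (HB2 := Rmax_r 2 (geomconv K (S m) / Cmod (Cnu 0 (S m)))). fold B in HB2.
      apply Rmult_le_compat_r with (r := Cmod (Cnu 0 (S m))) in HB2; [|lra].
      replace (geomconv K (S m) / Cmod (Cnu 0 (S m)) * Cmod (Cnu 0 (S m))) with (geomconv K (S m)) in HB2 by (field; lra).
      exact HB2.
    - rewrite Nat.add_succ_r. set (n := (S m + p)%nat) in *. change (geomconv K (S n)) with (Cmod (Cnu 0 (S n)) + K * geomconv K n).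
      assert (Hr := Cnu0_abs_ratio n). assert (Hp := Cnu0_abs_pos (S n)). assert (Hp0 := Cnu0_abs_pos n).
      assert (Hn : 16 * K <= INR (S n)).
      { apply Rle_trans with (INR m + 1). lra. rewrite <- S_INR. apply le_INR. lia. }
      assert (Hn0 : 0 < INR (S n)) by (apply lt_0_INR; lia).
      assert (HKr : K * Cmod (Cnu 0 n) <= / 2 * Cmod (Cnu 0 (S n))).
      { apply Rle_trans with (K * (8 / INR (S n) * Cmod (Cnu 0 (S n)))). apply Rmult_le_compat_l; auto.
        rewrite <- Rmult_assoc. apply Rmult_le_compat_r. lra.
        apply Rmult_le_reg_r with (INR (S n)); auto. replace (K * (8 / INR (S n)) * INR (S n)) with (8 * K) by (field; lra). lra. }
      apply Rle_trans with (Cmod (Cnu 0 (S n)) + B * (K * Cmod (Cnu 0 n))).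
      apply Rplus_le_compat_l. replace (B * (K * Cmod (Cnu 0 n))) with (K * (B * Cmod (Cnu 0 n))) by ring. apply Rmult_le_compat_l; auto.
      assert (B * (K * Cmod (Cnu 0 n)) <= B * (/ 2 * Cmod (Cnu 0 (S n)))) by (apply Rmult_le_compat_l; lra). nra. }
  intros n Hn. replace n with (S m + (n - S m))%nat by lia. apply G.
Qed.

Section FormalUniqueness.
Variables (K M : R) (HK : 0 <= K) (HM : 0 <= M).

(* Order 0 gives a_0 - i b_0 = 0. Since Cnu 0 n grows factorially and Cnu 1 n / Cnu 0 n -> -1, dividing order n by Cnu 0 n gives a_0 + i b_0 = 0 in the limit. *)
Lemma formal_unique_0 (a b : nat -> C) :
  (forall j, Cmod (a j) <= M * K ^ j) -> (forall j, Cmod (b j) <= M * K ^ j) ->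
  (forall n, conv a (Cnu 0) n + conv b h1coef n = RtoC 0)%C ->
  a 0%nat = RtoC 0 /\ b 0%nat = RtoC 0.
Proof.
  intros Ha Hb E.
  assert (E0 : (a 0%nat - Ci * b 0%nat)%C = RtoC 0).
  { assert (H := E 0%nat). unfold conv in H. rewrite !sum_O in H. simpl in H. unfold h1coef in H. rewrite !Cnu_0 in H.
    rewrite <- H. asC. ring. }
  assert (E1 : (a 0%nat + Ci * b 0%nat)%C = RtoC 0).
  { apply Cmod_eq_0. destruct (Rle_lt_or_eq_dec 0 _ (Cmod_ge_0 (a 0%nat + Ci * b 0%nat)%C)) as [Hp|]; auto. exfalso.
    set (q := Cmod (a 0%nat + Ci * b 0%nat)%C) in *.
    destruct (geomconv_ratio_bound K HK) as [B [n0 HB]].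
    (* 32 = (1 + 3) * 8: the weights 1 and 3 of C_{0j} and C_{1j} times the 8 of [Cnu0_abs_ratio].
       The second term pays for replacing C_{1,n+1} by -C_{0,n+1}. *)
    set (D := 32 * Rabs B * M * K + 2 * Cmod (b 0%nat)).
    assert (HD : 0 <= D). { unfold D. assert (H := Rabs_pos B). assert (H1 := Cmod_ge_0 (b 0%nat)).
      assert (0 <= Rabs B * M * K) by (repeat apply Rmult_le_pos; auto). lra. }
    assert (G : forall n, (n0 <= n)%nat -> q <= D / INR (S n)).
    { intros n Hn. specialize (HB n Hn). assert (En := E (S n)). rewrite !conv_S in En.
      assert (Hc := Cnu0_abs_pos (S n)). assert (Hc0 := Cnu0_abs_pos n).
      assert (Hn0 : 1 <= INR (S n)). { rewrite S_INR. assert (H := pos_INR n). lra. }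
      assert (A1 : Cmod (conv (fun j => a (S j)) (Cnu 0) n) <= 1 * (M * K) * geomconv K n).
      { apply conv_bound; auto. intros; lra. now apply Rmult_le_pos. intros j. specialize (Ha (S j)). simpl in Ha. lra. }
      assert (A2 : Cmod (conv (fun j => b (S j)) h1coef n) <= 3 * (M * K) * geomconv K n).
      { apply conv_bound; auto. intros j. unfold h1coef. rewrite Cmod_mult, Cmod_opp, Cmod_Ci, Rmult_1_l. apply Cnu1_abs_le.
        now apply Rmult_le_pos. intros j. specialize (Hb (S j)). simpl in Hb. lra. }
      assert (Hm : RtoC (2 * INR (S n) - 1) <> RtoC 0) by (apply RtoC_neq_0; lra).
      assert (Hd : Cnu 1 (S n) = (- (RtoC ((2 * INR (S n) + 1) / (2 * INR (S n) - 1)) * Cnu 0 (S n)))%C).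
      { unfold Rdiv. rewrite RtoC_mult, RtoC_inv by lra.
        transitivity (/ RtoC (2 * INR (S n) - 1) * (RtoC (2 * INR (S n) - 1) * Cnu 1 (S n)))%C. field; auto.
        rewrite Cnu_1_0. field; auto. }
      assert (Es : ((a 0%nat + Ci * b 0%nat) * Cnu 0 (S n) = - (conv (fun j => a (S j)) (Cnu 0) n + conv (fun j => b (S j)) h1coef n)
         - Ci * b 0%nat * RtoC (2 / (2 * INR (S n) - 1)) * Cnu 0 (S n))%C).
      { unfold h1coef at 1 in En. rewrite Hd in En.
        replace ((2 * INR (S n) + 1) / (2 * INR (S n) - 1)) with (1 + 2 / (2 * INR (S n) - 1)) in En by (field; lra).
        rewrite RtoC_plus in En.
        (* The relation of order n + 1, whose value is 0, is subtracted from the left side; the rest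
           is a ring identity. *)
        match goal with |- ?l = ?r => transitivity (l - RtoC 0)%C end. ring. rewrite <- En. ring. }
      apply (f_equal Cmod) in Es. rewrite Cmod_mult in Es. fold q in Es.
      assert (Bd : q * Cmod (Cnu 0 (S n)) <= D / INR (S n) * Cmod (Cnu 0 (S n))).
      { rewrite Es. unfold Cminus at 1. apply Rle_trans with (1 := Cmod_triangle _ _). rewrite !Cmod_opp.
        apply Rle_trans with ((1 * (M * K) * geomconv K n + 3 * (M * K) * geomconv K n) + Cmod (b 0%nat) * (2 / INR (S n)) * Cmod (Cnu 0 (S n))).
        - apply Rplus_le_compat.
          + apply Rle_trans with (1 := Cmod_triangle _ _). lra.
          + rewrite !Cmod_mult, Cmod_Ci, Cmod_R, Rmult_1_l. apply Rmult_le_compat_r. lra.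
            apply Rmult_le_compat_l. apply Cmod_ge_0. rewrite Rabs_pos_eq.
            apply Rmult_le_compat_l. lra. apply Rinv_le_contravar; lra.
            apply Rdiv_le_0_compat; lra.
        - assert (Hr := Cnu0_abs_ratio n).
          assert (Hg : geomconv K n <= Rabs B * (8 / INR (S n) * Cmod (Cnu 0 (S n)))).
          { apply Rle_trans with (1 := HB). apply Rle_trans with (Rabs B * Cmod (Cnu 0 n)).
            apply Rmult_le_compat_r. lra. apply Rle_abs. apply Rmult_le_compat_l. apply Rabs_pos. exact Hr. }
          assert (H4 : 4 * (M * K) * geomconv K n <= 4 * (M * K) * (Rabs B * (8 / INR (S n) * Cmod (Cnu 0 (S n))))).
          { apply Rmult_le_compat_l; auto. assert (0 <= M * K) by now apply Rmult_le_pos. lra. }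
          unfold D. replace ((32 * Rabs B * M * K + 2 * Cmod (b 0%nat)) / INR (S n) * Cmod (Cnu 0 (S n))) with
            (4 * (M * K) * (Rabs B * (8 / INR (S n) * Cmod (Cnu 0 (S n)))) + Cmod (b 0%nat) * (2 / INR (S n)) * Cmod (Cnu 0 (S n))) by (field; lra).
          lra. }
      apply Rmult_le_reg_r with (2 := Bd). auto. }
    destruct (nfloor_ex (D / q) ltac:(apply Rdiv_le_0_compat; auto)) as [m Hm].
    specialize (G (max n0 m) ltac:(lia)).
    assert (Hlt : D / q < INR (S (max n0 m))).
    { apply Rlt_le_trans with (INR m + 1). lra. rewrite <- S_INR. apply le_INR. lia. }
    assert (Hn0 : 0 < INR (S (max n0 m))) by (apply lt_0_INR; lia).
    set (N := INR (S (max n0 m))) in *.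
    apply Rmult_le_compat_r with (r := N) in G; [|lra]. replace (D / N * N) with D in G by (field; lra).
    apply Rmult_lt_compat_l with (r := q) in Hlt; auto. replace (q * (D / q)) with D in Hlt by (field; lra). lra. }
  assert (Ea : a 0%nat = RtoC 0).
  { transitivity (RtoC (/ 2) * ((a 0%nat - Ci * b 0%nat) + (a 0%nat + Ci * b 0%nat)))%C.
    rewrite RtoC_inv by lra. field. rewrite E0, E1. ring. }
  split; auto. rewrite Ea in E1.
  transitivity (/ Ci * (RtoC 0 + Ci * b 0%nat))%C. field. apply Ci_neq_0. rewrite E1. ring.
Qed.
End FormalUniqueness.

(** Once a_0 = b_0 = 0, the shifted sequences satisfy the same relations, with M replaced by M K. *)
Lemma formal_unique (n : nat) : forall (K M : R) (a b : nat -> C), 0 <= K -> 0 <= M ->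
  (forall j, Cmod (a j) <= M * K ^ j) -> (forall j, Cmod (b j) <= M * K ^ j) ->
  (forall n, conv a (Cnu 0) n + conv b h1coef n = RtoC 0)%C ->
  a n = RtoC 0 /\ b n = RtoC 0.
Proof.
  induction n as [|n IH]; intros K M a b HK HM Ha Hb E.
  - now apply (formal_unique_0 K M).
  - destruct (formal_unique_0 K M HK HM a b Ha Hb E) as [Ea Eb].
    apply (IH K (M * K) (fun j => a (S j)) (fun j => b (S j))); auto.
    + now apply Rmult_le_pos.
    + intros j. specialize (Ha (S j)). simpl in Ha. lra.
    + intros j. specialize (Hb (S j)). simpl in Hb. lra.
    + intros m. specialize (E (S m)). rewrite !conv_S, Ea, Eb in E. rewrite <- E. ring.
Qed.

(** * Completeness of the trigonometric system *)

Section Completeness.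
Variable g : R -> R.
Hypothesis Hg : forall x, continuous g x.
Hypothesis Hc : forall m : nat, is_RInt (fun t => g t * cos (INR m * t)) 0 (2 * PI) 0.
Hypothesis Hs : forall m : nat, is_RInt (fun t => g t * sin (INR m * t)) 0 (2 * PI) 0.

(** cos^2((t - x0)/2). Its powers are the unnormalized de la Vallee Poussin kernels, trigonometric
    polynomials to which g is orthogonal. *)
Definition kern (x0 t : R) : R := (1 + cos (t - x0)) / 2.

Lemma is_RInt_eq (f h : R -> R) (a b l1 l2 : R) :
  is_RInt f a b l1 -> (forall t, f t = h t) -> l1 = l2 -> is_RInt h a b l2.
Proof. intros H E <-. apply is_RInt_ext with f; auto. Qed.

Lemma is_RInt_comb (f h : R -> R) (a b c d : R) :
  is_RInt f a b 0 -> is_RInt h a b 0 -> is_RInt (fun t => c * f t + d * h t) a b 0.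
Proof.
  intros H1 H2.
  assert (H := is_RInt_plus _ _ _ _ _ _ (is_RInt_scal _ _ _ c _ H1) (is_RInt_scal _ _ _ d _ H2)).
  revert H. unfold plus, scal; simpl; unfold mult; simpl. now rewrite !Rmult_0_r, Rplus_0_r.
Qed.

(** Multiplication by [kern] shifts the frequency by one in both directions, so the induction runs
    over integer frequencies, negative ones included. *)
Lemma kern_moments (x0 : R) (n : nat) : forall z : Z,
  is_RInt (fun t => g t * kern x0 t ^ n * cos (IZR z * t)) 0 (2 * PI) 0 /\
  is_RInt (fun t => g t * kern x0 t ^ n * sin (IZR z * t)) 0 (2 * PI) 0.
Proof.
  induction n as [|n IH]; intros z.
  - assert (Hz : z = Z.of_nat (Z.abs_nat z) \/ z = (- Z.of_nat (Z.abs_nat z))%Z) by lia.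
    destruct Hz as [-> | ->]; [|rewrite opp_IZR]; rewrite <- INR_IZR_INZ; set (m := Z.abs_nat z); split.
    + apply (is_RInt_eq _ _ _ _ _ _ (Hc m)); auto. intros t. simpl. ring.
    + apply (is_RInt_eq _ _ _ _ _ _ (Hs m)); auto. intros t. simpl. ring.
    + apply (is_RInt_eq _ _ _ _ _ _ (Hc m)); auto. intros t. rewrite Ropp_mult_distr_l_reverse, cos_neg. simpl. ring.
    + apply (is_RInt_eq _ _ _ _ _ _ (is_RInt_comb _ _ _ _ (-1) 0 (Hs m) (Hs m))); auto.
      intros t. rewrite Ropp_mult_distr_l_reverse, sin_neg. simpl. ring.
  - assert (Ep : forall t, cos (t - x0) = cos t * cos x0 + sin t * sin x0) by (intros; apply cos_minus).
    destruct (IH z) as [C0 S0]. destruct (IH (z + 1)%Z) as [C1 S1]. destruct (IH (z - 1)%Z) as [C2 S2].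
    split.
    + apply (is_RInt_eq _ _ _ _ _ _ (is_RInt_comb _ _ _ _ (/ 2) 1 C0
        (is_RInt_comb _ _ _ _ (cos x0 / 4) 1 (is_RInt_comb _ _ _ _ 1 1 C1 C2)
           (is_RInt_comb _ _ _ _ (sin x0 / 4) (- (sin x0 / 4)) S1 S2)))); auto.
      intros t. cbv beta. unfold kern. simpl pow. rewrite Ep, plus_IZR, minus_IZR.
      replace ((IZR z + 1) * t) with (IZR z * t + t) by ring. replace ((IZR z - 1) * t) with (IZR z * t - t) by ring.
      rewrite cos_plus, cos_minus, sin_plus, sin_minus. field.
    + apply (is_RInt_eq _ _ _ _ _ _ (is_RInt_comb _ _ _ _ (/ 2) 1 S0
        (is_RInt_comb _ _ _ _ (cos x0 / 4) 1 (is_RInt_comb _ _ _ _ 1 1 S1 S2)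
           (is_RInt_comb _ _ _ _ (sin x0 / 4) (- (sin x0 / 4)) C2 C1)))); auto.
      intros t. cbv beta. unfold kern. simpl pow. rewrite Ep, plus_IZR, minus_IZR.
      replace ((IZR z + 1) * t) with (IZR z * t + t) by ring. replace ((IZR z - 1) * t) with (IZR z * t - t) by ring.
      rewrite cos_plus, cos_minus, sin_plus, sin_minus. field.
Qed.

Lemma kern_integral (x0 : R) (n : nat) : is_RInt (fun t => g t * kern x0 t ^ n) 0 (2 * PI) 0.
Proof.
  apply (is_RInt_eq _ _ _ _ _ _ (proj1 (kern_moments x0 n 0))); auto.
  intros t. rewrite Rmult_0_l, cos_0. ring.
Qed.

Lemma kern_bounds (x0 t : R) : 0 <= kern x0 t <= 1.
Proof. unfold kern. assert (H := COS_bound (t - x0)). lra. Qed.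

Lemma ex_RInt_kern (x0 : R) (n : nat) (a b : R) : ex_RInt (fun t => g t * kern x0 t ^ n) a b.
Proof.
  apply (@ex_RInt_continuous R_CompleteNormedModule). intros z _.
  apply (continuous_mult g). apply Hg.
  apply (ex_derive_continuous (fun t => kern x0 t ^ n)). unfold kern. auto_derive. auto.
Qed.

Lemma continuous_bounded (a b : R) : a <= b -> exists B, 0 <= B /\ forall t, a <= t <= b -> Rabs (g t) <= B.
Proof.
  intros Hab. destruct (continuity_ab_maj (fun t => Rabs (g t)) a b Hab) as [c [Hc1 Hc2]].
  - intros t _. apply continuity_pt_filterlim. apply (continuous_comp g Rabs). apply Hg. apply continuous_Rabs.
  - exists (Rabs (g c)). split. apply Rabs_pos. exact Hc1.
Qed.

Lemma cos_le_away (d u : R) : 0 <= d <= PI -> d <= Rabs u <= 2 * PI - d -> cos u <= cos d.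
Proof.
  intros Hd Hu. replace (cos u) with (cos (Rabs u)).
  2:{ unfold Rabs. destruct (Rcase_abs u). apply cos_neg. reflexivity. }
  set (v := Rabs u) in *. destruct (Rle_dec v PI).
  - apply cos_decr_1; lra.
  - replace (cos v) with (cos (2 * PI - v)).
    apply cos_decr_1; lra.
    rewrite cos_minus, cos_2PI, sin_2PI. ring.
Qed.

(* The powers of kern x0 concentrate at x0, so g x0 > 0 would make a vanishing moment positive. *)
Lemma fourier_nonpos (x0 : R) : 0 < x0 < 2 * PI -> g x0 <= 0.
Proof.
  intros Hx0. destruct (Rle_dec (g x0) 0) as [|Hn]; auto. exfalso.
  assert (HP := PI_RGT_0). assert (HP2 := PI2_3_2).
  destruct (proj1 (filterlim_locally _ _) (Hg x0) (mkposreal (g x0 / 2) ltac:(lra))) as [d0 Hd0].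
  (* The radius keeps [x0 - d, x0 + d] inside the integration interval, g above g(x0)/2 on it, and
     cos d positive. *)
  set (d := Rmin (Rmin 1 (d0 / 2)) (Rmin x0 (2 * PI - x0))).
  assert (D1 := Rmin_l (Rmin 1 (d0 / 2)) (Rmin x0 (2 * PI - x0))).
  assert (D2 := Rmin_r (Rmin 1 (d0 / 2)) (Rmin x0 (2 * PI - x0))). fold d in D1, D2.
  assert (D3 := Rmin_l 1 (d0 / 2)). assert (D4 := Rmin_r 1 (d0 / 2)).
  assert (D5 := Rmin_l x0 (2 * PI - x0)). assert (D6 := Rmin_r x0 (2 * PI - x0)).
  assert (Hdp : 0 < d). { unfold d. assert (H := cond_pos d0). repeat apply Rmin_pos; lra. }
  set (eta := g x0 / 2).
  assert (Hin : forall t, Rabs (t - x0) <= d -> eta <= g t).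
  { intros t Ht. assert (B : ball x0 d0 t).
    { unfold ball; simpl. unfold AbsRing_ball, abs, minus, plus, opp; simpl. assert (H := cond_pos d0). unfold Rminus in Ht. lra. }
    specialize (Hd0 t B). unfold ball in Hd0; simpl in Hd0. unfold AbsRing_ball, abs, minus, plus, opp in Hd0; simpl in Hd0.
    apply Rabs_def2 in Hd0. unfold eta. lra. }
  destruct (continuous_bounded 0 (2 * PI) ltac:(lra)) as [B [HB HBt]].
  (* [k1] is the least value of the kernel within d/2 of x0, [k2] its largest value at distance d or
     more; k2 < k1 decides the comparison of powers. *)
  set (k1 := (1 + cos (d / 2)) / 2). set (k2 := (1 + cos d) / 2).
  assert (Hk2 : 0 < k2). { unfold k2. assert (0 < cos d) by (apply cos_gt_0; lra). lra. }
  assert (Hk : k2 < k1). { unfold k1, k2. assert (cos d < cos (d / 2)) by (apply cos_decreasing_1; lra). lra. }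
  assert (Hlow : forall n t, 0 <= t <= 2 * PI -> - (B * k2 ^ n) <= g t * kern x0 t ^ n).
  { intros n t Ht. assert (Hkp : 0 <= kern x0 t ^ n) by (apply pow_le, kern_bounds).
    assert (HBk : 0 <= B * k2 ^ n) by (apply Rmult_le_pos; auto; apply pow_le; lra).
    destruct (Rle_dec (Rabs (t - x0)) d) as [Hi|Ho].
    - assert (0 <= g t * kern x0 t ^ n). { apply Rmult_le_pos; auto. specialize (Hin t Hi). unfold eta in Hin. lra. } lra.
    - assert (Hkk : kern x0 t ^ n <= k2 ^ n).
      { apply pow_incr. split. apply kern_bounds. unfold kern, k2.
        assert (cos (t - x0) <= cos d). { apply cos_le_away. lra. split. lra. apply Rabs_le. lra. } lra. }
      assert (Hb := HBt t Ht). apply Rabs_le_between in Hb.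
      apply Rle_trans with (- B * kern x0 t ^ n).
      assert (B * kern x0 t ^ n <= B * k2 ^ n) by (apply Rmult_le_compat_l; auto). lra.
      apply Rmult_le_compat_r; auto. lra. }
  assert (Hmid : forall n t, x0 - d / 2 <= t <= x0 + d / 2 -> eta * k1 ^ n <= g t * kern x0 t ^ n).
  { intros n t Ht. assert (Habs : Rabs (t - x0) <= d / 2) by (apply Rabs_le; lra).
    apply Rmult_le_compat. unfold eta; lra. apply pow_le; lra. apply Hin; lra.
    apply pow_incr. split. lra. unfold kern, k1.
    assert (cos (d / 2) <= cos (t - x0)).
    { replace (cos (t - x0)) with (cos (Rabs (t - x0))).
      2:{ unfold Rabs. destruct (Rcase_abs (t - x0)). apply cos_neg. reflexivity. }
      apply cos_decr_1; try lra. apply Rabs_pos. } lra. }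
  assert (Hconst : forall c a b, is_RInt (fun _ : R => c) a b ((b - a) * c)).
  { intros c a b. apply (is_RInt_const (V := R_NormedModule)). }
  assert (G : forall n, d * eta * k1 ^ n <= 4 * PI * B * k2 ^ n).
  { intros n. set (F := fun t => g t * kern x0 t ^ n).
    assert (I1 := RInt_correct (V := R_CompleteNormedModule) F 0 (x0 - d / 2) (ex_RInt_kern x0 n _ _)).
    assert (I2 := RInt_correct (V := R_CompleteNormedModule) F (x0 - d / 2) (x0 + d / 2) (ex_RInt_kern x0 n _ _)).
    assert (I3 := RInt_correct (V := R_CompleteNormedModule) F (x0 + d / 2) (2 * PI) (ex_RInt_kern x0 n _ _)).
    assert (I := is_RInt_Chasles _ _ _ _ _ _ (is_RInt_Chasles _ _ _ _ _ _ I1 I2) I3).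
    assert (E := is_RInt_R_unique _ _ _ _ _ I (kern_integral x0 n)).
    unfold plus in E; simpl in E.
    assert (L1 : ((x0 - d / 2) - 0) * (- (B * k2 ^ n)) <= RInt F 0 (x0 - d / 2)).
    { apply (is_RInt_le (fun _ => - (B * k2 ^ n)) F 0 (x0 - d / 2)); [lra | apply Hconst | exact I1 | intros; apply Hlow; lra]. }
    assert (L2 : ((x0 + d / 2) - (x0 - d / 2)) * (eta * k1 ^ n) <= RInt F (x0 - d / 2) (x0 + d / 2)).
    { apply (is_RInt_le (fun _ => eta * k1 ^ n) F (x0 - d / 2) (x0 + d / 2)); [lra | apply Hconst | exact I2 | intros; apply Hmid; lra]. }
    assert (L3 : ((2 * PI) - (x0 + d / 2)) * (- (B * k2 ^ n)) <= RInt F (x0 + d / 2) (2 * PI)).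
    { apply (is_RInt_le (fun _ => - (B * k2 ^ n)) F (x0 + d / 2) (2 * PI)); [lra | apply Hconst | exact I3 | intros; apply Hlow; lra]. }
    assert (HBk : 0 <= B * k2 ^ n) by (apply Rmult_le_pos; auto; apply pow_le; lra).
    assert (P1 : (x0 - d / 2 - 0) * - (B * k2 ^ n) >= - (2 * PI * (B * k2 ^ n))) by nra.
    assert (P3 : (2 * PI - (x0 + d / 2)) * - (B * k2 ^ n) >= - (2 * PI * (B * k2 ^ n))) by nra.
    replace ((x0 + d / 2 - (x0 - d / 2)) * (eta * k1 ^ n)) with (d * eta * k1 ^ n) in L2 by field.
    lra. }
  assert (L : is_lim_seq (fun n => 4 * PI * B * (k2 / k1) ^ n) 0).
  { replace (Finite 0) with (Rbar_mult (4 * PI * B) 0) by (simpl; f_equal; ring). apply is_lim_seq_scal_l.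
    apply is_lim_seq_geom. rewrite Rabs_pos_eq. apply Rmult_lt_reg_r with k1. lra.
    unfold Rdiv. rewrite Rmult_assoc, Rinv_l by lra. lra. apply Rdiv_le_0_compat; lra. }
  assert (Hle : Rbar_le (d * eta) 0).
  { apply (is_lim_seq_le (fun _ => d * eta) (fun n => 4 * PI * B * (k2 / k1) ^ n)); auto.
    intros n. specialize (G n). assert (0 < k1 ^ n) by (apply pow_lt; lra).
    apply Rmult_le_reg_r with (k1 ^ n); auto. unfold Rdiv. rewrite Rpow_mult_distr, pow_inv.
    replace (4 * PI * B * (k2 ^ n * / k1 ^ n) * k1 ^ n) with (4 * PI * B * k2 ^ n) by (field; lra). exact G.
    apply is_lim_seq_const. }
  simpl in Hle. assert (0 < d * eta) by (apply Rmult_lt_0_compat; unfold eta; lra). lra.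
Qed.
End Completeness.

(** * Periodic functions and uniqueness of Fourier coefficients *)

Lemma periodic_nat {T : Type} (f : R -> T) (p : R) : (forall x, f (x + p) = f x) ->
  forall (n : nat) x, f (x + INR n * p) = f x.
Proof.
  intros H. induction n as [|n IH]; intros x.
  - simpl. f_equal. ring.
  - rewrite S_INR. replace (x + (INR n + 1) * p) with (x + INR n * p + p) by ring. now rewrite H.
Qed.

Lemma periodic_reduce {T : Type} (f : R -> T) (p : R) : 0 < p -> (forall x, f (x + p) = f x) ->
  forall x, exists y, 0 <= y < p /\ f y = f x.
Proof.
  intros Hp H x.
  assert (Hn : forall n x, f (x - INR n * p) = f x).
  { intros n z. rewrite <- (periodic_nat f p H n (z - INR n * p)). f_equal. ring. }
  destruct (base_Int_part (x / p)) as [B1 B2]. set (k := Int_part (x / p)) in *.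
  exists (x - IZR k * p). split.
  - assert (E : x = x / p * p) by (field; lra). split.
    + assert (IZR k * p <= x / p * p) by (apply Rmult_le_compat_r; lra). lra.
    + assert ((x / p) * p < (IZR k + 1) * p) by (apply Rmult_lt_compat_r; lra). lra.
  - assert (Hz : k = Z.of_nat (Z.abs_nat k) \/ k = (- Z.of_nat (Z.abs_nat k))%Z) by lia.
    destruct Hz as [-> | ->]; [|rewrite opp_IZR]; rewrite <- INR_IZR_INZ.
    + apply Hn.
    + rewrite <- (periodic_nat f p H (Z.abs_nat k) x). f_equal. ring.
Qed.

Lemma fourier_unique (g : R -> R) :
  (forall x, continuous g x) -> (forall x, g (x + 2 * PI) = g x) ->
  (forall m : nat, is_RInt (fun t => g t * cos (INR m * t)) 0 (2 * PI) 0) ->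
  (forall m : nat, is_RInt (fun t => g t * sin (INR m * t)) 0 (2 * PI) 0) ->
  forall x, g x = 0.
Proof.
  intros Hg Hp Hc Hs. assert (HP := PI_RGT_0).
  assert (Hin : forall x, 0 < x < 2 * PI -> g x = 0).
  { intros x Hx. apply Rle_antisym.
    - now apply fourier_nonpos.
    - cut (- g x <= 0). lra.
      apply (fourier_nonpos (fun x => - g x)); auto.
      + intros y. apply (continuous_opp g). apply Hg.
      + intros m. apply (is_RInt_eq _ _ _ _ _ _ (is_RInt_comb _ _ _ _ (-1) 0 (Hc m) (Hc m))); auto. intros; ring.
      + intros m. apply (is_RInt_eq _ _ _ _ _ _ (is_RInt_comb _ _ _ _ (-1) 0 (Hs m) (Hs m))); auto. intros; ring. }
  (* At the end of the integration interval there is no room on both sides for the kernel;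
     continuity from the interior covers this point. *)
  assert (H0 : g 0 = 0).
  { destruct (Req_dec (g 0) 0) as [|Hn]; auto. exfalso.
    assert (Ha : 0 < Rabs (g 0)) by now apply Rabs_pos_lt.
    destruct (proj1 (filterlim_locally _ _) (Hg 0) (mkposreal _ Ha)) as [d Hd].
    assert (Hdp := cond_pos d). set (y := Rmin (d / 2) 1).
    assert (Y1 := Rmin_l (d / 2) 1). assert (Y2 := Rmin_r (d / 2) 1). fold y in Y1, Y2.
    assert (Y3 : 0 < y) by (apply Rmin_pos; lra). assert (HP2 := PI2_3_2).
    specialize (Hd y). unfold ball in Hd; simpl in Hd. unfold AbsRing_ball, abs, minus, plus, opp in Hd; simpl in Hd.
    rewrite Hin in Hd by lra. rewrite Rplus_0_l, Rabs_Ropp in Hd.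
    assert (Rabs (g 0) < Rabs (g 0)). { apply Hd. rewrite Rabs_pos_eq; lra. } lra. }
  intros x. destruct (periodic_reduce g (2 * PI) ltac:(lra) Hp x) as [y [Hy <-]].
  destruct (Req_dec y 0) as [->|]; auto. apply Hin. lra.
Qed.

(** * The Helmholtz equation in polar coordinates *)

Definition partial_x (u : R -> R -> R) (x y : R) : R := Derive (fun s => u s y) x.
Definition partial_y (u : R -> R -> R) (x y : R) : R := Derive (fun s => u x s) y.

Lemma locally_exterior (rho x y : R) : rho ^ 2 < x ^ 2 + y ^ 2 ->
  locally (x, y) (fun z : R * R => rho ^ 2 < fst z ^ 2 + snd z ^ 2).
Proof.
  intros H.
  assert (HC : continuity_2d_pt (fun x y => x ^ 2 + y ^ 2) x y).
  { apply continuity_2d_pt_plus.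
    apply continuity_2d_pt_ext with (fun x y => x * x). intros; ring.
    apply continuity_2d_pt_mult; apply continuity_2d_pt_id1.
    apply continuity_2d_pt_ext with (fun x y => y * y). intros; ring.
    apply continuity_2d_pt_mult; apply continuity_2d_pt_id2. }
  apply continuity_2d_pt_filterlim in HC.
  apply (HC (fun t => rho ^ 2 < t)). now apply (open_gt (rho ^ 2)).
Qed.

Section Polar.
Variable rho : R.
Hypothesis Hrho : 0 < rho.

Lemma polar_exterior (r phi : R) : rho < r -> rho ^ 2 < (r * cos phi) ^ 2 + (r * sin phi) ^ 2.
Proof.
  intros Hr. replace ((r * cos phi) ^ 2 + (r * sin phi) ^ 2) with (r ^ 2 * ((sin phi)² + (cos phi)²)) by (unfold Rsqr; ring).
  rewrite sin2_cos2. simpl. nra.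
Qed.

Section Chain.
Variable v : R -> R -> R.
Hypothesis Hv : forall x y, rho ^ 2 < x ^ 2 + y ^ 2 -> ex_diff_n v 1 x y.

(** The exterior is open, so the partials exist near the point, and continuity of one of them
    upgrades them to a total differential. *)
Lemma exterior_differentiable (x y : R) : rho ^ 2 < x ^ 2 + y ^ 2 ->
  differentiable_pt_lim v x y (partial_x v x y) (partial_y v x y).
Proof.
  intros H. apply filterdiff_differentiable_pt_lim.
  apply (is_derive_filterdiff v x y (partial_x v) (partial_y v x y)).
  - apply (filter_imp (fun z : R * R => rho ^ 2 < fst z ^ 2 + snd z ^ 2)).
    + intros [a b] Hab. simpl in *. destruct (Hv a b Hab) as (_ & H1 & _). now apply Derive_correct.
    + now apply locally_exterior.
  - destruct (Hv x y H) as (_ & _ & H1 & _). now apply Derive_correct.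
  - destruct (Hv x y H) as (_ & _ & _ & [H1 _] & _). now apply continuity_2d_pt_filterlim in H1.
Qed.

Lemma exterior_chain (f g : R -> R) (t a b : R) :
  rho ^ 2 < f t ^ 2 + g t ^ 2 -> is_derive f t a -> is_derive g t b ->
  is_derive (fun t => v (f t) (g t)) t (partial_x v (f t) (g t) * a + partial_y v (f t) (g t) * b).
Proof.
  intros H Hf Hg. apply is_derive_Reals. apply derivable_pt_lim_comp_2d.
  now apply exterior_differentiable. now apply is_derive_Reals. now apply is_derive_Reals.
Qed.

Lemma radial_derive (r phi : R) : rho < r ->
  is_derive (fun s => v (s * cos phi) (s * sin phi)) r
    (partial_x v (r * cos phi) (r * sin phi) * cos phi + partial_y v (r * cos phi) (r * sin phi) * sin phi).
Proof.
  intros Hr. apply (exterior_chain (fun s => s * cos phi) (fun s => s * sin phi)).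
  now apply polar_exterior. auto_derive; auto; ring. auto_derive; auto; ring.
Qed.

Lemma angular_derive (r phi : R) : rho < r ->
  is_derive (fun s => v (r * cos s) (r * sin s)) phi
    (partial_x v (r * cos phi) (r * sin phi) * (- r * sin phi) + partial_y v (r * cos phi) (r * sin phi) * (r * cos phi)).
Proof.
  intros Hr. apply (exterior_chain (fun s => r * cos s) (fun s => r * sin s)).
  now apply polar_exterior. auto_derive; auto; ring. auto_derive; auto; ring.
Qed.
End Chain.

Lemma continuity_2d_polar (v : R -> R -> R) (r phi : R) :
  continuity_2d_pt v (r * cos phi) (r * sin phi) ->
  continuity_2d_pt (fun r phi => v (r * cos phi) (r * sin phi)) r phi.
Proof.
  intros H. apply continuity_2d_pt_filterlim. apply continuity_2d_pt_filterlim in H.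
  assert (H1 : continuity_2d_pt (fun r phi => r * cos phi) r phi).
  { apply continuity_2d_pt_mult. apply continuity_2d_pt_id1. apply continuity_2d_of_snd.
    apply continuity_pt_filterlim, continuity_cos. }
  assert (H2 : continuity_2d_pt (fun r phi => r * sin phi) r phi).
  { apply continuity_2d_pt_mult. apply continuity_2d_pt_id1. apply continuity_2d_of_snd.
    apply continuity_pt_filterlim, continuity_sin. }
  apply continuity_2d_pt_filterlim in H1. apply continuity_2d_pt_filterlim in H2.
  apply (filterlim_comp_2 (fun z : R * R => fst z * cos (snd z)) (fun z : R * R => fst z * sin (snd z)) v H1 H2).
  intros P HP. destruct (H P HP) as [d Hd].
  apply (Filter_prod _ _ _ (ball (r * cos phi) d) (ball (r * sin phi) d)).
  - apply locally_ball.
  - apply locally_ball.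
  - intros a b Ha Hb. apply (Hd (a, b)). split; auto.
Qed.

Variable kappa : R.
Variable u : R -> R -> R.
Hypothesis Hu : forall x y, rho ^ 2 < x ^ 2 + y ^ 2 -> ex_diff_n u 2 x y.
Hypothesis Hh : forall x y, rho ^ 2 < x ^ 2 + y ^ 2 ->
  Derive_n (fun s => u s y) 2 x + Derive_n (fun s => u x s) 2 y + kappa ^ 2 * u x y = 0.

Lemma Hu1 (x y : R) : rho ^ 2 < x ^ 2 + y ^ 2 -> ex_diff_n u 1 x y.
Proof. intros H. apply (ex_diff_n_m 2); auto. Qed.

Lemma Hux (x y : R) : rho ^ 2 < x ^ 2 + y ^ 2 -> ex_diff_n (partial_x u) 1 x y.
Proof. intros H. destruct (Hu x y H) as (_ & _ & _ & H1 & _). exact H1. Qed.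

Lemma Huy (x y : R) : rho ^ 2 < x ^ 2 + y ^ 2 -> ex_diff_n (partial_y u) 1 x y.
Proof. intros H. destruct (Hu x y H) as (_ & _ & _ & _ & H1). exact H1. Qed.

Definition at_polar (v : R -> R -> R) (r phi : R) : R := v (r * cos phi) (r * sin phi).

(** The radial derivatives of order 0, 1, 2 are written through Cartesian partials, so that joint
    continuity in (r, phi) is inherited from the C^2 hypothesis. *)
Definition upol (j : nat) (r phi : R) : R :=
  match j with
  | O => at_polar u r phi
  | 1%nat => at_polar (partial_x u) r phi * cos phi + at_polar (partial_y u) r phi * sin phi
  | _ => (at_polar (partial_x (partial_x u)) r phi * cos phi + at_polar (partial_y (partial_x u)) r phi * sin phi) * cos phi
       + (at_polar (partial_x (partial_y u)) r phi * cos phi + at_polar (partial_y (partial_y u)) r phi * sin phi) * sin phi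
  end.

Lemma upol_derive (j : nat) (r phi : R) : (j < 2)%nat -> rho < r ->
  is_derive (fun s => upol j s phi) r (upol (S j) r phi).
Proof.
  intros Hj Hr. destruct j as [|[|j]]; [| |lia]; unfold upol, at_polar.
  - apply (radial_derive u Hu1); auto.
  - evar_last. apply der_plus; apply der_mult. apply (radial_derive _ Hux); auto. apply der_const.
    apply (radial_derive _ Huy); auto. apply der_const. cbv beta. ring.
Qed.

Lemma continuity_2d_cos_snd (r phi : R) : continuity_2d_pt (fun _ t => cos t) r phi.
Proof. apply continuity_2d_of_snd, continuity_pt_filterlim, continuity_cos. Qed.
Lemma continuity_2d_sin_snd (r phi : R) : continuity_2d_pt (fun _ t => sin t) r phi.
Proof. apply continuity_2d_of_snd, continuity_pt_filterlim, continuity_sin. Qed.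

Lemma ex_diff_1_cont (v : R -> R -> R) (r phi : R) :
  (forall x y, rho ^ 2 < x ^ 2 + y ^ 2 -> ex_diff_n v 1 x y) -> rho < r ->
  continuity_2d_pt (at_polar v) r phi /\ continuity_2d_pt (at_polar (partial_x v)) r phi /\
  continuity_2d_pt (at_polar (partial_y v)) r phi.
Proof.
  intros Hv Hr. destruct (Hv _ _ (polar_exterior r phi Hr)) as (H0 & _ & _ & [H1 _] & [H2 _]).
  repeat split; now apply continuity_2d_polar.
Qed.

Lemma upol_continuity (j : nat) (r phi : R) : rho < r -> continuity_2d_pt (upol j) r phi.
Proof.
  intros Hr.
  destruct (ex_diff_1_cont u r phi Hu1 Hr) as (C0 & C1 & C2).
  destruct (ex_diff_1_cont _ r phi Hux Hr) as (_ & C3 & C4).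
  destruct (ex_diff_1_cont _ r phi Huy Hr) as (_ & C5 & C6).
  destruct j as [|[|j]]; unfold upol;
    repeat first [assumption | apply continuity_2d_cos_snd | apply continuity_2d_sin_snd
      | apply continuity_2d_pt_plus | apply continuity_2d_pt_mult].
Qed.

Definition uang (r phi : R) : R :=
  at_polar (partial_x u) r phi * (- r * sin phi) + at_polar (partial_y u) r phi * (r * cos phi).

Lemma upol_angular (r phi : R) : rho < r -> is_derive (upol 0 r) phi (uang r phi).
Proof. intros Hr. apply (angular_derive u Hu1); auto. Qed.

(** The polar form of the equation. In r^2 u_rr + u_phiphi the mixed partials cancel, and sin^2 +
    cos^2 = 1 leaves r^2 times the Laplacian minus r u_r. *)
Lemma uang_angular (r phi : R) : rho < r ->
  is_derive (uang r) phi (- (r ^ 2 * upol 2 r phi + r * upol 1 r phi + kappa ^ 2 * r ^ 2 * upol 0 r phi)).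
Proof.
  intros Hr. unfold uang. evar_last.
  apply der_plus; apply der_mult.
  apply (angular_derive _ Hux); auto. auto_derive; auto; reflexivity.
  apply (angular_derive _ Huy); auto. auto_derive; auto; reflexivity.
  cbv beta. assert (H := Hh _ _ (polar_exterior r phi Hr)).
  change (Derive_n (fun s => u s (r * sin phi)) 2 (r * cos phi)) with (at_polar (partial_x (partial_x u)) r phi) in H.
  change (Derive_n (fun s => u (r * cos phi) s) 2 (r * sin phi)) with (at_polar (partial_y (partial_y u)) r phi) in H.
  fold (at_polar u r phi) in H. unfold upol.
  fold (at_polar (partial_x (partial_x u)) r phi) (at_polar (partial_y (partial_x u)) r phi)
    (at_polar (partial_x (partial_y u)) r phi) (at_polar (partial_y (partial_y u)) r phi).
  replace (kappa ^ 2 * r ^ 2 * at_polar u r phi) with (r ^ 2 * (kappa ^ 2 * at_polar u r phi)) by ring.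
  replace (kappa ^ 2 * at_polar u r phi) with
    (- (at_polar (partial_x (partial_x u)) r phi + at_polar (partial_y (partial_y u)) r phi)) by lra.
  set (xx := at_polar (partial_x (partial_x u)) r phi). set (yy := at_polar (partial_y (partial_y u)) r phi).
  assert (E := sin2_cos2 phi). unfold Rsqr in E.
  replace (r ^ 2 * - (xx + yy)) with (- r ^ 2 * (xx + yy) * (sin phi * sin phi + cos phi * cos phi)) by (rewrite E; ring).
  ring.
Qed.

(** [e] stands for cos(m t) or sin(m t), represented by its equation and its periodicity. *)
Variable m : nat.
Variable e e' : R -> R.
Hypothesis He : forall t, is_derive e t (e' t).
Hypothesis He' : forall t, is_derive e' t (- INR m ^ 2 * e t).
Hypothesis He2 : e (2 * PI) = e 0.
Hypothesis He'2 : e' (2 * PI) = e' 0.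

Definition mode (j : nat) (r : R) : R := RInt (fun t => upol j r t * e t) 0 (2 * PI).

Lemma mode_integrand_continuity (j : nat) (r t : R) : rho < r -> continuity_2d_pt (fun r t => upol j r t * e t) r t.
Proof.
  intros Hr. apply continuity_2d_pt_mult. now apply upol_continuity.
  apply continuity_2d_of_snd. apply (ex_derive_continuous e). eexists; apply He.
Qed.

Lemma mode_derive (j : nat) (r : R) : (j < 2)%nat -> rho < r -> is_derive (mode j) r (mode (S j) r).
Proof.
  intros Hj Hr.
  apply (der_RInt_param (fun r t => upol j r t * e t) (fun r t => upol (S j) r t * e t) rho); auto.
  - intros s t Hs. evar_last. apply der_mult. apply upol_derive; auto. apply der_const. cbv beta. ring.
  - intros s t Hs. now apply mode_integrand_continuity.
  - intros s t Hs. now apply mode_integrand_continuity.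
Qed.

Lemma is_RInt_mode (j : nat) (r : R) : rho < r -> is_RInt (fun t => upol j r t * e t) 0 (2 * PI) (mode j r).
Proof.
  intros Hr. apply (@RInt_correct R_CompleteNormedModule). apply (@ex_RInt_continuous R_CompleteNormedModule).
  intros t _. apply (continuity_2d_snd (fun r t => upol j r t * e t)). now apply mode_integrand_continuity.
Qed.

(** Two integrations by parts in the angle, carried out by the single primitive [F]; its end values
    agree by periodicity. *)
Lemma mode_ode (r : R) : rho < r ->
  r ^ 2 * mode 2 r + r * mode 1 r + (kappa ^ 2 * r ^ 2 - INR m ^ 2) * mode 0 r = 0.
Proof.
  intros Hr.
  set (F := fun t => - (uang r t * e t - upol 0 r t * e' t)).
  set (f := fun t => r ^ 2 * (upol 2 r t * e t) + (r * (upol 1 r t * e t) + (kappa ^ 2 * r ^ 2 - INR m ^ 2) * (upol 0 r t * e t))).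
  assert (I1 : is_RInt f 0 (2 * PI) (r ^ 2 * mode 2 r + (r * mode 1 r + (kappa ^ 2 * r ^ 2 - INR m ^ 2) * mode 0 r))).
  { apply (is_RInt_plus (fun t => r ^ 2 * (upol 2 r t * e t))).
    apply (is_RInt_scal (fun t => upol 2 r t * e t)). now apply is_RInt_mode.
    apply (is_RInt_plus (fun t => r * (upol 1 r t * e t))).
    apply (is_RInt_scal (fun t => upol 1 r t * e t)). now apply is_RInt_mode.
    apply (is_RInt_scal (fun t => upol 0 r t * e t)). now apply is_RInt_mode. }
  assert (I2 : is_RInt f 0 (2 * PI) (minus (F (2 * PI)) (F 0))).
  { apply (is_RInt_derive F).
    - intros t _. unfold F. evar_last. apply der_opp, der_minus; apply der_mult.
      now apply uang_angular. apply He. now apply upol_angular. apply He'. cbv beta. unfold f. ring.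
    - intros t _. assert (C := fun j => mode_integrand_continuity j r t Hr).
      apply (continuity_2d_snd (fun r t => r ^ 2 * (upol 2 r t * e t) + (r * (upol 1 r t * e t) + (kappa ^ 2 * r ^ 2 - INR m ^ 2) * (upol 0 r t * e t)))).
      assert (Cr : continuity_2d_pt (fun r _ => r ^ 2) r t).
      { apply continuity_2d_pt_ext with (fun x y => x * x). intros; ring.
        apply continuity_2d_pt_mult; apply continuity_2d_pt_id1. }
      repeat first [exact Cr | apply (C 2%nat) | apply (C 1%nat) | apply (C 0%nat) | apply continuity_2d_pt_const
        | apply continuity_2d_pt_id1 | apply continuity_2d_pt_plus | apply continuity_2d_pt_minus].
      apply continuity_2d_pt_mult. exact Cr. apply (C 2%nat).
      apply continuity_2d_pt_mult. apply continuity_2d_pt_id1. apply (C 1%nat).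
      apply continuity_2d_pt_mult. apply continuity_2d_pt_minus. apply continuity_2d_pt_mult. apply continuity_2d_pt_const. exact Cr.
      apply continuity_2d_pt_const. apply (C 0%nat). }
  assert (E := is_RInt_R_unique _ _ _ _ _ I1 I2).
  assert (Z : minus (F (2 * PI)) (F 0) = 0).
  { unfold F, uang, upol, at_polar, minus, plus, opp; simpl. rewrite He2, He'2, cos_2PI, sin_2PI, cos_0, sin_0. ring. }
  rewrite Z in E. lra.
Qed.
End Polar.

(** * Cylinder functions of integer order *)

(* The pair of orders m, m+1 of the solution of Z_{m+2} = 2(m+1)/x Z_{m+1} - Z_m with prescribed orders 0 and 1. *)
Fixpoint cyl_pair (x : R) (z0 z1 : C) (m : nat) : C * C :=
  match m with
  | O => (z0, z1)
  | S k => let p := cyl_pair x z0 z1 k in (snd p, (RtoC (2 * INR (S k) / x) * snd p - fst p)%C)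
  end.

Definition cyl (x : R) (z0 z1 : C) (m : nat) : C := fst (cyl_pair x z0 z1 m).

Lemma cyl_SS (x : R) (z0 z1 : C) (m : nat) :
  cyl x z0 z1 (S (S m)) = (RtoC (2 * INR (S m) / x) * cyl x z0 z1 (S m) - cyl x z0 z1 m)%C.
Proof. reflexivity. Qed.

Lemma pair_ind (P : nat -> Prop) : P 0%nat -> P 1%nat -> (forall m, P m -> P (S m) -> P (S (S m))) -> forall m, P m.
Proof.
  intros H0 H1 HS m. assert (P m /\ P (S m)) by (induction m as [|m [IH1 IH2]]; auto). tauto.
Qed.

(** The Lommel representation: [cyl x 1 0 m] and [cyl x 0 1 m] are P_m and Q_m. *)
Lemma cyl_linear (x : R) (z0 z1 : C) (m : nat) :
  cyl x z0 z1 m = (z0 * cyl x (RtoC 1) (RtoC 0) m + z1 * cyl x (RtoC 0) (RtoC 1) m)%C.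
Proof.
  revert m. apply pair_ind.
  - unfold cyl; simpl. ring.
  - unfold cyl; simpl. ring.
  - intros m H0 H1. rewrite !cyl_SS, H0, H1. ring.
Qed.

(** H_m generated upward from H_0 and H_1. The recurrence holds by definition, and Bessel's equation
    of order m is derived from it in [dHank_der]. *)
Definition Hank (m : nat) (x : R) : C := cyl x (hankel1 0 x) (hankel1 1 x) m.

Lemma Hank_SS (m : nat) (x : R) : Hank (S (S m)) x = (RtoC (2 * INR (S m) / x) * Hank (S m) x - Hank m x)%C.
Proof. apply cyl_SS. Qed.

Definition dHank (m : nat) (x : R) : C := (RtoC (INR m / x) * Hank m x - Hank (S m) x)%C.

(** Both ladder relations in one induction, since differentiating the recurrence for order m + 2
    calls for the derivatives at orders m + 1 and m. *)
Lemma Hank_der_pair (m : nat) (x : R) : 0 < x ->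
  Cder (Hank m) x (dHank m x) /\ Cder (Hank (S m)) x (Hank m x - RtoC (INR (S m) / x) * Hank (S m) x)%C.
Proof.
  intros Hx. assert (HxC : RtoC x <> RtoC 0) by (apply RtoC_neq_0; lra).
  induction m as [|m [IH1 IH2]].
  - split.
    + eapply Cder_eq. now apply hankel1_der_0. unfold dHank, Hank, cyl. simpl.
      replace (0 / x) with 0 by (field; lra). ring.
    + eapply Cder_eq. now apply hankel1_der_1. unfold Hank, cyl. simpl. replace (1 / x) with (/ x) by (field; lra). ring.
  - split.
    + eapply Cder_eq. exact IH2. unfold dHank. rewrite Hank_SS.
      replace (2 * INR (S m) / x) with (INR (S m) / x + INR (S m) / x) by (field; lra). rewrite RtoC_plus. ring.
    + apply (Cder_ext_gt 0 (fun x => RtoC (2 * INR (S m) * / x) * Hank (S m) x - Hank m x)%C); auto.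
      eapply Cder_eq. apply Cder_minus. apply Cder_mult. apply Cder_RtoC. apply der_scal.
      apply (is_derive_inv (fun x => x) x 1). apply der_id. lra. exact IH2. exact IH1.
      cbv beta. unfold dHank. rewrite Hank_SS, (S_INR (S m)), (S_INR m).
      set (s := INR m). set (A := Hank m x). set (B := Hank (S m) x).
      unfold Rdiv. replace (x ^ 2) with (x * x) by ring.
      rewrite !RtoC_mult, !RtoC_inv, !RtoC_mult, !RtoC_plus by nra.
      replace (RtoC (- (1))) with (- RtoC 1)%C by (now rewrite RtoC_opp).
      field. auto.
Qed.

Lemma Hank_der (m : nat) (x : R) : 0 < x -> Cder (Hank m) x (dHank m x).
Proof. intros Hx. now apply Hank_der_pair. Qed.

Lemma dHank_der (m : nat) (x : R) : 0 < x ->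
  Cder (dHank m) x (- (RtoC (/ x) * dHank m x) - RtoC (1 - INR m ^ 2 / x ^ 2) * Hank m x)%C.
Proof.
  intros Hx. assert (HxC : RtoC x <> RtoC 0) by (apply RtoC_neq_0; lra).
  unfold dHank.
  apply (Cder_ext_gt 0 (fun x => RtoC (INR m * / x) * Hank m x - Hank (S m) x)%C); auto.
  eapply Cder_eq. apply Cder_minus. apply Cder_mult. apply Cder_RtoC. apply der_scal.
  apply (is_derive_inv (fun x => x) x 1). apply der_id. lra. now apply Hank_der. apply (Hank_der_pair m x Hx).
  cbv beta. unfold dHank. rewrite (S_INR m).
  set (s := INR m). set (A := Hank m x). set (B := Hank (S m) x).
  unfold Rdiv, Rminus. replace (x ^ 2) with (x * x) by ring. replace (s ^ 2) with (s * s) by ring.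
  replace (- (s * s * / (x * x))) with (- 1 * (s * s * / (x * x))) by ring.
  rewrite !RtoC_plus, !RtoC_mult, !RtoC_inv, !RtoC_mult, !RtoC_plus by nra.
  replace (RtoC (- (1))) with (- RtoC 1)%C by (now rewrite RtoC_opp).
  replace (RtoC (- 1)) with (- RtoC 1)%C by (rewrite <- RtoC_opp; reflexivity).
  field. auto.
Qed.

(** The coefficient of the recurrence is real, so its term drops out of the determinant of real and
    imaginary parts, and the minus sign restores the orientation. *)
Lemma Hank_wronskian (m : nat) (x : R) : 0 < x ->
  x * (fst (Hank (S m) x) * snd (Hank m x) - fst (Hank m x) * snd (Hank (S m) x)) = 2 / PI.
Proof.
  intros Hx. induction m as [|m IH].
  - apply bessel_wronskian. exact Hx.
  - rewrite Hank_SS. set (c := 2 * INR (S m) / x).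
    unfold Cminus, Cplus, Copp, Cmult, RtoC; simpl. rewrite <- IH. ring.
Qed.

Lemma Hank_neq_0 (m : nat) (x : R) : 0 < x -> Hank m x <> RtoC 0.
Proof.
  intros Hx E. assert (H := Hank_wronskian m x Hx). rewrite E in H. simpl in H.
  assert (HP := PI_RGT_0). assert (0 < 2 / PI) by (apply Rdiv_lt_0_compat; lra). lra.
Qed.

Definition nHank (m : nat) (x : R) : C := (outinv x * Hank m x)%C.

Lemma is_lim_inv_0 (c : R) : is_lim (fun x => c * / x) p_infty 0.
Proof.
  replace (Finite 0) with (Rbar_mult c 0) by (simpl; f_equal; ring). apply is_lim_scal_l.
  replace (Finite 0) with (Rbar_inv p_infty) by reflexivity. apply is_lim_inv. apply is_lim_id. easy.
Qed.

Lemma Clim0_bounded (f : R -> C) (c : C) : Clim0 (fun x => f x - c)%C -> exists K X, forall x, X <= x -> Cmod (f x) <= K.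
Proof.
  intros H. apply is_lim_spec in H. destruct (H (mkposreal 1 Rlt_0_1)) as [M HM].
  exists (1 + Cmod c), (M + 1). intros x Hx. specialize (HM x ltac:(lra)). rewrite Rminus_0_r in HM. simpl in HM.
  apply Rabs_def2 in HM. replace (f x) with ((f x - c) + c)%C by ring.
  apply Rle_trans with (1 := Cmod_triangle _ _). lra.
Qed.

Lemma Clim0_over_x (f : R -> C) (a : R) (K X : R) : (forall x, X <= x -> Cmod (f x) <= K) ->
  Clim0 (fun x => RtoC (a / x) * f x)%C.
Proof.
  intros HK. apply Clim0_le with (fun x => (Rabs a * K) * / x) (Rmax 1 X). 2: apply is_lim_inv_0.
  intros x Hx. assert (H1 := Rmax_l 1 X). assert (H2 := Rmax_r 1 X).
  rewrite Cmod_mult, Cmod_R. unfold Rdiv. rewrite Rabs_mult, (Rabs_pos_eq (/ x)) by (apply Rlt_le, Rinv_0_lt_compat; lra).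
  replace (Rabs a * K * / x) with (Rabs a * / x * K) by ring.
  apply Rmult_le_compat_l. apply Rmult_le_pos. apply Rabs_pos. apply Rlt_le, Rinv_0_lt_compat; lra. apply HK. lra.
Qed.

Lemma Cminus1 : RtoC (-1) = (- RtoC 1)%C.
Proof. rewrite <- RtoC_opp. reflexivity. Qed.

(** At infinity the first term of the recurrence is O(1/x), which leaves z_{m+2} = -z_m, solved by
    (-i)^m. *)
Lemma nHank_lim (m : nat) : Clim0 (fun x => nHank m x - (- Ci) ^ m)%C.
Proof.
  revert m. apply pair_ind.
  - exact (proj1 hnorm_lead).
  - apply Clim0_ext with (2 := proj2 hnorm_lead) (X := 0). intros x _. unfold hnorm, nHank, Hank, cyl. simpl. ring.
  - intros m H0 H1. destruct (Clim0_bounded _ _ H1) as [K [X HK]].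
    assert (L := Clim0_plus _ _ (Clim0_over_x _ (2 * INR (S m)) K X HK) (Clim0_scal (RtoC (-1)) _ H0)).
    apply Clim0_ext with (2 := L) (X := 0). intros x _. unfold nHank. rewrite Hank_SS, Cminus1.
    set (p := ((- Ci) ^ m)%C). change ((- Ci) ^ S (S m))%C with (- Ci * (- Ci * p))%C.
    assert (E : (Ci * Ci = - RtoC 1)%C) by (unfold Ci, Cmult, Copp, RtoC; simpl; f_equal; ring).
    replace (- Ci * (- Ci * p))%C with (Ci * Ci * p)%C by ring. rewrite E. ring.
Qed.

Lemma dHank_lim (m : nat) : Clim0 (fun x => outinv x * (dHank m x - Ci * Hank m x))%C.
Proof.
  destruct (Clim0_bounded _ _ (nHank_lim m)) as [K [X HK]].
  assert (L := Clim0_plus _ _ (Clim0_over_x _ (INR m) K X HK)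
    (Clim0_plus _ _ (Clim0_scal (- Ci) _ (nHank_lim m)) (Clim0_scal (RtoC (-1)) _ (nHank_lim (S m))))).
  apply Clim0_ext with (2 := L) (X := 0). intros x _. unfold nHank, dHank. rewrite Cminus1. simpl. ring.
Qed.

Lemma Cmod_outinv (x : R) : 0 <= x -> Cmod (outinv x) = sqrt (PI / 2) * sqrt x.
Proof.
  intros Hx. assert (HP := PI_RGT_0). unfold outinv. rewrite Cmod_mult, Cmod_cis, Cmod_R, Rmult_1_r, Rabs_pos_eq by apply sqrt_pos.
  apply sqrt_mult_alt. lra.
Qed.

(** * Modes satisfying the radiation condition *)

Lemma Cder_conj (f : R -> C) (x : R) (l : C) : Cder f x l -> Cder (fun t => Cconj (f t)) x (Cconj l).
Proof. intros [H1 H2]. split; simpl; auto. now apply der_opp. Qed.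

Lemma Cder_zero_const (f : R -> C) (a : R) : (forall x, a < x -> Cder f x (RtoC 0)) ->
  forall x y, a < x -> a < y -> f x = f y.
Proof.
  intros H x y Hx Hy. apply injective_projections.
  - apply (is_derive_zero_const (fun t => fst (f t)) a); auto. intros z Hz. now apply H.
  - apply (is_derive_zero_const (fun t => snd (f t)) a); auto. intros z Hz. now apply H.
Qed.

(** Abel's identity: the first-order term A'/r puts the weight r on the Wronskian, whatever the
    potential q. *)
Lemma Cwronskian_const (A A1 B B1 : R -> C) (q : R -> R) (a : R) : 0 <= a ->
  (forall r, a < r -> Cder A r (A1 r)) ->
  (forall r, a < r -> Cder A1 r (- (RtoC (/ r) * A1 r) - RtoC (q r) * A r)%C) ->
  (forall r, a < r -> Cder B r (B1 r)) ->
  (forall r, a < r -> Cder B1 r (- (RtoC (/ r) * B1 r) - RtoC (q r) * B r)%C) ->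
  forall r s, a < r -> a < s ->
  (RtoC r * (A r * B1 r - A1 r * B r) = RtoC s * (A s * B1 s - A1 s * B s))%C.
Proof.
  intros Ha HA HA1 HB HB1. apply (Cder_zero_const (fun r => RtoC r * (A r * B1 r - A1 r * B r))%C).
  intros r Hr. assert (HrC : RtoC r <> RtoC 0) by (apply RtoC_neq_0; lra).
  eapply Cder_eq. apply Cder_mult. apply (Cder_RtoC (fun r => r)). apply der_id.
  apply Cder_minus; apply Cder_mult; auto. cbv beta. rewrite RtoC_inv by lra. field. auto.
Qed.

Section RadiatingMode.
Variables (kappa rho : R) (m : nat) (A A1 : R -> C).
Hypothesis (Hk : 0 < kappa) (Hrho : 0 < rho).
Hypothesis HA : forall r, rho < r -> Cder A r (A1 r).
Hypothesis HA1 : forall r, rho < r -> Cder A1 r (- (RtoC (/ r) * A1 r) - RtoC (kappa ^ 2 - INR m ^ 2 / r ^ 2) * A r)%C.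
Hypothesis Hrad : Clim0 (fun r => RtoC (sqrt r) * (A1 r - Ci * RtoC kappa * A r))%C.

Let B (r : R) : C := Hank m (kappa * r).
Let B1 (r : R) : C := (RtoC kappa * dHank m (kappa * r))%C.

Lemma Cder_dilate (f : R -> C) (l : C) (r : R) : Cder f (kappa * r) l -> Cder (fun r => f (kappa * r)) r (RtoC kappa * l)%C.
Proof.
  intros [H1 H2]. assert (Hl : is_derive (fun r => kappa * r) r kappa) by (auto_derive; auto; ring).
  split; simpl.
  - evar_last. apply (der_comp (fun t => fst (f t)) (fun r => kappa * r)); eauto. ring.
  - evar_last. apply (der_comp (fun t => snd (f t)) (fun r => kappa * r)); eauto. ring.
Qed.

Lemma B_der (r : R) : rho < r -> Cder B r (B1 r).
Proof. intros Hr. apply Cder_dilate, Hank_der. nra. Qed.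

Lemma B1_der (r : R) : rho < r -> Cder B1 r (- (RtoC (/ r) * B1 r) - RtoC (kappa ^ 2 - INR m ^ 2 / r ^ 2) * B r)%C.
Proof.
  intros Hr. assert (Hkr : 0 < kappa * r) by nra.
  eapply Cder_eq. apply Cder_scal. apply Cder_dilate. now apply dHank_der.
  unfold B1, B.
  replace (kappa ^ 2 - INR m ^ 2 / r ^ 2) with (kappa * kappa * (1 - INR m ^ 2 / (kappa * r) ^ 2)) by (field; lra).
  replace (/ r) with (kappa * / (kappa * r)) by (field; lra).
  rewrite !RtoC_mult. ring.
Qed.

Lemma outinv_B_bounded : exists K X, forall r, X <= r -> Cmod (RtoC (sqrt r) * B r)%C <= K.
Proof.
  destruct (Clim0_bounded _ _ (nHank_lim m)) as [K [X HK]].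
  assert (HP := PI_RGT_0). assert (Hs : 0 < sqrt (PI / 2)) by (apply sqrt_lt_R0; lra).
  assert (Hsk : 0 < sqrt kappa) by (apply sqrt_lt_R0; lra).
  exists (K / (sqrt (PI / 2) * sqrt kappa)), (Rmax 0 (X / kappa)). intros r Hr.
  assert (H1 := Rmax_l 0 (X / kappa)). assert (H2 := Rmax_r 0 (X / kappa)).
  assert (HX : X <= kappa * r). { replace X with (kappa * (X / kappa)) by (field; lra). apply Rmult_le_compat_l; lra. }
  specialize (HK _ HX). unfold nHank in HK. rewrite Cmod_mult, Cmod_outinv in HK by nra.
  rewrite sqrt_mult_alt in HK by lra. unfold B. rewrite Cmod_mult, Cmod_R, Rabs_pos_eq by apply sqrt_pos.
  apply Rmult_le_reg_l with (sqrt (PI / 2) * sqrt kappa). apply Rmult_lt_0_compat; auto.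
  replace (sqrt (PI / 2) * sqrt kappa * (K / (sqrt (PI / 2) * sqrt kappa))) with K by (field; lra). lra.
Qed.

Lemma B_radiates : Clim0 (fun r => RtoC (sqrt r) * (B1 r - Ci * RtoC kappa * B r))%C.
Proof.
  assert (HP := PI_RGT_0). assert (Hs : 0 < sqrt (PI / 2)) by (apply sqrt_lt_R0; lra).
  assert (Hsk : 0 < sqrt kappa) by (apply sqrt_lt_R0; lra).
  apply Clim0_le with (fun r => kappa / (sqrt (PI / 2) * sqrt kappa) * Cmod (outinv (kappa * r) * (dHank m (kappa * r) - Ci * Hank m (kappa * r)))%C) 0.
  - intros r Hr. rewrite !Cmod_mult, Cmod_outinv, Cmod_R by nra. rewrite sqrt_mult_alt by lra. unfold B1, B.
    replace (RtoC kappa * dHank m (kappa * r) - Ci * RtoC kappa * Hank m (kappa * r))%C with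
      (RtoC kappa * (dHank m (kappa * r) - Ci * Hank m (kappa * r)))%C by ring.
    rewrite Cmod_mult, Cmod_R, (Rabs_pos_eq kappa), (Rabs_pos_eq (sqrt r)) by (try apply sqrt_pos; lra).
    apply Req_le. field. lra.
  - replace (Finite 0) with (Rbar_mult (kappa / (sqrt (PI / 2) * sqrt kappa)) 0) by (simpl; f_equal; ring). apply is_lim_scal_l.
    apply (is_lim_comp (fun x => Cmod (outinv x * (dHank m x - Ci * Hank m x))%C) (fun r => kappa * r) p_infty 0 p_infty).
    apply dHank_lim.
    replace p_infty with (Rbar_mult kappa p_infty) at 2. apply is_lim_scal_l, is_lim_id.
    simpl. destruct (Rle_dec 0 kappa); [|lra]. destruct (Rle_lt_or_eq_dec _ _ r); [reflexivity|lra].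
    exists 0. intros; discriminate.
Qed.

Lemma Cconj_RtoC_mult (a : R) (z : C) : Cconj (RtoC a * z)%C = (RtoC a * Cconj z)%C.
Proof. unfold Cconj, Cmult, RtoC; simpl. f_equal; ring. Qed.

Lemma wronskian_B_conj (r : R) : rho < r ->
  (RtoC r * (B r * Cconj (B1 r) - B1 r * Cconj (B r)))%C = (- (Ci * RtoC (4 / PI)))%C.
Proof.
  intros Hr. assert (Hkr : 0 < kappa * r) by nra. assert (W := Hank_wronskian m _ Hkr).
  replace (4 / PI) with (2 * (2 / PI)) by (field; assert (H := PI_RGT_0); lra). rewrite <- W.
  unfold B, B1, dHank. set (c := INR m / (kappa * r)).
  destruct (Hank m (kappa * r)) as [a b]. destruct (Hank (S m) (kappa * r)) as [a' b'].
  unfold Cconj, Cmult, Cminus, Cplus, Copp, Ci, RtoC; simpl. f_equal; ring.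
Qed.

(* The radiation condition makes the Wronskian of A and H_m vanish; the one of H_m and its conjugate does not. *)
Lemma radiating_mode : exists c : C, forall r, rho < r -> A r = (c * Hank m (kappa * r))%C.
Proof.
  assert (HP := PI_RGT_0).
  set (q := fun r => kappa ^ 2 - INR m ^ 2 / r ^ 2).
  assert (W1 := Cwronskian_const A A1 B B1 q rho ltac:(lra) HA HA1 B_der B1_der).
  assert (W2 := Cwronskian_const A A1 (fun r => Cconj (B r)) (fun r => Cconj (B1 r)) q rho ltac:(lra) HA HA1
    (fun r Hr => Cder_conj _ _ _ (B_der r Hr))).
  assert (H3 : forall r, rho < r -> Cder (fun r => Cconj (B1 r)) r (- (RtoC (/ r) * Cconj (B1 r)) - RtoC (q r) * Cconj (B r))%C).
  { intros r Hr. eapply Cder_eq. apply Cder_conj. now apply B1_der.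
    unfold q. rewrite <- !Cconj_RtoC_mult. unfold Cconj, Cminus, Cplus, Copp; simpl. f_equal; ring. }
  specialize (W2 H3).
  set (w1 := (RtoC (rho + 1) * (A (rho + 1) * B1 (rho + 1) - A1 (rho + 1) * B (rho + 1)))%C) in *.
  set (w2 := (RtoC (rho + 1) * (A (rho + 1) * Cconj (B1 (rho + 1)) - A1 (rho + 1) * Cconj (B (rho + 1))))%C) in *.
  assert (E1 : forall r, rho < r -> (RtoC r * (A r * B1 r - A1 r * B r))%C = w1).
  { intros r Hr. apply W1; lra. }
  assert (E2 : forall r, rho < r -> (RtoC r * (A r * Cconj (B1 r) - A1 r * Cconj (B r)))%C = w2).
  { intros r Hr. apply W2; lra. }
  set (wH := (- (Ci * RtoC (4 / PI)))%C).
  assert (HwH : wH <> RtoC 0).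
  { intros E. apply (f_equal snd) in E. simpl in E. assert (0 < 4 / PI) by (apply Rdiv_lt_0_compat; lra). lra. }
  (* Cramer's rule in the basis formed by [B] and its conjugate, with the determinant from
     [wronskian_B_conj]. *)
  assert (ER : forall r, rho < r -> (A r * wH = B r * w2 - Cconj (B r) * w1)%C).
  { intros r Hr. unfold wH. rewrite <- (wronskian_B_conj r Hr), <- (E1 r Hr), <- (E2 r Hr). ring. }
  (* w1 = (sqrt r A) (sqrt r (B' - i kappa B)) - (sqrt r B) (sqrt r (A' - i kappa A)) is a sum of
     products of a bounded and a vanishing factor. The radiation condition does not bound sqrt r A
     by itself; [ER] does. *)
  assert (Hw1 : w1 = RtoC 0).
  { destruct outinv_B_bounded as [K [X HK]].
    set (KA := (K * Cmod w2 + K * Cmod w1) / Cmod wH).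
    assert (HwHp : 0 < Cmod wH) by now apply Cmod_gt_0.
    assert (BA : forall r, Rmax X (rho + 1) <= r -> Cmod (RtoC (sqrt r) * A r)%C <= KA).
    { intros r Hr. assert (R1 := Rmax_l X (rho + 1)). assert (R2 := Rmax_r X (rho + 1)).
      specialize (HK r ltac:(lra)). specialize (ER r ltac:(lra)).
      apply Rmult_le_reg_r with (Cmod wH); auto. rewrite <- Cmod_mult.
      replace (RtoC (sqrt r) * A r * wH)%C with ((RtoC (sqrt r) * B r) * w2 + - ((RtoC (sqrt r) * Cconj (B r)) * w1))%C.
      2:{ transitivity (RtoC (sqrt r) * (A r * wH))%C; [rewrite ER; ring | ring]. }
      apply Rle_trans with (1 := Cmod_triangle _ _). rewrite Cmod_opp, <- Cconj_RtoC_mult, !(Cmod_mult _ w2), !(Cmod_mult _ w1), Cmod_conj.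
      unfold KA. replace ((K * Cmod w2 + K * Cmod w1) / Cmod wH * Cmod wH) with (K * Cmod w2 + K * Cmod w1) by (field; lra).
      apply Rplus_le_compat; apply Rmult_le_compat_r; auto; apply Cmod_ge_0. }
    assert (L1 := Clim0_mult_bound _ _ KA _ BA B_radiates).
    assert (L2 := Clim0_mult_bound _ _ K _ HK Hrad).
    assert (L := Clim0_plus _ _ L1 (Clim0_scal (RtoC (-1)) _ L2)).
    assert (Lw : Clim0 (fun _ => w1)).
    { apply Clim0_ext with (2 := L) (X := rho + 1). intros r Hr. rewrite <- (E1 r) by lra. cbv beta. rewrite Cminus1.
      assert (Er : RtoC r = (RtoC (sqrt r) * RtoC (sqrt r))%C) by (rewrite <- RtoC_mult, sqrt_sqrt by lra; reflexivity).
      rewrite Er. ring. }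
    unfold Clim0 in Lw. apply is_lim_unique in Lw. rewrite Lim_const in Lw. injection Lw as E. now apply Cmod_eq_0. }
  exists (w2 / wH)%C. intros r Hr. specialize (ER r Hr). rewrite Hw1 in ER.
  transitivity (A r * wH / wH)%C. field; auto. rewrite ER. unfold B. field; auto.
Qed.
End RadiatingMode.

(** * Estimates for real series *)

Ltac asR := match goal with |- @eq _ ?a ?b => change (@eq R a b) end.

Lemma ex_series_bound (a b : nat -> R) : (forall n, Rabs (a n) <= b n) -> ex_series b -> ex_series a.
Proof. intros H. apply (ex_series_le (V := R_CompleteNormedModule)). exact H. Qed.

Lemma ex_series_scal_R (c : R) (a : nat -> R) : ex_series a -> ex_series (fun n => c * a n).
Proof. intros H. exact (ex_series_scal_l (V := R_NormedModule) c a H). Qed.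

Lemma ex_series_plus_R (a b : nat -> R) : ex_series a -> ex_series b -> ex_series (fun n => a n + b n).
Proof. intros H1 H2. exact (ex_series_plus (V := R_NormedModule) a b H1 H2). Qed.

Lemma Series_abs_le (a b : nat -> R) : (forall n, Rabs (a n) <= b n) -> ex_series b -> Rabs (Series a) <= Series b.
Proof.
  intros H Hb. assert (Ha : ex_series (fun n => Rabs (a n))).
  { apply ex_series_bound with b; auto. intros n. now rewrite Rabs_Rabsolu. }
  apply Rle_trans with (1 := Series_Rabs _ Ha). apply Series_le; auto. intros n. split; auto. apply Rabs_pos.
Qed.

(** * Absolutely convergent complex series *)

(** [Series] returns a number even for a divergent series, so the algebraic rules below ask for
    absolute summability. *)
Definition CSeries (f : nat -> C) : C := (Series (fun m => fst (f m)), Series (fun m => snd (f m))).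

Lemma ex_series_fst (f : nat -> C) : ex_series (fun m => Cmod (f m)) -> ex_series (fun m => fst (f m)).
Proof. apply ex_series_bound. intros; apply Rabs_fst_le. Qed.
Lemma ex_series_snd (f : nat -> C) : ex_series (fun m => Cmod (f m)) -> ex_series (fun m => snd (f m)).
Proof. apply ex_series_bound. intros; apply Rabs_snd_le. Qed.

Lemma CSeries_plus (f g : nat -> C) : ex_series (fun m => Cmod (f m)) -> ex_series (fun m => Cmod (g m)) ->
  CSeries (fun m => f m + g m)%C = (CSeries f + CSeries g)%C.
Proof.
  intros Hf Hg. unfold CSeries, Cplus; simpl. f_equal.
  - now rewrite <- Series_plus by (now apply ex_series_fst).
  - now rewrite <- Series_plus by (now apply ex_series_snd).
Qed.

Lemma CSeries_scal (c : C) (f : nat -> C) : ex_series (fun m => Cmod (f m)) ->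
  CSeries (fun m => c * f m)%C = (c * CSeries f)%C.
Proof.
  intros Hf. assert (H1 := ex_series_fst f Hf). assert (H2 := ex_series_snd f Hf).
  unfold CSeries, Cmult; simpl. f_equal.
  - rewrite Series_minus, !Series_scal_l by (apply ex_series_scal_R; auto). reflexivity.
  - rewrite Series_plus, !Series_scal_l by (apply ex_series_scal_R; auto). reflexivity.
Qed.

Lemma CSeries_ext (f g : nat -> C) : (forall m, f m = g m) -> CSeries f = CSeries g.
Proof. intros H. unfold CSeries. f_equal; apply Series_ext; intros; now rewrite H. Qed.

Lemma CSeries_bound (f : nat -> C) (b : nat -> R) : (forall m, Cmod (f m) <= b m) -> ex_series b ->
  Cmod (CSeries f) <= 2 * Series b.
Proof.
  intros H Hb. apply Rle_trans with (1 := Cmod_le_abs _). simpl.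
  assert (Rabs (Series (fun m => fst (f m))) <= Series b).
  { apply Series_abs_le; auto. intros n. apply Rle_trans with (2 := H n). apply Rabs_fst_le. }
  assert (Rabs (Series (fun m => snd (f m))) <= Series b).
  { apply Series_abs_le; auto. intros n. apply Rle_trans with (2 := H n). apply Rabs_snd_le. }
  lra.
Qed.

(** * Lommel polynomials *)

(** The cylinder recurrence with every sign made positive and initial values 1, 1. It is monotone in
    1/x and dominates both the values and the coefficients of the Lommel polynomials. *)
Fixpoint maj_pair (x : R) (m : nat) : R * R :=
  match m with O => (1, 1) | S k => let p := maj_pair x k in (snd p, 2 * INR (S k) / x * snd p + fst p) end.
Definition maj (x : R) (m : nat) : R := fst (maj_pair x m).

Lemma maj_SS (x : R) (m : nat) : maj x (S (S m)) = 2 * INR (S m) / x * maj x (S m) + maj x m.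
Proof. reflexivity. Qed.

Lemma maj_ge_1 (x : R) (m : nat) : 0 < x -> 1 <= maj x m.
Proof.
  intros Hx. revert m. apply pair_ind.
  - unfold maj; simpl; lra.
  - unfold maj; simpl; lra.
  - intros m H0 H1. rewrite maj_SS. assert (0 <= 2 * INR (S m) / x).
    { apply Rdiv_le_0_compat; auto. assert (H := pos_INR (S m)). lra. } nra.
Qed.

Lemma maj_decr (x y : R) (m : nat) : 0 < x -> x <= y -> maj y m <= maj x m.
Proof.
  intros Hx Hy. revert m. apply pair_ind.
  - unfold maj; simpl; lra.
  - unfold maj; simpl; lra.
  - intros m H0 H1. rewrite !maj_SS. assert (H := pos_INR (S m)).
    assert (G := maj_ge_1 y (S m) ltac:(lra)).
    apply Rplus_le_compat; auto. apply Rmult_le_compat; auto; try lra.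
    apply Rdiv_le_0_compat; lra. apply Rmult_le_compat_l. lra. apply Rinv_le_contravar; lra.
Qed.

Lemma Cmod_cyl_le (y : R) (z0 z1 : C) (m : nat) : 0 < y -> Cmod (cyl y z0 z1 m) <= maj y m * (Cmod z0 + Cmod z1).
Proof.
  intros Hy. assert (H0 := Cmod_ge_0 z0). assert (H1 := Cmod_ge_0 z1). revert m. apply pair_ind.
  - unfold maj, cyl; simpl; lra.
  - unfold maj, cyl; simpl; lra.
  - intros m IH0 IH1. rewrite cyl_SS, maj_SS. unfold Cminus. apply Rle_trans with (1 := Cmod_triangle _ _).
    rewrite Cmod_opp, Cmod_mult, Cmod_R.
    assert (H : 0 <= 2 * INR (S m) / y). { apply Rdiv_le_0_compat; auto. assert (H := pos_INR (S m)). lra. }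
    rewrite Rabs_pos_eq by auto. rewrite Rmult_plus_distr_r. apply Rplus_le_compat; auto.
    rewrite Rmult_assoc. apply Rmult_le_compat_l; auto.
Qed.

Definition shift1 (f : nat -> R) (j : nat) : R := match j with O => 0 | S i => f i end.

Fixpoint lom_pair (a b : R) (m : nat) : (nat -> R) * (nat -> R) :=
  match m with
  | O => (fun j => match j with O => a | _ => 0 end, fun j => match j with O => b | _ => 0 end)
  | S k => let p := lom_pair a b k in
      (snd p, fun j => 2 * INR (S k) * shift1 (snd p) j - fst p j)
  end.
(* The coefficient of x^-j in cyl x a b m, for constants a and b. *)
Definition lom (a b : R) (m : nat) : nat -> R := fst (lom_pair a b m).

Lemma lom_SS (a b : R) (m j : nat) :
  lom a b (S (S m)) j = 2 * INR (S m) * shift1 (lom a b (S m)) j - lom a b m j.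
Proof. reflexivity. Qed.

(** With positive signs nothing cancels, so [maj x m] dominates each coefficient times x^(-j). *)
Lemma lom_bound (a b x : R) (m : nat) : 0 < x -> Rabs a <= 1 -> Rabs b <= 1 ->
  forall j, Rabs (lom a b m j) <= maj x m * x ^ j.
Proof.
  intros Hx Ha Hb.
  assert (G : forall c j, Rabs c <= 1 -> Rabs (match j with O => c | _ => 0 end) <= 1 * x ^ j).
  { intros c [|j] Hc; simpl. lra. rewrite Rabs_R0. assert (0 < x ^ j) by (now apply pow_lt). nra. }
  induction m as [| |m IH0 IH1] using pair_ind.
  - intros j. exact (G a j Ha).
  - intros j. exact (G b j Hb).
  - intros j. rewrite lom_SS, maj_SS. unfold Rminus. apply Rle_trans with (1 := Rabs_triang _ _).
    rewrite Rabs_Ropp, Rmult_plus_distr_r. apply Rplus_le_compat; auto.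
    assert (H := pos_INR (S m)). assert (HM := maj_ge_1 x (S m) Hx).
    rewrite Rabs_mult, (Rabs_pos_eq (2 * INR (S m))) by lra.
    destruct j as [|j]; simpl shift1.
    + rewrite Rabs_R0, Rmult_0_r. apply Rmult_le_pos. apply Rmult_le_pos. apply Rdiv_le_0_compat; lra. lra. simpl; lra.
    + replace (2 * INR (S m) / x * maj x (S m) * x ^ S j) with (2 * INR (S m) * (maj x (S m) * x ^ j)) by (simpl; field; lra).
      apply Rmult_le_compat_l. lra. apply IH1.
Qed.

(** Parity as an identity of signs, the form in which the factor (-1)^m of the angular mode is
    exchanged for (-1)^j under the sum over m. *)
Lemma lom_parity_10 (m : nat) : forall j, (-1) ^ m * lom 1 0 m j = (-1) ^ j * lom 1 0 m j.
Proof.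
  induction m as [| |m IH0 IH1] using pair_ind.
  - intros [|j]; unfold lom; simpl; ring.
  - intros [|j]; unfold lom; simpl; ring.
  - intros j. rewrite lom_SS.
    assert (E : (-1) ^ S (S m) = (-1) ^ m) by (simpl; ring). rewrite E.
    rewrite !Rmult_minus_distr_l, IH0. f_equal.
    destruct j as [|j]; simpl shift1. ring. specialize (IH1 j). simpl pow in *.
    transitivity (2 * INR (S m) * (- (-1 * (-1) ^ m * lom 1 0 (S m) j))). ring. rewrite IH1. ring.
Qed.

Lemma lom_parity_01 (m : nat) : forall j, (-1) ^ m * lom 0 1 m j = - ((-1) ^ j * lom 0 1 m j).
Proof.
  induction m as [| |m IH0 IH1] using pair_ind.
  - intros [|j]; unfold lom; simpl; ring.
  - intros [|j]; unfold lom; simpl; ring.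
  - intros j. rewrite lom_SS.
    assert (E : (-1) ^ S (S m) = (-1) ^ m) by (simpl; ring). rewrite E.
    rewrite !Rmult_minus_distr_l, IH0.
    destruct j as [|j]; simpl shift1. ring. specialize (IH1 j). simpl pow in *.
    transitivity (2 * INR (S m) * (- (-1 * (-1) ^ m * lom 0 1 (S m) j)) - - ((-1) * (-1) ^ j * lom 0 1 m (S j))). ring.
    rewrite IH1. ring.
Qed.

Lemma geom_dom_series (p : nat -> R) (W x y : R) : 0 < x -> 2 * x <= y -> (forall j, Rabs (p j) <= W * x ^ j) ->
  (forall j, Rabs (p j / y ^ j) <= W * (/ 2) ^ j) /\ ex_series (fun j => W * (/ 2) ^ j) /\ Series (fun j => W * (/ 2) ^ j) = 2 * W.
Proof.
  intros Hx Hy Hp. split; [|split].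
  - intros j. assert (Hyj : 0 < y ^ j) by (apply pow_lt; lra).
    unfold Rdiv. rewrite Rabs_mult, (Rabs_pos_eq (/ y ^ j)) by (apply Rlt_le, Rinv_0_lt_compat; auto).
    assert (HW : 0 <= W). { specialize (Hp 0%nat). simpl in Hp. assert (H := Rabs_pos (p 0%nat)). lra. }
    apply Rle_trans with (W * x ^ j * / y ^ j).
    apply Rmult_le_compat_r. apply Rlt_le, Rinv_0_lt_compat; auto. apply Hp.
    rewrite Rmult_assoc. apply Rmult_le_compat_l; auto. rewrite <- pow_inv, <- Rpow_mult_distr.
    apply pow_incr. split. apply Rdiv_le_0_compat; lra.
    apply Rmult_le_reg_r with y. lra. rewrite Rmult_assoc, Rinv_l by lra. lra.
  - apply ex_series_scal_R. apply ex_series_geom. rewrite Rabs_pos_eq; lra.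
  - rewrite Series_scal_l, Series_geom by (rewrite Rabs_pos_eq; lra). field.
Qed.

Lemma ex_series_lom (a b y : R) (m : nat) : 0 < y -> Rabs a <= 1 -> Rabs b <= 1 -> ex_series (fun j => lom a b m j / y ^ j).
Proof.
  intros Hy Ha Hb.
  destruct (geom_dom_series (lom a b m) (maj (y / 2) m) (y / 2) y ltac:(lra) ltac:(lra)) as (H1 & H2 & _).
  apply lom_bound; auto; lra. now apply ex_series_bound with (1 := H1).
Qed.

(** A polynomial in 1/y written as an infinite series with finitely many nonzero terms, so that no
    degree depending on m appears in the superposition. *)
Lemma cyl_lom (a b y : R) (m : nat) : 0 < y -> Rabs a <= 1 -> Rabs b <= 1 ->
  cyl y (RtoC a) (RtoC b) m = RtoC (Series (fun j => lom a b m j / y ^ j)).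
Proof.
  intros Hy Ha Hb.
  assert (G : forall c, Rabs c <= 1 -> Series (fun j => (match j with O => c | _ => 0 end) / y ^ j) = c).
  { intros c Hc. rewrite Series_incr_1.
    2: exact (ex_series_lom c 0 y 0 Hy Hc ltac:(rewrite Rabs_R0; lra)).
    rewrite (Series_ext _ (fun k => 0 * 0)). rewrite Series_scal_l. simpl. field.
    intros k. unfold Rdiv. ring. }
  revert m. apply pair_ind.
  - unfold cyl, lom; simpl. now rewrite G.
  - unfold cyl, lom; simpl. now rewrite G.
  - intros m IH0 IH1. rewrite cyl_SS, IH0, IH1.
    assert (E0 := ex_series_lom a b y m Hy Ha Hb). assert (E1 := ex_series_lom a b y (S m) Hy Ha Hb).
    rewrite (Series_ext (fun j => lom a b (S (S m)) j / y ^ j)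
      (fun j => 2 * INR (S m) * (shift1 (lom a b (S m)) j / y ^ j) - lom a b m j / y ^ j)).
    2:{ intros j. rewrite lom_SS. unfold Rdiv. ring. }
    assert (E2 : ex_series (fun j => shift1 (lom a b (S m)) j / y ^ j)).
    { apply (ex_series_incr_1 (V := R_NormedModule)). simpl.
      apply ex_series_ext with (fun k => / y * (lom a b (S m) k / y ^ k)).
      intros k. asR. field. split. apply pow_nonzero; lra. lra. now apply ex_series_scal_R. }
    rewrite Series_minus, Series_scal_l, (Series_incr_1 (fun j => shift1 (lom a b (S m)) j / y ^ j)); auto.
    2: now apply ex_series_scal_R.
    simpl shift1. rewrite (Series_ext (fun k => lom a b (S m) k / y ^ S k) (fun k => / y * (lom a b (S m) k / y ^ k))).
    2:{ intros k. simpl. field. split. apply pow_nonzero; lra. lra. }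
    rewrite Series_scal_l. rewrite <- RtoC_mult, <- RtoC_minus. f_equal. unfold Rdiv. ring.
Qed.

(** * Expansion of a superposition of series in 1/y *)

(** The hypotheses survive the shift j -> j + 1 when W is replaced by W x. The induction on the
    order therefore only has to bound the sum, for y >= 2x, where each inner series is dominated by
    one of ratio 1/2. *)
Lemma series_asymN (x : R) (t : nat -> C) : 0 < x -> forall N (p : nat -> nat -> R) (W : nat -> R),
  (forall m j, Rabs (p m j) <= W m * x ^ j) ->
  ex_series (fun m => Cmod (t m) * W m) ->
  asymN N (fun y => CSeries (fun m => t m * RtoC (Series (fun j => (p m j / y ^ j)%R)))%C)
    (fun j => CSeries (fun m => t m * RtoC (p m j))%C).
Proof.
  intros Hx.
  assert (HB : forall p W m y, 2 * x <= y -> (forall j, Rabs (p m j) <= W m * x ^ j) ->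
     Cmod (t m * RtoC (Series (fun j => (p m j / y ^ j)%R)))%C <= 2 * (Cmod (t m) * W m)).
  { intros p W m y Hy Hp. rewrite Cmod_mult, Cmod_R.
    destruct (geom_dom_series (p m) (W m) x y Hx Hy Hp) as (H1 & H2 & H3).
    replace (2 * (Cmod (t m) * W m)) with (Cmod (t m) * (2 * W m)) by ring. rewrite <- H3.
    apply Rmult_le_compat_l. apply Cmod_ge_0. apply Series_abs_le; auto. }
  induction N as [|N IH]; intros p W Hp HW.
  - exists (2 * Series (fun m => 2 * (Cmod (t m) * W m))), (2 * x). intros y Hy.
    apply CSeries_bound. intros m. now apply HB. now apply ex_series_scal_R.
  - simpl.
    assert (A := IH (fun m j => p m (S j)) (fun m => W m * x)).
    assert (A' : asymN N (fun y => CSeries (fun m => t m * RtoC (Series (fun j => (p m (S j) / y ^ j)%R)))%C)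
      (fun j => CSeries (fun m => t m * RtoC (p m (S j)))%C)).
    { apply A. intros m j. specialize (Hp m (S j)). simpl in Hp. lra.
      apply ex_series_ext with (fun m => x * (Cmod (t m) * W m)). intros n. asR. ring. now apply ex_series_scal_R. }
    apply (asymN_ext N) with (3 := A') (X := 2 * x); auto.
    intros y Hy.
    assert (Hd := fun m => geom_dom_series (p m) (W m) x y Hx Hy (Hp m)).
    assert (Ep : forall m, ex_series (fun j => (p m j / y ^ j)%R)).
    { intros m. destruct (Hd m) as (H1 & H2 & _). now apply ex_series_bound with (1 := H1). }
    assert (X1 : ex_series (fun m => Cmod (t m * RtoC (Series (fun j => (p m j / y ^ j)%R)))%C)).
    { apply ex_series_bound with (fun m => 2 * (Cmod (t m) * W m)). intros m. rewrite Rabs_pos_eq by apply Cmod_ge_0.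
      now apply HB. now apply ex_series_scal_R. }
    assert (X2 : ex_series (fun m => Cmod (t m * RtoC (p m 0%nat))%C)).
    { apply ex_series_bound with (fun m => Cmod (t m) * W m); auto. intros m. rewrite Rabs_pos_eq by apply Cmod_ge_0.
      rewrite Cmod_mult, Cmod_R. apply Rmult_le_compat_l. apply Cmod_ge_0. specialize (Hp m 0%nat). simpl in Hp. lra. }
    transitivity (RtoC y * (CSeries (fun m => t m * RtoC (Series (fun j => (p m j / y ^ j)%R))) + RtoC (-1) * CSeries (fun m => t m * RtoC (p m 0%nat))))%C.
    2:{ rewrite Cminus1. ring. }
    rewrite <- CSeries_scal by auto.
    assert (X3 : ex_series (fun m => Cmod (RtoC (-1) * (t m * RtoC (p m 0%nat)))%C)).
    { apply ex_series_ext with (fun m => Cmod (t m * RtoC (p m 0%nat))%C); auto. intros m.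
      rewrite (Cmod_mult (RtoC (-1))), Cmod_R, Rabs_left by lra. asR. ring. }
    rewrite <- CSeries_plus by auto.
    rewrite <- CSeries_scal.
    2:{ apply ex_series_bound with (fun m => Cmod (t m * RtoC (Series (fun j => (p m j / y ^ j)%R)))%C + Cmod (RtoC (-1) * (t m * RtoC (p m 0%nat)))%C).
        intros m. rewrite Rabs_pos_eq by apply Cmod_ge_0. apply Cmod_triangle. now apply ex_series_plus_R. }
    apply CSeries_ext. intros m. rewrite (Series_incr_1 (fun j => (p m j / y ^ j)%R)) by auto.
    rewrite (Series_ext (fun k => p m (S k) / y ^ S k) (fun k => / y * (p m (S k) / y ^ k))).
    2:{ intros k. simpl. field. split. apply pow_nonzero; lra. lra. }
    rewrite Series_scal_l. simpl pow. set (s := Series _). rewrite Cminus1.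
    replace (p m 0%nat / 1 + / y * s) with (p m 0%nat + / y * s) by (field; lra).
    rewrite RtoC_plus, RtoC_mult, RtoC_inv by lra. field. apply RtoC_neq_0; lra.
Qed.

(** * Growth of the Hankel functions with the order *)

Lemma Hank_abs_pos (m : nat) (x : R) : 0 < x -> 0 < Cmod (Hank m x).
Proof. intros Hx. apply Cmod_gt_0. now apply Hank_neq_0. Qed.

(** If |H_m| decreased from n0 on, the recurrence would give |H_{m+1}| = O(1/m), and the Wronskian
    would tend to 0 with m although it is constant. *)
Lemma Hank_not_decreasing (x : R) (n0 : nat) : 0 < x -> exists m, (n0 <= m)%nat /\ Cmod (Hank m x) <= Cmod (Hank (S m) x).
Proof.
  intros Hx. destruct (Classical_Prop.classic (exists m, (n0 <= m)%nat /\ Cmod (Hank m x) <= Cmod (Hank (S m) x))) as [|Hn]; auto.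
  exfalso. assert (HP := PI_RGT_0).
  assert (Hd : forall m, (n0 <= m)%nat -> Cmod (Hank (S m) x) < Cmod (Hank m x)).
  { intros m Hm. destruct (Rle_dec (Cmod (Hank m x)) (Cmod (Hank (S m) x))). exfalso; apply Hn; now exists m. lra. }
  set (h := Cmod (Hank n0 x)). assert (Hh : 0 < h) by now apply Hank_abs_pos.
  assert (Hb : forall k, Cmod (Hank (n0 + k) x) <= h).
  { induction k as [|k IH]. rewrite Nat.add_0_r. unfold h; lra. rewrite Nat.add_succ_r.
    assert (H := Hd (n0 + k)%nat ltac:(lia)). lra. }
  assert (Hw : 0 < 2 / PI) by (apply Rdiv_lt_0_compat; lra).
  (* Chooses an order at which the O(1/m) bound falls below the Wronskian 2/pi. *)
  destruct (nfloor_ex (2 * x * x * h * h / (2 / PI))) as [k Hk].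
  { apply Rdiv_le_0_compat; auto. repeat apply Rmult_le_pos; lra. }
  set (m := (n0 + k)%nat).
  assert (B0 : Cmod (Hank m x) <= h) by apply Hb.
  assert (B2 : Cmod (Hank (S (S m)) x) <= h). { replace (S (S m)) with (n0 + S (S k))%nat by (unfold m; lia). apply Hb. }
  assert (HN : 0 < INR (S m)) by (apply lt_0_INR; lia).
  assert (B1 : Cmod (Hank (S m) x) <= x / INR (S m) * h).
  { assert (E : (RtoC (2 * INR (S m) / x) * Hank (S m) x = Hank (S (S m)) x + Hank m x)%C) by (rewrite Hank_SS; ring).
    apply (f_equal Cmod) in E. rewrite Cmod_mult, Cmod_R in E.
    assert (Hp : 0 < 2 * INR (S m) / x) by (apply Rdiv_lt_0_compat; lra).
    rewrite Rabs_pos_eq in E by lra.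
    assert (T := Cmod_triangle (Hank (S (S m)) x) (Hank m x)). rewrite <- E in T.
    apply Rmult_le_reg_l with (2 * INR (S m) / x); auto.
    replace (2 * INR (S m) / x * (x / INR (S m) * h)) with (2 * h) by (field; lra). lra. }
  assert (W := Hank_wronskian m x Hx).
  assert (Q : x * (fst (Hank (S m) x) * snd (Hank m x) - fst (Hank m x) * snd (Hank (S m) x)) <= x * (2 * (Cmod (Hank (S m) x) * Cmod (Hank m x)))).
  { apply Rmult_le_compat_l. lra.
    assert (A1 := Rabs_fst_le (Hank (S m) x)). assert (A2 := Rabs_snd_le (Hank (S m) x)).
    assert (A3 := Rabs_fst_le (Hank m x)). assert (A4 := Rabs_snd_le (Hank m x)).
    apply Rle_trans with (1 := Rle_abs _). unfold Rminus. apply Rle_trans with (1 := Rabs_triang _ _).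
    rewrite Rabs_Ropp, !Rabs_mult.
    assert (Rabs (fst (Hank (S m) x)) * Rabs (snd (Hank m x)) <= Cmod (Hank (S m) x) * Cmod (Hank m x))
      by (apply Rmult_le_compat; auto; apply Rabs_pos).
    assert (Rabs (fst (Hank m x)) * Rabs (snd (Hank (S m) x)) <= Cmod (Hank m x) * Cmod (Hank (S m) x))
      by (apply Rmult_le_compat; auto; apply Rabs_pos).
    lra. }
  rewrite W in Q.
  assert (Q2 : x * (2 * (Cmod (Hank (S m) x) * Cmod (Hank m x))) <= 2 * x * x * h * h / INR (S m)).
  { replace (2 * x * x * h * h / INR (S m)) with (x * (2 * ((x / INR (S m) * h) * h))) by (field; lra).
    apply Rmult_le_compat_l. lra. apply Rmult_le_compat_l. lra. apply Rmult_le_compat; auto; apply Cmod_ge_0. }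
  assert (Q3 : 2 / PI * INR (S m) <= 2 * x * x * h * h).
  { apply Rmult_le_reg_r with (/ INR (S m)). apply Rinv_0_lt_compat; auto.
    replace (2 / PI * INR (S m) * / INR (S m)) with (2 / PI) by (field; lra). lra. }
  assert (Hlt : 2 * x * x * h * h / (2 / PI) < INR (S m)).
  { apply Rlt_le_trans with (INR k + 1). lra. rewrite <- S_INR. apply le_INR. unfold m; lia. }
  apply Rmult_lt_compat_l with (r := 2 / PI) in Hlt; auto.
  replace (2 / PI * (2 * x * x * h * h / (2 / PI))) with (2 * x * x * h * h) in Hlt by (field; lra). lra.
Qed.

(** Put c = (m+1)/x. Where both sequences increase, one step multiplies |H| by at least 2c - 1, and
    the majorant at 4x by at most c/2 + 1. For c >= 3 the second factor is at most half the first.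
    [Hank_not_decreasing] supplies one index from which |H| keeps increasing. *)
Lemma lommel_summable (x : R) : 0 < x -> ex_series (fun m => maj (4 * x) m / Cmod (Hank m x)).
Proof.
  intros Hx. destruct (nfloor_ex (3 * x) ltac:(lra)) as [k0 Hk0].
  destruct (Hank_not_decreasing x (S k0) Hx) as [m1 [Hm1 Hinc]].
  assert (HINR : forall m, (m1 <= m)%nat -> 3 * x <= INR (S m)).
  { intros m Hm. apply Rle_trans with (INR k0 + 1). lra. rewrite <- S_INR. apply le_INR. lia. }
  assert (Hstep : forall m, Cmod (Hank (S (S m)) x) >= 2 * INR (S m) / x * Cmod (Hank (S m) x) - Cmod (Hank m x)).
  { intros m. assert (E : (RtoC (2 * INR (S m) / x) * Hank (S m) x = Hank (S (S m)) x + Hank m x)%C) by (rewrite Hank_SS; ring).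
    apply (f_equal Cmod) in E. rewrite Cmod_mult, Cmod_R in E.
    assert (HN : 0 < INR (S m)) by (apply lt_0_INR; lia).
    assert (Hp : 0 < 2 * INR (S m) / x) by (apply Rdiv_lt_0_compat; lra).
    rewrite Rabs_pos_eq in E by lra.
    assert (T := Cmod_triangle (Hank (S (S m)) x) (Hank m x)). lra. }
  assert (Hi : forall m, (m1 <= m)%nat -> Cmod (Hank m x) <= Cmod (Hank (S m) x)).
  { intros m Hm. induction Hm as [|m Hm IH]; auto.
    assert (H := Hstep m). specialize (HINR m Hm). assert (Hp := Hank_abs_pos (S m) x Hx).
    assert (Hq : 6 <= 2 * INR (S m) / x).
    { apply Rmult_le_reg_r with x; auto. unfold Rdiv. rewrite Rmult_assoc, Rinv_l by lra. lra. }
    nra. }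
  assert (HM : forall m, (m1 <= m)%nat -> maj (4 * x) (S m) <= maj (4 * x) (S (S m))).
  { intros m Hm. rewrite maj_SS. specialize (HINR m Hm).
    assert (G1 := maj_ge_1 (4 * x) (S m) ltac:(lra)). assert (G0 := maj_ge_1 (4 * x) m ltac:(lra)).
    assert (Hq : 1 <= 2 * INR (S m) / (4 * x)).
    { apply Rmult_le_reg_r with (4 * x). lra. unfold Rdiv. rewrite Rmult_assoc, Rinv_l by lra. lra. }
    nra. }
  set (q := fun m => maj (4 * x) m / Cmod (Hank m x)).
  assert (Hqp : forall m, 0 < q m).
  { intros m. apply Rdiv_lt_0_compat. assert (G := maj_ge_1 (4 * x) m ltac:(lra)). lra. now apply Hank_abs_pos. }
  assert (Hq : forall m, (S m1 <= m)%nat -> q (S (S m)) <= / 2 * q (S m)).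
  { intros m Hm. unfold q.
    assert (Hp1 := Hank_abs_pos (S m) x Hx). assert (Hp2 := Hank_abs_pos (S (S m)) x Hx).
    assert (G1 := maj_ge_1 (4 * x) (S m) ltac:(lra)).
    assert (HI := HINR m ltac:(lia)).
    set (c := INR (S m) / x).
    assert (Hc : 3 <= c).
    { unfold c. apply Rmult_le_reg_r with x; auto. unfold Rdiv. rewrite Rmult_assoc, Rinv_l by lra. lra. }
    assert (U : maj (4 * x) (S (S m)) <= (c / 2 + 1) * maj (4 * x) (S m)).
    { rewrite maj_SS. replace (2 * INR (S m) / (4 * x)) with (c / 2) by (unfold c; field; lra).
      assert (Hmm : maj (4 * x) m <= maj (4 * x) (S m)). { destruct m as [|m]. lia. apply HM. lia. } lra. }
    assert (L : (2 * c - 1) * Cmod (Hank (S m) x) <= Cmod (Hank (S (S m)) x)).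
    { assert (H := Hstep m). replace (2 * INR (S m) / x) with (2 * c) in H by (unfold c; field; lra).
      assert (H1 := Hi m ltac:(lia)). lra. }
    set (a1 := maj (4 * x) (S m)) in *. set (a2 := maj (4 * x) (S (S m))) in *.
    set (b1 := Cmod (Hank (S m) x)) in *. set (b2 := Cmod (Hank (S (S m)) x)) in *.
    apply Rmult_le_reg_r with b2; auto. replace (a2 / b2 * b2) with a2 by (field; lra).
    apply Rle_trans with (/ 2 * (a1 / b1) * ((2 * c - 1) * b1)).
    replace (/ 2 * (a1 / b1) * ((2 * c - 1) * b1)) with (/ 2 * (2 * c - 1) * a1) by (field; lra).
    apply Rle_trans with (1 := U). apply Rmult_le_compat_r; lra.
    apply Rmult_le_compat_l; auto. apply Rmult_le_pos. lra. apply Rdiv_le_0_compat; lra. }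
  apply (ex_series_incr_n (V := R_NormedModule) q (S (S m1))).
  apply ex_series_bound with (fun k => q (S (S m1)) * (/ 2) ^ k).
  - assert (G : forall k, q (S (S m1) + k)%nat <= q (S (S m1)) * (/ 2) ^ k).
    { induction k as [|k IH]. rewrite Nat.add_0_r. simpl. lra.
      replace (S (S m1) + S k)%nat with (S (S (S m1 + k)))%nat by lia.
      assert (H := Hq (S m1 + k)%nat ltac:(lia)). change (S (S m1 + k)) with (S (S m1) + k)%nat in H at 2. simpl pow. lra. }
    intros k. rewrite Rabs_pos_eq by apply Rlt_le, Hqp. apply G.
  - apply ex_series_scal_R, ex_series_geom. rewrite Rabs_pos_eq; lra.
Qed.

(** * Fourier series *)

Lemma is_RInt_cos_nat (n : nat) : (0 < n)%nat -> is_RInt (fun t => cos (INR n * t)) 0 (2 * PI) 0.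
Proof.
  intros Hn. assert (Hn' : 0 < INR n) by now apply lt_0_INR.
  evar_last. apply (is_RInt_derive (fun t => sin (INR n * t) / INR n)).
  - intros t _. auto_derive. lra. field. lra.
  - intros t _. apply (ex_derive_continuous (fun t => cos (INR n * t))). auto_derive. auto.
  - unfold minus, plus, opp; simpl. rewrite Rmult_0_r, sin_0.
    replace (INR n * (2 * PI)) with (0 + 2 * INR n * PI) by ring. rewrite sin_period, sin_0. field. lra.
Qed.

Lemma is_RInt_sin_nat (n : nat) : is_RInt (fun t => sin (INR n * t)) 0 (2 * PI) 0.
Proof.
  destruct n as [|n].
  - apply is_RInt_ext with (fun _ => 0). intros t _. simpl. now rewrite Rmult_0_l, sin_0.
    evar_last. apply (is_RInt_const (V := R_NormedModule)). unfold scal; simpl; unfold mult; simpl. ring.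
  - assert (Hn' : 0 < INR (S n)) by (apply lt_0_INR; lia). set (c := INR (S n)) in *.
    evar_last. apply (is_RInt_derive (fun t => - cos (c * t) / c)).
    + intros t _. auto_derive. lra. field. lra.
    + intros t _. apply (ex_derive_continuous (fun t => sin (c * t))). auto_derive. auto.
    + unfold minus, plus, opp; simpl. rewrite Rmult_0_r, cos_0. unfold c.
      replace (INR (S n) * (2 * PI)) with (0 + 2 * INR (S n) * PI) by ring. rewrite cos_period, cos_0. fold c. field. lra.
Qed.

Definition fnorm (m : nat) : R := match m with O => / (2 * PI) | _ => / PI end.

Lemma fnorm_bounds (m : nat) : 0 < fnorm m <= 1.
Proof.
  assert (HP := PI_RGT_0). assert (HP2 := PI2_3_2).
  destruct m; simpl; (split; [apply Rinv_0_lt_compat; lra | rewrite <- Rinv_1; apply Rinv_le_contravar; lra]).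
Qed.

Lemma is_RInt_const_2PI (c : R) : is_RInt (fun _ : R => c) 0 (2 * PI) (2 * PI * c).
Proof.
  evar_last. apply (is_RInt_const (V := R_NormedModule) 0 (2 * PI) c). unfold scal; simpl; unfold mult; simpl. ring.
Qed.

Lemma is_RInt_cos_sum (a b : nat) :
  is_RInt (fun t => cos (INR a * t + INR b * t)) 0 (2 * PI) (if Nat.eqb (a + b) 0 then 2 * PI else 0).
Proof.
  apply is_RInt_ext with (fun t => cos (INR (a + b) * t)). intros t _. rewrite plus_INR. f_equal. asR. ring.
  destruct (Nat.eqb_spec (a + b) 0) as [E|E].
  - rewrite E. apply (is_RInt_eq (fun _ => 1) _ _ _ (2 * PI * 1)). apply is_RInt_const_2PI.
    intros t. simpl. now rewrite Rmult_0_l, cos_0. ring.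
  - apply is_RInt_cos_nat. lia.
Qed.

Lemma is_RInt_cos_diff (a b : nat) :
  is_RInt (fun t => cos (INR a * t - INR b * t)) 0 (2 * PI) (if Nat.eqb a b then 2 * PI else 0).
Proof.
  destruct (Nat.eqb_spec a b) as [E|E].
  - subst. apply (is_RInt_eq (fun _ => 1) _ _ _ (2 * PI * 1)). apply is_RInt_const_2PI.
    intros t. rewrite Rminus_diag. now rewrite cos_0. ring.
  - destruct (Nat.lt_ge_cases a b) as [H|H].
    + apply is_RInt_ext with (fun t => cos (INR (b - a) * t)). intros t _. rewrite minus_INR by lia.
      rewrite <- cos_neg. f_equal. asR. ring. apply is_RInt_cos_nat. lia.
    + apply is_RInt_ext with (fun t => cos (INR (a - b) * t)). intros t _. rewrite minus_INR by lia.
      f_equal. asR. ring. apply is_RInt_cos_nat. lia.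
Qed.

Lemma is_RInt_sin_sum (a b : nat) : is_RInt (fun t => sin (INR a * t + INR b * t)) 0 (2 * PI) 0.
Proof.
  apply is_RInt_ext with (fun t => sin (INR (a + b) * t)). intros t _. rewrite plus_INR. f_equal. asR. ring.
  apply is_RInt_sin_nat.
Qed.

Lemma is_RInt_sin_diff (a b : nat) : is_RInt (fun t => sin (INR a * t - INR b * t)) 0 (2 * PI) 0.
Proof.
  destruct (Nat.lt_ge_cases a b) as [H|H].
  - apply (is_RInt_eq _ _ _ _ _ _ (is_RInt_comb _ _ _ _ (-1) 0 (is_RInt_sin_nat (b - a)) (is_RInt_sin_nat 0))); auto.
    intros t. rewrite minus_INR by lia. replace (INR a * t - INR b * t) with (- ((INR b - INR a) * t)) by ring. rewrite sin_neg. ring.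
  - apply is_RInt_ext with (fun t => sin (INR (a - b) * t)). intros t _. rewrite minus_INR by lia.
    f_equal. asR. ring. apply is_RInt_sin_nat.
Qed.

Lemma is_RInt_lin (f h : R -> R) (a b c d l1 l2 : R) :
  is_RInt f a b l1 -> is_RInt h a b l2 -> is_RInt (fun t => c * f t + d * h t) a b (c * l1 + d * l2).
Proof. intros H1 H2. exact (is_RInt_plus _ _ _ _ _ _ (is_RInt_scal _ _ _ c _ H1) (is_RInt_scal _ _ _ d _ H2)). Qed.

Section FourierSeries.
Variables (u : R -> R) (al be W : nat -> R).
Hypothesis Hu : forall x, continuous u x.
Hypothesis Hper : forall x, u (x + 2 * PI) = u x.
Hypothesis Hal : forall m, is_RInt (fun t => u t * cos (INR m * t)) 0 (2 * PI) (al m).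
Hypothesis Hbe : forall m, is_RInt (fun t => u t * sin (INR m * t)) 0 (2 * PI) (be m).
Hypothesis HWa : forall m, Rabs (al m) <= W m.
Hypothesis HWb : forall m, Rabs (be m) <= W m.
Hypothesis HW : ex_series W.

Definition fterm (m : nat) (t : R) : R := fnorm m * (al m * cos (INR m * t) + be m * sin (INR m * t)).
Definition fsum (t : R) : R := Series (fun m => fterm m t).
Definition fpart (n : nat) (t : R) : R := sum_n (fun m => fterm m t) n.

Lemma fterm_bound (m : nat) (t : R) : Rabs (fterm m t) <= 2 * W m.
Proof.
  unfold fterm. assert (Hf := fnorm_bounds m). assert (Hc := COS_bound (INR m * t)). assert (Hs := SIN_bound (INR m * t)).
  assert (Hcc : Rabs (cos (INR m * t)) <= 1) by (apply Rabs_le; lra).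
  assert (Hss : Rabs (sin (INR m * t)) <= 1) by (apply Rabs_le; lra).
  rewrite Rabs_mult, (Rabs_pos_eq (fnorm m)) by lra.
  assert (H : Rabs (al m * cos (INR m * t) + be m * sin (INR m * t)) <= 2 * W m).
  { apply Rle_trans with (1 := Rabs_triang _ _). rewrite !Rabs_mult.
    assert (Rabs (al m) * Rabs (cos (INR m * t)) <= W m * 1) by (apply Rmult_le_compat; auto; apply Rabs_pos).
    assert (Rabs (be m) * Rabs (sin (INR m * t)) <= W m * 1) by (apply Rmult_le_compat; auto; apply Rabs_pos). lra. }
  assert (H0 := Rabs_pos (al m * cos (INR m * t) + be m * sin (INR m * t))). nra.
Qed.

Lemma ex_series_2W : ex_series (fun m => 2 * W m).
Proof. now apply ex_series_scal_R. Qed.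

Lemma ex_series_fterm (t : R) : ex_series (fun m => fterm m t).
Proof. apply ex_series_bound with (fun m => 2 * W m). intros; apply fterm_bound. apply ex_series_2W. Qed.

Lemma fpart_uniform (eps : R) : 0 < eps -> exists N, forall n t, (N <= n)%nat -> Rabs (fsum t - fpart n t) <= eps.
Proof.
  intros He. assert (HS := Series_correct _ ex_series_2W).
  change (is_lim_seq (sum_n (fun m => 2 * W m)) (Series (fun m => 2 * W m))) in HS.
  apply is_lim_seq_spec in HS.
  destruct (HS (mkposreal eps He)) as [N HN]. exists N. intros n t Hn.
  unfold fsum, fpart.
  rewrite (Series_incr_n (fun m => fterm m t) (S n)) by (try lia; apply ex_series_fterm). simpl pred.
  rewrite <- sum_n_Reals.
  replace (sum_n (fun m => fterm m t) n + Series (fun k => fterm (S n + k) t) - sum_n (fun m => fterm m t) n)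
    with (Series (fun k => fterm (S n + k) t)) by ring.
  assert (Ht : ex_series (fun k => 2 * W (S n + k)%nat)).
  { apply (ex_series_incr_n (V := R_NormedModule) (fun m => 2 * W m) (S n)). apply ex_series_2W. }
  apply Rle_trans with (Series (fun k => 2 * W (S n + k)%nat)).
  { apply Series_abs_le; auto. intros k. apply fterm_bound. }
  specialize (HN n Hn). simpl in HN.
  rewrite (Series_incr_n (fun m => 2 * W m) (S n)) in HN by (try lia; apply ex_series_2W). simpl pred in HN.
  rewrite <- sum_n_Reals in HN. apply Rabs_def2 in HN. lra.
Qed.

Lemma fterm_continuous (m : nat) (t : R) : continuous (fterm m) t.
Proof.
  apply (ex_derive_continuous (fun t => fnorm m * (al m * cos (INR m * t) + be m * sin (INR m * t)))). auto_derive. auto.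
Qed.

Lemma fpart_continuous (n : nat) (t : R) : continuous (fpart n) t.
Proof.
  induction n as [|n IH].
  - apply continuous_ext with (fterm 0). intros s. unfold fpart. now rewrite sum_O. apply fterm_continuous.
  - apply continuous_ext with (fun s => plus (fpart n s) (fterm (S n) s)). intros s. unfold fpart. now rewrite sum_Sn.
    apply (continuous_plus (fpart n)). exact IH. apply fterm_continuous.
Qed.

Lemma fsum_continuous (t : R) : continuous fsum t.
Proof.
  apply continuity_pt_filterlim. intros eps He.
  destruct (fpart_uniform (eps / 4) ltac:(lra)) as [N HN].
  assert (C := fpart_continuous N t). apply continuity_pt_filterlim in C.
  destruct (C (eps / 4) ltac:(lra)) as [d [Hd HC]]. exists d. split; auto. intros s Hs. specialize (HC s Hs).
  simpl in *. unfold R_dist in *. assert (H1 := HN N s ltac:(lia)). assert (H2 := HN N t ltac:(lia)).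
  apply Rabs_def2 in HC. apply Rabs_le_between in H1. apply Rabs_le_between in H2. apply Rabs_def1; lra.
Qed.

Lemma fsum_periodic (t : R) : fsum (t + 2 * PI) = fsum t.
Proof.
  unfold fsum. apply Series_ext. intros m. unfold fterm.
  replace (INR m * (t + 2 * PI)) with (INR m * t + 2 * INR m * PI) by ring. now rewrite cos_period, sin_period.
Qed.

Lemma fterm_cos (m k : nat) : is_RInt (fun t => fterm m t * cos (INR k * t)) 0 (2 * PI) (if Nat.eqb m k then al k else 0).
Proof.
  assert (HP := PI_RGT_0).
  assert (H1 := is_RInt_lin _ _ _ _ (/ 2) (/ 2) _ _ (is_RInt_cos_sum m k) (is_RInt_cos_diff m k)).
  assert (H2 := is_RInt_lin _ _ _ _ (/ 2) (/ 2) _ _ (is_RInt_sin_sum m k) (is_RInt_sin_diff m k)).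
  assert (H := is_RInt_lin _ _ _ _ (fnorm m * al m) (fnorm m * be m) _ _ H1 H2).
  apply (is_RInt_eq _ _ _ _ _ _ H).
  - intros t. unfold fterm. rewrite cos_plus, cos_minus, sin_plus, sin_minus. field.
  - destruct (Nat.eqb_spec m k) as [->|E].
    + destruct (Nat.eqb_spec (k + k) 0) as [E2|E2]. replace k with 0%nat by lia. simpl. field. lra.
      destruct k; [lia|]. simpl. field. lra.
    + destruct (Nat.eqb_spec (m + k) 0) as [E2|E2]. lia. ring.
Qed.

(** At k = 0 the test function sin(0 t) is zero, so the moment is 0 in place of [be 0]. *)
Lemma fterm_sin (m k : nat) : is_RInt (fun t => fterm m t * sin (INR k * t)) 0 (2 * PI) (if Nat.eqb m k then (if Nat.eqb k 0 then 0 else be k) else 0).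
Proof.
  assert (HP := PI_RGT_0).
  assert (H1 := is_RInt_lin _ _ _ _ (/ 2) (- / 2) _ _ (is_RInt_cos_diff m k) (is_RInt_cos_sum m k)).
  assert (H2 := is_RInt_lin _ _ _ _ (/ 2) (- / 2) _ _ (is_RInt_sin_sum m k) (is_RInt_sin_diff m k)).
  assert (H := is_RInt_lin _ _ _ _ (fnorm m * al m) (fnorm m * be m) _ _ H2 H1).
  apply (is_RInt_eq _ _ _ _ _ _ H).
  - intros t. unfold fterm. rewrite cos_plus, cos_minus, sin_plus, sin_minus. field.
  - destruct (Nat.eqb_spec m k) as [->|E].
    + destruct (Nat.eqb_spec (k + k) 0) as [E2|E2]. replace k with 0%nat by lia. simpl. ring.
      destruct k; [lia|]. simpl. field. lra.
    + destruct (Nat.eqb_spec (m + k) 0) as [E2|E2]. lia. ring.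
Qed.

Lemma fpart_moment (e : R -> R) (c : nat -> R) (n : nat) :
  (forall m, is_RInt (fun t => fterm m t * e t) 0 (2 * PI) (c m)) ->
  is_RInt (fun t => fpart n t * e t) 0 (2 * PI) (sum_n c n).
Proof.
  intros H. induction n as [|n IH].
  - rewrite sum_O. apply is_RInt_ext with (fun t => fterm 0 t * e t). intros t _. unfold fpart. now rewrite sum_O. apply H.
  - rewrite sum_Sn. apply is_RInt_ext with (fun t => plus (fpart n t * e t) (fterm (S n) t * e t)).
    intros t _. unfold fpart. rewrite sum_Sn. unfold plus; simpl. asR. ring.
    apply @is_RInt_plus. exact IH. apply H.
Qed.

Lemma sum_n_single (k n : nat) (v : R) : (k <= n)%nat -> sum_n (fun m => if Nat.eqb m k then v else 0) n = v.
Proof.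
  assert (Z : forall p, (p < k)%nat -> sum_n (fun m => if Nat.eqb m k then v else 0) p = 0).
  { induction p as [|j IH]; intros Hj.
    - rewrite sum_O. destruct (Nat.eqb_spec 0 k); [lia|reflexivity].
    - rewrite sum_Sn, IH by lia. destruct (Nat.eqb_spec (S j) k); [lia|]. unfold plus; simpl. asR. ring. }
  induction n as [|n IH]; intros Hk.
  - rewrite sum_O. destruct (Nat.eqb_spec 0 k); [reflexivity|lia].
  - rewrite sum_Sn. destruct (Nat.eqb_spec (S n) k) as [E|E].
    + rewrite Z by lia. unfold plus; simpl. asR. ring.
    + rewrite IH by lia. unfold plus; simpl. asR. ring.
Qed.

(** For n >= k the partial sum already has the moment v, so the residual moment is, up to sign, that
    of the uniformly small tail. *)
Lemma residual_moment (e : R -> R) (k : nat) (v : R) :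
  (forall t, Rabs (e t) <= 1) -> (forall t, continuous e t) ->
  is_RInt (fun t => u t * e t) 0 (2 * PI) v ->
  (forall m, is_RInt (fun t => fterm m t * e t) 0 (2 * PI) (if Nat.eqb m k then v else 0)) ->
  is_RInt (fun t => (u t - fsum t) * e t) 0 (2 * PI) 0.
Proof.
  intros He Hce Hv Hm. assert (HP := PI_RGT_0).
  assert (Hex : ex_RInt (fun t => (u t - fsum t) * e t) 0 (2 * PI)).
  { apply (@ex_RInt_continuous R_CompleteNormedModule). intros t _.
    apply (continuous_mult (fun t => u t - fsum t) e); auto. apply (continuous_minus u fsum); auto. apply fsum_continuous. }
  destruct Hex as [I HI].
  replace 0 with I at 2; [exact HI|].
  destruct (Req_dec I 0) as [|Hn]; auto. exfalso.
  assert (Ha : 0 < Rabs I) by now apply Rabs_pos_lt.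
  (* Over the length 2 pi this tolerance yields |I| <= |I|/2. *)
  destruct (fpart_uniform (Rabs I / (4 * PI)) ltac:(apply Rdiv_lt_0_compat; lra)) as [N HN].
  set (n := max N k).
  assert (HP1 := fpart_moment e _ n Hm). rewrite sum_n_single in HP1 by (unfold n; lia).
  assert (H2 := is_RInt_lin _ _ _ _ 1 (-1) _ _ Hv HP1).
  assert (H3 := is_RInt_lin _ _ _ _ 1 (-1) _ _ H2 HI).
  assert (H4 : is_RInt (fun t => (fsum t - fpart n t) * e t) 0 (2 * PI) (- I)).
  { apply (is_RInt_eq _ _ _ _ _ _ H3). intros t. ring. ring. }
  assert (B : Rabs (- I) <= (2 * PI - 0) * (Rabs I / (4 * PI))).
  { rewrite <- (is_RInt_unique _ _ _ _ H4). apply abs_RInt_le_const. lra. eexists; exact H4.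
    intros t _. rewrite Rabs_mult. specialize (HN n t ltac:(unfold n; lia)).
    rewrite <- (Rmult_1_r (Rabs I / (4 * PI))). apply Rmult_le_compat; auto; apply Rabs_pos. }
  rewrite Rabs_Ropp in B. replace ((2 * PI - 0) * (Rabs I / (4 * PI))) with (Rabs I / 2) in B by (field; lra). lra.
Qed.

Lemma fourier_series (t : R) : u t = fsum t.
Proof.
  cut (u t - fsum t = 0). lra. revert t.
  apply (fourier_unique (fun t => u t - fsum t)).
  - intros t. apply (continuous_minus u fsum). apply Hu. apply fsum_continuous.
  - intros t. now rewrite Hper, fsum_periodic.
  - intros k. apply (residual_moment _ k (al k)); auto.
    intros t. apply Rabs_le, COS_bound.
    intros t. apply (ex_derive_continuous (fun t => cos (INR k * t))). auto_derive. auto.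
    intros m. apply fterm_cos.
  - intros k. apply (residual_moment _ k (if Nat.eqb k 0 then 0 else be k)); auto.
    intros t. apply Rabs_le, SIN_bound.
    intros t. apply (ex_derive_continuous (fun t => sin (INR k * t))). auto_derive. auto.
    destruct k as [|k]; simpl; [|apply (Hbe (S k))].
    apply is_RInt_ext with (fun _ => 0). intros t _. rewrite Rmult_0_l, sin_0. asR. ring.
    apply (is_RInt_eq _ _ _ _ _ _ (is_RInt_const_2PI 0)); auto; ring.
    intros m. apply fterm_sin.
Qed.
End FourierSeries.

(** * Convergent series in 1/r as asymptotic series *)

Lemma series_asymN_R (x : R) : 0 < x -> forall N (p : nat -> R) (W : R),
  (forall j, Rabs (p j) <= W * x ^ j) ->
  asymN N (fun y => RtoC (Series (fun j => (p j / y ^ j)%R))) (fun j => RtoC (p j)).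
Proof.
  intros Hx. induction N as [|N IH]; intros p W Hp.
  - exists (2 * W), (2 * x). intros y Hy. destruct (geom_dom_series p W x y Hx Hy Hp) as (H1 & H2 & H3).
    rewrite Cmod_R, <- H3. now apply Series_abs_le.
  - simpl. assert (A := IH (fun j => p (S j)) (W * x)).
    assert (A' : asymN N (fun y => RtoC (Series (fun j => (p (S j) / y ^ j)%R))) (fun j => RtoC (p (S j)))).
    { apply A. intros j. specialize (Hp (S j)). simpl in Hp. lra. }
    apply (asymN_ext N) with (3 := A') (X := 2 * x); auto.
    intros y Hy. destruct (geom_dom_series p W x y Hx Hy Hp) as (H1 & H2 & _).
    rewrite (Series_incr_1 (fun j => p j / y ^ j)) by (now apply ex_series_bound with (1 := H1)).
    rewrite (Series_ext (fun k => p (S k) / y ^ S k) (fun k => / y * (p (S k) / y ^ k))).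
    2:{ intros k. simpl. field. split. apply pow_nonzero; lra. lra. }
    rewrite Series_scal_l, <- RtoC_minus, <- RtoC_mult. f_equal. simpl. field. lra.
Qed.

Lemma is_series_C_parts (a : nat -> C) (l : C) : is_series a l ->
  is_series (fun j => fst (a j)) (fst l) /\ is_series (fun j => snd (a j)) (snd l).
Proof.
  intros H.
  assert (S1 : forall n, fst (sum_n a n) = sum_n (fun j => fst (a j)) n).
  { induction n as [|n IH]. now rewrite !sum_O. rewrite !sum_Sn, <- IH. reflexivity. }
  assert (S2 : forall n, snd (sum_n a n) = sum_n (fun j => snd (a j)) n).
  { induction n as [|n IH]. now rewrite !sum_O. rewrite !sum_Sn, <- IH. reflexivity. }
  assert (HB : forall eps : posreal, exists N, forall n, (N <= n)%nat ->
    Rabs (fst (sum_n a n) - fst l) < eps /\ Rabs (snd (sum_n a n) - snd l) < eps).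
  { intros eps. destruct (proj1 (filterlim_locally _ _) H eps) as [N HN]. exists N.
    intros n Hn. exact (HN n Hn). }
  split.
  - change (is_lim_seq (sum_n (fun j => fst (a j))) (fst l)). apply is_lim_seq_spec. intros eps.
    destruct (HB eps) as [N HN]. exists N. intros n Hn. rewrite <- S1. apply (HN n Hn).
  - change (is_lim_seq (sum_n (fun j => snd (a j))) (snd l)). apply is_lim_seq_spec. intros eps.
    destruct (HB eps) as [N HN]. exists N. intros n Hn. rewrite <- S2. apply (HN n Hn).
Qed.

Lemma C_re_im (z : C) : z = (RtoC (fst z) + Ci * RtoC (snd z))%C.
Proof. destruct z as [a b]. unfold RtoC, Ci, Cplus, Cmult; simpl. f_equal; ring. Qed.

Lemma fst_div_pow (z : C) (r : R) (j : nat) : 0 < r ->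
  fst (z / RtoC (r ^ j))%C = fst z / r ^ j /\ snd (z / RtoC (r ^ j))%C = snd z / r ^ j.
Proof.
  intros Hr. assert (Hp : r ^ j <> 0) by (apply pow_nonzero; lra).
  unfold Cdiv. rewrite <- RtoC_inv by auto. destruct z as [a b]. unfold Cmult, RtoC; simpl. split; unfold Rdiv; ring.
Qed.

Lemma karp_series_asym (F : nat -> C) (A : R -> C) (rho M K : R) : 0 < rho -> 0 < K ->
  (forall r, rho <= r -> is_series (fun j => (F j / RtoC (r ^ j))%C) (A r)) ->
  (forall j, Cmod (F j) <= M * K ^ j) -> asym A F.
Proof.
  intros Hrho HK HA HF N.
  assert (B1 : forall j, Rabs (fst (F j)) <= M * K ^ j). { intros j. apply Rle_trans with (2 := HF j). apply Rabs_fst_le. }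
  assert (B2 : forall j, Rabs (snd (F j)) <= M * K ^ j). { intros j. apply Rle_trans with (2 := HF j). apply Rabs_snd_le. }
  assert (A1 := asymN_plus N _ _ _ _ (series_asymN_R K HK N _ M B1) (asymN_scal N Ci _ _ (series_asymN_R K HK N _ M B2))).
  apply (asymN_ext N) with (3 := A1) (X := rho).
  - intros r Hr. destruct (is_series_C_parts _ _ (HA r Hr)) as [S1 S2].
    rewrite (C_re_im (A r)). rewrite <- (is_series_unique _ _ S1), <- (is_series_unique _ _ S2).
    f_equal; [|f_equal]; f_equal; apply Series_ext; intros j; symmetry; apply fst_div_pow; lra.
  - intros j. symmetry. apply C_re_im.
Qed.

(** Absolute convergence at one radius gives geometric growth of the coefficients, the form in which
    convergence enters the uniqueness argument. *)
Lemma series_terms_bounded (F : nat -> C) (r : R) : 0 < r ->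
  ex_series (fun j => Cmod (F j / RtoC (r ^ j))%C) -> exists M, 0 <= M /\ forall j, Cmod (F j) <= M * r ^ j.
Proof.
  intros Hr H. apply ex_series_lim_0 in H. apply is_lim_seq_Reals in H.
  destruct (maj_by_pos _ (exist _ 0 H)) as [M [HM HMn]]. exists M. split. lra. intros j. specialize (HMn j).
  assert (Hp : 0 < r ^ j) by (now apply pow_lt).
  rewrite Rabs_pos_eq in HMn by apply Cmod_ge_0.
  unfold Cdiv in HMn. rewrite <- RtoC_inv in HMn by lra. rewrite Cmod_mult, Cmod_R in HMn.
  rewrite Rabs_pos_eq in HMn by (apply Rlt_le, Rinv_0_lt_compat; auto).
  apply Rmult_le_reg_r with (/ r ^ j). now apply Rinv_0_lt_compat. rewrite Rmult_assoc, Rinv_r, Rmult_1_r by lra. exact HMn.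
Qed.

(** * Cauchy products of coefficient sequences *)

Lemma conv_Sr (a b : nat -> C) (n : nat) :
  conv a b (S n) = (conv a (fun j => b (S j)) n + a (S n) * b 0%nat)%C.
Proof.
  unfold conv. rewrite sum_Sn. change plus with Cplus. rewrite Nat.sub_diag. f_equal.
  apply sum_n_ext_loc. intros k Hk. now replace (S n - k)%nat with (S (n - k)) by lia.
Qed.

Lemma conv_comm (n : nat) : forall a b : nat -> C, conv a b n = conv b a n.
Proof.
  induction n as [|n IH]; intros a b.
  - unfold conv. rewrite !sum_O. apply Cmult_comm.
  - rewrite conv_S, conv_Sr, IH. ring.
Qed.

Lemma conv_ext (a a' b b' : nat -> C) (n : nat) : (forall j, a j = a' j) -> (forall j, b j = b' j) -> conv a b n = conv a' b' n.
Proof. intros H1 H2. unfold conv. apply sum_n_ext. intros k. now rewrite H1, H2. Qed.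

Lemma conv_dilate (c : R) (a b : nat -> C) (n : nat) :
  conv (fun j => a j * RtoC (c ^ j))%C (fun j => b j * RtoC (c ^ j))%C n = (RtoC (c ^ n) * conv a b n)%C.
Proof.
  unfold conv. rewrite <- sum_n_C_scal. apply sum_n_ext_loc. intros k Hk.
  replace (c ^ n) with (c ^ k * c ^ (n - k)). rewrite RtoC_mult. asC. ring.
  rewrite <- pow_add. f_equal. lia.
Qed.

Lemma conv_minus_l (a a' b : nat -> C) (n : nat) : conv (fun j => a j - a' j)%C b n = (conv a b n - conv a' b n)%C.
Proof.
  unfold conv. induction n as [|n IH] using nat_ind.
  - rewrite !sum_O. asC. ring.
  - clear IH. transitivity (sum_n (fun k => a k * b (S n - k)%nat + RtoC (-1) * (a' k * b (S n - k)%nat))%C (S n)).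
    apply sum_n_ext. intros k. rewrite Cminus1. asC. ring.
    assert (G : forall (f g : nat -> C) m, sum_n (fun k => f k + g k)%C m = (sum_n f m + sum_n g m)%C).
    { intros f g m. exact (sum_n_plus f g m). }
    rewrite G, sum_n_C_scal, Cminus1. asC. ring.
Qed.

(** * The coefficients f in terms of F and G *)

Definition hcoef0 (kappa : R) (j : nat) : C := (Cnu 0 j / RtoC (kappa ^ j))%C.
Definition hcoef1 (kappa : R) (j : nat) : C := (h1coef j / RtoC (kappa ^ j))%C.

Lemma karp_coefficients (kappa R0 : R) (f a b : nat -> C) (p A B : R -> C) : 0 < kappa ->
  (forall r, R0 <= r -> p r = (hankel1 0 (kappa * r) * A r + hankel1 1 (kappa * r) * B r)%C) ->
  asym (fun r => p r / outgoing_factor kappa r)%C f -> asym A a -> asym B b ->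
  forall n, f n = (conv (hcoef0 kappa) a n + conv (hcoef1 kappa) b n)%C.
Proof.
  intros Hk Hp Hf HA HB n.
  assert (H := asym_plus _ _ _ _ (asym_mult _ _ _ _ (asym_dilate kappa _ _ Hk asym_hnorm_0) HA)
    (asym_mult _ _ _ _ (asym_dilate kappa _ _ Hk asym_hnorm_1) HB)).
  apply (asym_unique n _ f (fun n => conv (hcoef0 kappa) a n + conv (hcoef1 kappa) b n)%C Hf).
  apply asym_ext with (3 := H) (X := Rmax R0 1); auto.
  intros r Hr. assert (H1 := Rmax_l R0 1). assert (H2 := Rmax_r R0 1).
  rewrite Hp, outgoing_factor_scal, Cdiv_outgoing by nra. unfold hnorm. ring.
Qed.

(** Multiplying the j-th coefficient by kappa^j commutes with convolution and reduces the claim to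
    [formal_unique], with K replaced by kappa K. *)
Lemma karp_coefficients_unique (kappa K M : R) (a b a' b' : nat -> C) : 0 < kappa -> 0 <= K -> 0 <= M ->
  (forall j, Cmod (a j) <= M * K ^ j) -> (forall j, Cmod (b j) <= M * K ^ j) ->
  (forall j, Cmod (a' j) <= M * K ^ j) -> (forall j, Cmod (b' j) <= M * K ^ j) ->
  (forall n, conv (hcoef0 kappa) a n + conv (hcoef1 kappa) b n = conv (hcoef0 kappa) a' n + conv (hcoef1 kappa) b' n)%C ->
  forall n, a n = a' n /\ b n = b' n.
Proof.
  intros Hk HK HM Ha Hb Ha' Hb' E n.
  assert (HkC : forall j, RtoC (kappa ^ j) <> RtoC 0) by (intros j; apply RtoC_neq_0, pow_nonzero; lra).
  assert (Bd : forall u v : nat -> C, (forall j, Cmod (u j) <= M * K ^ j) -> (forall j, Cmod (v j) <= M * K ^ j) ->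
    forall j, Cmod ((u j - v j) * RtoC (kappa ^ j))%C <= 2 * M * (kappa * K) ^ j).
  { intros u v Hu Hv j. rewrite Cmod_mult, Cmod_R, Rabs_pos_eq, Rpow_mult_distr by (apply pow_le; lra).
    replace (2 * M * (kappa ^ j * K ^ j)) with ((M * K ^ j + M * K ^ j) * kappa ^ j) by ring.
    apply Rmult_le_compat_r. apply pow_le; lra. apply Rle_trans with (1 := Cmod_triangle _ _). rewrite Cmod_opp.
    apply Rplus_le_compat; auto. }
  destruct (formal_unique n (kappa * K) (2 * M) (fun j => (a j - a' j) * RtoC (kappa ^ j))%C (fun j => (b j - b' j) * RtoC (kappa ^ j))%C) as [E1 E2].
  - apply Rmult_le_pos; lra.
  - lra.
  - now apply Bd.
  - now apply Bd.
  - intros m.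
    rewrite (conv_ext _ (fun j => (a j - a' j) * RtoC (kappa ^ j))%C (Cnu 0) (fun j => hcoef0 kappa j * RtoC (kappa ^ j))%C); auto.
    2:{ intros j. unfold hcoef0. field. auto. }
    rewrite (conv_ext _ (fun j => (b j - b' j) * RtoC (kappa ^ j))%C h1coef (fun j => hcoef1 kappa j * RtoC (kappa ^ j))%C); auto.
    2:{ intros j. unfold hcoef1. field. auto. }
    rewrite !(conv_dilate kappa (fun j => _ - _)%C), !conv_minus_l, !(conv_comm m _ (hcoef0 kappa)), !(conv_comm m _ (hcoef1 kappa)).
    transitivity (RtoC (kappa ^ m) * ((conv (hcoef0 kappa) a m + conv (hcoef1 kappa) b m) - (conv (hcoef0 kappa) a' m + conv (hcoef1 kappa) b' m)))%C.
    ring. rewrite E. ring.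
  - assert (G : forall z : C, (z * RtoC (kappa ^ n))%C = RtoC 0 -> z = RtoC 0).
    { intros z Hz. transitivity (z * RtoC (kappa ^ n) / RtoC (kappa ^ n))%C. field; auto. rewrite Hz. field; auto. }
    apply G in E1. apply G in E2. split.
    transitivity ((a n - a' n) + a' n)%C. ring. rewrite E1. ring.
    transitivity ((b n - b' n) + b' n)%C. ring. rewrite E2. ring.
Qed.

(** * The expansion of a radiating field *)

Section RadiatingField.
Variables (kappa rho : R) (psi : R -> R -> C).
Hypothesis (Hk : 0 < kappa) (Hrho : 0 < rho).
Let uR (x y : R) : R := Re (psi x y).
Let uI (x y : R) : R := Im (psi x y).
Hypothesis HregR : forall x y, rho ^ 2 < x ^ 2 + y ^ 2 -> ex_diff_n uR 2 x y.
Hypothesis HregI : forall x y, rho ^ 2 < x ^ 2 + y ^ 2 -> ex_diff_n uI 2 x y.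
Hypothesis HhelmR : forall x y, rho ^ 2 < x ^ 2 + y ^ 2 ->
  Derive_n (fun s => uR s y) 2 x + Derive_n (fun s => uR x s) 2 y + kappa ^ 2 * uR x y = 0.
Hypothesis HhelmI : forall x y, rho ^ 2 < x ^ 2 + y ^ 2 ->
  Derive_n (fun s => uI s y) 2 x + Derive_n (fun s => uI x s) 2 y + kappa ^ 2 * uI x y = 0.
Hypothesis Hrad : forall eps : R, 0 < eps -> exists r0 : R, forall r phi : R, r0 < r ->
  Cmod (RtoC (sqrt r) * (radial_derivative psi r phi - Ci * RtoC kappa * polar psi r phi))%C < eps.

Section Mode.
Variables (m : nat) (e e' : R -> R).
Hypothesis He : forall t, is_derive e t (e' t).
Hypothesis He' : forall t, is_derive e' t (- INR m ^ 2 * e t).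
Hypothesis He2 : e (2 * PI) = e 0.
Hypothesis He'2 : e' (2 * PI) = e' 0.
Hypothesis Hb : forall t, Rabs (e t) <= 1.

Definition cmode (j : nat) (r : R) : C := (mode uR e j r, mode uI e j r).

Lemma cmode_der (r : R) : rho < r -> Cder (cmode 0) r (cmode 1 r).
Proof.
  intros Hr. split; simpl.
  - apply (mode_derive rho Hrho uR HregR e e' He 0 r); auto.
  - apply (mode_derive rho Hrho uI HregI e e' He 0 r); auto.
Qed.

Lemma cmode_der1 (r : R) : rho < r ->
  Cder (cmode 1) r (- (RtoC (/ r) * cmode 1 r) - RtoC (kappa ^ 2 - INR m ^ 2 / r ^ 2) * cmode 0 r)%C.
Proof.
  intros Hr. apply Cder_eq with (cmode 2 r).
  - split; simpl.
    + apply (mode_derive rho Hrho uR HregR e e' He 1 r); auto.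
    + apply (mode_derive rho Hrho uI HregI e e' He 1 r); auto.
  - assert (O1 := mode_ode rho Hrho kappa uR HregR HhelmR m e e' He He' He2 He'2 r Hr).
    assert (O2 := mode_ode rho Hrho kappa uI HregI HhelmI m e e' He He' He2 He'2 r Hr).
    assert (G : forall a0 a1 a2, r ^ 2 * a2 + r * a1 + (kappa ^ 2 * r ^ 2 - INR m ^ 2) * a0 = 0 ->
      a2 = - (/ r * a1) - (kappa ^ 2 - INR m ^ 2 / r ^ 2) * a0).
    { intros a0 a1 a2 H. apply Rmult_eq_reg_l with (r ^ 2). 2: apply pow_nonzero; lra.
      replace (r ^ 2 * (- (/ r * a1) - (kappa ^ 2 - INR m ^ 2 / r ^ 2) * a0)) with
        (- (r * a1 + (kappa ^ 2 * r ^ 2 - INR m ^ 2) * a0)) by (field; lra). lra. }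
    apply G in O1. apply G in O2. unfold cmode. rewrite O1, O2.
    unfold Cminus, Cplus, Copp, Cmult, RtoC; simpl. f_equal; ring.
Qed.

Lemma radial_derivative_upol (r phi : R) : rho < r ->
  radial_derivative psi r phi = (upol uR 1 r phi, upol uI 1 r phi).
Proof.
  intros Hr. unfold radial_derivative. f_equal; apply is_derive_unique.
  - apply (upol_derive rho Hrho uR HregR 0 r phi); auto.
  - apply (upol_derive rho Hrho uI HregI 0 r phi); auto.
Qed.

Lemma polar_upol (r t : R) : polar psi r t = (upol uR 0 r t, upol uI 0 r t).
Proof. exact (surjective_pairing (psi (r * cos t) (r * sin t))). Qed.

(** Uniformity in direction lets the radiation condition pass through the angular integral. The
    tolerance eps/(8 pi) becomes eps/4 over the length 2 pi, once for each of the two components. *)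
Lemma cmode_radiates : Clim0 (fun r => RtoC (sqrt r) * (cmode 1 r - Ci * RtoC kappa * cmode 0 r))%C.
Proof.
  assert (HP := PI_RGT_0).
  apply is_lim_spec. intros eps. assert (Hep := cond_pos eps).
  destruct (Hrad (eps / (8 * PI)) ltac:(apply Rdiv_lt_0_compat; lra)) as [r0 Hr0].
  exists (Rmax r0 rho). intros r Hr. assert (R1 := Rmax_l r0 rho). assert (R2 := Rmax_r r0 rho).
  assert (Hr' : rho < r) by lra.
  rewrite Rminus_0_r, Rabs_pos_eq by apply Cmod_ge_0.
  assert (P : forall t, Rabs (sqrt r * (upol uR 1 r t + kappa * upol uI 0 r t)) <= eps / (8 * PI) /\
    Rabs (sqrt r * (upol uI 1 r t - kappa * upol uR 0 r t)) <= eps / (8 * PI)).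
  { intros t. specialize (Hr0 r t ltac:(lra)). rewrite radial_derivative_upol in Hr0 by auto.
    rewrite polar_upol in Hr0.
    set (z := (RtoC (sqrt r) * ((upol uR 1 r t, upol uI 1 r t) - Ci * RtoC kappa * (upol uR 0 r t, upol uI 0 r t)))%C) in Hr0.
    replace (sqrt r * (upol uR 1 r t + kappa * upol uI 0 r t)) with (fst z).
    replace (sqrt r * (upol uI 1 r t - kappa * upol uR 0 r t)) with (snd z).
    split; apply Rlt_le; apply Rle_lt_trans with (2 := Hr0). apply Rabs_fst_le. apply Rabs_snd_le.
    unfold z, Cminus, Cplus, Copp, Cmult, Ci, RtoC; simpl. ring.
    unfold z, Cminus, Cplus, Copp, Cmult, Ci, RtoC; simpl. ring. }
  assert (MR := fun j => is_RInt_mode rho Hrho uR HregR e e' He j r Hr').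
  assert (MI := fun j => is_RInt_mode rho Hrho uI HregI e e' He j r Hr').
  assert (B : forall (f : R -> R) v, is_RInt (fun t => f t * e t) 0 (2 * PI) v ->
     (forall t, Rabs (sqrt r * f t) <= eps / (8 * PI)) -> Rabs (sqrt r * v) <= eps / 4).
  { intros f v Hv Hf.
    assert (Hv' : is_RInt (fun t => sqrt r * (f t * e t)) 0 (2 * PI) (sqrt r * v)) by (apply (is_RInt_scal (fun t => f t * e t)); exact Hv).
    rewrite <- (is_RInt_unique _ _ _ _ Hv').
    replace (eps / 4) with ((2 * PI - 0) * (eps / (8 * PI))) by (field; lra).
    apply abs_RInt_le_const. lra. eexists; exact Hv'. intros t _. rewrite <- Rmult_assoc, Rabs_mult.
    rewrite <- (Rmult_1_r (eps / (8 * PI))). apply Rmult_le_compat; auto; apply Rabs_pos. }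
  assert (B1 := B (fun t => 1 * upol uR 1 r t + kappa * upol uI 0 r t) (1 * mode uR e 1 r + kappa * mode uI e 0 r)).
  assert (B2 := B (fun t => 1 * upol uI 1 r t + - kappa * upol uR 0 r t) (1 * mode uI e 1 r + - kappa * mode uR e 0 r)).
  assert (C1 : Rabs (sqrt r * (1 * mode uR e 1 r + kappa * mode uI e 0 r)) <= eps / 4).
  { apply B1. apply (is_RInt_eq _ _ _ _ _ _ (is_RInt_lin _ _ _ _ 1 kappa _ _ (MR 1%nat) (MI 0%nat))); auto. intros; ring.
    intros t. rewrite Rmult_1_l. apply P. }
  assert (C2 : Rabs (sqrt r * (1 * mode uI e 1 r + - kappa * mode uR e 0 r)) <= eps / 4).
  { apply B2. apply (is_RInt_eq _ _ _ _ _ _ (is_RInt_lin _ _ _ _ 1 (- kappa) _ _ (MI 1%nat) (MR 0%nat))); auto. intros; ring.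
    intros t. replace (1 * upol uI 1 r t + - kappa * upol uR 0 r t) with (upol uI 1 r t - kappa * upol uR 0 r t) by ring. apply P. }
  apply Rle_lt_trans with (1 := Cmod_le_abs _).
  match goal with |- Rabs ?a + Rabs ?b < _ =>
    replace a with (sqrt r * (1 * mode uR e 1 r + kappa * mode uI e 0 r)) by (unfold cmode; simpl; ring);
    replace b with (sqrt r * (1 * mode uI e 1 r + - kappa * mode uR e 0 r)) by (unfold cmode; simpl; ring) end.
  lra.
Qed.

Lemma cmode_hankel : exists c : C, forall r, rho < r -> cmode 0 r = (c * Hank m (kappa * r))%C.
Proof. exact (radiating_mode kappa rho m (cmode 0) (cmode 1) Hk Hrho cmode_der cmode_der1 cmode_radiates). Qed.

Lemma cmode_ratio (r1 r : R) : rho < r1 -> rho < r ->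
  cmode 0 r = (cmode 0 r1 / Hank m (kappa * r1) * Hank m (kappa * r))%C.
Proof.
  intros H1 Hr. destruct cmode_hankel as [c Hc]. rewrite (Hc r Hr), (Hc r1 H1).
  assert (Hn : Hank m (kappa * r1) <> RtoC 0) by (apply Hank_neq_0; nra). field. auto.
Qed.

Lemma cmode_bound (r1 B : R) : rho < r1 ->
  (forall t, 0 <= t <= 2 * PI -> Rabs (upol uR 0 r1 t) <= B /\ Rabs (upol uI 0 r1 t) <= B) -> Cmod (cmode 0 r1) <= 4 * PI * B.
Proof.
  intros Hr HB. assert (HP := PI_RGT_0). apply Rle_trans with (1 := Cmod_le_abs _). simpl.
  assert (G : forall u, is_RInt (fun t => upol u 0 r1 t * e t) 0 (2 * PI) (mode u e 0 r1) ->
    (forall t, 0 <= t <= 2 * PI -> Rabs (upol u 0 r1 t) <= B) -> Rabs (mode u e 0 r1) <= (2 * PI - 0) * B).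
  { intros u Hu HuB. rewrite <- (is_RInt_unique _ _ _ _ Hu). apply abs_RInt_le_const. lra. eexists; exact Hu.
    intros t Ht. rewrite Rabs_mult. rewrite <- (Rmult_1_r B). apply Rmult_le_compat; auto; apply Rabs_pos. }
  assert (G1 := G uR (is_RInt_mode rho Hrho uR HregR e e' He 0 r1 Hr) (fun t Ht => proj1 (HB t Ht))).
  assert (G2 := G uI (is_RInt_mode rho Hrho uI HregI e e' He 0 r1 Hr) (fun t Ht => proj2 (HB t Ht))).
  lra.
Qed.
End Mode.

(** Reference circle in the exterior: amplitudes are read off there by dividing by H_m(kappa r1),
    which never vanishes. *)
Let r1 : R := rho + 1.
Let x1 : R := kappa * r1.

Definition ecos (m : nat) (t : R) : R := cos (INR m * t).
Definition esin (m : nat) (t : R) : R := sin (INR m * t).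

Lemma ecos_der (m : nat) (t : R) : is_derive (ecos m) t (- INR m * esin m t).
Proof. unfold ecos, esin. generalize (INR m). intros c. auto_derive. auto. ring. Qed.
Lemma esin_der (m : nat) (t : R) : is_derive (esin m) t (INR m * ecos m t).
Proof. unfold ecos, esin. generalize (INR m). intros c. auto_derive. auto. ring. Qed.
Lemma ecos_der2 (m : nat) (t : R) : is_derive (fun t => - INR m * esin m t) t (- INR m ^ 2 * ecos m t).
Proof. evar_last. apply der_scal, esin_der. ring. Qed.
Lemma esin_der2 (m : nat) (t : R) : is_derive (fun t => INR m * ecos m t) t (- INR m ^ 2 * esin m t).
Proof. evar_last. apply der_scal, ecos_der. ring. Qed.
Lemma ecos_2PI (m : nat) : ecos m (2 * PI) = ecos m 0.
Proof.
  unfold ecos. replace (INR m * (2 * PI)) with (INR m * 0 + 2 * INR m * PI) by ring. apply cos_period.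
Qed.
Lemma esin_2PI (m : nat) : esin m (2 * PI) = esin m 0.
Proof.
  unfold esin. replace (INR m * (2 * PI)) with (INR m * 0 + 2 * INR m * PI) by ring. apply sin_period.
Qed.

Lemma ecos_PI (m : nat) (t : R) : ecos m (t + PI) = (-1) ^ m * ecos m t.
Proof.
  unfold ecos. replace (INR m * (t + PI)) with (INR m * t + INR m * PI) by ring.
  induction m as [|m IH].
  - simpl. rewrite !Rmult_0_l, Rplus_0_l. ring.
  - rewrite S_INR. rewrite cos_plus.
    assert (C : forall k : nat, cos (INR k * PI) = (-1) ^ k /\ sin (INR k * PI) = 0).
    { induction k as [|k [IC IS]]. simpl. rewrite Rmult_0_l, cos_0, sin_0. auto.
      rewrite S_INR. replace ((INR k + 1) * PI) with (INR k * PI + PI) by ring. rewrite neg_cos, neg_sin, IC, IS. simpl. split; ring. }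
    rewrite <- S_INR. destruct (C (S m)) as [-> ->]. ring.
Qed.

Lemma esin_PI (m : nat) (t : R) : esin m (t + PI) = (-1) ^ m * esin m t.
Proof.
  unfold esin. replace (INR m * (t + PI)) with (INR m * t + INR m * PI) by ring.
  assert (C : forall k : nat, cos (INR k * PI) = (-1) ^ k /\ sin (INR k * PI) = 0).
  { induction k as [|k [IC IS]]. simpl. rewrite Rmult_0_l, cos_0, sin_0. auto.
    rewrite S_INR. replace ((INR k + 1) * PI) with (INR k * PI + PI) by ring. rewrite neg_cos, neg_sin, IC, IS. simpl. split; ring. }
  rewrite sin_plus. destruct (C m) as [-> ->]. ring.
Qed.

Definition ampc (m : nat) : C := (cmode (ecos m) 0 r1 / Hank m x1)%C.
Definition amps (m : nat) : C := (cmode (esin m) 0 r1 / Hank m x1)%C.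

(** The angular factor of order m; times H_m(kappa r) it is the m-th Fourier term of the field. *)
Definition tm (phi : R) (m : nat) : C :=
  (RtoC (fnorm m) * (ampc m * RtoC (ecos m phi) + amps m * RtoC (esin m phi)))%C.

Lemma tm_PI (phi : R) (m : nat) : tm (phi + PI) m = (RtoC ((-1) ^ m) * tm phi m)%C.
Proof. unfold tm. rewrite ecos_PI, esin_PI, !RtoC_mult. ring. Qed.

Lemma r1_gt : rho < r1.
Proof. unfold r1. lra. Qed.
Lemma x1_pos : 0 < x1.
Proof. unfold x1. assert (H := r1_gt). nra. Qed.

Lemma ecos_mode (m : nat) (r : R) : rho < r -> cmode (ecos m) 0 r = (ampc m * Hank m (kappa * r))%C.
Proof.
  intros Hr. unfold ampc, x1. assert (E' : - INR m * esin m (2 * PI) = - INR m * esin m 0) by now rewrite esin_2PI.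
  exact (cmode_ratio m (ecos m) (fun t => - INR m * esin m t) (ecos_der m) (ecos_der2 m) (ecos_2PI m) E'
    (fun t => Rabs_cos_le1 _) r1 r r1_gt Hr).
Qed.

Lemma esin_mode (m : nat) (r : R) : rho < r -> cmode (esin m) 0 r = (amps m * Hank m (kappa * r))%C.
Proof.
  intros Hr. unfold amps, x1. assert (E' : INR m * ecos m (2 * PI) = INR m * ecos m 0) by now rewrite ecos_2PI.
  exact (cmode_ratio m (esin m) (fun t => INR m * ecos m t) (esin_der m) (esin_der2 m) (esin_2PI m) E'
    (fun t => Rabs_sin_le1 _) r1 r r1_gt Hr).
Qed.

(** Continuity of psi bounds its modes on the reference circle independently of m; the decay comes
    from the denominator H_m. *)
Lemma amp_bound : exists T, 0 <= T /\ forall m,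
  Cmod (ampc m) <= T / Cmod (Hank m x1) /\ Cmod (amps m) <= T / Cmod (Hank m x1).
Proof.
  assert (HP := PI_RGT_0).
  assert (CR : forall t, continuous (upol uR 0 r1) t).
  { intros t. apply continuity_2d_snd. apply (upol_continuity rho Hrho uR HregR). apply r1_gt. }
  assert (CI : forall t, continuous (upol uI 0 r1) t).
  { intros t. apply continuity_2d_snd. apply (upol_continuity rho Hrho uI HregI). apply r1_gt. }
  destruct (continuous_bounded (upol uR 0 r1) CR 0 (2 * PI) ltac:(lra)) as [B1 [HB1 HB1t]].
  destruct (continuous_bounded (upol uI 0 r1) CI 0 (2 * PI) ltac:(lra)) as [B2 [HB2 HB2t]].
  assert (HB : forall t, 0 <= t <= 2 * PI -> Rabs (upol uR 0 r1 t) <= B1 + B2 /\ Rabs (upol uI 0 r1 t) <= B1 + B2).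
  { intros t Ht. specialize (HB1t t Ht). specialize (HB2t t Ht). lra. }
  exists (4 * PI * (B1 + B2)). split. apply Rmult_le_pos; lra.
  intros m. assert (Hh := Hank_abs_pos m x1 x1_pos).
  assert (Hn : Hank m x1 <> RtoC 0) by (apply Hank_neq_0, x1_pos).
  unfold ampc, amps. rewrite !Cmod_div by auto.
  split; apply Rmult_le_compat_r; try (apply Rlt_le, Rinv_0_lt_compat; auto).
  - exact (cmode_bound (ecos m) (fun t => - INR m * esin m t) (ecos_der m) (fun t => Rabs_cos_le1 _) r1 _ r1_gt HB).
  - exact (cmode_bound (esin m) (fun t => INR m * ecos m t) (esin_der m) (fun t => Rabs_sin_le1 _) r1 _ r1_gt HB).
Qed.

Lemma tm_summable (phi : R) : ex_series (fun m => Cmod (tm phi m) * maj (4 * x1) m).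
Proof.
  destruct amp_bound as [T [HT HTm]].
  apply ex_series_bound with (fun m => 2 * T * (maj (4 * x1) m / Cmod (Hank m x1))).
  2: apply ex_series_scal_R, lommel_summable, x1_pos.
  intros m. assert (Hh := Hank_abs_pos m x1 x1_pos). assert (HX := x1_pos). assert (HM := maj_ge_1 (4 * x1) m ltac:(lra)).
  rewrite Rabs_pos_eq. 2:{ apply Rmult_le_pos. apply Cmod_ge_0. lra. }
  replace (2 * T * (maj (4 * x1) m / Cmod (Hank m x1))) with (2 * (T / Cmod (Hank m x1)) * maj (4 * x1) m) by (field; lra).
  apply Rmult_le_compat_r. lra.
  destruct (HTm m) as [H1 H2]. assert (Hf := fnorm_bounds m).
  unfold tm. rewrite Cmod_mult, Cmod_R, Rabs_pos_eq by lra.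
  assert (H3 : Cmod (ampc m * RtoC (ecos m phi) + amps m * RtoC (esin m phi))%C <= 2 * (T / Cmod (Hank m x1))).
  { apply Rle_trans with (1 := Cmod_triangle _ _). rewrite !Cmod_mult, !Cmod_R.
    assert (A1 : Rabs (ecos m phi) <= 1) by apply Rabs_cos_le1. assert (A2 : Rabs (esin m phi) <= 1) by apply Rabs_sin_le1.
    assert (Cmod (ampc m) * Rabs (ecos m phi) <= T / Cmod (Hank m x1) * 1) by (apply Rmult_le_compat; auto using Cmod_ge_0, Rabs_pos).
    assert (Cmod (amps m) * Rabs (esin m phi) <= T / Cmod (Hank m x1) * 1) by (apply Rmult_le_compat; auto using Cmod_ge_0, Rabs_pos). lra. }
  assert (H4 := Cmod_ge_0 (ampc m * RtoC (ecos m phi) + amps m * RtoC (esin m phi))%C). nra.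
Qed.

(** Far out, kappa r >= 4 x1, so the m-th mode is at most a constant times [maj (4 * x1) m] over
    |H_m(x1)|. This summable bound yields uniform convergence of the Fourier series. *)
Lemma polar_expansion (r phi : R) : 8 * r1 <= r ->
  polar psi r phi = CSeries (fun m => tm phi m * Hank m (kappa * r))%C.
Proof.
  intros Hr. assert (Hr1 := r1_gt). assert (Hrr : rho < r) by lra. assert (HX := x1_pos).
  assert (Hy : 4 * x1 <= kappa * r). { unfold x1. nra. }
  assert (Hy0 : 0 < kappa * r) by lra.
  destruct amp_bound as [T [HT HTm]].
  set (h := Cmod (hankel1 0 (kappa * r)) + Cmod (hankel1 1 (kappa * r))).
  assert (Hh0 : 0 <= h) by (unfold h; assert (H1 := Cmod_ge_0 (hankel1 0 (kappa * r))); assert (H2 := Cmod_ge_0 (hankel1 1 (kappa * r))); lra).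
  (* [T] bounds the amplitudes through [amp_bound]; [h] collects H_0 and H_1 at kappa r, the initial
     values of the recurrence. *)
  set (W := fun m => T * h * (maj (4 * x1) m / Cmod (Hank m x1))).
  assert (HW : ex_series W) by (apply ex_series_scal_R, lommel_summable, x1_pos).
  assert (HWc : forall m c, Cmod c <= T / Cmod (Hank m x1) -> Cmod (c * Hank m (kappa * r))%C <= W m).
  { intros m c Hc. rewrite Cmod_mult. unfold W. assert (Hh := Hank_abs_pos m x1 x1_pos).
    replace (T * h * (maj (4 * x1) m / Cmod (Hank m x1))) with (T / Cmod (Hank m x1) * (maj (4 * x1) m * h)) by (field; lra).
    apply Rmult_le_compat; auto using Cmod_ge_0.
    apply Rle_trans with (1 := Cmod_cyl_le (kappa * r) _ _ m Hy0). apply Rmult_le_compat_r; auto. apply maj_decr; lra. }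
  assert (HWcos : forall m, Cmod (cmode (ecos m) 0 r) <= W m).
  { intros m. rewrite ecos_mode by auto. exact (HWc m _ (proj1 (HTm m))). }
  assert (HWsin : forall m, Cmod (cmode (esin m) 0 r) <= W m).
  { intros m. rewrite esin_mode by auto. exact (HWc m _ (proj2 (HTm m))). }
  assert (Hper : forall u x, upol u 0 r (x + 2 * PI) = upol u 0 r x).
  { intros u x. unfold upol, at_polar. assert (H1 := cos_period x 1). assert (H2 := sin_period x 1). simpl INR in *.
    rewrite Rmult_1_r in *. now rewrite H1, H2. }
  assert (ER := fourier_series (upol uR 0 r) (fun m => fst (cmode (ecos m) 0 r)) (fun m => fst (cmode (esin m) 0 r)) W
    (fun x => continuity_2d_snd _ _ _ (upol_continuity rho Hrho uR HregR 0 r x Hrr)) (Hper uR)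
    (fun m => is_RInt_mode rho Hrho uR HregR (ecos m) _ (ecos_der m) 0 r Hrr)
    (fun m => is_RInt_mode rho Hrho uR HregR (esin m) _ (esin_der m) 0 r Hrr)
    (fun m => Rle_trans _ _ _ (Rabs_fst_le _) (HWcos m)) (fun m => Rle_trans _ _ _ (Rabs_fst_le _) (HWsin m)) HW phi).
  assert (EI := fourier_series (upol uI 0 r) (fun m => snd (cmode (ecos m) 0 r)) (fun m => snd (cmode (esin m) 0 r)) W
    (fun x => continuity_2d_snd _ _ _ (upol_continuity rho Hrho uI HregI 0 r x Hrr)) (Hper uI)
    (fun m => is_RInt_mode rho Hrho uI HregI (ecos m) _ (ecos_der m) 0 r Hrr)
    (fun m => is_RInt_mode rho Hrho uI HregI (esin m) _ (esin_der m) 0 r Hrr)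
    (fun m => Rle_trans _ _ _ (Rabs_snd_le _) (HWcos m)) (fun m => Rle_trans _ _ _ (Rabs_snd_le _) (HWsin m)) HW phi).
  rewrite polar_upol, ER, EI.
  unfold fsum, CSeries.
  assert (Et : forall m, (tm phi m * Hank m (kappa * r))%C =
    (RtoC (fnorm m) * (cmode (ecos m) 0 r * RtoC (ecos m phi) + cmode (esin m) 0 r * RtoC (esin m phi)))%C).
  { intros m. rewrite ecos_mode, esin_mode by auto. unfold tm. ring. }
  f_equal; apply Series_ext; intros m; rewrite Et; unfold fterm; fold (ecos m phi) (esin m phi);
    destruct (cmode (ecos m) 0 r) as [a1 a2]; destruct (cmode (esin m) 0 r) as [b1 b2];
    unfold Cmult, Cplus, RtoC; simpl; ring.
Qed.

(** The Karp coefficients of the constructed expansion: the j-th Lommel coefficients superposed over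
    all modes. The power of kappa passes from kappa r to r. *)
Definition Fs (phi : R) (j : nat) : C := (CSeries (fun m => tm phi m * RtoC (lom 1 0 m j)) * RtoC (/ kappa ^ j))%C.
Definition Gs (phi : R) (j : nat) : C := (CSeries (fun m => tm phi m * RtoC (lom 0 1 m j)) * RtoC (/ kappa ^ j))%C.

Lemma lom_summable (phi : R) (a b : R) (j : nat) : Rabs a <= 1 -> Rabs b <= 1 ->
  ex_series (fun m => Cmod (tm phi m * RtoC (lom a b m j))%C) /\
  Cmod (CSeries (fun m => tm phi m * RtoC (lom a b m j))%C) <= 2 * Series (fun m => Cmod (tm phi m) * maj (4 * x1) m) * (4 * x1) ^ j.
Proof.
  intros Ha Hb. assert (HX := x1_pos).
  assert (Bd : forall m, Cmod (tm phi m * RtoC (lom a b m j))%C <= (4 * x1) ^ j * (Cmod (tm phi m) * maj (4 * x1) m)).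
  { intros m. rewrite Cmod_mult, Cmod_R.
    replace ((4 * x1) ^ j * (Cmod (tm phi m) * maj (4 * x1) m)) with (Cmod (tm phi m) * (maj (4 * x1) m * (4 * x1) ^ j)) by ring.
    apply Rmult_le_compat_l. apply Cmod_ge_0. apply lom_bound; auto; lra. }
  assert (Ex : ex_series (fun m => (4 * x1) ^ j * (Cmod (tm phi m) * maj (4 * x1) m))) by (apply ex_series_scal_R, tm_summable).
  split.
  - apply ex_series_bound with (2 := Ex). intros m. rewrite Rabs_pos_eq by apply Cmod_ge_0. apply Bd.
  - apply Rle_trans with (1 := CSeries_bound _ _ Bd Ex). rewrite Series_scal_l. apply Req_le. ring.
Qed.

Lemma Rabs_0_le : Rabs 0 <= 1.
Proof. rewrite Rabs_R0. lra. Qed.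
Lemma Rabs_1_le : Rabs 1 <= 1.
Proof. rewrite Rabs_R1. lra. Qed.

Lemma FGs_bound (phi : R) : exists M, 0 <= M /\ forall j,
  Cmod (Fs phi j) <= M * (4 * r1) ^ j /\ Cmod (Gs phi j) <= M * (4 * r1) ^ j.
Proof.
  exists (2 * Series (fun m => Cmod (tm phi m) * maj (4 * x1) m)).
  assert (G : forall j z, Cmod z <= 2 * Series (fun m => Cmod (tm phi m) * maj (4 * x1) m) * (4 * x1) ^ j ->
    Cmod (z * RtoC (/ kappa ^ j))%C <= 2 * Series (fun m => Cmod (tm phi m) * maj (4 * x1) m) * (4 * r1) ^ j).
  { intros j z Hz. assert (Hp : 0 < kappa ^ j) by now apply pow_lt.
    rewrite Cmod_mult, Cmod_R, Rabs_pos_eq by (apply Rlt_le, Rinv_0_lt_compat; auto).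
    apply Rle_trans with (2 * Series (fun m => Cmod (tm phi m) * maj (4 * x1) m) * (4 * x1) ^ j * / kappa ^ j).
    apply Rmult_le_compat_r; auto. apply Rlt_le, Rinv_0_lt_compat; auto.
    apply Req_le. replace (4 * x1) with (kappa * (4 * r1)) by (unfold x1; ring). rewrite Rpow_mult_distr. field. lra. }
  split.
  - destruct (lom_summable phi 1 0 0 Rabs_1_le Rabs_0_le) as [_ H]. simpl pow in H. rewrite Rmult_1_r in H.
    apply Rle_trans with (2 := H). apply Cmod_ge_0.
  - intros j. split; apply G; apply lom_summable; apply Rabs_0_le || apply Rabs_1_le.
Qed.

Lemma Fs_PI (phi : R) (j : nat) : Fs (phi + PI) j = (RtoC ((-1) ^ j) * Fs phi j)%C.
Proof.
  unfold Fs. rewrite Cmult_assoc. f_equal. rewrite <- CSeries_scal.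
  2: apply lom_summable; apply Rabs_0_le || apply Rabs_1_le.
  apply CSeries_ext. intros m. rewrite tm_PI.
  transitivity (tm phi m * (RtoC ((-1) ^ m * lom 1 0 m j)))%C. rewrite RtoC_mult. ring.
  rewrite lom_parity_10, RtoC_mult. ring.
Qed.

Lemma Gs_PI (phi : R) (j : nat) : Gs (phi + PI) j = (- (RtoC ((-1) ^ j) * Gs phi j))%C.
Proof.
  unfold Gs. transitivity ((RtoC (-1) * RtoC ((-1) ^ j)) * CSeries (fun m => tm phi m * RtoC (lom 0 1 m j)) * RtoC (/ kappa ^ j))%C.
  2:{ rewrite Cminus1. ring. }
  f_equal. rewrite <- CSeries_scal.
  2: apply lom_summable; apply Rabs_0_le || apply Rabs_1_le.
  apply CSeries_ext. intros m. rewrite tm_PI.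
  transitivity (tm phi m * (RtoC ((-1) ^ m * lom 0 1 m j)))%C. rewrite RtoC_mult. ring.
  rewrite lom_parity_01, RtoC_opp, RtoC_mult, Cminus1. ring.
Qed.

Definition Afun (a b phi r : R) : C := CSeries (fun m => tm phi m * cyl (kappa * r) (RtoC a) (RtoC b) m)%C.

Lemma cyl_summable (phi a b r : R) : 8 * r1 <= r -> Rabs a <= 1 -> Rabs b <= 1 ->
  ex_series (fun m => Cmod (tm phi m * cyl (kappa * r) (RtoC a) (RtoC b) m)%C).
Proof.
  intros Hr Ha Hb. assert (HX := x1_pos). assert (Hr1 := r1_gt).
  assert (Hy : 4 * x1 <= kappa * r). { unfold x1. nra. }
  assert (Hy0 : 0 < kappa * r) by lra.
  apply ex_series_bound with (fun m => 2 * (Cmod (tm phi m) * maj (4 * x1) m)).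
  2: apply ex_series_scal_R, tm_summable.
  intros m. rewrite Rabs_pos_eq by apply Cmod_ge_0. rewrite Cmod_mult.
  replace (2 * (Cmod (tm phi m) * maj (4 * x1) m)) with (Cmod (tm phi m) * (maj (4 * x1) m * 2)) by ring.
  apply Rmult_le_compat_l. apply Cmod_ge_0.
  apply Rle_trans with (1 := Cmod_cyl_le (kappa * r) _ _ m Hy0). rewrite !Cmod_R.
  assert (HM := maj_ge_1 (kappa * r) m ltac:(lra)).
  apply Rmult_le_compat; try lra. assert (H1 := Rabs_pos a). assert (H2 := Rabs_pos b). lra. apply maj_decr; lra.
Qed.

Lemma polar_FG (r phi : R) : 8 * r1 <= r ->
  polar psi r phi = (hankel1 0 (kappa * r) * Afun 1 0 phi r + hankel1 1 (kappa * r) * Afun 0 1 phi r)%C.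
Proof.
  intros Hr. rewrite polar_expansion by auto.
  assert (S1 := cyl_summable phi 1 0 r Hr Rabs_1_le Rabs_0_le).
  assert (S2 := cyl_summable phi 0 1 r Hr Rabs_0_le Rabs_1_le).
  unfold Afun. rewrite <- !CSeries_scal by auto. rewrite <- CSeries_plus.
  - apply CSeries_ext. intros m. unfold Hank. rewrite cyl_linear. ring.
  - apply ex_series_ext with (fun m => Cmod (hankel1 0 (kappa * r)) * Cmod (tm phi m * cyl (kappa * r) (RtoC 1) (RtoC 0) m)%C).
    intros m. now rewrite (Cmod_mult (hankel1 0 (kappa * r))). now apply ex_series_scal_R.
  - apply ex_series_ext with (fun m => Cmod (hankel1 1 (kappa * r)) * Cmod (tm phi m * cyl (kappa * r) (RtoC 0) (RtoC 1) m)%C).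
    intros m. now rewrite (Cmod_mult (hankel1 1 (kappa * r))). now apply ex_series_scal_R.
Qed.

Lemma Afun_asym (a b phi : R) : Rabs a <= 1 -> Rabs b <= 1 ->
  asym (Afun a b phi) (fun j => CSeries (fun m => tm phi m * RtoC (lom a b m j)) * RtoC (/ kappa ^ j))%C.
Proof.
  intros Ha Hb. assert (HX := x1_pos).
  assert (A : asym (fun y => CSeries (fun m => tm phi m * RtoC (Series (fun j => (lom a b m j / y ^ j)%R)))%C)
    (fun j => CSeries (fun m => tm phi m * RtoC (lom a b m j))%C)).
  { intros N. apply (series_asymN (4 * x1) (tm phi) ltac:(lra) N (fun m j => lom a b m j) (fun m => maj (4 * x1) m)).
    intros m j. apply lom_bound; auto; lra. apply tm_summable. }
  apply asym_ext with (3 := asym_dilate kappa _ _ Hk A) (X := 1).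
  - intros r Hr. unfold Afun. apply CSeries_ext. intros m. rewrite cyl_lom by (auto; nra). reflexivity.
  - intros j. rewrite RtoC_inv by (apply pow_nonzero; lra). reflexivity.
Qed.

Lemma parity_expansion (f : R -> nat -> C) : (forall phi, asym (fun r => polar psi r phi / outgoing_factor kappa r)%C (f phi)) ->
  forall phi n, f phi n = (conv (hcoef0 kappa) (Fs phi) n + conv (hcoef1 kappa) (Gs phi) n)%C.
Proof.
  intros Hf phi n.
  apply (karp_coefficients kappa (8 * r1) (f phi) (Fs phi) (Gs phi) (fun r => polar psi r phi) (Afun 1 0 phi) (Afun 0 1 phi)); auto.
  - intros r Hr. now apply polar_FG.
  - apply Afun_asym. apply Rabs_1_le. apply Rabs_0_le.
  - apply Afun_asym. apply Rabs_0_le. apply Rabs_1_le.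
Qed.
End RadiatingField.

(** * The recursion *)

Lemma conv_recursion (kappa : R) (a b : nat -> C) (n : nat) :
  (conv (hcoef0 kappa) a n + conv (hcoef1 kappa) b n =
   a n - Ci * b n + sum_n_m (fun j => hcoef0 kappa j * a (n - j)%nat + hcoef1 kappa j * b (n - j)%nat) 1 n)%C.
Proof.
  assert (E := sum_n_m_plus (fun j => hcoef0 kappa j * a (n - j)%nat)%C (fun j => hcoef1 kappa j * b (n - j)%nat)%C 1 n).
  change (@plus C_AbelianMonoid) with Cplus in E. rewrite E.
  unfold conv, sum_n. rewrite !(sum_Sn_m _ 0 n) by lia.
  change (@plus C_AbelianMonoid) with Cplus. rewrite Nat.sub_0_r.
  unfold hcoef0 at 1, hcoef1 at 1, h1coef. rewrite !Cnu_0. simpl pow.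
  asC. field.
Qed.

Lemma Ci_system (x y p q : C) : (x - Ci * y = p)%C -> (x + Ci * y = q)%C ->
  x = ((p + q) / RtoC 2)%C /\ y = ((p - q) * Ci / RtoC 2)%C.
Proof.
  intros <- <-. assert (E : (Ci * Ci = - RtoC 1)%C) by (unfold Ci, Cmult, Copp, RtoC; simpl; f_equal; ring).
  split. field.
  replace ((x - Ci * y - (x + Ci * y)) * Ci)%C with (- (RtoC 2 * (Ci * Ci) * y))%C by ring. rewrite E. field.
Qed.

Lemma Ci_system_sol (p q : C) :
  ((p + q) / RtoC 2 - Ci * ((p - q) * Ci / RtoC 2) = p)%C /\ ((p + q) / RtoC 2 + Ci * ((p - q) * Ci / RtoC 2) = q)%C.
Proof.
  assert (E : (Ci * Ci = - RtoC 1)%C) by (unfold Ci, Cmult, Copp, RtoC; simpl; f_equal; ring).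
  replace (Ci * ((p - q) * Ci / RtoC 2))%C with ((Ci * Ci) * (p - q) / RtoC 2)%C by field. rewrite E. split; field.
Qed.

Lemma enorm_exterior (rho x y : R) : 0 < rho -> rho ^ 2 < x ^ 2 + y ^ 2 -> rho <= enorm (x, y).
Proof.
  intros Hrho H. unfold enorm; simpl fst; simpl snd. rewrite <- (sqrt_pow2 rho) by lra. apply sqrt_le_1_alt. lra.
Qed.

Lemma karp_parity (kappa rho : R) (U : R * R -> Prop) (psi : R -> R -> C) (F G f : nat -> R -> C) :
  0 < kappa -> 0 < rho -> (forall x, rho <= enorm x -> U x) -> radiation_solution kappa U psi ->
  karp_expansion kappa rho psi F G -> asymptotic_expansion kappa psi f ->
  (forall phi n, f n phi = conv (hcoef0 kappa) (fun j => F j phi) n + conv (hcoef1 kappa) (fun j => G j phi) n)%C /\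
  (forall phi j, F j (phi + PI)%R = RtoC ((-1) ^ j) * F j phi /\ G j (phi + PI)%R = - (RtoC ((-1) ^ j) * G j phi))%C.
Proof.
  intros Hk Hrho HU [Hreg [Hhelm Hrad]] [HFper [HGper [A [B [HAB Hunif]]]]] [Hfper Hf].
  assert (HE : forall x y, rho ^ 2 < x ^ 2 + y ^ 2 -> U (x, y)) by (intros; now apply HU, enorm_exterior).
  assert (RR : forall x y, rho ^ 2 < x ^ 2 + y ^ 2 -> ex_diff_n (fun x y => Re (psi x y)) 2 x y) by (intros; now apply Hreg, HE).
  assert (RI : forall x y, rho ^ 2 < x ^ 2 + y ^ 2 -> ex_diff_n (fun x y => Im (psi x y)) 2 x y) by (intros; now apply Hreg, HE).
  assert (LR : forall x y, rho ^ 2 < x ^ 2 + y ^ 2 -> Derive_n (fun s => Re (psi s y)) 2 x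
     + Derive_n (fun s => Re (psi x s)) 2 y + kappa ^ 2 * Re (psi x y) = 0).
  { intros x y H. assert (E := f_equal fst (Hhelm x y (HE x y H))). transitivity (fst (RtoC 0)); [rewrite <- E|reflexivity].
    unfold laplacian, Cplus, Cmult, RtoC, Re; simpl. ring. }
  assert (LI : forall x y, rho ^ 2 < x ^ 2 + y ^ 2 -> Derive_n (fun s => Im (psi s y)) 2 x
     + Derive_n (fun s => Im (psi x s)) 2 y + kappa ^ 2 * Im (psi x y) = 0).
  { intros x y H. assert (E := f_equal snd (Hhelm x y (HE x y H))). transitivity (snd (RtoC 0)); [rewrite <- E|reflexivity].
    unfold laplacian, Cplus, Cmult, RtoC, Im; simpl. ring. }
  assert (Af : forall phi, asym (fun r => polar psi r phi / outgoing_factor kappa r)%C (fun j => f j phi)).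
  { intros phi. apply asym_of_lim. intros N. apply Hf. }
  assert (E1 := parity_expansion kappa rho psi Hk Hrho RR RI LR LI Hrad (fun phi j => f j phi) Af).
  destruct (Hunif (rho + 1) ltac:(lra)) as [[HF _] [HG _]].
  assert (BF : forall phi, exists M, 0 <= M /\ forall j, Cmod (F j phi) <= M * (rho + 1) ^ j).
  { intros phi. apply series_terms_bounded. lra. apply HF. lra. }
  assert (BG : forall phi, exists M, 0 <= M /\ forall j, Cmod (G j phi) <= M * (rho + 1) ^ j).
  { intros phi. apply series_terms_bounded. lra. apply HG. lra. }
  assert (E2 : forall phi n, f n phi = (conv (hcoef0 kappa) (fun j => F j phi) n + conv (hcoef1 kappa) (fun j => G j phi) n)%C).
  { intros phi n. destruct (BF phi) as [M1 [_ HM1]]. destruct (BG phi) as [M2 [_ HM2]].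
    apply (karp_coefficients kappa rho (fun j => f j phi) (fun j => F j phi) (fun j => G j phi)
      (fun r => polar psi r phi) (fun r => A r phi) (fun r => B r phi) Hk).
    - intros r Hr. apply (HAB r phi Hr).
    - apply Af.
    - apply (karp_series_asym (fun j => F j phi) (fun r => A r phi) rho M1 (rho + 1)); auto; try lra. intros r Hr. apply (HAB r phi Hr).
    - apply (karp_series_asym (fun j => G j phi) (fun r => B r phi) rho M2 (rho + 1)); auto; try lra. intros r Hr. apply (HAB r phi Hr). }
  assert (E3 : forall phi j, F j phi = Fs kappa rho psi phi j /\ G j phi = Gs kappa rho psi phi j).
  { intros phi. destruct (BF phi) as [M1 [P1 HM1]]. destruct (BG phi) as [M2 [P2 HM2]].
    destruct (FGs_bound kappa rho psi Hk Hrho RR RI phi) as [M3 [P3 HM3]].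
    (* One geometric bound for all four sequences, as [karp_coefficients_unique] asks: the constants
       are added and the larger ratio 4 (rho + 1) is used. *)
    assert (W : forall z M j, 0 <= M -> M <= M1 + M2 + M3 -> Cmod z <= M * (rho + 1) ^ j \/ Cmod z <= M * (4 * (rho + 1)) ^ j ->
      Cmod z <= (M1 + M2 + M3) * (4 * (rho + 1)) ^ j).
    { intros z M j H0 H1 H2. assert (H3 : (rho + 1) ^ j <= (4 * (rho + 1)) ^ j) by (apply pow_incr; lra).
      assert (H4 : 0 <= (rho + 1) ^ j) by (apply pow_le; lra).
      apply Rle_trans with (M * (4 * (rho + 1)) ^ j). 2: apply Rmult_le_compat_r; lra.
      destruct H2 as [H2|H2]; auto. apply Rle_trans with (1 := H2). apply Rmult_le_compat_l; auto. }
    apply (karp_coefficients_unique kappa (4 * (rho + 1)) (M1 + M2 + M3) (fun j => F j phi) (fun j => G j phi)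
      (Fs kappa rho psi phi) (Gs kappa rho psi phi)); auto; try lra.
    - intros j. apply (W _ M1); auto; lra.
    - intros j. apply (W _ M2); auto; lra.
    - intros j. apply (W _ M3); auto; try lra. right. exact (proj1 (HM3 j)).
    - intros j. apply (W _ M3); auto; try lra. right. exact (proj2 (HM3 j)).
    - intros n. rewrite <- E2, <- E1. reflexivity. }
  split; auto.
  intros phi j. destruct (E3 phi j) as [-> ->]. destruct (E3 (phi + PI) j) as [-> ->].
  split. apply (Fs_PI kappa rho psi Hk Hrho RR RI). apply (Gs_PI kappa rho psi Hk Hrho RR RI).
Qed.

(** At phi + pi, F_{n-j} and G_{n-j} acquire (-1)^(n-j) with opposite signs; the opposite sign of G
    turns -i into +i. *)
Lemma karp_relations_of_parity (kappa : R) (f F G : nat -> R -> C) :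
  (forall phi n, f n phi = conv (hcoef0 kappa) (fun j => F j phi) n + conv (hcoef1 kappa) (fun j => G j phi) n)%C ->
  (forall phi j, F j (phi + PI)%R = RtoC ((-1) ^ j) * F j phi /\ G j (phi + PI)%R = - (RtoC ((-1) ^ j) * G j phi))%C ->
  forall n phi, karp_relations kappa f F G n phi.
Proof.
  intros Hf HP n phi.
  assert (R1 := Hf phi n). assert (R2 := Hf (phi + PI) n). rewrite conv_recursion in R1, R2.
  destruct (HP phi n) as [HPF HPG]. rewrite HPF, HPG in R2.
  assert (D : forall j, (Ci * (Cnu 1 j / RtoC (kappa ^ j)) = - hcoef1 kappa j)%C).
  { intros j. unfold hcoef1, h1coef, Cdiv. ring. }
  split.
  - rewrite R1. match goal with |- _ = (?a + ?b - ?c)%C => replace c with b end. ring.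
    apply sum_n_m_ext_loc. intros j Hj. fold (hcoef0 kappa j). rewrite D. asC. ring.
  - assert (S2 : (RtoC ((-1) ^ n) * RtoC ((-1) ^ n) = RtoC 1)%C).
    { rewrite <- RtoC_mult, <- Rpow_mult_distr. replace (-1 * -1) with 1 by ring. now rewrite pow1. }
    rewrite R2. match goal with |- _ = (_ * (?a + ?b - ?c))%C => replace c with b end.
    + transitivity ((RtoC ((-1) ^ n) * RtoC ((-1) ^ n)) * (F n phi + Ci * G n phi))%C. rewrite S2. ring. ring.
    + apply sum_n_m_ext_loc. intros j Hj. destruct (HP phi (n - j)%nat) as [-> ->].
      fold (hcoef0 kappa j). rewrite D. asC. ring.
Qed.

(** * Solving the relations for the coefficients *)

Lemma karp_relations_unique (kappa : R) (f F G F' G' : nat -> R -> C) (phi : R) (n : nat) :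
  (forall m, (m <= n)%nat -> karp_relations kappa f F G m phi) ->
  (forall m, (m <= n)%nat -> karp_relations kappa f F' G' m phi) ->
  forall m, (m <= n)%nat -> F' m phi = F m phi /\ G' m phi = G m phi.
Proof.
  intros H H' m. induction m as [m IH] using lt_wf_ind. intros Hm.
  destruct (H m Hm) as [H1 H2]. destruct (H' m Hm) as [H1' H2'].
  assert (IH' : forall j, (1 <= j <= m)%nat -> F' (m - j)%nat phi = F (m - j)%nat phi /\ G' (m - j)%nat phi = G (m - j)%nat phi).
  { intros j Hj. apply IH; lia. }
  destruct (Ci_system _ _ _ _ H1 H2) as [-> ->]. destruct (Ci_system _ _ _ _ H1' H2') as [-> ->].
  (* After inverting the 2 by 2 system, the two solutions can differ only through the sums over
     lower indices, which agree by induction. *)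
  match goal with |- ((?f - ?a + ?s * (?g - ?b)) / _)%C = ((_ - ?a' + _ * (_ - ?b')) / _)%C /\ _ =>
    assert (Ea : a = a'); [|assert (Eb : b = b'); [|rewrite Ea, Eb; auto]] end.
  - apply sum_n_m_ext_loc. intros j Hj. now destruct (IH' j Hj) as [-> ->].
  - apply sum_n_m_ext_loc. intros j Hj. now destruct (IH' j Hj) as [-> ->].
Qed.

Lemma set_coefficient_eq (F : nat -> R -> C) (n : nat) (a : C) (phi : R) : set_coefficient F n a n phi = a.
Proof. unfold set_coefficient. now rewrite Nat.eqb_refl. Qed.

Lemma set_coefficient_neq (F : nat -> R -> C) (n m : nat) (a : C) (phi : R) : m <> n -> set_coefficient F n a m phi = F m phi.
Proof. intros H. unfold set_coefficient. apply Nat.eqb_neq in H. now rewrite H. Qed.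

Lemma karp_relations_step (kappa : R) (f F G : nat -> R -> C) (n : nat) (phi : R) :
  exists! ab : C * C, karp_relations kappa f (set_coefficient F n (fst ab)) (set_coefficient G n (snd ab)) n phi.
Proof.
  set (P := (f n phi - sum_n_m (fun j => Cnu 0 j / RtoC (kappa ^ j) * F (n - j)%nat phi
         - Ci * (Cnu 1 j / RtoC (kappa ^ j)) * G (n - j)%nat phi) 1 n)%C).
  set (Q := (RtoC ((-1) ^ n) * (f n (phi + PI)%R - sum_n_m (fun j => RtoC ((-1) ^ (n - j)) *
          (Cnu 0 j / RtoC (kappa ^ j) * F (n - j)%nat phi
           + Ci * (Cnu 1 j / RtoC (kappa ^ j)) * G (n - j)%nat phi)) 1 n))%C).
  assert (K : forall a b, karp_relations kappa f (set_coefficient F n a) (set_coefficient G n b) n phi <->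
    (a - Ci * b = P)%C /\ (a + Ci * b = Q)%C).
  { intros a b. unfold karp_relations. rewrite !set_coefficient_eq. unfold P, Q.
    (* The sums start at j = 1 and read indices below n only, so the coefficient set at n is
       invisible to them; for n = 0 they are empty. *)
    rewrite (sum_n_m_ext_loc (fun j => Cnu 0 j / RtoC (kappa ^ j) * F (n - j)%nat phi
         - Ci * (Cnu 1 j / RtoC (kappa ^ j)) * G (n - j)%nat phi)%C (fun j => Cnu 0 j / RtoC (kappa ^ j) * set_coefficient F n a (n - j)%nat phi
         - Ci * (Cnu 1 j / RtoC (kappa ^ j)) * set_coefficient G n b (n - j)%nat phi)%C).
    2:{ intros j Hj. rewrite !set_coefficient_neq by lia. reflexivity. }
    rewrite (sum_n_m_ext_loc (fun j => RtoC ((-1) ^ (n - j)) * (Cnu 0 j / RtoC (kappa ^ j) * F (n - j)%nat phi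
           + Ci * (Cnu 1 j / RtoC (kappa ^ j)) * G (n - j)%nat phi))%C
      (fun j => RtoC ((-1) ^ (n - j)) * (Cnu 0 j / RtoC (kappa ^ j) * set_coefficient F n a (n - j)%nat phi
           + Ci * (Cnu 1 j / RtoC (kappa ^ j)) * set_coefficient G n b (n - j)%nat phi))%C).
    2:{ intros j Hj. rewrite !set_coefficient_neq by lia. reflexivity. }
    reflexivity. }
  exists (((P + Q) / RtoC 2)%C, ((P - Q) * Ci / RtoC 2)%C). split.
  - apply K. apply Ci_system_sol.
  - intros [a b] Hab. apply K in Hab. destruct Hab as [H1 H2]. destruct (Ci_system _ _ _ _ H1 H2) as [Ea Eb].
    simpl in Ea, Eb. now rewrite Ea, Eb.
Qed.

Theorem theorem3 (S U : R * R -> Prop) (kappa rho : R)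
    (psi : R -> R -> C) (F G f : nat -> R -> C)
    (hS : closed_regular_curve S)
    (hU : forall x, U x <-> outside S x)
    (hkappa : 0 < kappa)
    (hrho : 0 < rho)
    (hrhoU : forall x, rho <= enorm x -> U x)
    (hpsi : radiation_solution kappa U psi)
    (hKarp : karp_expansion kappa rho psi F G)
    (hf : asymptotic_expansion kappa psi f) :
  (forall (n : nat) (phi : R), karp_relations kappa f F G n phi) /\
  (* f_0, ..., f_n determine F_0, G_0, ..., F_n, G_n uniquely *)
  (forall (n : nat) (phi : R) (F' G' : nat -> R -> C),
     (forall m, (m <= n)%nat -> karp_relations kappa f F' G' m phi) ->
     forall m, (m <= n)%nat -> F' m phi = F m phi /\ G' m phi = G m phi) /\
  (* recursive step: once the coefficients of index < n are known,
     the relations of index n have exactly one solution *)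
  (forall (n : nat) (phi : R) (F' G' : nat -> R -> C),
     exists! ab : C * C,
       karp_relations kappa f
         (set_coefficient F' n (fst ab)) (set_coefficient G' n (snd ab)) n phi).
Proof.
  destruct (karp_parity kappa rho U psi F G f hkappa hrho hrhoU hpsi hKarp hf) as [Hf HP].
  assert (HR := karp_relations_of_parity kappa f F G Hf HP).
  split; [exact HR|split].
  - intros n phi F' G' H' m Hm. exact (karp_relations_unique kappa f F G F' G' phi n (fun m _ => HR m phi) H' m Hm).
  - intros n phi F' G'. apply karp_relations_step.
Qed.
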